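(* Let $p$ be a prime number and let $k$ be a global field. Let $k_{p^\infty}=(k_{p^n})_{n\ge 0}$ be a $\mathbb{Z}_p$-extension of $k$. Then each of the following sequences of integers converges in $\mathbb{Z}_p$ as $n\to\infty$: $|\mathrm{C}(k_{p^n})|$; $|\mathrm{C}(k_{p^n})_{\text{non-}p}|$; and, for each prime number $l$, $|\mathrm{C}(k_{p^n})_{(l)}|$.
   Context: A global field is a finite extension of $\mathbb{Q}$ (number field) or of $\mathbb{F}_{p'}(x)$ for some prime $p'$ (function field). For a global field $k$, $\mathrm{C}(k)$ denotes the ideal class group $\mathrm{Cl}(k)$ if $k$ is a number field, and the degree-zero divisor class group $\mathrm{Cl}^0(k)$ if $k$ is a function field; it is a finite abelian group. For a finite abelian group $G$ and a prime $l$, $G_{(l)}$ is its $l$-torsion (Sylow $l$-) subgroup and $G_{\text{non-}p}$ is the subgroup of elements of order prime to $p$. A $\mathbb{Z}_p$-extension of $k$ is a tower $k=k_{1}\subset k_p\subset k_{p^2}\subset\cdots$ in which each $k_{p^n}/k$ is a Galois extension with group $\mathbb{Z}/p^n\mathbb{Z}$ (equivalently, a Galois extension $\bigcup_n k_{p^n}$ of $k$ with group $\mathbb{Z}_p$). *)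

(* Defs.v *)
From HB Require Import structures.
From mathcomp Require Import all_boot all_order all_algebra.
From mathcomp Require Import fingroup cyclic falgebra fieldext galois.

Set Implicit Arguments.
Unset Strict Implicit.
Unset Printing Implicit Defensive.

Import GRing.Theory.
Local Open Scope ring_scope.

Definition nclasses (T : Type) (E : T -> T -> Prop) (X : T -> Prop) (N : nat) :=
  exists f : 'I_N -> T,
    [/\ forall i, X (f i),
        forall i j, E (f i) (f j) -> i = j
      & forall x, X x -> exists i, E x (f i)].

Definition char0 (F : fieldType) := forall n : nat, (n.+1)%:R != 0 :> F.

(* evaluation at t of a polynomial with coefficients in the prime field
   (coefficients given as naturals, mapped through n |-> n%:R) *)
Definition evalN (F : fieldType) (q : seq nat) (t : F) : F :=
  \sum_(i < size q) (nth 0%N q i)%:R * t ^+ i.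

Definition number_field (F : fieldType) :=
  char0 F /\
  exists (n : nat) (b : 'I_n -> F),
    forall x : F, exists c : 'I_n -> rat, x = \sum_i ratr (c i) * b i.

(* function field: finite extension of F_p'(t) with t transcendental over
   the prime field F_p' *)
Definition function_field (F : fieldType) :=
  exists p' : nat, [/\ prime p', p'%:R = 0 :> F &
  exists t : F,
    (forall q : seq nat, evalN q t = 0 -> all (fun c => p' %| c)%N q) /\
    exists (n : nat) (b : 'I_n -> F),
      forall x : F, exists c : 'I_n -> F,
        (forall i, exists f g : seq nat, evalN g t != 0 /\ c i = evalN f t / evalN g t)
        /\ x = \sum_i c i * b i].

Definition global_field (F : fieldType) := number_field F \/ function_field F.

(* Number field case: ideal class group Cl(F) of the ring of integers, *)
(* realized as nonzero ideals of O_F modulo  I ~ J <-> aI = bJ.        *)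
Definition integral (F : fieldType) (x : F) :=
  exists q : {poly int}, q \is monic /\ root (map_poly (fun z : int => z%:~R) q) x.

Definition nz_ideal (F : fieldType) (I : F -> Prop) :=
  [/\ forall x, I x -> integral x,
      I 0,
      forall x y, I x -> I y -> I (x + y),
      forall r x, integral r -> I x -> I (r * x)
    & exists x, I x /\ x != 0].

Definition ideal_equiv (F : fieldType) (I J : F -> Prop) :=
  exists a b : F, [/\ a != 0, b != 0 &
    forall x, (exists y, I y /\ x = a * y) <-> (exists z, J z /\ x = b * z)].

Definition ideal_mul (F : fieldType) (I J : F -> Prop) : F -> Prop :=
  fun x => exists s : seq (F * F),
    (forall pr, pr \in s -> I pr.1 /\ J pr.2) /\ x = \sum_(pr <- s) pr.1 * pr.2.

Definition ideal_pow (F : fieldType) (I : F -> Prop) (n : nat) : F -> Prop :=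
  iter n (ideal_mul I) (@integral F).

Definition principal_ideal (F : fieldType) (I : F -> Prop) :=
  exists a : F, a != 0 /\ forall x, I x <-> exists r, integral r /\ x = a * r.

(* Function field case: degree-zero divisor class group Cl^0(F).       *)
(* Places = proper valuation rings of F.                               *)
Definition valring (F : fieldType) (R : F -> Prop) :=
  [/\ R 0 /\ R 1,
      forall x y, R x -> R y -> R (x - y),
      forall x y, R x -> R y -> R (x * y),
      forall x : F, x != 0 -> R x \/ R x^-1
    & exists x, ~ R x].

Definition place (F : fieldType) := {R : F -> Prop | valring R}.

Definition vunit (F : fieldType) (R : F -> Prop) (x : F) := [/\ x != 0, R x & R x^-1].

Definition uniformizer (F : fieldType) (R : F -> Prop) (t : F) :=
  [/\ R t, t != 0, ~ vunit R t &
      forall y, R y -> ~ vunit R y -> exists r, R r /\ y = t * r].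

Definition vP (F : fieldType) (P : place F) (x : F) (n : int) :=
  exists t u : F, [/\ uniformizer (sval P) t, vunit (sval P) u & x = u * t ^ n].

(* deg P = d : the residue field of P has p'^d elements, p' = char F *)
Definition place_deg (F : fieldType) (P : place F) (d : nat) :=
  exists p' : nat, [/\ prime p', p'%:R = 0 :> F &
    nclasses (fun x y : F => sval P (x - y) /\ ~ vunit (sval P) (x - y))
             (sval P) (p' ^ d)%N].

Definition divisor_deg (F : fieldType) (D : place F -> int) (d : int) :=
  exists (m : nat) (f : 'I_m -> place F) (dg : 'I_m -> nat),
    [/\ injective f,
        forall P, D P != 0 -> exists i, f i = P,
        forall i, place_deg (f i) (dg i)
      & d = \sum_i D (f i) * (dg i)%:Z].

Definition deg0_divisor (F : fieldType) (D : place F -> int) := divisor_deg D 0.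

Definition principal_divisor (F : fieldType) (D : place F -> int) :=
  exists x : F, x != 0 /\ forall P, vP P x (D P).

Definition lin_equiv (F : fieldType) (D1 D2 : place F -> int) :=
  principal_divisor (fun P => D1 P - D2 P).

(* |C(F)| and its parts.  The selector S restricts to the classes c    *)
(* such that c^n = 1 for some n with S n:                              *)
(*   None                         : the whole group C(F)               *)
(*   Some (fun n => exists m, n = l^m) : the l-Sylow subgroup C(F)_(l) *)
(*   Some (fun n => 0 < n /\ coprime n p) : C(F)_{non-p}               *)
Definition C_card (F : fieldType) (S : option (nat -> Prop)) (N : nat) : Prop :=
  (char0 F ->
     nclasses (@ideal_equiv F)
       (fun I => nz_ideal I /\
          match S with None => True
          | Some Q => exists n, Q n /\ principal_ideal (ideal_pow I n) end) N) /\
  (~ char0 F ->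
     nclasses (@lin_equiv F)
       (fun D => deg0_divisor D /\
          match S with None => True
          | Some Q => exists n, Q n /\ principal_divisor (fun P => (n%:Z * D P)%R) end) N).

Definition all_part : option (nat -> Prop) := None.
Definition l_part (l : nat) : option (nat -> Prop) := Some (fun n => exists m, n = (l ^ m)%N).
Definition nonp_part (p : nat) : option (nat -> Prop) :=
  Some (fun n => (0 < n)%N /\ coprime n p).

(* Convergence in Z_p of a sequence of naturals: Z_p = lim Z/p^m,      *)
(* a p-adic integer is a coherent sequence of residues x m mod p^m.    *)
Definition padic_converges (p : nat) (a : nat -> nat) :=
  exists x : nat -> nat,
    (forall m, x m.+1 = x m %[mod p ^ m]) /\
    forall m, exists N, forall n, (N <= n)%N -> a n = x m %[mod p ^ m].

Definition Zp_extension (K : fieldType) (p : nat) (L : nat -> splittingFieldType K) :=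
  forall n : nat,
    [/\ galois 1%VS (fullv : {vspace L n}),
        cyclic ('Gal((fullv : {vspace L n}) / 1%VS))%g,
        #|('Gal((fullv : {vspace L n}) / 1%VS))%g| = (p ^ n)%N
      & exists f : 'AHom(L n, L n.+1), True].

(* Main.v *)
(* Throughout, k_n is the n-th layer, s_n a generator of its Galois group
   (chosen compatibly), C(k_n) = degree-zero divisors modulo principal ones (all
   divisors for a number field) and h_n = |C(k_n)|.

   A class not fixed by the subgroup of order p of <s_{n+1}> has an orbit of
   p^(n+1) elements, so |C(k_{n+1})_X| is congruent mod p^(n+1) to the number of
   fixed classes, for each part X.  On the non-p part, extension of divisors
   identifies the fixed classes with C(k_n)_X (norms provide the inverse up to
   powers of p), so these orders form a p-adic Cauchy sequence.

   For the p-part it suffices that h_n divides the number y of fixed classes of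
   k_{n+1} for n large: then v_p(h_{n+1}) >= min(n+1, v_p(h_n)), and v_p(h_n) is
   eventually constant or tends to infinity.  Chevalley's ambiguous class formula
   for k_{m+k}/k_m reads y |H^1(E)| X s_k = W h_m |H^0(E)|, where W counts fixed
   divisors modulo those of k_m and s_k = [E_m : E_m /\ N k_{m+k}^*].

   Number fields: the infinite places split, so Herbrand's quotient of the units
   is p^k; X = 1; W = p^t for a prime step, t being eventually nonincreasing
   because a place that ramifies does so totally ever after and lies over p.  As
   s_1^k <= s_k, the formula bounds (p s_1)^k by p^(t k) h_m for all k, so
   p s_1 divides p^t and h_m divides y.

   Function fields: the units are finite, so |H^0| = |H^1| and s_1 <= s_k^(1/k)
   is 1; thus y X = W h_m.  A comparison of degrees gives X | W at every ramified
   step; if nothing ever ramifies, the degree defects that X divides have product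
   at most h_m, so X = 1 at almost all steps. *)
From HB Require Import structures.
From mathcomp Require Import all_boot all_order all_algebra.
From mathcomp Require Import fingroup perm action morphism quotient cyclic pgroup sylow nilpotent abelian all_field.
From mathcomp Require Import boolp classical_sets functions.
From mathcomp Require Import zify ring lra.
From mathcomp Require Import complex.
From mathcomp Require Import reals sequences exp Rstruct.
Require Import Defs.
Set Implicit Arguments.
Unset Strict Implicit.
Unset Printing Implicit Defensive.
Import Order.TTheory GRing.Theory Num.Theory.
Local Open Scope ring_scope.

(** * Indices of subgroups *)

(** The obstacle is the p-part. Extension of classes may have a kernel (capitulation) and a fixed
    class need not contain a fixed divisor, so h_n has no evident reason to divide y. Both defects
    are governed by units, and Chevalley's formula balances them against ramification. Evaluating
    s_k exactly would call for local norms and class field theory; here only the growth s_1^k <= s_k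
    enters, which rests on Hilbert 90, and letting k tend to infinity over a fixed base k_m turns a
    rough bound into a sharp one. That the infinite places split is an issue for p = 2 only: a real
    field has no cyclic extension of degree 4 whose quadratic subextension is imaginary. Places are
    valuation rings and are never completed. They are discrete because the field is finite over the
    image of Z, of F_q[t] or of F_q[1/t]. Class numbers are finite by Hurwitz's pigeonhole argument
    for number fields and by counting Riemann spaces for function fields. *)

Definition equivr (T : Type) (E : T -> T -> Prop) :=
  [/\ forall x, E x x, forall x y, E x y -> E y x
    & forall x y z, E x y -> E y z -> E x z].

Definition subg (V : zmodType) (A : V -> Prop) :=
  A 0 /\ forall x y, A x -> A y -> A (x - y).

(** An index as a relation: the groups involved are mostly infinite and given by predicates, so no
    quotient is formed, and finiteness is part of what an [idx] statement asserts. *)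
Definition idx (V : zmodType) (A B : V -> Prop) (n : nat) :=
  nclasses (fun x y => B (x - y)) A n.

Lemma choice_ex (A B : Type) (P : A -> B -> Prop) :
  (forall a, exists b, P a b) -> exists f, forall a, P a (f a).
Proof. by move=> h; exists (fun a => projT1 (cid (h a))) => a; case: cid. Qed.

(** A family of pairwise inequivalent elements of maximal size meets every class, since otherwise it
    could be enlarged. *)
Lemma nc_bound (T : Type) (E : T -> T -> Prop) (X : T -> Prop) N :
  (forall x, E x x) -> (forall x y, E x y -> E y x) ->
  (forall n (f : 'I_n -> T), (forall i, X (f i)) ->
     (forall i j, E (f i) (f j) -> i = j) -> (n <= N)%N) ->
  exists2 n, (n <= N)%N & nclasses E X n.
Proof.
move=> rE sE bd.
pose P n := `[< exists f : 'I_n -> T, (forall i, X (f i)) /\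
     (forall i j, E (f i) (f j) -> i = j) >].
have exP : exists n, P n.
  by exists 0; apply/asboolP; exists (fun i : 'I_0 => False_rect _ (notF (ltn_ord i))); split=> -[].
have PN n : P n -> (n <= N)%N.
  by move=> /asboolP [f [Xf If]]; apply: bd Xf If.
case: (ex_maxnP exP PN) => n Pn mx.
exists n; first exact: PN.
move/asboolP: Pn => [f [Xf If]]; exists f; split=> // x Xx.
have [//|nx] := pselect (exists i, E x (f i)).
suff: P n.+1 by move=> /mx; rewrite ltnn.
apply/asboolP.
exists (fun i : 'I_n.+1 => if unlift ord0 i is Some j then f j else x); split.
  by move=> i; case: unliftP => [j _|_].
move=> i j; case: unliftP => [i' ->|->]; case: unliftP => [j' ->|->] //.
- by move/If => ->.
- by move=> h; case: nx; exists i'; apply: sE.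
- by move=> h; case: nx; exists j'.
Qed.

(** The map [g] is injective on classes; this is how an index is shown to be finite and bounded
    without being computed. *)
Lemma nc_inj (T T' : Type) (E : T -> T -> Prop) (E' : T' -> T' -> Prop)
    (X : T -> Prop) (X' : T' -> Prop) (g : T -> T') N :
  equivr E -> equivr E' -> (forall x, X x -> X' (g x)) ->
  (forall x y, X x -> X y -> E' (g x) (g y) -> E x y) ->
  nclasses E' X' N -> exists2 n, (n <= N)%N & nclasses E X n.
Proof.
move=> [rE sE _] [_ sE' tE'] gX gE [f' [Xf' If' cf']].
apply: nc_bound => // n f Xf If.
have [c Pc] := choice_ex (fun i => cf' _ (gX _ (Xf i))).
suff ci : injective c by have := leq_card c ci; rewrite !card_ord.
move=> i j cij; apply: If; apply: gE => //.
by apply: tE' (Pc i) _; rewrite cij; apply: sE'.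
Qed.

Lemma nc_sub (T : Type) (E : T -> T -> Prop) (X X' : T -> Prop) N :
  equivr E -> (forall x, X x -> X' x) -> nclasses E X' N ->
  exists2 n, (n <= N)%N & nclasses E X n.
Proof. by move=> eE XX'; apply: (nc_inj (g := id)). Qed.

Lemma nc_uniq (T : Type) (E : T -> T -> Prop) (X : T -> Prop) n m :
  equivr E -> nclasses E X n -> nclasses E X m -> n = m.
Proof.
move=> [_ sE tE].
suff le a b : nclasses E X a -> nclasses E X b -> (a <= b)%N.
  by move=> hn hm; apply/eqP; rewrite eqn_leq !le.
move=> [f [Xf If _]] [g [_ _ cg]].
have [c Pc] := choice_ex (fun i => cg _ (Xf i)).
suff ci : injective c by have := leq_card c ci; rewrite !card_ord.
by move=> i j cij; apply/If/(tE _ _ _ (Pc i)); rewrite cij; apply: sE.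
Qed.

Lemma nc_card (T : Type) (I : finType) (E : T -> T -> Prop) (X : T -> Prop) (f : I -> T) :
  (forall i, X (f i)) -> (forall i j, E (f i) (f j) -> i = j) ->
  (forall x, X x -> exists i, E x (f i)) -> nclasses E X #|I|.
Proof.
move=> Xf If cf; exists (fun k => f (enum_val k)); split=> //.
  by move=> i j /If /enum_val_inj.
by move=> x /cf [i h]; exists (enum_rank i); rewrite enum_rankK.
Qed.

Lemma nc_iso (T T' : Type) (E : T -> T -> Prop) (E' : T' -> T' -> Prop)
    (X : T -> Prop) (X' : T' -> Prop) (g : T -> T') N :
  equivr E' -> (forall x, X x -> X' (g x)) ->
  (forall x y, X x -> X y -> E x y <-> E' (g x) (g y)) ->
  (forall y, X' y -> exists2 x, X x & E' y (g x)) ->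
  nclasses E X N <-> nclasses E' X' N.
Proof.
move=> [_ sE tE] gX gE sg; split=> -[f [Xf If cf]].
- exists (g \o f); split=> [i|i j /=|y /sg [x Xx yx]]; first exact: gX.
    by rewrite -gE //; apply: If.
  have [i xi] := cf _ Xx; exists i; apply: tE yx _.
  by apply/gE.
- have [h Ph] := choice_ex (fun i => (let: ex_intro2 x a b := sg _ (Xf i) in ex_intro _ x (conj a b))).
  exists h; split=> [i|i j|x Xx]; first by case: (Ph i).
    move=> /(gE _ _ (Ph i).1 (Ph j).1) hij; apply: If; apply: (tE _ _ _ (Ph i).2); apply: (tE _ _ _ hij).
    by apply: sE; case: (Ph j).
  have [i xi] := cf _ (gX _ Xx); exists i; apply/gE => //; first by case: (Ph i).
  by apply: tE xi _; case: (Ph i).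
Qed.

Lemma nc_ext (T : Type) (E E' : T -> T -> Prop) (X X' : T -> Prop) N :
  (forall x y, E x y <-> E' x y) -> (forall x, X x <-> X' x) ->
  nclasses E X N -> nclasses E' X' N.
Proof.
move=> eE eX [f [Xf If cf]]; exists f; split=> [i|i j|x]; first by apply/eX.
  by move/eE; apply: If.
by move/eX/cf => [i h]; exists i; apply/eE.
Qed.

Lemma nc_pos (T : Type) (E : T -> T -> Prop) (X : T -> Prop) N x :
  nclasses E X N -> X x -> (0 < N)%N.
Proof. by move=> [f [_ _ cf]] /cf [i _]; apply: leq_ltn_trans (ltn_ord i). Qed.

Section Subgroups.
Variable V : zmodType.
Implicit Types A B C : V -> Prop.

Lemma subg0 A : subg A -> A 0. Proof. by case. Qed.
Lemma subgB A x y : subg A -> A x -> A y -> A (x - y). Proof. by case=> _; apply. Qed.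
Lemma subgN A x : subg A -> A x -> A (- x).
Proof. by move=> sA Ax; rewrite -sub0r; apply: subgB => //; apply: subg0. Qed.
Lemma subgD A x y : subg A -> A x -> A y -> A (x + y).
Proof. by move=> sA Ax Ay; rewrite -[y]opprK; apply: subgB => //; apply: subgN. Qed.
Lemma subgMn A x n : subg A -> A x -> A (x *+ n).
Proof. by move=> sA Ax; elim: n => [|n ih]; [apply: subg0|rewrite mulrS; apply: subgD]. Qed.
Lemma subgMz A x (n : int) : subg A -> A x -> A (x *~ n).
Proof.
move=> sA Ax; case: n => n; first exact: subgMn.
by rewrite NegzE mulrNz; apply: subgN => //; apply: subgMn.
Qed.
Lemma subg_sum A I (r : seq I) (P : pred I) (f : I -> V) : subg A ->
  (forall i, P i -> A (f i)) -> A (\sum_(i <- r | P i) f i).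
Proof. by move=> sA Af; apply: (big_ind A) => // *; [apply: subg0|apply: subgD]. Qed.
Lemma subg_cong A x y : subg A -> A (x - y) -> A y -> A x.
Proof. by move=> sA Axy Ay; rewrite -[x](subrK y); apply: subgD. Qed.

Lemma subg_eqv A : subg A -> equivr (fun x y => A (x - y)).
Proof.
move=> sA; split=> [x|x y|x y z].
- by rewrite subrr; apply: subg0.
- by move=> /(subgN sA); rewrite opprB.
- by move=> h1 /(subgD sA h1); rewrite addrA subrK.
Qed.

Lemma subgI A B : subg A -> subg B -> subg (fun x => A x /\ B x).
Proof.
move=> sA sB; split; first by split; apply: subg0.
by move=> x y [? ?] [? ?]; split; apply: subgB.
Qed.

Lemma subgP A B : subg A -> subg B -> subg (fun x => exists a b, [/\ A a, B b & x = a + b]).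
Proof.
move=> sA sB; split; first by exists 0, 0; split; rewrite ?addr0 //; apply: subg0.
move=> _ _ [a [b [Aa Bb ->]]] [c [d [Ac Bd ->]]]; exists (a - c), (b - d).
by split; [apply: subgB|apply: subgB|rewrite opprD addrACA].
Qed.

Lemma idx_uniq A B n m : subg B -> idx A B n -> idx A B m -> n = m.
Proof. by move=> sB; apply: nc_uniq; apply: subg_eqv. Qed.

Lemma idx_pos A B n : subg A -> idx A B n -> (0 < n)%N.
Proof. by move=> sA h; apply: nc_pos h (subg0 sA). Qed.

Lemma idx_mul A B C n m : subg A -> subg B -> subg C ->
  (forall x, C x -> B x) -> (forall x, B x -> A x) ->
  idx A B n -> idx B C m -> idx A C (n * m).
Proof.
move=> sA sB sC CB BA [f [Af If cf]] [g [Bg Ig cg]].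
have -> : (n * m = #|{: 'I_n * 'I_m}|)%N by rewrite card_prod !card_ord.
apply: (nc_card (f := fun ij => f ij.1 + g ij.2)) => [[i j]|[i j] [i' j'] /=|x Ax] /=.
- by apply: subgD => //; apply: BA.
- move=> h; have e : i = i'.
    apply: If; have := CB _ h; rewrite opprD addrACA => h'.
    apply: (subg_cong sB (y := - (g j - g j'))); first by rewrite opprK.
    by apply: subgN => //; apply: subgB.
  by rewrite e in h *; congr (_, _); apply: Ig; move: h; rewrite opprD addrACA subrr add0r.
- have [i xi] := cf _ Ax; have [j yj] := cg _ xi; exists (i, j).
  by rewrite opprD addrA.
Qed.

(** The converse of [idx_mul]: finiteness of the large index yields both factors. Comparing two such
    factorizations of one number replaces exact sequences of finite groups throughout. *)
Lemma idx_sub A B C k : subg A -> subg B -> subg C ->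
  (forall x, C x -> B x) -> (forall x, B x -> A x) ->
  idx A C k -> exists n m, [/\ idx A B n, idx B C m & k = (n * m)%N].
Proof.
move=> sA sB sC CB BA h.
have [n _ hn] : exists2 n, (n <= k)%N & idx A B n.
  by apply: (nc_inj (g := id)) h => //; try exact: subg_eqv; move=> x y _ _; apply: CB.
have [m _ hm] : exists2 m, (m <= k)%N & idx B C m.
  by apply: (nc_sub _ _ h) => //; exact: subg_eqv.
exists n, m; split=> //; apply: idx_uniq h _ => //; exact: idx_mul hn hm.
Qed.

Lemma idx_ext A B A' B' n : (forall x, A x <-> A' x) -> (forall x, B x <-> B' x) ->
  idx A B n -> idx A' B' n.
Proof. by move=> eA eB; apply: nc_ext => // x y; apply: eB. Qed.

Lemma idx1 A : subg A -> idx A A 1.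
Proof.
move=> sA; exists (fun _ => 0); split=> [_|i j _|x Ax]; first exact: subg0.
  by rewrite !ord1.
by exists ord0; rewrite subr0.
Qed.

Lemma idx1P A B : subg A -> subg B -> idx A B 1 -> forall x, A x -> B x.
Proof.
move=> sA sB [f [Af _ cf]] x Ax.
have [i h1] := cf _ Ax; have [j] := cf _ (subg0 sA).
rewrite sub0r ord1 => /(subgN sB); rewrite opprK => h2.
by move: h1; rewrite ord1 => /subg_cong; apply.
Qed.

End Subgroups.

(** The hypotheses say that [g] induces an isomorphism from A / B onto A' / B'. Connecting
    homomorphisms below are treated as pairs of such maps out of a common group. *)
Lemma idx_hom (V W : zmodType) (g : V -> W) (A B : V -> Prop) (A' B' : W -> Prop) n :
  subg A -> subg B' -> (forall x y, g (x - y) = g x - g y) -> (forall x, A x -> A' (g x)) ->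
  (forall x, A x -> B x <-> B' (g x)) ->
  (forall y, A' y -> exists2 x, A x & B' (y - g x)) ->
  idx A B n <-> idx A' B' n.
Proof.
move=> sA sB' gB gA gBB sg; apply: nc_iso (subg_eqv sB') gA _ sg => x y Ax Ay.
by rewrite -gB; apply: gBB; apply: subgB.
Qed.

(** * Orbits of a cyclic group of prime power order *)

Lemma card_fix_cyclic (T : finType) (s : {perm T}) (p n : nat) : prime p ->
  (forall x, iter (p ^ n.+1) s x = x) ->
  #|T| = #|[set x | iter (p ^ n) s x == x]| %[mod p ^ n.+1].
Proof.
move=> pp sp; set S := [set x | _].
have -> : #|T| = (#|S| + #|~: S|)%N by rewrite cardsC.
have iterM a x L : iter L s x = x -> iter (a * L) s x = x.
  by move=> h; elim: a => // a ih; rewrite mulSn iterD ih.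
have orb x : x \notin S -> #|porbit s x| = (p ^ n.+1)%N.
  set L := #|porbit s x|; rewrite inE => xS.
  have L0 : (0 < L)%N by rewrite lt0n card_porbit_neq0.
  have iL : iter L s x = x by apply: iter_porbit.
  have per m : iter m s x = x -> (L %| m)%N.
    move=> hm; rewrite /dvdn; set r := (m %% L)%N.
    have hr : iter r s x = x.
      by move: hm; rewrite (divn_eq m L) addnC iterD iterM.
    have rL : (r < L)%N by rewrite ltn_mod.
    have := uniq_traject_porbit s x; rewrite -/L => /(nth_uniq x) h.
    have := h r 0 _ _; rewrite size_traject rL L0 !nth_traject // => <- //=.
    by rewrite hr.
  case/(dvdn_pfactor _ _ pp): (per _ (sp x)) => k kn Lk; rewrite Lk; congr (_ ^ _)%N.
  apply/eqP; rewrite eqn_leq kn ltnNge; apply/negP => kn'.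
  case/negP: xS; apply/eqP; rewrite -(subnK kn') expnD -Lk; exact: iterM.
have acts : [acts <[s]>%g, on ~: S | 'P].
  rewrite cycle_subG; apply/astabsP => x; rewrite !inE /= apermE.
  by rewrite -iterSr iterS (inj_eq perm_inj).
suff h : (p ^ n.+1 %| #|~: S|)%N.
  by apply/eqP; rewrite -[in X in _ == X](addn0 #|S|) eqn_modDl mod0n.
rewrite -(acts_sum_card_orbit acts); apply: dvdn_sum => _ /imsetP [x xS ->].
have := orb x; rewrite inE in xS => /(_ xS) e.
suff -> : orbit 'P <[s]>%G x = porbit s x by rewrite e.
by rewrite porbitE.
Qed.

(* A generator of Z/p^(n+1) acting on the classes: a class not fixed by the
   subgroup of order p has trivial stabilizer, hence an orbit of size p^(n+1). *)
Lemma nc_fix_mod (T : Type) (E : T -> T -> Prop) (X : T -> Prop) (s : T -> T) p n N :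
  prime p -> equivr E -> (forall x, X x -> X (s x)) ->
  (forall x y, X x -> X y -> E x y -> E (s x) (s y)) ->
  (forall x, X x -> E (iter (p ^ n.+1) s x) x) -> nclasses E X N ->
  exists2 M, nclasses E (fun x => X x /\ E (iter (p ^ n) s x) x) M
           & N = M %[mod p ^ n.+1].
Proof.
move=> pp eE Xs Es sp [f [Xf If cf]]; have [rE sE tE] := eE.
have [g gP] := choice_ex (fun i => cf _ (Xs _ (Xf i))).
have Xit k x : X x -> X (iter k s x) by elim: k => //= k ih /ih; apply: Xs.
have Eit k x y : X x -> X y -> E x y -> E (iter k s x) (iter k s y).
  by elim: k => //= k ih Xx Xy xy; apply: Es; [apply: Xit|apply: Xit|apply: ih].
have git k i : E (iter k s (f i)) (f (iter k g i)).
  elim: k => [|k ih] /=; first exact: rE.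
  by apply: (tE _ _ _ _ (gP _)); apply: Es => //; apply: Xit.
have gid i : iter (p ^ n.+1) g i = i.
  by apply: If; apply: (tE _ _ _ _ (sp _ (Xf i))); apply: sE.
have p0 : (0 < p ^ n.+1)%N by rewrite expn_gt0 prime_gt0.
have gi : injective g.
  by move=> a b gab; rewrite -[a]gid -[b]gid -(prednK p0) !iterSr gab.
pose G := perm gi.
have itG k i : iter k G i = iter k g i by elim: k => //= k ->; rewrite permE.
have := card_fix_cyclic pp (s := G) (n := n); rewrite card_ord => /(_ _) h.
exists #|[set x | iter (p ^ n) G x == x]|; last by apply: h => x; rewrite itG gid.
set S := [set _ | _].
rewrite -[#|S|](card_ord #|S|).
apply: (nc_card (f := fun i : 'I_#|S| => f (enum_val i))).
- move=> i; split=> //; have := enum_valP i; rewrite inE itG => /eqP e.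
  by rewrite -[X in E _ (f X)]e.
- by move=> i j /If /enum_val_inj.
- move=> x [Xx xs]; have [i xi] := cf _ Xx.
  have iS : i \in S.
    rewrite inE itG; apply/eqP; apply: If.
    apply: (tE _ _ _ _ xi); apply: (tE _ _ _ _ xs).
    apply: (tE _ _ _ _ (Eit (p ^ n)%N _ _ (Xf i) Xx (sE _ _ xi))).
    by apply: sE; apply: git.
  by exists (enum_rank_in iS i); rewrite enum_rankK_in.
Qed.

(** * Cauchy's theorem and the primary parts of an index *)

Section Cauchy.
Variable V : zmodType.
Implicit Types A B : V -> Prop.

(** [r] is the order of [x] modulo B, finite because n + 1 multiples of [x] fall into n classes. *)
Lemma idx_cyclic A B n x : subg A -> subg B -> idx A B n -> A x -> ~ B x ->
  (forall y, B y -> A y) ->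
  exists2 r, (1 < r)%N & idx (fun y => exists k : nat, B (y - x *+ k)) B r /\
   (B (x *+ r) /\ forall k, (0 < k < r)%N -> ~ B (x *+ k)).
Proof.
move=> sA sB [f [Af If cf]] Ax nBx BA.
have [c cP] := choice_ex (fun k => cf _ (subgMn k sA Ax)).
have [r0 r0P] : exists r, (0 < r)%N && `[< B (x *+ r) >].
  have [ci|] := pselect (injective (fun i : 'I_n.+1 => c i)).
    by have := leq_card _ ci; rewrite !card_ord ltnn.
  move/existsNP => [i /existsNP [j /not_implyP [cij /eqP nij]]].
  wlog ij : i j cij nij / (i < j)%N.
    move=> h; case: (ltngtP i j) => [|ji|/val_inj e]; first exact: h.
      by apply: (h j i) => //; rewrite eq_sym.
    by rewrite e eqxx in nij.
  exists (j - i)%N; rewrite subn_gt0 ij; apply/asboolP.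
  rewrite mulrnBr; last exact: ltnW.
  have := subgB sB (cP j) (cP i).
  by rewrite cij opprB addrA subrK.
have exr : exists r, (0 < r)%N && `[< B (x *+ r) >] by exists r0.
case: (ex_minnP exr) => r /andP [r_gt0 /asboolP Br] rmin.
have r1 : (1 < r)%N.
  by rewrite ltn_neqAle eq_sym r_gt0 andbT; apply/eqP => e; rewrite e mulr1n in Br.
have nB k : (0 < k < r)%N -> ~ B (x *+ k).
  move=> /andP [k0 kr] Bk; have := rmin k; rewrite k0 leqNgt kr => /(_ _) h.
  by have := h (asboolT Bk).
exists r => //; split=> //.
exists (fun i : 'I_r => x *+ i); split.
- by move=> i; exists i; rewrite subrr; apply: subg0.
- move=> i j h; apply: val_inj => /=.
  wlog ij : i j h / (i <= j)%N.
    move=> w; case/orP: (leq_total i j) => [|ji]; first exact: w.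
    by apply/esym/w => //; rewrite -opprB; apply: subgN.
  apply/eqP; rewrite eqn_leq ij /= leqNgt; apply/negP => lij.
  apply: (nB (j - i)%N); first by rewrite subn_gt0 lij (leq_ltn_trans (leq_subr _ _)).
  by rewrite mulrnBr // -opprB; apply: subgN.
- move=> y [k yk]; have kr : (k %% r < r)%N by rewrite ltn_mod.
  exists (Ordinal kr) => /=.
  apply: (subg_cong sB (y := y - x *+ k)) => //.
  rewrite opprB addrC addrA subrK {1}(divn_eq k r) mulrnDr addrK mulnC mulrnA.
  exact: subgMn.
Qed.

Lemma subg_cyc B x r : subg B -> (0 < r)%N -> B (x *+ r) ->
  subg (fun y => exists k : nat, B (y - x *+ k)).
Proof.
move=> sB r0 Br; split; first by exists 0; rewrite mulr0n subr0; apply: subg0.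
move=> y z [k hk] [m hm]; exists (k + m * r.-1)%N.
have -> : y - z - x *+ (k + m * r.-1) = (y - x *+ k) - (z - x *+ m) - x *+ r *+ m.
  have -> : x *+ r *+ m = x *+ m + x *+ (m * r.-1).
    by rewrite -mulrnA -[in LHS](prednK r0) mulSn mulrnDr mulnC.
  by rewrite opprB [x *+ m - z]addrC addrA addrKA mulrnDr opprD !addrA [in RHS](addrAC y).
by apply: subgB => //; [apply: subgB|apply: subgMn].
Qed.

(** Cauchy's theorem by induction on the index: an element outside B has order prime to l modulo B,
    and adding the cyclic group it generates to B lowers the index and keeps the quotient free of
    l-torsion. *)
Lemma idx_coprime l n A B : prime l -> subg A -> subg B -> (forall y, B y -> A y) ->
  (forall x, A x -> B (x *+ l) -> B x) -> idx A B n -> coprime l n.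
Proof.
move=> pl sA; elim/ltn_ind: n B => n IH B sB BA tf hn.
have [AB|/existsNP [x /not_implyP [Ax nBx]]] := pselect (forall x, A x -> B x).
  have -> : n = 1 by apply: idx_uniq hn _ => //; apply: idx_ext (idx1 sA) => // x; split; auto.
  exact: coprimen1.
have [r r1 [hr [Br nB]]] := idx_cyclic sA sB hn Ax nBx BA.
set B' := (fun y => _) in hr.
have lr : coprime l r.
  rewrite prime_coprime //; apply/negP => /dvdnP [k rk].
  have k0 : (0 < k < r)%N.
    by move: r1 (prime_gt1 pl); rewrite rk; case: k {rk} => // k; nia.
  apply: (nB k k0); apply: tf; first exact: subgMn.
  by rewrite -mulrnA -rk.
have sB' : subg B' by apply: subg_cyc (ltnW r1) Br.
have B'A y : B' y -> A y.
  by move=> [k /BA h]; apply: subg_cong h _ => //; apply: subgMn.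
have BB' y : B y -> B' y by move=> By; exists 0; rewrite mulr0n subr0.
have [n1 [n2 [h1 h2 e]]] := idx_sub sA sB' sB BB' B'A hn.
have e2 : n2 = r by apply: idx_uniq h2 hr.
rewrite e e2 coprimeMr lr andbT; apply: (IH n1 _ B') => //.
- have := idx_pos sA h1; rewrite e e2 => n10; nia.
- move=> y Ay [k hk].
  (* As l is invertible modulo r, the multiple k of x is congruent to l u times x; subtracting u x
     from y leaves an element killed by l modulo B. *)
  have [u _ hu] : exists2 u : nat, true & (l * u = k %[mod r])%N.
    case: (egcdnP r (prime_gt0 pl)) => a b hab _.
    exists (a * k)%N => //.
    have g1 : gcdn l r = 1 by apply/eqP.
    by rewrite mulnA [(l * a)%N]mulnC hab g1 mulnDl mul1n mulnAC modnMDl.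
  exists u; apply: tf; first by apply: subgB => //; apply: subgMn.
  have e3 : (y - x *+ u) *+ l = (y *+ l - x *+ k) + (x *+ k - x *+ (l * u)).
    by rewrite mulrnBl -mulrnA [(u * l)%N]mulnC addrA subrK.
  rewrite e3; apply: subgD => //.
  rewrite (divn_eq k r) (divn_eq (l * u)%N r) hu !mulrnDr opprD addrACA subrr addr0.
  by apply: subgB => //; rewrite mulnC mulrnA; apply: subgMn.
Qed.

Lemma idx_pnat p n A B : prime p -> subg A -> subg B -> (forall y, B y -> A y) ->
  (forall x, A x -> exists k, B (x *+ p ^ k)) -> idx A B n -> p.-nat n.
Proof.
move=> pp sA sB BA tors hn.
apply/pnatP; first exact: idx_pos hn.
move=> l pl ln; rewrite inE; apply/negP => /negP lp.
suff : coprime l n by rewrite prime_coprime // ln.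
apply: idx_coprime hn => // x Ax Bl; have [k Bk] := tors x Ax.
have pk0 : (0 < p ^ k)%N by rewrite expn_gt0 prime_gt0.
case: (egcdnP l pk0) => a b hab _.
have g1 : gcdn (p ^ k) l = 1.
  by apply/eqP; rewrite -/(coprime _ _) coprimeXl // prime_coprime // dvdn_prime2 // eq_sym.
have -> : x = x *+ p ^ k *+ a - x *+ l *+ b.
  by rewrite -!mulrnA mulnC hab g1 addnC [(b * _)%N]mulnC mulrnDr addrK mulr1n.
by apply: subgB => //; apply: subgMn.
Qed.

(** The p-torsion part [Ap] lies between B and A with [Ap] / B a p-group and A / [Ap] without
    p-torsion, so its index over B is exactly the p-part of n. The roles are exchanged for [Aq]. *)
Lemma idx_parts p n A B : prime p -> subg A -> subg B -> (forall y, B y -> A y) ->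
  idx A B n ->
  idx (fun x => A x /\ exists k, B (x *+ p ^ k)) B n`_p /\
  idx (fun x => A x /\ exists m, ((0 < m)%N /\ coprime m p) /\ B (x *+ m)) B n`_p^'.
Proof.
move=> pp sA sB BA hn.
set Ap := (fun x => _ /\ exists k, _); set Aq := (fun x => _ /\ exists m, _ /\ _).
have sAp : subg Ap.
  split; first by split; [apply: subg0|exists 0; rewrite mul0rn; apply: subg0].
  move=> x y [Ax [k hk]] [Ay [m hm]]; split; first exact: subgB.
  exists (k + m)%N; rewrite mulrnBl expnD mulrnA [(p ^ k * _)%N]mulnC mulrnA.
  by apply: subgB => //; apply: subgMn.
have sAq : subg Aq.
  split; first by split; [apply: subg0|exists 1; rewrite mul0rn coprime1n; split=> //; apply: subg0].
  move=> x y [Ax [k [[k0 ck] hk]]] [Ay [m [[m0 cm] hm]]]; split; first exact: subgB.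
  exists (k * m)%N; rewrite muln_gt0 k0 m0 coprimeMl ck cm; split=> //.
  rewrite mulrnBl mulrnA [(k * _)%N]mulnC mulrnA.
  by apply: subgB => //; apply: subgMn.
have BAp y : B y -> Ap y by move=> By; split; [apply: BA|exists 0; rewrite expn0 mulr1n].
have BAq y : B y -> Aq y by move=> By; split; [apply: BA|exists 1; rewrite coprime1n mulr1n].
have ApA y : Ap y -> A y by case.
have [b [a [hb ha e]]] := idx_sub sA sAp sB BAp ApA hn.
have pa : p.-nat a by apply: (idx_pnat pp sAp sB BAp _ ha) => x [_ [k hk]]; exists k.
have n0 := idx_pos sA hn.
have [n1 n2] := idx_sub sA sAq sB BAq (fun y h => h.1) hn.
case: n2 => c [hn1 hc ec].
have cc : coprime p c.
  apply: (idx_coprime pp sAq sB BAq _ hc) => x [Ax [m [[m0 cm] hm]]] Bp.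
  case: (egcdnP p m0) => u v huv _; move: cm => /eqP g1.
  have -> : x = x *+ m *+ u - x *+ p *+ v.
    by rewrite -!mulrnA mulnC huv g1 addnC [(v * _)%N]mulnC mulrnDr addrK mulr1n.
  by apply: subgB => //; apply: subgMn.
have pn1 : p.-nat n1.
  apply: (idx_pnat pp sA sAq _ _ hn1) => [y [] //|x Ax].
  (* Lagrange: the order of y modulo B divides n. Hence the p-part of n sends every x into [Aq]. *)
  have Bn y : A y -> B (y *+ n).
    move=> Ay; have [By|nBy] := pselect (B y); first exact: subgMn.
    have [r r1 [hr [Br nB]]] := idx_cyclic sA sB hn Ay nBy BA.
    have [] := @idx_sub _ A (fun y' => exists k, B (y' - y *+ k)) B n sA _ sB _ _ hn.
    - by apply: subg_cyc (ltnW r1) Br.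
    - by move=> z Bz; exists 0; rewrite mulr0n subr0.
    - by move=> z [k /BA h]; apply: subg_cong h _ => //; apply: subgMn.
    - move=> u [v [_ hv ->]]; rewrite (idx_uniq sB hv hr) mulnC mulrnA.
      exact: subgMn.
  exists (logn p n); rewrite /Aq; split; first exact: subgMn.
  exists (n`_p^')%N; rewrite part_gt0 -mulrnA -p_part partnC //; split; last exact: Bn.
  by split=> //; rewrite coprime_sym (pnat_coprime (pnat_id pp)) // part_pnat.
have ca : (n`_p = a)%N.
  have := ha => _.
  rewrite e partnM //; last 2 first.
  - exact: idx_pos hb.
  - exact: idx_pos ha.
  rewrite (part_pnat_id pa).
  suff -> : (b`_p = 1)%N by rewrite mul1n.
  apply: part_p'nat; apply/pnatP; first exact: idx_pos hb.
  move=> l pl lb; rewrite !inE; apply/negP => /eqP lp.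
  suff : coprime p b by rewrite prime_coprime // -lp lb.
  apply: (idx_coprime pp sA sAp ApA _ hb) => x Ax [_ [k hk]]; split=> //.
  by exists k.+1; rewrite expnS mulrnA.
have cq : (n`_p^' = c)%N.
  rewrite ec partnM //; last 2 first.
  - exact: idx_pos hn1.
  - exact: idx_pos hc.
  rewrite part_p'nat ?pnatNK // mul1n part_pnat_id //.
  apply/pnatP; first exact: idx_pos hc.
  move=> l pl lc; rewrite !inE; apply/negP => /eqP lp.
  by move: cc; rewrite prime_coprime // -lp lc.
by rewrite ca cq.
Qed.

End Cauchy.

(** * Convergence in Z_p *)

Lemma padic_ext p a b : (forall n, a n = b n) -> padic_converges p a -> padic_converges p b.
Proof. by move=> e; have -> : b = a by apply: funext. Qed.

Lemma padic_cauchy p a :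
  (forall m, exists N, forall n, (N <= n)%N -> a n.+1 = a n %[mod p ^ m]) ->
  padic_converges p a.
Proof.
move=> /choice_ex [N NP].
have st m n : (N m <= n)%N -> a n = a (N m) %[mod p ^ m].
  move=> /subnKC <-; elim: (n - N m)%N => [|k ih]; first by rewrite addn0.
  by rewrite addnS NP ?leq_addr.
exists (fun m => a (N m)); split=> m; last by exists (N m) => n /st.
have h1 := st m _ (leq_maxl (N m) (N m.+1)).
have h2 := st m.+1 _ (leq_maxr (N m) (N m.+1)).
rewrite -h1; have d : (p ^ m %| p ^ m.+1)%N by rewrite expnS dvdn_mull.
by rewrite -(modn_dvdm _ d) -h2 modn_dvdm.
Qed.

Lemma padic_mul p a b : padic_converges p a -> padic_converges p b ->
  padic_converges p (fun n => a n * b n)%N.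
Proof.
move=> [x [xc xl]] [y [yc yl]]; exists (fun m => x m * y m)%N; split=> m.
  by rewrite -modnMm xc yc modnMm.
have [N1 h1] := xl m; have [N2 h2] := yl m; exists (maxn N1 N2) => n.
by rewrite geq_max => /andP [n1 n2]; rewrite -modnMm h1 // h2 // modnMm.
Qed.

(** Modulo p^m, the power p^v depends only on min(v, m). By the hypothesis this minimum is
    nondecreasing for large n, and being bounded by m it is eventually constant. *)
Lemma padic_pow p (v : nat -> nat) n0 : (0 < p)%N ->
  (forall n, (n0 <= n)%N -> (minn n (v n) <= v n.+1)%N) ->
  padic_converges p (fun n => p ^ v n)%N.
Proof.
move=> p0 hv; apply: padic_cauchy => m.
pose w n := minn (v n) m.
have wm n : (maxn n0 m <= n)%N -> (w n <= w n.+1)%N.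
  rewrite geq_max /w => /andP [/hv h hm]; lia.
have pw n : (p ^ v n = p ^ w n %[mod p ^ m])%N.
  rewrite /w; case: (leqP (v n) m) => // mv.
  by rewrite modnn -(subnK (ltnW mv)) expnD modnMl.
pose N0 := maxn n0 m.
have [N NP] : exists N, forall n, (N <= n)%N -> w (N0 + n)%N = w (N0 + N)%N.
  pose P k := `[< exists n, w (N0 + n)%N = k >].
  have exP : exists k, P k by exists (w (N0 + 0)%N); apply/asboolP; exists 0.
  have bP k : P k -> (k <= m)%N by move=> /asboolP [n <-]; apply: geq_minr.
  case: (ex_maxnP exP bP) => k /asboolP [N wN] mx; exists N => n Nn.
  apply/eqP; rewrite eqn_leq; apply/andP; split.
    by rewrite wN; apply: mx; apply/asboolP; exists n.
  rewrite -(subnKC Nn); elim: (n - N)%N => [|j ih]; first by rewrite addn0.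
  apply: leq_trans ih _; rewrite !addnS; apply: wm.
  by rewrite leq_addr.
exists (N0 + N)%N => n Nn; rewrite pw [RHS]pw; congr (_ ^ _ %% _)%N.
have h : (N0 <= n)%N by apply: leq_trans Nn; apply: leq_addr.
have e1 := NP (n - N0)%N; have e2 := NP (n.+1 - N0)%N.
rewrite subnKC in e1 => //; rewrite subnKC in e2; last exact: leqW.
rewrite e1 ?e2 //; lia.
Qed.

(** The element 1 + s + ... + s^(k-1) of the group ring; it is a norm when W is a multiplicative
    group written additively. *)
Definition trc (W : zmodType) (s : W -> W) k (x : W) := \sum_(i < k) iter i s x.

Section Additive.
Variables (W W' : zmodType) (s : W -> W').
Hypothesis sB : forall x y, s (x - y) = s x - s y.

Lemma morB0 : s 0 = 0. Proof. by rewrite -[X in s X](subrr 0) sB subrr. Qed.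
Lemma morBN x : s (- x) = - s x. Proof. by rewrite -sub0r sB morB0 sub0r. Qed.
Lemma morBD x y : s (x + y) = s x + s y.
Proof. by rewrite -{1}[y]opprK sB morBN opprK. Qed.
Lemma morB_sum I r (P : pred I) F : s (\sum_(i <- r | P i) F i) = \sum_(i <- r | P i) s (F i).
Proof. exact: (big_morph s morBD morB0). Qed.
Lemma morB_Mn x n : s (x *+ n) = s x *+ n.
Proof. by elim: n => [|n ih]; [rewrite !mulr0n morB0|rewrite !mulrS morBD ih]. Qed.
End Additive.

Section Generic.
Variables (W : zmodType) (s : W -> W).
Hypothesis sB : forall x y, s (x - y) = s x - s y.

Lemma iterB k x y : iter k s (x - y) = iter k s x - iter k s y.
Proof. by elim: k => [|k ih] //=; rewrite ih. Qed.
Lemma iter_morD k x y : iter k s (x + y) = iter k s x + iter k s y.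
Proof. by elim: k => [|k ih] //=; rewrite ih (morBD sB). Qed.
Lemma trcB k x y : trc s k (x - y) = trc s k x - trc s k y.
Proof. by rewrite /trc -sumrB; apply: eq_bigr => i _; rewrite iterB. Qed.
Lemma trc_s k x : s (trc s k x) - trc s k x = iter k s x - x.
Proof.
rewrite /trc (morB_sum sB) -sumrB -(big_mkord xpredT (fun i => s (iter i s x) - iter i s x)).
by rewrite (telescope_sumr (fun i => iter i s x)).
Qed.
Lemma trc_sub k x : trc s k (s x - x) = iter k s x - x.
Proof. by rewrite trcB -trc_s /trc (morB_sum sB); congr (_ - _); apply: eq_bigr => i _; rewrite -iterSr iterS. Qed.
Lemma trc_fix k x : s x = x -> trc s k x = x *+ k.
Proof.
move=> sx; rewrite /trc (eq_bigr (fun=> x)) ?sumr_const ?card_ord // => i _.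
by elim: (nat_of_ord i) => //= j ->.
Qed.
Lemma trc_comp a b x : trc s (a * b) x = trc s a (trc (iter a s) b x).
Proof.
have ha z i : iter i (iter a s) z = iter (i * a) s z.
  by elim: i => //= i ->; rewrite mulSn iterD.
rewrite /trc; under [RHS]eq_bigr => i _.
  have -> : iter i s (\sum_(j < b) iter j (iter a s) x) =
            \sum_(j < b) iter (i + j * a) s x.
    rewrite (big_morph (iter i s) (id1 := 0) (op1 := +%R)).
    - by apply: eq_bigr => j _; rewrite ha iterD.
    - exact: iter_morD.
    - by elim: (nat_of_ord i) => //= n ->; rewrite (morB0 sB).
  over.
rewrite exchange_big /= -(big_mkord xpredT (fun i => iter i s x)) mulnC.
rewrite big_nat_mul big_mkord; apply: eq_bigr => j _.
by rewrite -{1}[(j * a)%N]add0n big_addn mulSn addnK big_mkord.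
Qed.
Lemma trcC k l x : trc s k (iter l s x) = iter l s (trc s k x).
Proof.
elim: l => //= l ih; rewrite -ih /trc (morB_sum sB).
by apply: eq_bigr => i _; rewrite -iterSr.
Qed.
End Generic.

(** * The ambiguous class formula *)

Section Chevalley.
Variables (M V : zmodType) (d : M -> V) (sM : M -> M) (sV : V -> V) (g : nat).
Hypothesis dB : forall x y, d (x - y) = d x - d y.
Hypothesis sMB : forall x y, sM (x - y) = sM x - sM y.
Hypothesis sVB : forall x y, sV (x - y) = sV x - sV y.
Hypothesis ds : forall x, d (sM x) = sV (d x).
Hypothesis sMg : forall x, iter g sM x = x.
Hypothesis sVg : forall v, iter g sV v = v.
Hypothesis H90 : forall x, trc sM g x = 0 -> exists y, x = sM y - y.
Variables I0 J : V -> Prop.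
Hypotheses (sI0 : subg I0) (sJ : subg J).
Hypothesis I0s : forall v, I0 v -> I0 (sV v).
Hypothesis I0d : forall x, I0 (d x).
Hypothesis JI0 : forall v, J v -> I0 v /\ sV v = v.
Hypothesis Jd : forall x, sM x = x -> J (d x).

(** Intended reading: M is the multiplicative group of the top field, V its divisors, d the
    principal divisor map, I0 the divisors whose classes are counted, J those extended from the
    base. Then J modulo [Pr'] is the class group of the base. *)
Definition Pr v := exists x, v = d x.
Definition Prf v := Pr v /\ sV v = v.
Definition Pr' v := exists x, sM x = x /\ v = d x.
Definition I0f v := I0 v /\ sV v = v.
(** With E the kernel of d, [EkerN] modulo [Esub] is H^1(E), in the shape H^-1 that it takes for a
    cyclic group, and [Ef] modulo [ENE] is Tate's H^0(E). *)
Definition EkerN x := d x = 0 /\ trc sM g x = 0.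
Definition Esub x := exists y, d y = 0 /\ x = sM y - y.
Definition Ef x := d x = 0 /\ sM x = x.
Definition ENE x := exists y, d y = 0 /\ x = trc sM g y.
(** Fixed units that are norms of arbitrary elements, as opposed to norms of units in [ENE]; its
    index in [Ef] is the number s of the overview. *)
Definition Enorm x := Ef x /\ exists y, x = trc sM g y.
(** Modulo [Pr] these are the ambiguous classes, that is, the classes fixed by the group. *)
Definition Qamb v := I0 v /\ Pr (sV v - v).
(** [kerNP] modulo [sPr] is H^-1 of the principal divisors, and [sI0P] modulo [sPr] is the part that
    dies in H^-1(I0). The index of [sI0P] in [kerNP] is the X of the overview. *)
Definition kerNP v := Pr v /\ trc sV g v = 0.
Definition sPr v := exists u, Pr u /\ v = sV u - u.
Definition sI0P v := Pr v /\ exists u, I0 u /\ v = sV u - u.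

Let d0 := morB0 dB.
Let sM0 := morB0 sMB.
Let sV0 := morB0 sVB.
Let tB := trcB sMB g.
Let t0 := morB0 tB.

Lemma sub_comm (W : zmodType) (s : W -> W) : (forall x y, s (x - y) = s x - s y) ->
  forall x y, s (x - y) - (x - y) = (s x - x) - (s y - y).
Proof. by move=> sB x y; rewrite sB opprD addrACA opprD. Qed.

Lemma d_trc x : d (trc sM g x) = trc sV g (d x).
Proof.
rewrite /trc (morB_sum dB); apply: eq_bigr => i _.
by elim: (nat_of_ord i) => //= n ih; rewrite ds ih.
Qed.

Lemma sgPr : subg Pr.
Proof. by split; [exists 0; rewrite d0|move=> _ _ [x ->] [y ->]; exists (x - y)]. Qed.
Lemma sgPrf : subg Prf.
Proof.
split; first by split; [apply: subg0 sgPr|rewrite sV0].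
by move=> x y [Px ex] [Py ey]; split; [apply: (subgB sgPr)|rewrite sVB ex ey].
Qed.
Lemma sgPr' : subg Pr'.
Proof.
split; first by exists 0; rewrite sM0 d0.
by move=> _ _ [x [ex ->]] [y [ey ->]]; exists (x - y); rewrite sMB ex ey dB.
Qed.
Lemma sgI0f : subg I0f.
Proof.
split; first by split; [apply: subg0|rewrite sV0].
by move=> x y [Px ex] [Py ey]; split; [apply: subgB|rewrite sVB ex ey].
Qed.
Lemma sgEsub : subg Esub.
Proof.
split; first by exists 0; rewrite d0 sM0 subrr.
move=> _ _ [x [ex ->]] [y [ey ->]]; exists (x - y).
by rewrite dB ex ey subrr sub_comm.
Qed.
Lemma sgEf : subg Ef.
Proof.
split; first by split; rewrite ?d0 ?sM0.
by move=> x y [ex fx] [ey fy]; split; rewrite ?dB ?sMB ?ex ?ey ?fx ?fy ?subrr.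
Qed.
Lemma sgENE : subg ENE.
Proof.
split; first by exists 0; rewrite d0 t0.
by move=> _ _ [x [ex ->]] [y [ey ->]]; exists (x - y); rewrite dB ex ey subrr tB.
Qed.
Lemma sgEnorm : subg Enorm.
Proof.
split; first by split; [apply: subg0 sgEf|exists 0; rewrite t0].
move=> x y [ex [u eu]] [ey [v ev]]; split; last by exists (u - v); rewrite tB eu ev.
exact: (subgB sgEf ex ey).
Qed.
Lemma sgQ : subg Qamb.
Proof.
split; first by split; [apply: subg0|rewrite sV0 subrr; apply: subg0 sgPr].
move=> x y [Ix Px] [Iy Py]; split; first exact: subgB.
by rewrite sub_comm //; apply: (subgB sgPr).
Qed.
Lemma sgkerNP : subg kerNP.
Proof.
have tVB := trcB sVB g.
split; first by split; [apply: subg0 sgPr|rewrite (morB0 tVB)].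
by move=> x y [ex fx] [ey fy]; split; [apply: (subgB sgPr)|rewrite tVB fx fy subrr].
Qed.
Lemma sg_sPr : subg sPr.
Proof.
split; first by exists 0; split; [apply: subg0 sgPr|rewrite sV0 subrr].
move=> _ _ [x [Px ->]] [y [Py ->]]; exists (x - y); split; first exact: (subgB sgPr).
by rewrite sub_comm.
Qed.
Lemma sg_sI0P : subg sI0P.
Proof.
split; first by split; [apply: subg0 sgPr|exists 0; split; [apply: subg0|rewrite sV0 subrr]].
move=> v w [Pv [x [Ix ev]]] [Pw [y [Iy ew]]]; split; first exact: (subgB sgPr).
by exists (x - y); split; [apply: subgB|rewrite sub_comm // ev ew].
Qed.

Lemma Prf_Pr' v : Pr' v -> Prf v.
Proof. by move=> [x [ex ->]]; split; [exists x|rewrite -ds ex]. Qed.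

Lemma Ef_ENE x : ENE x -> Enorm x.
Proof.
move=> [y [ey ->]]; split; last by exists y.
split; last by apply/eqP; rewrite -subr_eq0 trc_s // sMg subrr.
by rewrite d_trc ey (morB0 (trcB sVB g)).
Qed.

(** The connecting map of 1 -> E -> M -> Pr -> 0. From the group [Y] of elements with fixed divisor,
    d leads to the left side and x -> s x - x to the right one; both have kernel [Y'], and Hilbert
    90 gives surjectivity on the right. *)
Lemma idx_H1 n : idx Prf Pr' n <-> idx EkerN Esub n.
Proof.
pose Y x := d (sM x - x) = 0.
pose Y' x := exists a e, [/\ sM a = a, d e = 0 & x = a + e].
have sY : subg Y.
  split; first by rewrite /Y sM0 subrr d0.
  by move=> x y Yx Yy; rewrite /Y sub_comm // dB Yx Yy subrr.
rewrite -(@idx_hom _ _ d Y Y' Prf Pr' n sY sgPr' dB); first last.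
- by move=> y [[x ->] sx]; exists x; rewrite ?subrr; [rewrite /Y dB ds sx subrr|apply: subg0 sgPr'].
- move=> x Yx; split=> [[a [e [sa de ->]]]|[a [sa da]]].
    by exists a; rewrite (morBD dB) de addr0.
  by exists a, (x - a); rewrite dB da subrr addrC subrK.
- by move=> x Yx; split; [exists x|apply/eqP; rewrite -ds -subr_eq0 -dB Yx].
refine (@idx_hom _ _ (fun x => sM x - x) Y Y' EkerN Esub n sY sgEsub _ _ _ _); first by move=> x y; exact: sub_comm.
- by move=> x Yx; split=> //; rewrite trc_sub // sMg subrr.
- move=> x Yx; split=> [[a [e [sa de ->]]]|[e [de se]]].
    by exists e; rewrite (morBD sMB) sa [a + sM e]addrC addrKA.
  exists (x - e), e; rewrite subrK; split=> //.
  by apply/eqP; rewrite -subr_eq0 sub_comm // se subrr.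
- move=> y [dy /H90 [x ex]]; exists x; first by rewrite /Y -ex.
  by rewrite ex subrr; apply: subg0 sgEsub.
Qed.

(** The next connecting map, from H^-1(Pr) to H^0(E), whose image consists of the classes of units
    that are norms. The common source [Y] is the group of elements whose norm is a unit. *)
Lemma idx_u n : idx kerNP sPr n <-> idx Enorm ENE n.
Proof.
pose Y x := d (trc sM g x) = 0.
pose Y' x := exists y e, [/\ d e = 0 & x = (sM y - y) + e].
have sY : subg Y.
  split; first by rewrite /Y t0 d0.
  by move=> x y Yx Yy; rewrite /Y tB dB Yx Yy subrr.
rewrite -(@idx_hom _ _ d Y Y' kerNP sPr n sY sg_sPr dB); first last.
- by move=> y [[x ->] sx]; exists x; rewrite ?subrr; [rewrite /Y d_trc|apply: subg0 sg_sPr].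
- move=> x Yx; split=> [[y [e [de ->]]]|[_ [[y ->] ey]]].
    by exists (d y); split; [exists y|rewrite (morBD dB) de addr0 dB ds].
  exists y, (x - (sM y - y)); rewrite dB ey dB ds subrr; split=> //.
  by rewrite addrC subrK.
- by move=> x Yx; split; [exists x|rewrite -d_trc].
refine (@idx_hom _ _ _ Y Y' Enorm ENE n sY sgENE tB _ _ _).
- move=> x Yx; split; last by exists x.
  by split=> //; apply/eqP; rewrite -subr_eq0 trc_s // sMg subrr.
- move=> x Yx; split=> [[y [e [de ->]]]|[e [de se]]].
    by exists e; rewrite (morBD tB) trc_sub // sMg subrr add0r.
  have /H90 [y ey] : trc sM g (x - e) = 0 by rewrite tB se subrr.
  by exists y, e; rewrite -ey subrK.
- move=> y [[dy _] [x ex]]; exists x; first by rewrite /Y -ex.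
  by rewrite ex subrr; apply: subg0 sgENE.
Qed.

(** Modulo [Pr], the classes that contain a fixed divisor. *)
Definition I0fP v := exists a b, [/\ I0f a, Pr b & v = a + b].

(** The principal divisor s v - v, taken modulo [sPr], is the obstruction to a fixed divisor in the
    ambiguous class of v. *)
Lemma idx_Q1 n : idx Qamb I0fP n <-> idx sI0P sPr n.
Proof.
refine (@idx_hom _ _ (fun x => sV x - x) Qamb I0fP sI0P sPr n sgQ sg_sPr _ _ _ _); first by move=> x y; exact: sub_comm.
- by move=> v [Iv Pv]; split=> //; exists v.
- move=> v [Iv Pv]; split=> [[a [b [[Ia sa] Pb ->]]]|[u [Pu eu]]].
    by exists b; split=> //; rewrite (morBD sVB) sa [a + sV b]addrC addrKA.
  exists (v - u), u; rewrite subrK; split=> //; split.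
    by apply: subgB => //; case: Pu => x ->.
  by apply/eqP; rewrite -subr_eq0 sub_comm // eu subrr.
- move=> v [Pv [u [Iu e]]]; exists u; first by split=> //; rewrite -e.
  by rewrite e subrr; apply: subg0 sg_sPr.
Qed.

Lemma idx_Q2 n : idx I0fP Pr n <-> idx I0f Prf n.
Proof.
apply: iff_sym; refine (@idx_hom _ _ id I0f Prf I0fP Pr n sgI0f sgPr _ _ _ _) => //.
- by move=> x Ix; exists x, 0; rewrite addr0; split=> //; apply: subg0 sgPr.
- by move=> x [Ix sx]; split=> [[]|Px] //.
- by move=> _ [a [b [Ia Pb ->]]]; exists a => //; rewrite addrC addKr.
Qed.

(** The index of [Pr'] in the fixed divisors is computed twice, through J and through the fixed
    principal divisors. *)
Lemma chev_H1 h W0 : idx J Pr' h -> idx I0f J W0 ->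
  exists a H1, [/\ idx I0f Prf a, idx EkerN Esub H1 & (W0 * h = a * H1)%N].
Proof.
move=> hh hW.
have J' v : Pr' v -> J v by move=> [x [sx ->]]; apply: Jd.
have := idx_mul sgI0f sJ sgPr' J' JI0 hW hh.
case/(idx_sub sgI0f sgPrf sgPr' Prf_Pr') => [v [[x ->] sx]|a [b [ha hb e]]].
  by split.
by exists a, b; split=> //; apply/idx_H1.
Qed.

Lemma sPr_sI0P v : sPr v -> sI0P v.
Proof.
move=> [_ [[x ->] ->]]; split; first by exists (sM x - x); rewrite dB ds.
by exists (d x).
Qed.

Lemma sI0P_kerNP v : sI0P v -> kerNP v.
Proof. by move=> [Pv [u [Iu e]]]; split=> //; rewrite e trc_sub // sVg subrr. Qed.

(** Write a for the index of [Prf] in [I0f] and z for that of [sPr] in [sI0P]. The product results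
    from y = z a, W0 h = a H1, and H0 = s u with u = X z. *)
Lemma chevalley h W0 H0 H1 y : idx J Pr' h -> idx I0f J W0 -> idx Ef ENE H0 ->
  idx EkerN Esub H1 -> idx Qamb Pr y ->
  exists s X, [/\ idx Ef Enorm s, idx kerNP sI0P X, (y * H1 * X * s = W0 * h * H0)%N,
     (X <= H0)%N & (s <= H0)%N].
Proof.
move=> hh hW hH0 hH1 hy.
have [a [b [ha hb e1]]] := chev_H1 hh hW.
have eb : b = H1 by apply: idx_uniq hb hH1; exact: sgEsub.
have [s [u [hs hu e2]]] := idx_sub sgEf sgEnorm sgENE Ef_ENE (fun x => @proj1 _ _) hH0.
have /idx_u hu' := hu.
have [X [z [hX hz e3]]] := idx_sub sgkerNP sg_sI0P sg_sPr sPr_sI0P sI0P_kerNP hu'.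
have sgI0fP : subg I0fP by apply: subgP sgI0f sgPr.
have [a' [b' [ha' hb' e4]]] : exists n m, [/\ idx Qamb I0fP n, idx I0fP Pr m & y = (n * m)%N].
  apply: idx_sub hy => //; first exact: sgQ.
  - exact: sgPr.
  - by move=> v Pv; exists 0, v; rewrite add0r; split=> //; apply: subg0 sgI0f.
  - move=> _ [v [w [[Iv sv] [x ->] ->]]]; split; first exact: subgD.
    exists (sM x - x); by rewrite dB ds (morBD sVB) sv [v + sV _]addrC addrKA.
have e5 : a' = z by apply: idx_uniq hz; [exact: sg_sPr|apply/idx_Q1].
have e6 : b' = a by apply: idx_uniq ha; [exact: sgPrf|apply/idx_Q2].
exists s, X; split=> //; first by rewrite e1 e2 e3 e4 e5 e6 eb; ring.
  have s0 := idx_pos sgEf hs; have z0 := idx_pos sg_sI0P hz.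
  rewrite e2 e3; nia.
have u0 := idx_pos sgEnorm hu; rewrite e2; nia.
Qed.

End Chevalley.

Section PowerNorms.
Variables (M : zmodType) (s : M -> M) (p k : nat).
Hypothesis sB : forall x y, s (x - y) = s x - s y.
Hypothesis H90 : forall x, trc (iter (p ^ k) s) p x = 0 -> exists y, x = iter (p ^ k) s y - y.

(* Injectivity of inflation on H^2: a p-th power which is a norm from the top
   is already the p-th power of a norm from the intermediate layer. *)
Lemma norm_descent x y : s x = x -> x *+ p = trc s (p ^ k.+1) y ->
  exists z, iter (p ^ k) s z = z /\ x = trc s (p ^ k) z.
Proof.
move=> sx e.
have iB := iterB sB (p ^ k).
have ix : iter (p ^ k) s x = x by elim: (p ^ k)%N => //= n ->.
have /H90 [w ew] : trc (iter (p ^ k) s) p (trc s (p ^ k) y - x) = 0.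
  rewrite trcB // (trc_fix _ ix) e expnSr.
  have -> : trc (iter (p ^ k) s) p (trc s (p ^ k) y) = trc s (p ^ k * p) y.
    rewrite trc_comp // {1}/trc; under eq_bigr => i _.
      have -> : iter i (iter (p ^ k) s) (trc s (p ^ k) y)
              = trc s (p ^ k) (iter i (iter (p ^ k) s) y).
        by elim: (nat_of_ord i) => //= n ->; rewrite trcC.
      over.
    by rewrite -(morB_sum (trcB sB (p ^ k))).
  by rewrite subrr.
have ex : trc s (p ^ k) (y - (s w - w)) = x.
  by rewrite trcB // trc_sub // -ew opprB addrC subrK.
exists (y - (s w - w)); split=> //.
by apply/eqP; rewrite -subr_eq0 -trc_s // ex sx subrr.
Qed.
End PowerNorms.

(* p-th powers that are norms from level k+1 come from norms at level k, so each
   step multiplies the index by at least that of the first step. *)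
Lemma norm_index_growth (M : zmodType) (E : M -> Prop) (Nm : nat -> M -> Prop) p (s : nat -> nat) :
  subg E -> (forall k, subg (Nm k)) -> (forall k x, Nm k.+1 x -> Nm k x) ->
  (forall x, E x -> Nm 0 x) ->
  (forall k x, E x -> Nm k.+1 (x *+ p) <-> Nm k x) ->
  (forall k, idx E (fun x => E x /\ Nm k x) (s k)) -> forall k, (s 1 ^ k <= s k)%N.
Proof.
move=> sE sN NN N0 Np hs; elim=> [|k ih].
  by rewrite expn0; apply: idx_pos (hs 0); exact: sE.
rewrite expnS; apply: leq_trans (leq_mul (leqnn _) ih) _.
(* B is the product of the p-th powers with the norms from level k + 1. By the hypothesis on p-th
   powers its index over those norms is s k, and B consists of norms from level 1, so its index in E
   is at least s 1. *)
pose B x := exists a b, [/\ (exists2 e, E e & a = e *+ p), E b /\ Nm k.+1 b & x = a + b].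
have sNk j := subgI sE (sN j).
have N1 j x : Nm j.+1 x -> Nm 1 x by elim: j => // j ihj /NN /ihj.
have sp : subg (fun a => exists2 e, E e & a = e *+ p).
  split; first by exists 0; rewrite ?mul0rn //; apply: subg0.
  by move=> _ _ [x Ex ->] [y Ey ->]; exists (x - y); rewrite ?mulrnBl //; apply: subgB.
have sBB : subg B by apply: subgP.
have BE x : B x -> E x.
  by move=> [_ [b [[e Ee ->] [Eb _] ->]]]; apply: subgD => //; apply: subgMn.
have NB x : E x /\ Nm k.+1 x -> B x.
  by move=> h; exists 0, x; rewrite add0r; split=> //; exists 0; rewrite ?mul0rn //; apply: subg0.
have [a [b [ha hb ->]]] := idx_sub sE sBB (sNk _) NB BE (hs k.+1).
have eb : b = s k.
  apply: idx_uniq hb _; first exact: sNk.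
  refine (proj1 (@idx_hom _ _ (fun x => x *+ p) E (fun x => E x /\ Nm k x) B (fun x => E x /\ Nm k.+1 x) (s k) sE _ _ _ _ _) _) => //.
  - by move=> x y; rewrite mulrnBl.
  - by move=> x Ex; exists (x *+ p), 0; rewrite addr0; split=> //; [exists x|apply: subg0 (sNk _)].
  - move=> x Ex; split=> [[_ h]|[_ h]]; last by split=> //; apply/Np.
    by split; [apply: subgMn|apply/Np].
  - by move=> _ [_ [b' [[e Ee ->] h ->]]]; exists e => //; rewrite addrC addKr.
rewrite eb leq_mul2r; apply/orP; right.
have [|c [c' [hc hc' ->]]] := @idx_sub _ E (fun x => E x /\ Nm 1 x) B a sE (sNk 1) sBB _ (fun x => @proj1 _ _) ha.
  move=> x Bx; split; first exact: BE.
  case: Bx => _ [b' [[e Ee ->] [_ /N1 nb] ->]]; apply: subgD => //.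
  by apply/Np => //; apply: N0.
rewrite (idx_uniq (sNk 1) (hs 1) hc) leq_pmulr //.
by apply: idx_pos hc'; exact: sNk.
Qed.

(** * Places and valuations *)

Section Valring.
Variables (F : fieldType) (P : place F).
Implicit Types x y : F.

(** The maximal ideal of the valuation ring. *)
Definition mx x := sval P x /\ ~ vunit (sval P) x.

Lemma plB x y : sval P x -> sval P y -> sval P (x - y).
Proof. by case: (svalP P) => _ h _ _ _; apply: h. Qed.
Lemma plM x y : sval P x -> sval P y -> sval P (x * y).
Proof. by case: (svalP P) => _ _ h _ _; apply: h. Qed.
Lemma pl0 : sval P 0. Proof. by case: (svalP P) => [[]]. Qed.
Lemma pl1 : sval P 1. Proof. by case: (svalP P) => [[]]. Qed.
Lemma plN x : sval P x -> sval P (- x).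
Proof. by move=> h; rewrite -sub0r; apply: plB => //; apply: pl0. Qed.
Lemma plD x y : sval P x -> sval P y -> sval P (x + y).
Proof. by move=> hx hy; rewrite -[y]opprK; apply: plB => //; apply: plN. Qed.
Lemma plX x n : sval P x -> sval P (x ^+ n).
Proof. by move=> h; elim: n => [|n ih]; [apply: pl1|rewrite exprS; apply: plM]. Qed.
Lemma pl_nat n : sval P n%:R.
Proof. by elim: n => [|n ih]; [apply: pl0|rewrite -natr1; apply: plD => //; apply: pl1]. Qed.
Lemma plV x : ~ sval P x -> sval P x^-1.
Proof.
have [->|x0] := eqVneq x 0; first by case; apply: pl0.
by case: (svalP P) => _ _ _ /(_ x x0) [].
Qed.
Lemma pl_sum I r (Q : pred I) (f : I -> F) : (forall i, Q i -> sval P (f i)) ->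
  sval P (\sum_(i <- r | Q i) f i).
Proof. by move=> h; apply: (big_ind (sval P)) => // *; [apply: pl0|apply: plD]. Qed.
Lemma pl_prod I r (Q : pred I) (f : I -> F) : (forall i, Q i -> sval P (f i)) ->
  sval P (\prod_(i <- r | Q i) f i).
Proof. by move=> h; apply: (big_ind (sval P)) => // *; [apply: pl1|apply: plM]. Qed.

Lemma vunit1 : vunit (sval P) 1.
Proof. by split; rewrite ?invr1 ?oner_eq0 //; apply: pl1. Qed.
Lemma vunitM x y : vunit (sval P) x -> vunit (sval P) y -> vunit (sval P) (x * y).
Proof. by move=> [a b c] [d e f]; split; rewrite ?mulf_neq0 ?invfM //; apply: plM. Qed.
Lemma vunitV x : vunit (sval P) x -> vunit (sval P) x^-1.
Proof. by move=> [a b c]; split; rewrite ?invr_eq0 ?invrK. Qed.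
Lemma vunitX x n : vunit (sval P) x -> vunit (sval P) (x ^+ n).
Proof. by move=> h; elim: n => [|n ih]; [apply: vunit1|rewrite exprS; apply: vunitM]. Qed.
Lemma vunit_mx x : sval P x -> vunit (sval P) x \/ mx x.
Proof. by move=> Px; have [|] := pselect (vunit (sval P) x); [left|right]. Qed.

Lemma mx0 : mx 0. Proof. by split; [apply: pl0|case; rewrite eqxx]. Qed.
Lemma mxM x y : sval P x -> mx y -> mx (x * y).
Proof.
move=> Px [Py nu]; split; first exact: plM.
move=> [xy0 _ h]; apply: nu; move: xy0; rewrite mulf_eq0 => /norP [x0 y0]; split=> //.
have -> : y^-1 = x * (x * y)^-1 by rewrite invfM mulrA divff // mul1r.
exact: plM.
Qed.
Lemma mxMr x y : mx x -> sval P y -> mx (x * y).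
Proof. by rewrite mulrC => *; apply: mxM. Qed.
Lemma mx_pl x : mx x -> sval P x. Proof. by case. Qed.
Lemma mxB x y : mx x -> mx y -> mx (x - y).
Proof.
move=> mx_ my.
have [->|x0] := eqVneq x 0; first by rewrite sub0r -mulN1r; apply: mxM => //; apply/plN/pl1.
have [->|y0] := eqVneq y 0; first by rewrite subr0.
have [h|h] := pselect (sval P (y / x)).
  have -> : x - y = (1 - y / x) * x by rewrite mulrBl mul1r divfK.
  by apply: mxM => //; apply: plB => //; apply: pl1.
have -> : x - y = (x / y - 1) * y by rewrite mulrBl mul1r divfK.
apply: mxM => //; apply: plB; last exact: pl1.
by rewrite -[x / y]invrK invfM invrK mulrC; apply: plV.
Qed.
Lemma mxN x : mx x -> mx (- x).
Proof. by rewrite -sub0r => h; apply: mxB => //; apply: mx0. Qed.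
Lemma mxD x y : mx x -> mx y -> mx (x + y).
Proof. by move=> hx hy; rewrite -[y]opprK; apply: mxB => //; apply: mxN. Qed.
Lemma mx_sum I r (Q : pred I) (f : I -> F) : (forall i, Q i -> mx (f i)) ->
  mx (\sum_(i <- r | Q i) f i).
Proof. by move=> h; apply: (big_ind mx) => // *; [apply: mx0|apply: mxD]. Qed.
Lemma mxV x : ~ sval P x -> mx x^-1.
Proof.
move=> h; split; first exact: plV.
by case=> _ _; rewrite invrK.
Qed.
Lemma mx1F : ~ mx 1. Proof. by case=> _; apply; apply: vunit1. Qed.
Lemma vunit_notmx x : vunit (sval P) x -> ~ mx x. Proof. by move=> h []. Qed.
Lemma vunitBm x y : vunit (sval P) x -> mx y -> vunit (sval P) (x - y).
Proof.
move=> ux my; have [_ Px _] := ux.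
have [//|h] := vunit_mx (plB Px (mx_pl my)).
by have := mxD h my; rewrite subrK => /(vunit_notmx ux).
Qed.
Lemma mx_prime x y : sval P x -> sval P y -> mx (x * y) -> mx x \/ mx y.
Proof.
move=> Px Py h; case: (vunit_mx Px) => [ux|]; last by left.
case: (vunit_mx Py) => [uy|]; last by right.
by case: (vunit_notmx (vunitM ux uy)).
Qed.
Lemma mxX_inv x n : sval P x -> mx (x ^+ n) -> mx x.
Proof.
move=> Px; elim: n => [/mx1F //|n ih]; rewrite exprS => /(mx_prime Px (plX n Px)) [//|]; exact: ih.
Qed.

End Valring.

Lemma place_eq (F : fieldType) (P Q : place F) : (forall x, sval P x <-> sval Q x) -> P = Q.
Proof.
move=> h; case: P Q h => [R hR] [S hS] /= h.
have e : R = S by apply: funext => x; apply/propeqP.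
by case: _ / e hS => hS; congr exist; apply: Prop_irrelevance.
Qed.

(** * Existence of valuation rings dominating a subring and a proper ideal *)

Definition sring (F : fieldType) (A : F -> Prop) :=
  [/\ A 1, forall x y, A x -> A y -> A (x - y) & forall x y, A x -> A y -> A (x * y)].
Definition sideal (F : fieldType) (A a : F -> Prop) :=
  [/\ a 0, forall x, a x -> A x, forall x y, a x -> a y -> a (x - y)
    & forall x y, A x -> a y -> a (x * y)].

Section Dominating.
Variable F : fieldType.
Implicit Types (A a B b : F -> Prop).

Lemma sring0 A : sring A -> A 0. Proof. by case=> h1 hB _; rewrite -(subrr 1); apply: hB. Qed.
Lemma sringD A x y : sring A -> A x -> A y -> A (x + y).
Proof. by move=> sA; case: (sA) => h1 hB _ Ax Ay; rewrite -[y]opprK -[- y]sub0r; apply: (hB) => //; apply: (hB) => //; apply: sring0. Qed.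
Lemma sring_sum A I r (Q : pred I) (f : I -> F) : sring A ->
  (forall i, Q i -> A (f i)) -> A (\sum_(i <- r | Q i) f i).
Proof. by move=> sA h; apply: (big_ind A) => // *; [apply: sring0|apply: sringD]. Qed.
Lemma sidealD A a x y : sideal A a -> a x -> a y -> a (x + y).
Proof. by case=> a0 _ aB _ ax ay; rewrite -[y]opprK -[- y]sub0r; apply: (aB) => //; apply: aB. Qed.
Lemma sideal_sum A a I r (Q : pred I) (f : I -> F) : sideal A a ->
  (forall i, Q i -> a (f i)) -> a (\sum_(i <- r | Q i) f i).
Proof. by move=> sa h; apply: (big_ind a) => // *; [case: sa|apply: (sidealD sa)]. Qed.

Definition cf A (q : {poly F}) := forall i, A q`_i.
Definition adj A x y := exists2 q, cf A q & y = q.[x].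

Lemma adj_sub A a x y : adj A x y -> (forall z, A z -> a z) -> adj a x y.
Proof. by move=> [q qA ->] h; exists q => // i; apply: h. Qed.

Lemma adj_sring A x : sring A -> sring (adj A x).
Proof.
move=> sA; have [A1 AB AM] := sA; split.
- by exists 1%:P; rewrite ?hornerC // => i; rewrite coefC; case: (i == 0)%N => //; apply: sring0.
- move=> _ _ [q hq ->] [r hr ->]; exists (q - r); rewrite ?hornerD ?hornerN // => i.
  by rewrite coefB; apply: AB.
- move=> _ _ [q hq ->] [r hr ->]; exists (q * r); rewrite ?hornerM // => i.
  by rewrite coefM; apply: sring_sum => // j _; apply: AM.
Qed.

Lemma adj_sideal A a x : sring A -> sideal A a -> sideal (adj A x) (adj a x).
Proof.
move=> sA sa; have [a0 aA aB aM] := sa; split.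
- by exists 0; rewrite ?horner0 // => i; rewrite coef0.
- by move=> y /adj_sub; apply.
- move=> _ _ [q hq ->] [r hr ->]; exists (q - r); rewrite ?hornerD ?hornerN // => i.
  by rewrite coefB; apply: aB.
- move=> _ _ [q hq ->] [r hr ->]; exists (q * r); rewrite ?hornerM // => i.
  by rewrite coefM; move: (@sideal_sum A a) => h; apply: h sa _ => j _; apply: aM.
Qed.

Lemma adj_incl A x y : A 0 -> A y -> adj A x y.
Proof. by move=> A0 Ay; exists y%:P; rewrite ?hornerC // => i; rewrite coefC; case: eqP. Qed.

(** The classical core of the extension theorem: among two such relations for x and 1/x, the one of
    larger degree can be shortened with the help of the other. *)
Lemma no_unit_relations A a x : sring A -> sideal A a -> ~ a 1 -> x != 0 ->
  forall q r, cf a q -> cf a r -> q.[x] = 1 -> r.[x^-1] = 1 -> False.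
Proof.
move=> sA sa na1 x0 q r; move: {2}(size q + size r)%N (leqnn (size q + size r)) => N.
have [a0 aA aB aM] := sa; have [A1 AB AM] := sA.
elim: N x x0 q r => [|N IH] x x0 q r hN aq ar qx rx.
  have q0 : q = 0 by apply/eqP; rewrite -size_poly_eq0; lia.
  by move/eqP: qx; rewrite q0 horner0 eq_sym oner_eq0.
wlog sqr : x x0 q r hN aq ar qx rx / (size r <= size q)%N.
  move=> h; case: (leqP (size r) (size q)) => [|/ltnW] sqr; first exact: (h x x0 q r).
  by apply: (h x^-1 _ r q) => //; rewrite ?invr_eq0 ?invrK // addnC.
have r1 : (1 < size r)%N.
  rewrite ltnNge; apply/negP => /size1_polyC e.
  by apply: na1; rewrite -rx e hornerC.
set n := (size q).-1; have sq : size q = n.+1 by rewrite /n prednK //; lia.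
(* Multiplying the relation for 1/x by x^n gives x^n (1 - r_0) = sum of r_(n-i) x^i over i < n.
   After q is multiplied by 1 - r_0, its leading term is replaced accordingly, and r_0 is added to
   restore the value 1. *)
pose q' := (r`_0)%:P + (1 - r`_0) *: (q - q`_n *: 'X^n) + q`_n *: \poly_(i < n) r`_(n - i).
have ex : (\poly_(i < n) r`_(n - i)).[x] = x ^+ n * (1 - r`_0).
  rewrite horner_poly -rx (horner_coef_wide _ (n := n.+1)); last by rewrite -sq.
  rewrite big_ord_recl expr0 mulr1 addrAC subrr add0r mulr_sumr.
  rewrite (reindex_inj rev_ord_inj); apply: eq_bigr => i _ /=.
  have ii : (n - (n - i.+1) = i.+1)%N by have := ltn_ord i; lia.
  rewrite ii /bump /= add1n mulrCA; congr (_ * _).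
  rewrite exprVn -exprB ?unitfE //; have := ltn_ord i; lia.
apply: (IH x x0 q' r) => //.
- have s1 : (size q' <= n)%N.
    apply/leq_sizeP => j nj; rewrite !coefD coefC !coefZ coefB coefZ coefXn coef_poly.
    have -> : (j < n)%N = false by lia.
    rewrite mulr0 addr0; have j0 : (j == 0)%N = false by lia.
    rewrite j0 add0r; case: eqP => [->|/eqP jn]; first by rewrite mulr1 subrr mulr0.
    have -> : q`_j = 0 by apply: nth_default; rewrite sq; lia.
    by rewrite mulr0 subrr mulr0.
  by lia.
- move=> i; rewrite !coefD; apply: (sidealD sa); first apply: (sidealD sa).
  + by rewrite coefC; case: eqP.
  + rewrite coefZ coefB coefZ coefXn; apply: aM; first by apply: AB => //; apply: aA.
    case: eqP => [->|_]; first by rewrite mulr1 subrr.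
    by rewrite mulr0 subr0.
  + rewrite coefZ; apply: aM; first exact: aA.
    by rewrite coef_poly; case: ifP.
- rewrite /q' !hornerD hornerC !hornerZ hornerD hornerN hornerZ hornerXn ex qx.
  by ring.
Qed.

(** Zorn's lemma on pairs (subring, proper ideal) ordered by inclusion; a maximal pair is a
    valuation ring with an ideal inside its maximal ideal. The nonzero element of [a] makes the ring
    proper, since its inverse is excluded. *)
Lemma place_dominating A a : sring A -> sideal A a -> ~ a 1 -> (exists2 x, a x & x != 0) ->
  exists P : place F, (forall x, A x -> sval P x) /\ (forall x, a x -> mx P x).
Proof.
move=> sA sa na1 [x0 ax0 nx0].
pose ok (q : (F -> Prop) * (F -> Prop)) := [/\ sring q.1, sideal q.1 q.2, ~ q.2 1,
  forall x, A x -> q.1 x & forall x, a x -> q.2 x].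
pose T := {q | ok q}.
have ok0 : ok (A, a) by [].
pose R (s t : T) := `[< (forall x, (sval s).1 x -> (sval t).1 x) /\
                        (forall x, (sval s).2 x -> (sval t).2 x) >].
have RP s t : R s t <-> (forall x, (sval s).1 x -> (sval t).1 x) /\
                        (forall x, (sval s).2 x -> (sval t).2 x).
  by split=> /asboolP.
have Rr t : R t t by apply/RP.
have Rt r s t : R r s -> R s t -> R r t.
  by move=> /RP [h1 h2] /RP [h3 h4]; apply/RP; split=> x; auto.
have [C totC|[[B b] okB] mB] := ZL_preorder (exist _ _ ok0 : T) Rr Rt.
  have [[c Cc]|C0] := pselect (exists c, C c); last first.
    by exists (exist _ _ ok0) => s Cs; case: C0; exists s.
  pose U := ((fun x => exists s : T, C s /\ (sval s).1 x), (fun x => exists s : T, C s /\ (sval s).2 x)).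
  have up s t : C s -> C t -> exists u : T, [/\ C u, R s u & R t u].
    by move=> Cs Ct; case: (totC _ _ Cs Ct) => h; [exists t|exists s].
  have okU : ok U.
    split=> /=.
    - split; first by exists c; split=> //; case: (svalP c) => [[]].
        move=> x y [s [Cs sx]] [t [Ct ty]]; have [u [Cu /RP [h1 _] /RP [h2 _]]] := up s t Cs Ct.
        exists u; split=> //; case: (svalP u) => [[_ h _] _ _ _ _]; apply: h; auto.
      move=> x y [s [Cs sx]] [t [Ct ty]]; have [u [Cu /RP [h1 _] /RP [h2 _]]] := up s t Cs Ct.
      exists u; split=> //; case: (svalP u) => [[_ _ h] _ _ _ _]; apply: h; auto.
    - split.
      + by exists c; split=> //; case: (svalP c) => _ [].
      + by move=> x [s [Cs sx]]; exists s; split=> //; case: (svalP s) => _ [_ h _ _] _ _ _; apply: h.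
      + move=> x y [s [Cs sx]] [t [Ct ty]]; have [u [Cu /RP [_ h1] /RP [_ h2]]] := up s t Cs Ct.
        exists u; split=> //; case: (svalP u) => _ [_ _ h _] _ _ _; apply: h; auto.
      + move=> x y [s [Cs sx]] [t [Ct ty]]; have [u [Cu /RP [h1 _] /RP [_ h2]]] := up s t Cs Ct.
        exists u; split=> //; case: (svalP u) => _ [_ _ _ h] _ _ _; apply: h; auto.
    - by move=> [s [Cs]]; case: (svalP s).
    - by move=> x Ax; exists c; split=> //; case: (svalP c) => _ _ _ h _; apply: h.
    - by move=> x Ax; exists c; split=> //; case: (svalP c) => _ _ _ _ h; apply: h.
  exists (exist _ U okU) => s Cs; apply/RP.
  by split=> x h; exists s.
have [sB sb nb1 AB ab] := okB; rewrite /= in sB sb nb1 AB ab.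
have [b0 bB bbB bM] := sb; have [B1 BB BM] := sB.
have B00 := sring0 sB.
(* By maximality, adjoining an x outside B makes the ideal improper. If this happened to both x and
   1/x, [no_unit_relations] would be contradicted. *)
have ext x : ~ B x -> adj b x 1.
  move=> nBx; have [//|n1] := pselect (adj b x 1); case: nBx.
  have okx : ok (adj B x, adj b x).
    split=> //=; [exact: adj_sring|exact: adj_sideal| |] => y hy; apply: adj_incl; auto.
  have /mB /RP /= [h _] : R (exist _ (B, b) okB) (exist _ _ okx).
    by apply/RP; split=> y hy; apply: adj_incl.
  apply: h; exists 'X; rewrite ?hornerX // => i; rewrite coefX.
  by case: eqP => _ //; apply: sring0.
have vr : valring B.
  split=> //.
    move=> x nx; have [|nB] := pselect (B x); first by left.
    right; have [//|nBv] := pselect (B x^-1).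
    have [q bq eq] := ext _ nB; have [r br er] := ext _ nBv.
    by case: (no_unit_relations sB sb nb1 nx bq br).
  exists x0^-1 => h; apply: nb1; rewrite -(mulVf nx0); apply: bM => //; exact: ab.
exists (exist _ B vr); split=> //= x ax; split=> /=; first exact/bB/ab.
by move=> [x1 _ h]; apply: nb1; rewrite -(mulVf x1); apply: bM => //; apply: ab.
Qed.

End Dominating.

HB.instance Definition _ (F : fieldType) := gen_eqMixin (place F).
HB.instance Definition _ (F : fieldType) := gen_choiceMixin (place F).

(** Rank at most one: powers of an element of the maximal ideal absorb any denominator. Distinct
    valuation rings of this kind are incomparable by [arch_max], which is what approximation relies
    on. *)
Definition arch (F : fieldType) (P : place F) :=
  forall x z, mx P x -> exists k : nat, sval P (z * x ^+ k).

(** * Weak approximation for valuation rings of rank one *)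

Section Approx.
Variable F : fieldType.
Implicit Types (P Q : place F) (s : seq (place F)).

Lemma arch_ge P x z k l : mx P x -> sval P (z * x ^+ k) -> (k <= l)%N -> sval P (z * x ^+ l).
Proof.
by move=> mX h kl; rewrite -(subnKC kl) exprD mulrA; apply: plM => //; apply/plX/mx_pl.
Qed.

Lemma arch_all s (x z : place F -> F) : (forall P, P \in s -> arch P /\ mx P (x P)) ->
  exists k, forall l, (k <= l)%N -> forall P, P \in s -> sval P (z P * x P ^+ l).
Proof.
elim: s => [|P s IH] h; first by exists 0.
have [|k hk] := IH; first by move=> Q Qs; apply: h; rewrite inE Qs orbT.
have [aP mP] := h P (mem_head _ _).
have [j hj] := aP _ (z P) mP.
exists (maxn k j) => l; rewrite geq_max => /andP [kl jl] Q; rewrite inE => /orP [/eqP ->|Qs].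
  exact: arch_ge jl.
exact: hk.
Qed.

Lemma arch_max P Q : arch P -> (forall x, sval P x -> sval Q x) -> P = Q.
Proof.
move=> aP PQ; apply: place_eq => x; split; first exact: PQ.
move=> Qx; have [//|nPx] := pselect (sval P x).
case: (svalP Q) => _ _ _ _ [z []].
have [k hk] := aP _ z (mxV nPx).
have x0 : x != 0 by apply/eqP => e; case: nPx; rewrite e; apply: pl0.
have -> : z = z * x^-1 ^+ k * x ^+ k by rewrite -mulrA -exprMn mulVf // expr1n mulr1.
by apply: plM; [apply: PQ|apply: plX].
Qed.

Lemma approx_pair P Q : arch P -> arch Q -> P != Q -> exists x, mx P x /\ ~ sval Q x.
Proof.
move=> aP aQ /eqP nPQ.
have [a [Pa nQa]] : exists a, sval P a /\ ~ sval Q a.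
  apply: contrapT => h; apply: nPQ; apply: arch_max => // x Px.
  by apply: contrapT => nQ; apply: h; exists x.
have [b [Qb nPb]] : exists b, sval Q b /\ ~ sval P b.
  apply: contrapT => h; apply/nPQ/esym; apply: arch_max => // x Px.
  by apply: contrapT => nQ; apply: h; exists x.
exists (a / b); split; first by apply: mxM => //; apply: mxV.
have b0 : b != 0 by apply/eqP => e; apply: nPb; rewrite e; apply: pl0.
by move=> h; apply: nQa; rewrite -(divfK b0 a); apply: plM.
Qed.

(** If the y found for s lacks a pole at Q, a large power of y is added to an element z with a pole
    at Q: at Q the term z prevails, at the places of s the power of y does. *)
Lemma approx_sep P s : arch P -> (forall Q, Q \in s -> arch Q) -> P \notin s ->
  exists x, mx P x /\ forall Q, Q \in s -> ~ sval Q x.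
Proof.
move=> aP; elim: s => [|Q s IH] as_ Ps; first by exists 0; split=> //; apply: mx0.
move: Ps; rewrite inE negb_or => /andP [nPQ Ps].
have [|y [my hy]] := IH _ Ps; first by move=> R Rs; apply: as_; rewrite inE Rs orbT.
have [z [mz hz]] := approx_pair aP (as_ _ (mem_head _ _)) nPQ.
have [Qy|nQy] := pselect (sval Q y); last first.
  by exists y; split=> // R; rewrite inE => /orP [/eqP ->|/hy].
have [|k hk] := @arch_all s (fun=> y^-1) (fun=> z).
  by move=> R Rs; split; [apply: as_; rewrite inE Rs orbT|apply/mxV/hy].
exists (y ^+ k.+1 + z); split.
  by apply: mxD => //; rewrite exprS; apply: mxMr => //; apply/plX/mx_pl.
move=> R; rewrite inE => /orP [/eqP ->|Rs] h.
  by apply: hz; rewrite -(addrK (y ^+ k.+1) z); apply: plB; [rewrite addrC|apply: plX].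
have y0 : y != 0 by apply/eqP => e; apply: (hy _ Rs); rewrite e; apply: pl0.
apply: (@mx1F _ R).
have -> : 1 = (y ^+ k.+1 + z) * y^-1 ^+ k.+1 - z * y^-1 ^+ k.+1.
  by rewrite -mulrBl addrK -exprMn divff // expr1n.
have my1 : mx R y^-1 by apply/mxV/hy.
apply: mxB; first by apply: mxM => //; rewrite exprS; apply: mxMr => //; apply/plX/mx_pl.
by rewrite exprSr mulrA; apply: mxM => //; apply: hk.
Qed.

(** With x in the maximal ideal of P and with poles along s, the element 1 / (1 + x^N) is close to 1
    at P and close to 0 along s. *)
Lemma approx_idem P s (c : place F -> F) : arch P -> (forall Q, Q \in s -> arch Q) ->
  P \notin s -> exists e, sval P ((e - 1) * c P) /\ forall Q, Q \in s -> sval Q (e * c Q).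
Proof.
move=> aP as_ Ps; have [x [mX hx]] := approx_sep aP as_ Ps.
have [|k hk] := @arch_all s (fun=> x^-1) c.
  by move=> R Rs; split; [apply: as_|apply/mxV/hx].
have [j hj] := aP x (c P) mX.
pose N := (maxn k j).+1.
have u1 : vunit (sval P) (1 + x ^+ N).
  rewrite -[x ^+ N]opprK; apply: vunitBm; [exact: vunit1|apply: mxN].
  by rewrite exprS; apply: mxMr => //; apply/plX/mx_pl.
have [n0 _ Pu] := u1.
exists (1 + x ^+ N)^-1; split.
  have -> : ((1 + x ^+ N)^-1 - 1) * c P = - (c P * x ^+ N) * (1 + x ^+ N)^-1.
    by field.
  by apply: plM => //; apply: plN; apply: (arch_ge mX hj); rewrite leqW // leq_maxr.
move=> Q Qs; have x0 : x != 0 by apply/eqP => e; apply: (hx _ Qs); rewrite e; apply: pl0.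
have mx1 : mx Q x^-1 by apply/mxV/hx.
have xN0 : x ^+ N != 0 by rewrite expf_neq0.
have -> : (1 + x ^+ N)^-1 * c Q = c Q * x^-1 ^+ N * (1 - - x^-1 ^+ N)^-1.
  by rewrite opprK exprVn -mulrA -invfM mulrDr mulr1 mulfV // [_ + 1]addrC mulrC.
apply: plM; first by apply: hk => //; rewrite leqW // leq_maxl.
have [] // : vunit (sval Q) (1 - - x^-1 ^+ N).
apply: vunitBm; first exact: vunit1.
by apply: mxN; rewrite exprS; apply: mxMr => //; apply/plX/mx_pl.
Qed.

(** The factors [c P] express closeness, because at this stage the places are only known to have
    rank one and carry no valuation. *)
Lemma weak_approx s (z c : place F -> F) : (forall Q, Q \in s -> arch Q) -> uniq s ->
  exists y, forall P, P \in s -> sval P ((y - z P) * c P).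
Proof.
move=> as_ us.
have ex P : exists e, P \in s -> sval P ((e - 1) * (z P * c P)) /\
    forall Q, Q \in s -> Q != P -> sval Q (e * (z P * c Q)).
  have [Ps|nPs] := boolP (P \in s); last by exists 0.
  have [||e [h1 h2]] := @approx_idem P [seq Q <- s | Q != P] (fun Q => z P * c Q) (as_ _ Ps).
  - by move=> Q; rewrite mem_filter => /andP [_ /as_].
  - by rewrite mem_filter negb_and eqxx.
  - by exists e => _; split=> // Q Qs QP; apply: h2; rewrite mem_filter QP.
have [e eP] := choice_ex ex.
exists (\sum_(P <- s) e P * z P) => P Ps.
rewrite (bigD1_seq P) //= addrAC mulrDl; apply: plD.
  by have [h _] := eP P Ps; rewrite -[X in _ - X]mul1r -mulrBl -mulrA.
rewrite mulr_suml big_seq_cond; apply: pl_sum => Q /andP [Qs QP].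
by rewrite -mulrA; apply: (eP Q Qs).2 => //; rewrite eq_sym.
Qed.

End Approx.

Lemma nc_cover (T : Type) (I : finType) (E : T -> T -> Prop) (X : T -> Prop) (R : T -> I -> Prop) :
  equivr E -> (forall x, X x -> exists i, R x i) ->
  (forall x y i, R x i -> R y i -> E x y) -> exists2 n, (n <= #|I|)%N & nclasses E X n.
Proof.
move=> [rE sE tE] cov RE; apply: nc_bound => // n f Xf If.
have [c cP] := choice_ex (fun i => cov _ (Xf i)).
suff ci : injective c by have := leq_card c ci; rewrite card_ord.
by move=> i j cij; apply/If/(RE _ _ _ (cP i)); rewrite cij.
Qed.

(** * Finiteness of quotients modulo a prime of the base ring *)

Section FinQuot.
Variables (F : fieldType) (A : F -> Prop) (pi : F) (s : seq F) (n : nat) (S : F -> Prop).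
Definition piS (B : F -> Prop) x := exists2 y, B y & x = pi * y.
Hypothesis sA : sring A.
Hypothesis As : forall e, A e -> exists2 r, r \in s & A r /\ piS A (e - r).
Hypothesis Af : forall e, A e -> piS A e \/ exists2 e', A e' & piS A (e * e' - 1).
Hypothesis dep : forall x : nat -> F, exists c : nat -> F,
  [/\ forall i, A (c i), exists2 i, (i <= n)%N & ~ piS A (c i) & \sum_(i < n.+1) c i * x i = 0].
Hypothesis sS : subg S.
Hypothesis AS : forall a x, A a -> S x -> S (a * x).

Lemma sg_piS : subg (piS S).
Proof.
split; first by exists 0; [apply: subg0|rewrite mulr0].
by move=> _ _ [x Sx ->] [y Sy ->]; exists (x - y); [apply: subgB|rewrite mulrBr].
Qed.
Lemma piSA a x : piS A a -> S x -> piS S (a * x).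
Proof. by move=> [b Ab ->] Sx; exists (b * x); [apply: AS|rewrite mulrA]. Qed.
Lemma ApiS a x : A a -> piS S x -> piS S (a * x).
Proof. by move=> Aa [y Sy ->]; exists (a * y); [apply: AS|rewrite mulrCA]. Qed.

(** S / pi S is a vector space over the field A / pi. Its dimension is at most n, since a primitive
    relation among n + 1 elements, one with some coefficient outside pi A, stays nontrivial modulo
    pi. *)
Lemma fin_quot : exists2 N, (N <= size s ^ n)%N & idx S (piS S) N.
Proof.
have A0 := sring0 sA.
have [A1 AB AM] := sA.
have pA0 : piS A 0 by exists 0; rewrite ?mulr0.
pose indep r (y : nat -> F) := (forall i, (i < r)%N -> S (y i)) /\
  forall c : nat -> F, (forall i, A (c i)) -> piS S (\sum_(i < r) c i * y i) ->
  forall i, (i < r)%N -> piS A (c i).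
pose Pd r := `[< exists y, indep r y >].
have ant r : Pd r.+1 -> Pd r.
  move=> /asboolP [y [Sy Iy]]; apply/asboolP; exists y; split=> [i ir|c Ac h i ir].
    by apply: Sy; apply: leqW.
  pose c' j := if (j < r)%N then c j else 0.
  have Ac' j : A (c' j) by rewrite /c'; case: ifP.
  have := Iy c' Ac' _ i (leqW ir); rewrite {2}/c' ir; apply.
  rewrite big_ord_recr /= {2}/c' ltnn mul0r addr0.
  by rewrite (eq_bigr (fun j : 'I_r => c j * y j)) // => j _; rewrite /c' ltn_ord.
have top : ~ Pd n.+1.
  move=> /asboolP [y [Sy Iy]]; have [c [Ac [i ni nc] e]] := dep y.
  by apply: nc; apply: (Iy c) => //; rewrite e; apply: subg0 sg_piS.
have bd r : Pd r -> (r <= n)%N.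
  move=> Pr_; rewrite leqNgt; apply/negP => nr; apply: top.
  have aux k : Pd (n.+1 + k)%N -> Pd n.+1.
    by elim: k => [|k ih]; [rewrite addn0|rewrite addnS => /ant].
  by apply: (aux (r - n.+1)%N); rewrite subnKC.
have ex0 : exists r, Pd r by exists 0; apply/asboolP; exists (fun=> 0).
case: (ex_maxnP ex0 bd) => r Pr_ rmax.
move/asboolP: (Pr_) => [y [Sy Iy]].
have rn := bd _ Pr_.
have [r0 r0s _] := As A0.
have s0 : (0 < size s)%N by case: (s) r0s.
have cov x : S x -> exists f : {ffun 'I_r -> 'I_(size s)},
    piS S (x - \sum_(i < r) s`_(f i) * y i).
  move=> Sx; pose y' i := if (i < r)%N then y i else x.
  have : ~ indep r.+1 y'.
    by move=> h; have := rmax r.+1 (asboolT (ex_intro _ _ h)); rewrite ltnn.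
  move/not_andP => [h|].
    case: h => i ir; rewrite /y'; case: ltnP => // ?; exact: Sy.
  move/existsNP => [c /not_implyP [Ac /not_implyP [pc /existsNP [i /not_implyP [ir nci]]]]].
  have y'r (j : 'I_r) : y' j = y j by rewrite /y' ltn_ord.
  move: pc; rewrite big_ord_recr /= {2}/y' ltnn; under eq_bigr do rewrite y'r; move=> pc.
  (* The coefficient of x is invertible modulo pi: if it vanished there, the independence of the
     [y i] would make all coefficients vanish. *)
  case: (Af (Ac r)) => [pcr|[e Ae pe]].
    case: nci; move: ir; rewrite ltnS leq_eqVlt => /orP [/eqP -> //|ir].
    apply: Iy => //; rewrite -(addrK (c r * x) (\sum_(j < r) _)).
    by apply: subgB sg_piS pc _; apply: piSA.
  have exf (j : 'I_r) : exists f, f \in s /\ piS A ((0 - e) * c j - f).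
    by have [f fs [_ h]] := As (AM _ _ (AB _ _ A0 Ae) (Ac j)); exists f.
  have [f fP] := choice_ex exf.
  have fi (j : 'I_r) : (index (f j) s < size s)%N.
    by rewrite index_mem; case: (fP j).
  exists [ffun j => Ordinal (fi j)].
  under eq_bigr => j _ do rewrite ffunE /= nth_index ?(proj1 (fP j)) //.
  have -> : x - \sum_(j < r) f j * y j = e * (\sum_(j < r) c j * y j + c r * x)
      - (c r * e - 1) * x + \sum_(j < r) (((0 - e) * c j - f j) * y j).
    under [X in _ = _ + X]eq_bigr => j _ do rewrite mulrBl sub0r mulNr mulNr -mulrA.
    rewrite sumrB sumrN -mulr_sumr.
    by ring.
  apply: (subgD sg_piS); first apply: (subgB sg_piS).
  - exact: ApiS.
  - exact: piSA.
  - apply: subg_sum sg_piS _ => j _; apply: piSA; last exact: Sy.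
    by case: (fP j).
have RE x x' (f : {ffun 'I_r -> 'I_(size s)}) :
    piS S (x - \sum_(i < r) s`_(f i) * y i) ->
    piS S (x' - \sum_(i < r) s`_(f i) * y i) -> piS S (x - x').
  by move=> h h'; have := subgB sg_piS h h'; rewrite opprB addrA subrK.
have [N NN hN] := nc_cover (subg_eqv sg_piS) cov RE.
exists N; last exact: hN.
by apply: leq_trans NN _; rewrite card_ffun !card_ord leq_pexp2l.
Qed.

End FinQuot.

Lemma subg_pl (F : fieldType) (P : place F) : subg (sval P).
Proof. by split; [apply: pl0|move=> x y; apply: plB]. Qed.
Lemma subg_mx (F : fieldType) (P : place F) : subg (@mx F P).
Proof. by split; [apply: mx0|move=> x y; apply: mxB]. Qed.

Lemma uniformizerP (F : fieldType) (P : place F) t :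
  uniformizer (sval P) t <-> [/\ mx P t, t != 0 & forall y, mx P y -> sval P (y / t)].
Proof.
split=> [[Pt t0 nu h]|[[Pt nu] t0 h]].
  split=> // y [Py nuy]; have [r [Pr_ ->]] := h _ Py nuy.
  by rewrite mulrC mulKf.
split=> // y Py nuy; exists (y / t); split; first exact: h.
by rewrite mulrC divfK.
Qed.

Lemma divr_mid (F : fieldType) (a t b : F) : t != 0 -> a / b = (a / t) * (t / b).
Proof. by move=> t0; rewrite mulrA divfK. Qed.

Definition algrel (F : fieldType) (A : F -> Prop) x := exists (n : nat) (c : nat -> F),
  [/\ forall i, A (c i), exists2 i, (i <= n)%N & c i != 0 & \sum_(i < n.+1) c i * x ^+ i = 0].

(** [e] is the lowest nonzero coefficient of an algebraic relation of x over A: dividing the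
    relation by the appropriate power of x exhibits e / x as a polynomial in x over A. *)
Lemma algrel_low (F : fieldType) (A : F -> Prop) x : x != 0 -> algrel A x ->
  exists2 e, A e /\ e != 0 & forall P : place F, (forall y, A y -> sval P y) ->
    sval P x -> sval P (e / x).
Proof.
move=> x0 [n [c [Ac [i0 i0n ci0] e]]].
have exi : exists i, c i != 0 by exists i0.
case: (ex_minnP exi) => m cm mmin; exists (c m) => // P AP Px.
have mn : (m <= n)%N by apply: leq_trans (mmin _ ci0) i0n.
have -> : c m / x = - \sum_(i < n.+1 | (m < i)%N) c i * x ^+ (i - m.+1).
  have mn' : (m < n.+1)%N by [].
  have xm : x ^+ m != 0 by rewrite expf_neq0.
  apply: (mulIf x0); rewrite divfK // mulNr mulr_suml; apply: (mulIf xm).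
  rewrite mulNr mulr_suml; apply/eqP; rewrite -addr_eq0; apply/eqP.
  apply: (etrans _ e); rewrite [RHS](bigD1 (Ordinal mn')) //=; congr (_ + _).
  rewrite [RHS]big_mkcond [LHS]big_mkcond; apply: eq_bigr => i _.
  case: ltnP => mi; last first.
    case: eqP => //= /eqP ne; have im : (i < m)%N.
      by rewrite ltn_neqAle mi andbT; apply: contra ne => /eqP h; apply/eqP/val_inj.
    have -> : c i = 0 by apply: contraTeq im => /mmin; rewrite leqNgt.
    by rewrite mul0r.
  have -> : (i != Ordinal mn') by apply/eqP => h; rewrite h /= ltnn in mi.
  by rewrite -!mulrA -exprS -exprD; congr (_ * x ^+ _); lia.
apply: plN; apply: pl_sum => i _; apply: plM; [exact: AP|exact: plX].
Qed.

(** * Discreteness of a valuation ring over a prime of the base *)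

Section Dvr.
Variables (F : fieldType) (P : place F) (A : F -> Prop) (pi : F) (N : nat).
Hypotheses (AP : forall x, A x -> sval P x) (mpi : mx P pi) (pi0 : pi != 0).
Hypothesis Afac : forall e, A e -> e != 0 -> exists k e', vunit (sval P) e' /\ e = pi ^+ k * e'.
Hypothesis alg : forall x, algrel A x.
Hypothesis fin : idx (sval P) (piS pi (sval P)) N.

(** A uniformizer generates a largest proper principal ideal containing pi. Size is measured by
    [mu], the number of representatives modulo pi lying in the ideal, which grows strictly with
    it. *)
Lemma exists_uniformizer : exists t, uniformizer (sval P) t /\ sval P (pi / t).
Proof.
case: (fin) => f [Pf If cf].
pose mu x := #|[set i : 'I_N | `[< sval P (f i / x) >]]|.
pose ok k := `[< exists x, [/\ mx P x, x != 0, sval P (pi / x) & mu x = k] >].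
have exok : exists k, ok k.
  by exists (mu pi); apply/asboolP; exists pi; rewrite divff //; split=> //; apply: pl1.
have bd k : ok k -> (k <= N)%N.
  by move=> /asboolP [x [_ _ _ <-]]; rewrite -[X in (_ <= X)%N](card_ord N); apply: max_card.
case: (ex_maxnP exok bd) => k /asboolP [t [mt t0 pt mk]] kmax.
exists t; split=> //; apply/uniformizerP; split=> // y my.
have [->|y0] := eqVneq y 0; first by rewrite mul0r; apply: pl0.
apply: contrapT => nyt.
have ty : sval P (t / y) by rewrite -[t / y]invrK invfM invrK mulrC; apply: plV.
have py : sval P (pi / y).
  by rewrite (divr_mid pi y t0); apply: plM.
have oky : ok (mu y) by apply/asboolP; exists y.
have := kmax _ oky; rewrite leqNgt -mk => /negP; apply.
apply: proper_card; apply/properP; split.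
  apply/fintype.subsetP => i; rewrite !inE => h.
  by rewrite (divr_mid _ y t0); apply: plM.
have [i [z Pz e]] := cf _ (mx_pl my).
have fe : f i = y - pi * z by rewrite -e opprB addrC subrK.
exists i; [rewrite !inE|apply/negP; rewrite !inE => h; apply: nyt].
  by rewrite fe mulrBl divff // mulrAC; apply: plB; [apply: pl1|apply: plM].
have -> : y / t = f i / t + pi / t * z by rewrite fe; ring.
by apply: plD => //; apply: plM.
Qed.

(** Two of the N + 1 powers 1, t, ..., t^N agree modulo pi. Then pi divides t^i up to a unit for
    some i <= N, which excludes that t^n divides pi with n > N. *)
Lemma pi_bounded t : mx P t -> t != 0 -> forall n, sval P (pi / t ^+ n) -> (n <= N)%N.
Proof.
move=> mt t0 n pn; rewrite leqNgt; apply/negP => Nn.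
case: fin => f [Pf If cf].
have [c cP] := choice_ex (fun i : 'I_N.+1 => cf _ (plX i (mx_pl mt))).
suff ci : injective c by have := leq_card _ ci; rewrite !card_ord ltnn.
have key (i j : 'I_N.+1) : (i < j)%N -> c i <> c j.
  move=> ij cij; have := subgB (sg_piS pi (subg_pl P)) (cP i) (cP j).
  rewrite cij opprB addrA subrK => -[z Pz e].
  have ti0 : t ^+ i != 0 by rewrite expf_neq0.
  have u1 : vunit (sval P) (1 - t ^+ (j - i)).
    apply: vunitBm; first exact: vunit1.
    have := ij; rewrite -subn_gt0; case: (j - i)%N => // l _.
    by rewrite exprS; apply: mxMr => //; apply/plX/mx_pl.
  have e2 : t ^+ i * (1 - t ^+ (j - i)) = pi * z.
    by rewrite mulrBr mulr1 -exprD subnKC // ltnW.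
  have [n1 _ Pv] := u1; have iN := ltn_ord i.
  have e3 : 1 = pi / t ^+ n * t ^+ (n - i) * z * (1 - t ^+ (j - i))^-1.
    apply: (mulIf n1); rewrite mul1r divfK //; apply: (mulfI ti0); rewrite e2.
    have -> : t ^+ i * (pi / t ^+ n * t ^+ (n - i) * z) =
              pi * z * (t ^+ i * t ^+ (n - i)) / t ^+ n by ring.
    by rewrite -exprD subnKC ?mulfK ?expf_neq0 //; lia.
  apply: (@mx1F _ P); rewrite e3; apply: mxMr => //; apply: mxMr => //; apply: mxM => //.
  have : (0 < n - i)%N by lia.
  by case: (n - i)%N => // l _; rewrite exprS; apply: mxMr => //; apply/plX/mx_pl.
move=> i j cij; apply: val_inj => /=; case: (ltngtP i j) => // h.
  by case: (key _ _ h cij).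
by case: (key _ _ h (esym cij)).
Qed.

(** The order of y in t is bounded: y divides a nonzero element of A, this is pi^k up to a unit, and
    pi is t^m up to a unit. *)
Lemma exists_val x : x != 0 -> exists n, vP P x n.
Proof.
have [t [ut pt]] := exists_uniformizer.
have [mt t0 tmax] := (uniformizerP _ _).1 ut.
have notunit y : sval P y -> ~ sval P (y / t) -> vunit (sval P) y.
  by move=> Py h; case: (vunit_mx Py) => // /tmax.
have exm : exists m, `[< sval P (pi / t ^+ m) >] by exists 1%N; apply/asboolP.
have bdm m : `[< sval P (pi / t ^+ m) >] -> (m <= N)%N.
  by move=> /asboolP; apply: (pi_bounded mt t0).
case: (ex_maxnP exm bdm) => m /asboolP hm mmax.
have um : vunit (sval P) (pi / t ^+ m).
  apply: notunit => // h.
  have okm : `[< sval P (pi / t ^+ m.+1) >] by apply/asboolP; rewrite exprS invfM mulrCA mulrC.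
  by have := mmax _ okm; rewrite ltnn.
pose vs y n := vP P y n.
suff main y : y != 0 -> sval P y -> exists n, vP P y n.
  move=> x0; have [Px|nPx] := pselect (sval P x); first exact: main.
  have [||n [t' [u [ut' uu e]]]] := main x^-1; rewrite ?invr_eq0 //; first exact: plV.
  exists (- n), t', u^-1; split=> //; first exact: vunitV.
  by rewrite -[x]invrK e invfM invr_expz.
move=> y0 Py.
have [e [Ae e0] /(_ _ AP Py) ey] := algrel_low y0 (alg y).
have [k [e' [ue' ee]]] := Afac Ae e0.
have t_pow n : t ^+ n != 0 by rewrite expf_neq0.
have bd n : `[< sval P (y / t ^+ n) >] -> (n <= m * k)%N.
  move=> /asboolP hn; rewrite leqNgt; apply/negP => mkn.
  have h : sval P (e / t ^+ n).
    by rewrite (divr_mid e _ y0); apply: plM.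
  have [_ _ hw] := vunitM (vunitX k um) ue'.
  apply: (@mx1F _ P); move: h.
  have pik0 : pi ^+ k != 0 by rewrite expf_neq0.
  have -> : e / t ^+ n = ((pi / t ^+ m) ^+ k * e') / t ^+ (n - m * k).
    rewrite ee -[in LHS](subnKC (ltnW mkn)) exprD expr_div_n -exprM invfM; ring.
  move=> h; have := plM h hw; rewrite mulrAC divff; last by case: (vunitM (vunitX k um) ue').
  rewrite mul1r => h2; rewrite -(mulVf (t_pow (n - m * k)%N)); apply: mxM => //.
  have : (0 < n - m * k)%N by lia.
  by case: (n - m * k)%N => // l _; rewrite exprS; apply: mxMr => //; apply/plX/mx_pl.
have ex0 : exists n, `[< sval P (y / t ^+ n) >] by exists 0; apply/asboolP; rewrite divr1.
case: (ex_maxnP ex0 bd) => n /asboolP hn nmax.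
exists n%:Z, t, (y / t ^+ n); split=> //; last by rewrite divfK.
apply: notunit => // h.
have okn : `[< sval P (y / t ^+ n.+1) >] by apply/asboolP; rewrite exprS invfM mulrCA mulrC.
by have := nmax _ okn; rewrite ltnn.
Qed.

End Dvr.

(** The properties of places that the theory of cyclic extensions uses: discreteness, finite
    supports, finite residue fields. Number fields and function fields both have them. *)
Record gl (F : fieldType) : Prop := Gl {
  gl_val : forall (P : place F) x, x != 0 -> exists n, vP P x n;
  gl_supp : forall x : F, x != 0 -> exists s : seq (place F), forall P : place F, ~ vunit (sval P) x -> P \in s;
  gl_res : forall P : place F, exists q, idx (sval P) (@mx F P) q }.

(* A subring A with a multiplicative Euclidean norm over whose fraction field
   F has dimension at most n: the image of Z, or of F_p[t]. *)
Record ebase (F : fieldType) (A : F -> Prop) (n : nat) : Prop := Ebase {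
  eb_ring : sring A;
  eb_dep : forall x : nat -> F, exists c : nat -> F,
    [/\ forall i, A (c i), exists2 i, (i <= n)%N & c i != 0 & \sum_(i < n.+1) c i * x i = 0];
  eb_norm : exists sz : F -> nat,
    [/\ forall a, A a -> sz a = 0 -> a = 0,
        forall a b, A a -> A b -> a != 0 -> b != 0 -> sz (a * b) = (sz a * sz b)%N,
        forall a b, A a -> A b -> b != 0 -> exists2 q, A q & (sz (a - q * b)%R < sz b)%N
      & forall m, exists s : seq F, forall e, A e -> (sz e < m)%N -> e \in s] }.

(** * Places over a Euclidean base ring *)

Section Base.
Variables (F : fieldType) (A : F -> Prop) (n : nat).
Hypothesis H : ebase A n.

Lemma eb_algrel x : algrel A x.
Proof. by have [c [h1 h2 h3]] := eb_dep H (fun i => x ^+ i); exists n, c. Qed.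

(** If every nonzero element of A were a unit at P, the algebraic relations over A would put all of
    F into P. *)
Lemma eb_mx P : (forall x, A x -> sval P x) -> exists e, [/\ A e, e != 0 & mx P e].
Proof.
move=> AP; apply: contrapT => h.
have un e : A e -> e != 0 -> vunit (sval P) e.
  move=> Ae e0; case: (vunit_mx (AP _ Ae)) => // me; case: h; exists e; split=> //.
case: (svalP P) => _ _ _ _ [x nx]; apply: nx; apply: contrapT => nx.
have x0 : x != 0 by apply/eqP => e; apply: nx; rewrite e; apply: pl0.
have v0 : x^-1 != 0 by rewrite invr_eq0.
have [e [Ae e0] /(_ P AP (plV nx))] := algrel_low v0 (eb_algrel _).
rewrite invrK => h2; apply: nx; have [_ _ hv] := un _ Ae e0.
by rewrite -(mulKf e0 x); apply: plM.
Qed.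

(** The prime of A below P is principal by Euclidean division. Minimality of the norm of pi, the
    last clause, later confines pi to a finite list. *)
Lemma eb_gen P (sz : F -> nat) : (forall x, A x -> sval P x) ->
  (forall a, A a -> sz a = 0 -> a = 0) ->
  (forall a b, A a -> A b -> b != 0 -> exists2 q, A q & (sz (a - q * b)%R < sz b)%N) ->
  exists pi, [/\ A pi, pi != 0, mx P pi, forall e, A e -> mx P e -> piS pi A e
     & forall e, A e -> mx P e -> e != 0 -> (sz pi <= sz e)%N].
Proof.
move=> AP sz0 szE; have [A1 AB AM] := eb_ring H.
pose ok k := `[< exists e, [/\ A e, e != 0, mx P e & sz e = k] >].
have exok : exists k, ok k.
  by have [e [h1 h2 h3]] := eb_mx AP; exists (sz e); apply/asboolP; exists e.
case: (ex_minnP exok) => k /asboolP [pi [Api pi0 mpi szpi]] kmin.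
have mn e : A e -> mx P e -> e != 0 -> (sz pi <= sz e)%N.
  by move=> Ae me e0; rewrite szpi; apply: kmin; apply/asboolP; exists e.
exists pi; split=> // e Ae me.
have [q Aq szq] := szE _ _ Ae Api pi0.
exists q => //; apply/eqP; rewrite mulrC -subr_eq0; apply/negP => /negP ne.
have Ar : A (e - q * pi) by apply: AB => //; apply: AM.
have mr : mx P (e - q * pi) by apply: mxB => //; apply: mxM => //; apply: AP.
by have := mn _ Ar mr ne; rewrite leqNgt szq.
Qed.

Section AtPrime.
Variables (P : place F) (sz : F -> nat) (pi : F).
Hypothesis AP : forall x, A x -> sval P x.
Hypothesis sz0 : forall a, A a -> sz a = 0 -> a = 0.
Hypothesis szM : forall a b, A a -> A b -> a != 0 -> b != 0 -> sz (a * b) = (sz a * sz b)%N.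
Hypothesis szE : forall a b, A a -> A b -> b != 0 -> exists2 q, A q & (sz (a - q * b)%R < sz b)%N.
Hypotheses (Api : A pi) (pi0 : pi != 0) (mpi : mx P pi).
Hypothesis Apm : forall e, A e -> mx P e -> piS pi A e.
Hypothesis pimin : forall e, A e -> mx P e -> e != 0 -> (sz pi <= sz e)%N.

Lemma sz_pos a : A a -> a != 0 -> (0 < sz a)%N.
Proof. by move=> Aa a0; rewrite lt0n; apply: contra a0 => /eqP /sz0 ->. Qed.

Lemma sz_pi : (1 < sz pi)%N.
Proof.
rewrite ltn_neqAle sz_pos // andbT; apply/eqP => e.
have [A1 AB AM] := eb_ring H.
have [q Aq] := szE A1 Api pi0; rewrite -e ltnS leqn0 => /eqP h.
have /sz0 /(_ h) e2 : A (1 - q * pi) by apply: AB => //; apply: AM.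
apply: (@mx1F _ P); move/eqP: e2; rewrite subr_eq0 => /eqP ->.
by apply: mxM => //; apply: AP.
Qed.

Lemma eb_fac e : A e -> e != 0 -> exists k e', [/\ A e', vunit (sval P) e' & e = pi ^+ k * e'].
Proof.
move: {2}(sz e).+1 (ltnSn (sz e)) => m; elim: m e => // m IH e; rewrite ltnS => szm Ae e0.
case: (vunit_mx (AP Ae)) => [ue|me]; first by exists 0, e; rewrite mul1r.
have [e1 Ae1 ee] := Apm Ae me.
have e10 : e1 != 0 by apply: contra e0 => /eqP h; rewrite ee h mulr0.
have sm : (sz e1 < m)%N.
  by have := sz_pos Ae1 e10; have := sz_pi; move: szm; rewrite ee szM //; nia.
have [k [e' [Ae' ue' e1e]]] := IH e1 sm Ae1 e10.
by exists k.+1, e'; split=> //; rewrite ee e1e exprS mulrA.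
Qed.

(** Descent on the norm: the remainder of pi on division by e is smaller than e, and an inverse of
    it modulo pi gives one of e. If that remainder lies in the maximal ideal, minimality of pi
    forces it to be 0. *)
Lemma eb_inv_small e : A e -> ~ mx P e -> (sz e < sz pi)%N ->
  exists2 e', A e' & piS pi A (e * e' - 1).
Proof.
have [A1 AB AM] := eb_ring H; have A0 := sring0 (eb_ring H).
move: {2}(sz e).+1 (ltnSn (sz e)) => m; elim: m e => // m IH e; rewrite ltnS => szm Ae nme spi.
have e0 : e != 0 by apply/eqP => h; apply: nme; rewrite h; apply: mx0.
have [q Aq szq] := szE Api Ae e0; set r := pi - q * e in szq.
have Ar : A r by apply: AB => //; apply: AM.
have [mr|nmr] := pselect (mx P r).
  have mq : mx P q.
    have : mx P (q * e) by rewrite -[q * e](subKr pi); apply: mxB.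
    by case/(mx_prime (AP Aq) (AP Ae)) => // /nme.
  have [q' Aq' qe] := Apm Aq mq.
  have re : r = pi * (1 - q' * e) by rewrite /r qe; ring.
  have [r0|nr0] := eqVneq r 0.
    exists q' => //; exists 0; rewrite ?mulr0 //; apply/eqP; rewrite subr_eq0 mulrC eq_sym -subr_eq0.
    by move/eqP: r0; rewrite re mulf_eq0 (negbTE pi0).
  by have := pimin Ar mr nr0; lia.
have sr : (sz r < m)%N by lia.
have sr' : (sz r < sz pi)%N by lia.
have [r' Ar' [z Az ez]] := IH r sr Ar nmr sr'.
exists (0 - q * r'); first by apply: AB => //; apply: AM.
exists (z - r'); first exact: AB.
by rewrite [RHS]mulrBr -ez /r; ring.
Qed.

Lemma eb_inv e : A e -> ~ mx P e -> exists2 e', A e' & piS pi A (e * e' - 1).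
Proof.
have [A1 AB AM] := eb_ring H.
move=> Ae nme; have [q Aq szq] := szE Ae Api pi0.
have Ar : A (e - q * pi) by apply: AB => //; apply: AM.
have nmr : ~ mx P (e - q * pi).
  move=> h; apply: nme; rewrite -(subrK (q * pi) e); apply: mxD => //.
  by apply: mxM => //; apply: AP.
have [e' Ae' [z Az ez]] := eb_inv_small Ar nmr szq.
exists e' => //; exists (z + q * e'); first by apply: (sringD (eb_ring H)) => //; apply: AM.
by rewrite [RHS]mulrDr -ez; ring.
Qed.

(** Common factors pi are cancelled from a relation; this terminates because the norm of a fixed
    nonzero coefficient drops each time. *)
Lemma eb_dep_prim (x : nat -> F) : exists c : nat -> F,
  [/\ forall i, A (c i), exists2 i, (i <= n)%N & ~ piS pi A (c i) & \sum_(i < n.+1) c i * x i = 0].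
Proof.
have A0 := sring0 (eb_ring H).
have [c [Ac [i0 i0n ci0] e]] := eb_dep H x.
move: {2}(sz (c i0)).+1 (ltnSn (sz (c i0))) => m.
elim: m c Ac ci0 e => // m IH c Ac ci0 e; rewrite ltnS => szm.
have [[i [ni nc]]|h] := pselect (exists i, (i <= n)%N /\ ~ piS pi A (c i)); first by exists c; split=> //; exists i.
have all i : (i <= n)%N -> piS pi A (c i) by move=> ni; apply: contrapT => hc; apply: h; exists i.
have exd i : exists d, A d /\ ((i <= n)%N -> c i = pi * d).
  have [/all [d Ad ->]|] := boolP (i <= n)%N; first by exists d.
  by exists 0.
have [d dP] := choice_ex exd.
have di0 : d i0 != 0 by apply: contra ci0 => /eqP hd; rewrite (dP i0).2 // hd mulr0.
apply: (IH d) => //.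
- by move=> i; case: (dP i).
- apply: (mulfI pi0); rewrite mulr0 -[RHS]e mulr_sumr; apply: eq_bigr => i _.
  by rewrite (dP i).2 ?mulrA // -ltnS.
- have [Ad _] := dP i0; have := sz_pos Ad di0; have := sz_pi.
  by move: szm; rewrite (dP i0).2 // szM //; nia.
Qed.

Lemma eb_fin_quot (S : F -> Prop) s : subg S -> (forall a x, A a -> S x -> S (a * x)) ->
  (forall e, A e -> (sz e < sz pi)%N -> e \in s) ->
  exists2 N, (N <= size s ^ n)%N & idx S (piS pi S) N.
Proof.
have [A1 AB AM] := eb_ring H.
move=> sS AS hs; apply: (fin_quot (eb_ring H)) => //.
- move=> e Ae; have [q Aq szq] := szE Ae Api pi0.
  have Ar : A (e - q * pi) by apply: AB => //; apply: AM.
  exists (e - q * pi); first exact: hs.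
  by split=> //; exists q => //; rewrite opprB addrC subrK mulrC.
- move=> e Ae; have [me|nme] := pselect (mx P e); first by left; apply: Apm.
  by right; apply: eb_inv.
- exact: eb_dep_prim.
Qed.

End AtPrime.

Lemma eb_setup P : (forall x, A x -> sval P x) ->
  exists pi N, [/\ mx P pi, pi != 0,
    forall e, A e -> e != 0 -> exists k e', vunit (sval P) e' /\ e = pi ^+ k * e' &
    idx (sval P) (piS pi (sval P)) N].
Proof.
move=> AP; have [sz [sz0 szM szE szf]] := eb_norm H.
have [pi [Api pi0 mpi Apm pimin]] := eb_gen AP sz0 szE.
have [s hs] := szf (sz pi).
have APM a x : A a -> sval P x -> sval P (a * x) by move=> Aa; apply: plM; apply: AP.
have [N _ hN] := eb_fin_quot AP sz0 szM szE Api pi0 mpi Apm pimin (subg_pl P) APM hs.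
exists pi, N; split=> // e Ae e0.
have [k [e' [_ h1 h2]]] := eb_fac AP sz0 szM szE Api pi0 mpi Apm Ae e0.
by exists k, e'.
Qed.

Lemma eb_val P x : (forall x, A x -> sval P x) -> x != 0 -> exists n, vP P x n.
Proof.
move=> AP; have [pi [N [h1 h2 h3 h4]]] := eb_setup AP.
exact: (exists_val AP h1 h2 h3 eb_algrel h4).
Qed.

Lemma eb_res P : (forall x, A x -> sval P x) -> exists q, idx (sval P) (@mx F P) q.
Proof.
move=> AP; have [pi [N [h1 h2 h3 h4]]] := eb_setup AP.
have [q _ hq] : exists2 q, (q <= N)%N & idx (sval P) (@mx F P) q; last by exists q.
apply: (nc_inj (g := id)) h4 => //; [exact/subg_eqv/subg_mx|exact/subg_eqv/sg_piS/subg_pl|].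
by move=> x y _ _ [z Pz ->]; apply: mxMr.
Qed.

Lemma vP_arch P : (forall x : F, x != 0 -> exists n, vP P x n) -> arch P.
Proof.
move=> hv x z mX.
have [->|z0] := eqVneq z 0; first by exists 0; rewrite mul0r; apply: pl0.
have [->|x0] := eqVneq x 0; first by exists 1; rewrite expr1 mulr0; apply: pl0.
have [k [t [u [ut uu e]]]] := hv z z0.
have [mt t0 tmax] := (uniformizerP _ _).1 ut; have [_ Pu _] := uu.
have P1 : sval P (x / t) by apply: tmax.
exists `|k|%N; rewrite e.
have -> : u * t ^ k * x ^+ `|k|%N = u * (x / t) ^+ `|k|%N * (t ^ k * t ^+ `|k|%N).
  by rewrite -{1}[x](divfK t0) exprMn mulrACA !mulrA.
apply: plM; first by apply: plM => //; apply: plX.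
have Pt := mx_pl mt.
case: k {e} => k /=; first by rewrite -exprnP -exprD; apply: plX.
by rewrite NegzE -exprnN mulVf ?expf_neq0 //; apply: pl1.
Qed.

Lemma bounded_list (T : choiceType) (Q : T -> Prop) m :
  (forall s : seq T, uniq s -> (forall x, x \in s -> Q x) -> (size s <= m)%N) ->
  exists s : seq T, forall x, Q x -> x \in s.
Proof.
move=> bd; pose ok k := `[< exists s : seq T, [/\ uniq s, forall x, x \in s -> Q x & size s = k] >].
have ok0 : exists k, ok k by exists 0; apply/asboolP; exists [::].
have bdk k : ok k -> (k <= m)%N by move=> /asboolP [s [us hs <-]]; apply: bd.
case: (ex_maxnP ok0 bdk) => k /asboolP [s [us hs sk]] kmax.
exists s => x Qx; apply: contrapT => /negP xs.
have okk : ok k.+1.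
  apply/asboolP; exists (x :: s); split; rewrite /= ?xs ?us ?sk // => y.
  by rewrite inE => /orP [/eqP ->|/hs].
by have := kmax _ okk; rewrite ltnn.
Qed.

(** If y lies in the maximal ideal of P, so does the lowest coefficient e of a relation of y. The
    generator pi of the prime below then has norm at most that of e, hence finitely many values.
    Above one pi there are at most n places: otherwise weak approximation gives n + 1 elements, each
    a unit at its own place and in the maximal ideals of the others, and these violate a primitive
    relation. *)
Lemma eb_supp x : x != 0 -> exists s : seq (place F), forall P : place F,
  (forall y, A y -> sval P y) -> ~ vunit (sval P) x -> P \in s.
Proof.
suff main y : y != 0 -> exists s : seq (place F), forall P : place F,
    (forall y, A y -> sval P y) -> mx P y -> P \in s.
  move=> x0; have [s hs] := main x x0; have [|s' hs'] := main x^-1; first by rewrite invr_eq0.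
  exists (s ++ s') => P AP nu; rewrite mem_cat.
  have [Px|nPx] := pselect (sval P x); first by rewrite hs.
  by rewrite hs' ?orbT //; apply: mxV.
move=> {x} y0; have [sz [sz0 szM szE szf]] := eb_norm H.
have [e [Ae e0] he] := algrel_low y0 (eb_algrel y).
have [L hL] := szf (sz e).+1.
have ex pi : exists s : seq (place F), forall P : place F,
    [/\ forall y, A y -> sval P y, A pi, pi != 0, mx P pi & (forall e, A e -> mx P e -> piS pi A e) /\
     (forall e, A e -> mx P e -> e != 0 -> (sz pi <= sz e)%N)] -> P \in s.
  apply: (bounded_list (m := n)) => s us hs; rewrite leqNgt; apply/negP => ns.
  have as_ Q : Q \in s -> arch Q.
    by move=> /hs [AQ _ _ _ _]; apply: vP_arch => x; apply: eb_val.
  have exy P : exists x, P \in s -> vunit (sval P) x /\ forall Q, Q \in s -> Q != P -> mx Q x.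
    have [Ps|_] := boolP (P \in s); last by exists 0.
    have [x hx] := weak_approx (fun Q => if Q == P then 1 else 0) (fun=> pi^-1) as_ us.
    exists x => _; have [APP _ pi0 mP _] := hs _ Ps.
    have dv Q : Q \in s -> mx Q (x - (if Q == P then 1 else 0)).
      move=> Qs; have [_ _ _ mQ _] := hs _ Qs.
      by rewrite -(divfK pi0 (x - _)); apply: mxM => //; apply: hx.
    split; first by have := dv _ Ps; rewrite eqxx => h; rewrite -[x](subKr 1) -[1 - x]opprB opprK;
       rewrite -[x - 1]opprK; apply: vunitBm; [exact: vunit1|exact: mxN].
    by move=> Q Qs QP; have := dv _ Qs; rewrite (negbTE QP) subr0.
  have [x xP] := choice_ex exy.
  have [P0 P0s] : exists P, P \in s by case: (s) ns => // P s' _; exists P; apply: mem_head.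
  have [AP0 Api pi0 mP0 [Apm pimin]] := hs _ P0s.
  have [c [Ac [i ni nci] ec]] := eb_dep_prim AP0 sz0 szM szE Api pi0 mP0 (fun i => x (nth P0 s i)).
  have is_ : (i < size s)%N by apply: leq_ltn_trans ns.
  set P := nth P0 s i; have Ps : P \in s by apply: mem_nth.
  have [AP _ _ mP [ApmP _]] := hs _ Ps.
  have [uP hP] := xP _ Ps.
  have uc : vunit (sval P) (c i).
    by case: (vunit_mx (AP _ (Ac i))) => // /(ApmP _ (Ac i)).
  have ni' : (i < n.+1)%N by [].
  apply: (vunit_notmx (vunitM uc uP)).
  move/eqP: ec; rewrite (bigD1 (Ordinal ni')) //= addr_eq0 => /eqP ->.
  apply: mxN; apply: mx_sum => j ji; apply: mxM; first exact: AP.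
  have js : (j < size s)%N by apply: leq_ltn_trans ns; rewrite -ltnS.
  apply: (xP _ (mem_nth _ js)).2 => //.
  by rewrite nth_uniq // eq_sym; apply: contra ji => /eqP h; apply/eqP/val_inj.
have [l lP] := choice_ex ex.
exists (flatten [seq l pi | pi <- L]) => P AP mP.
have [pi [Api pi0 mpi Apm pimin]] := eb_gen AP sz0 szE.
apply/flatten_mapP; exists pi; last exact: lP.
apply: hL => //; rewrite ltnS; apply: pimin => //.
by rewrite -(divfK y0 e); apply: mxM => //; apply: he => //; apply: mx_pl.
Qed.

End Base.

(** Two base rings, because a place of a function field may have a pole at t and then lies over
    F_q[1/t]. *)
Lemma gl_ebase (F : fieldType) (A B : F -> Prop) n m : ebase A n -> ebase B m ->
  (forall P : place F, (forall x, A x -> sval P x) \/ (forall x, B x -> sval P x)) -> gl F.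
Proof.
move=> HA HB cov; split.
- by move=> P x; case: (cov P) => h; [apply: (eb_val HA)|apply: (eb_val HB)].
- move=> x x0; have [s hs] := eb_supp HA x0; have [s' hs'] := eb_supp HB x0.
  exists (s ++ s') => P nu; rewrite mem_cat.
  by case: (cov P) => h; [rewrite hs|rewrite hs' ?orbT].
- by move=> P; case: (cov P) => h; [apply: (eb_res HA)|apply: (eb_res HB)].
Qed.

(** * Normalized valuations *)

Definition vl (F : fieldType) (P : place F) (x : F) : int := xget 0 [set n | vP P x n]%classic.

Lemma vP_unif (F : fieldType) (P : place F) t x n : vP P x n -> uniformizer (sval P) t ->
  vunit (sval P) (x / t ^ n) /\ x != 0.
Proof.
move=> [t' [u [ut' uu ->]]] ut.
have [mt t0 ht] := (uniformizerP _ _).1 ut; have [mt' t'0 ht'] := (uniformizerP _ _).1 ut'.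
have uq : vunit (sval P) (t' / t).
  by split; [rewrite mulf_neq0 ?invr_eq0|apply: ht|rewrite invfM invrK mulrC; apply: ht'].
have u0 : u != 0 by case: uu.
split; last by rewrite mulf_neq0 ?expfz_neq0.
have -> : u * t' ^ n / t ^ n = u * (t' / t) ^ n.
  by rewrite -mulrA expfzMl invr_expz exprz_inv.
apply: vunitM => //; case: n => n; first exact: vunitX.
by rewrite NegzE -exprz_inv; apply/vunitX/vunitV.
Qed.

Lemma vP_inj (F : fieldType) (P : place F) x n m : vP P x n -> vP P x m -> n = m.
Proof.
move=> hn hm; have [t [u [ut uu e]]] := hn.
have [mt t0 ht] := (uniformizerP _ _).1 ut.
have [u1 x0] := vP_unif hn ut; have [u2 _] := vP_unif hm ut.
have key a b : vunit (sval P) (x / t ^ a) -> vunit (sval P) (x / t ^ b) -> a <= b.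
  move=> ua ub; rewrite leNgt; apply/negP => ba.
  have := vunitM ub (vunitV ua).
  have -> : x / t ^ b * (x / t ^ a)^-1 = t ^ (a - b).
    rewrite expfzDr // -invr_expz invfM invrK; field.
    by rewrite x0 !expfz_neq0.
  have : 0 < a - b by rewrite subr_gt0.
  case: (a - b) => // -[|k] // _ h; apply: (vunit_notmx h).
  by rewrite -exprnP exprS; apply: mxMr => //; apply/plX/mx_pl.
by apply/eqP; rewrite eq_le !key.
Qed.

Lemma vl_eq (F : fieldType) (P : place F) x n : vP P x n -> vl P x = n.
Proof. by move=> h; apply: xget_unique => // m hm; apply: (vP_inj hm h). Qed.

Section Valuation.
Variables (F : fieldType) (G : gl F).
Implicit Types (P Q : place F) (x y t : F) (s : seq (place F)).

Lemma vlP P x : x != 0 -> vP P x (vl P x).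
Proof. by move=> x0; have [n hn] := gl_val G P x0; rewrite (vl_eq hn). Qed.

Lemma unif_ex P : exists t, uniformizer (sval P) t.
Proof. by have [n [t [u [ut _ _]]]] := gl_val G P (oner_neq0 F); exists t. Qed.

Lemma vl_unif P t x : uniformizer (sval P) t -> x != 0 -> vunit (sval P) (x / t ^ vl P x).
Proof. by move=> ut x0; case: (vP_unif (vlP P x0) ut). Qed.

Lemma vl_of P t u n : uniformizer (sval P) t -> vunit (sval P) u -> vl P (u * t ^ n) = n.
Proof. by move=> ut uu; apply: vl_eq; exists t, u. Qed.

Lemma vlM P x y : x != 0 -> y != 0 -> vl P (x * y) = vl P x + vl P y.
Proof.
move=> x0 y0; have [t ut] := unif_ex P; have [mt t0 _] := (uniformizerP _ _).1 ut.
have := vl_of (vl P x + vl P y) ut (vunitM (vl_unif ut x0) (vl_unif ut y0)).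
move=> <-; congr (vl P _); rewrite expfzDr //; field.
by rewrite !expfz_neq0.
Qed.

Lemma vl1 P : vl P 1 = 0.
Proof.
have := vlM P (oner_neq0 F) (oner_neq0 F); rewrite mulr1 => h.
by apply: (@addrI _ (vl P 1)); rewrite addr0; exact: esym h.
Qed.
Lemma vlV P x : x != 0 -> vl P x^-1 = - vl P x.
Proof.
move=> x0; have v0 : x^-1 != 0 by rewrite invr_eq0.
by have := vlM P x0 v0; rewrite divff // vl1; lia.
Qed.
Lemma vlD P x y : x != 0 -> y != 0 -> vl P (x / y) = vl P x - vl P y.
Proof. by move=> x0 y0; rewrite vlM ?invr_eq0 // vlV. Qed.
Lemma vlX P x n : x != 0 -> vl P (x ^+ n) = vl P x *+ n.
Proof.
move=> x0; elim: n => [|n ih]; first by rewrite vl1.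
by rewrite exprS vlM ?expf_neq0 // ih mulrS.
Qed.
Lemma vl_prod P I (r : seq I) (Q : pred I) (f : I -> F) : (forall i, Q i -> f i != 0) ->
  vl P (\prod_(i <- r | Q i) f i) = \sum_(i <- r | Q i) vl P (f i).
Proof.
move=> f0; elim: r => [|i r ih]; first by rewrite !big_nil vl1.
rewrite !big_cons; case: ifP => // Qi; rewrite vlM ?f0 ?ih //.
by apply: (big_ind (fun x => x != 0)) => [|x y|j Qj]; [exact: oner_neq0|exact: mulf_neq0|exact: f0].
Qed.

Lemma vl_ge0 P x : x != 0 -> sval P x <-> 0 <= vl P x.
Proof.
move=> x0; have [t ut] := unif_ex P; have [mt t0 _] := (uniformizerP _ _).1 ut.
have [_ Pu Pv] := vl_unif ut x0; split.
  move=> Px; rewrite leNgt; apply/negP => h.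
  have Pt : sval P (x / t ^ vl P x * x^-1 * x) by rewrite divfK.
  case: (vl P x) h Pv => // k _ Pv.
  have : sval P ((x / t ^ Negz k)^-1 * x) by apply: plM.
  rewrite invfM invrK mulrAC mulVf // mul1r NegzE -exprnN => h.
  apply: (@mx1F _ P); rewrite -(mulVf (expf_neq0 k.+1 t0)); apply: mxM => //.
  by rewrite exprS; apply: mxMr => //; apply/plX/mx_pl.
move=> h; rewrite -(divfK (expfz_neq0 (vl P x) t0) x); apply: plM => //.
by case: (vl P x) h => // k _; apply/plX/mx_pl.
Qed.

Lemma vl_gt0 P x : x != 0 -> mx P x <-> 0 < vl P x.
Proof.
move=> x0; split=> [mx_|h].
  rewrite ltNge; apply/negP => h; case: mx_ => Px; apply; split=> //.
  by apply/vl_ge0; rewrite ?invr_eq0 // vlV // oppr_ge0.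
split; first by apply/vl_ge0 => //; apply: ltW.
case=> _ _ /vl_ge0; rewrite invr_eq0 => /(_ x0); rewrite vlV // oppr_ge0 => h2.
by have := lt_le_trans h h2; rewrite ltxx.
Qed.

Lemma vl_eq0 P x : x != 0 -> vunit (sval P) x <-> vl P x = 0.
Proof.
move=> x0; split=> [[_ h1 h2]|h].
  apply/eqP; rewrite eq_le; apply/andP; split; last by apply/vl_ge0.
  by rewrite -oppr_ge0 -vlV //; apply/vl_ge0; rewrite ?invr_eq0.
by split=> //; apply/vl_ge0; rewrite ?invr_eq0 ?vlV // h.
Qed.

Lemma vl_t P t : uniformizer (sval P) t -> vl P t = 1.
Proof. by move=> ut; have := vl_of 1 ut (vunit1 P); rewrite mul1r expr1z. Qed.

Lemma unif_vl P t : t != 0 -> vl P t = 1 -> uniformizer (sval P) t.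
Proof.
move=> t0 e; apply/uniformizerP; split=> //; first by apply/vl_gt0; rewrite ?e.
move=> y my; have [->|y0] := eqVneq y 0; first by rewrite mul0r; apply: pl0.
apply/vl_ge0; first by rewrite mulf_neq0 ?invr_eq0.
by rewrite vlD // e; move/vl_gt0: my => /(_ y0); lia.
Qed.

(** The case x = 0 is separate because [vl] takes the default value 0 there instead of infinity. *)
Definition vge P (n : int) x := x = 0 \/ n <= vl P x.

Lemma vgeP P t n x : t != 0 -> vl P t = 1 -> vge P n x <-> sval P (x / t ^ n).
Proof.
move=> t0 e; rewrite /vge; have [->|x0] := eqVneq x 0.
  by rewrite mul0r; split=> _; [apply: pl0|left].
have vt : vl P (t ^ n) = n.
  case: n => n; first by rewrite -exprnP vlX // e natz.
  by rewrite NegzE -exprnN vlV ?expf_neq0 // vlX // e natz.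
rewrite vl_ge0 ?mulf_neq0 ?invr_eq0 ?expfz_neq0 // vlD ?expfz_neq0 // vt subr_ge0.
by split=> [[h|//]|]; [rewrite h eqxx in x0|right].
Qed.

Lemma subg_vge P n : subg (vge P n).
Proof.
have [t ut] := unif_ex P; have [mt t0 _] := (uniformizerP _ _).1 ut.
split; first by left.
move=> x y /(vgeP _ _ t0 (vl_t ut)) hx /(vgeP _ _ t0 (vl_t ut)) hy.
by apply/(vgeP _ _ t0 (vl_t ut)); rewrite mulrBl; apply: plB.
Qed.

Lemma vgeM P n m x y : vge P n x -> vge P m y -> vge P (n + m) (x * y).
Proof.
move=> [->|hx]; first by rewrite mul0r; left.
move=> [->|hy]; first by rewrite mulr0; left.
have [->|x0] := eqVneq x 0; first by rewrite mul0r; left.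
have [->|y0] := eqVneq y 0; first by rewrite mulr0; left.
by right; rewrite vlM // lerD.
Qed.

Lemma vge0 P x : vge P 0 x <-> sval P x.
Proof.
have [->|x0] := eqVneq x 0; first by split=> _; [apply: pl0|left].
rewrite vl_ge0 //; split=> [[h|//]|]; [by rewrite h eqxx in x0|by right].
Qed.
Lemma vge1 P x : vge P 1 x <-> mx P x.
Proof.
have [->|x0] := eqVneq x 0; first by split=> _; [apply: mx0|left].
rewrite vl_gt0 //; split=> [[h|//]|]; [by rewrite h eqxx in x0|by right].
Qed.
Lemma vge_le P n m x : n <= m -> vge P m x -> vge P n x.
Proof. by move=> nm [->|h]; [left|right; apply: le_trans h]. Qed.

Lemma gl_arch P : arch P.
Proof. by apply: vP_arch => x; apply: gl_val. Qed.

Lemma vl_notge P x n : x != 0 -> ~ vge P (n + 1) x -> vge P n x -> vl P x = n.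
Proof.
move=> x0 h [e|h2]; first by rewrite e eqxx in x0.
apply/eqP; rewrite eq_le h2 andbT leNgt; apply/negP => h3; apply: h; right.
by rewrite lezD1.
Qed.

Lemma unif_at P n : exists2 t, t != 0 & vl P t = n.
Proof.
have [t ut] := unif_ex P; have [_ t0 _] := (uniformizerP _ _).1 ut.
by exists (t ^ n); [rewrite expfz_neq0|rewrite -[t ^ n]mul1r (vl_of _ ut (vunit1 P))].
Qed.

Lemma weak_approx_vl s (z : place F -> F) (n : place F -> int) : uniq s ->
  exists y, forall P, P \in s -> vge P (n P) (y - z P).
Proof.
move=> us; have [t tP] := choice_ex (fun P => (let: ex_intro2 x a b := unif_at P 1 in ex_intro (fun t => t != 0 /\ vl P t = 1) x (conj a b))).
have [y hy] := weak_approx z (fun P => (t P ^ n P)^-1) (fun Q _ => @gl_arch Q) us.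
by exists y => P /hy; case: (tP P) => t0 e; move/(vgeP _ _ t0 e).
Qed.

Lemma approx_vl s (n : place F -> int) : uniq s ->
  exists2 y, y != 0 & forall P, P \in s -> vl P y = n P.
Proof.
move=> us; have [z zP] := choice_ex (fun P => (let: ex_intro2 x a b := unif_at P (n P) in ex_intro (fun t => t != 0 /\ vl P t = n P) x (conj a b))).
case: s us => [|P0 s] us; first by exists 1; rewrite ?oner_neq0.
(* Precision n P + 1 exceeds the valuation n P of z P, so y inherits that valuation. *)
have [y hy] := weak_approx_vl z (fun P => n P + 1) us.
have key P : P \in P0 :: s -> y != 0 /\ vl P y = n P.
  move=> Ps; have [z0 ez] := zP P; have h := hy P Ps.
  have nz : ~ vge P (n P + 1) (z P) by case=> [e|]; [rewrite e eqxx in z0|rewrite ez; lia].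
  have ny : ~ vge P (n P + 1) y.
    by move=> hy'; apply: nz; rewrite -(subKr y (z P)); apply: subgB (subg_vge _ _) hy' h.
  have y0 : y != 0 by apply/eqP => e; apply: ny; left.
  split=> //; apply: vl_notge => //.
  rewrite -(subrK (z P) y); apply: subgD (subg_vge _ _) _ _; last by right; rewrite ez.
  by apply: vge_le h; lia.
by exists y => [|P /key []]; [case: (key P0 (mem_head _ _))|].
Qed.

Lemma place_integral P (q : {poly F}) x : q \is monic -> (forall i, sval P q`_i) ->
  root q x -> sval P x.
Proof.
move=> mq cq /eqP rx; apply: contrapT => nPx.
have x0 : x != 0 by apply/eqP => e; apply: nPx; rewrite e; apply: pl0.
have s0 : (0 < size q)%N by rewrite size_poly_gt0 monic_neq0.
apply: (@mx1F _ P); move: rx; rewrite horner_coef -(prednK s0) big_ord_recr /=.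
rewrite -[q`_ _]/(lead_coef q) (monicP mq) mul1r => /eqP.
set n := (size q).-1; rewrite addrC addr_eq0 => /eqP e.
have xn : x ^+ n != 0 by rewrite expf_neq0.
have -> : 1 = - \sum_(i < n) q`_i * x^-1 ^+ (n - i).
  apply: (mulIf xn); rewrite mul1r {1}e mulNr mulr_suml; congr (- _).
  apply: eq_bigr => i _; rewrite -mulrA; congr (_ * _).
  have -> : x ^+ n = x ^+ (n - i) * x ^+ i by rewrite -exprD subnK // ltnW.
  by rewrite mulrA -exprMn mulVf // expr1n mul1r.
apply: mxN; apply: mx_sum => i _; apply: mxM => //.
have : (0 < n - i)%N by rewrite subn_gt0.
by case: (n - i)%N => // k _; rewrite exprS; apply: mxMr; [apply: mxV|apply/plX/plV].
Qed.

End Valuation.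

(** * Divisors and cyclic extensions *)

(* F^* written additively, to fit the zmodType-based index calculus. *)
Definition munit (F : fieldType) := {x : F | x != 0}.
HB.instance Definition _ (F : fieldType) := Choice.copy (munit F) {x : F | x != 0}.

Section MulGroup.
Variable F : fieldType.
Implicit Types x y z : munit F.
Definition mu_mul x y : munit F := exist _ (val x * val y) (mulf_neq0 (valP x) (valP y)).
Definition mu_one : munit F := exist _ 1 (oner_neq0 F).
Lemma mu_inv_subproof x : (val x)^-1 != 0. Proof. by rewrite invr_eq0 (valP x). Qed.
Definition mu_inv x : munit F := exist _ (val x)^-1 (mu_inv_subproof x).
Lemma mu_mulA : associative mu_mul. Proof. by move=> x y z; apply: val_inj; rewrite /= mulrA. Qed.
Lemma mu_mulC : commutative mu_mul. Proof. by move=> x y; apply: val_inj; rewrite /= mulrC. Qed.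
Lemma mu_mul1 : left_id mu_one mu_mul. Proof. by move=> x; apply: val_inj; rewrite /= mul1r. Qed.
Lemma mu_mulV : left_inverse mu_one mu_inv mu_mul.
Proof. by move=> x; apply: val_inj; rewrite /= mulVf // (valP x). Qed.
End MulGroup.
HB.instance Definition _ (F : fieldType) := GRing.isZmodule.Build (munit F)
  (@mu_mulA F) (@mu_mulC F) (@mu_mul1 F) (@mu_mulV F).

Section MunitVal.
Variable F : fieldType.
Implicit Types x y : munit F.
Lemma mu0 : val (0 : munit F) = 1. Proof. by []. Qed.
Lemma muD x y : val (x + y) = val x * val y. Proof. by []. Qed.
Lemma muN x : val (- x) = (val x)^-1. Proof. by []. Qed.
Lemma muB x y : val (x - y) = val x / val y. Proof. by []. Qed.
Lemma muMn x n : val (x *+ n) = val x ^+ n.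
Proof. by elim: n => [|n ih]; rewrite ?mulr0n ?mu0 // mulrS muD ih exprS. Qed.
Lemma mu_sum I (r : seq I) (P : pred I) (f : I -> munit F) :
  val (\sum_(i <- r | P i) f i) = \prod_(i <- r | P i) val (f i).
Proof. exact: (big_morph (fun x : munit F => val x) muD mu0). Qed.
Definition mu (x : F) (x0 : x != 0) : munit F := exist _ x x0.
End MunitVal.

Section MuMap.
Variables (A B : fieldType) (f : {rmorphism A -> B}).
Lemma mu_map_subproof (x : munit A) : f (val x) != 0. Proof. by rewrite fmorph_eq0 (valP x). Qed.
Definition mu_map (x : munit A) : munit B := exist _ (f (val x)) (mu_map_subproof x).
Lemma mu_mapB x y : mu_map (x - y) = mu_map x - mu_map y.
Proof. by apply: val_inj; rewrite /= rmorphM fmorphV. Qed.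
End MuMap.

Definition dvs (F : fieldType) := place F -> int.
HB.instance Definition _ (F : fieldType) := GRing.Zmodule.copy (dvs F) (place F -> int).
Definition fsupp (F : fieldType) (D : dvs F) := exists s : seq (place F), forall P, D P != 0 -> P \in s.
Definition dv (F : fieldType) (x : munit F) : dvs F := fun P => vl P (val x).
(* Zero in characteristic 0: there Div0 below is the group of all divisors, so
   that Div0 modulo principal divisors is the ideal class group. *)
Definition wt (F : fieldType) (P : place F) : int :=
  if `[< char0 F >] then 0 else (xget 0 [set d | place_deg P d]%classic)%:Z.
Definition dsupp (F : fieldType) (D : dvs F) : seq (place F) :=
  xget [::] [set s | uniq s /\ forall P, D P != 0 -> P \in s]%classic.
Definition deg (F : fieldType) (D : dvs F) : int := \sum_(P <- dsupp D) wt P * D P.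

Section Divisors.
Variables (F : fieldType) (G : gl F).
Implicit Types (D : dvs F) (P : place F).

Lemma dvsB D D' P : (D - D') P = D P - D' P. Proof. by []. Qed.
Lemma dvsD D D' P : (D + D') P = D P + D' P. Proof. by []. Qed.
Lemma dvsN D P : (- D) P = - D P. Proof. by []. Qed.
Lemma dvs0 P : (0 : dvs F) P = 0. Proof. by []. Qed.
Lemma dvsMn D n P : (D *+ n) P = D P *+ n.
Proof. by elim: n => [|n ih]; rewrite ?mulr0n // !mulrS dvsD ih. Qed.
Lemma dvs_sum I (r : seq I) (Q : pred I) (f : I -> dvs F) P :
  (\sum_(i <- r | Q i) f i) P = \sum_(i <- r | Q i) f i P.
Proof. exact: (big_morph (fun D : dvs F => D P) (fun D D' => dvsD D D' P) (dvs0 P)). Qed.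

Lemma dvB (x y : munit F) : dv (x - y) = dv x - dv y.
Proof. by apply: funext => P; rewrite /dv muB vlD // ?(valP x) ?(valP y). Qed.

Lemma fsuppP D : fsupp D <-> exists s : seq (place F), uniq s /\ forall P, D P != 0 -> P \in s.
Proof.
split=> [[s hs]|[s [_ hs]]]; last by exists s.
by exists (undup s); rewrite undup_uniq; split=> // P /hs; rewrite mem_undup.
Qed.

Lemma dsuppP D : fsupp D -> uniq (dsupp D) /\ forall P, D P != 0 -> P \in dsupp D.
Proof.
move=> /fsuppP h.
exact: (@xgetPex _ [::] [set s | uniq s /\ forall P, D P != 0 -> P \in s]%classic h).
Qed.

Lemma subg_fsupp : subg (@fsupp F).
Proof.
split; first by exists [::] => P; rewrite dvs0 eqxx.
move=> D D' [s hs] [s' hs']; exists (s ++ s') => P; rewrite mem_cat dvsB.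
have [->|/hs -> //] := eqVneq (D P) 0.
have [->|/hs' ->] := eqVneq (D' P) 0; last by rewrite orbT.
by rewrite subrr eqxx.
Qed.

Lemma fsupp_dv (x : munit F) : fsupp (dv x).
Proof.
have [s hs] := gl_supp G (valP x); exists s => P h; apply: hs.
by move/(vl_eq0 G P (valP x)) => e; rewrite /dv e eqxx in h.
Qed.

Lemma sum_supp (w : place F -> int) D (s s' : seq (place F)) : uniq s -> uniq s' ->
  (forall P, D P != 0 -> P \in s) -> (forall P, D P != 0 -> P \in s') ->
  \sum_(P <- s) w P * D P = \sum_(P <- s') w P * D P.
Proof.
move=> us us' hs hs'.
have red (r : seq (place F)) : \sum_(P <- r) w P * D P = \sum_(P <- [seq P <- r | D P != 0]) w P * D P.
  rewrite big_filter [RHS]big_mkcond; apply: eq_bigr => P _.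
  by case: ifP => // /negbT; rewrite negbK => /eqP ->; rewrite mulr0.
rewrite red [RHS]red; apply: perm_big; apply: uniq_perm; rewrite ?filter_uniq // => P.
rewrite !mem_filter; case: (boolP (D P != 0)) => // /[dup] /hs -> /hs' -> //.
Qed.

Lemma degE D (s : seq (place F)) : uniq s -> (forall P, D P != 0 -> P \in s) ->
  deg D = \sum_(P <- s) wt P * D P.
Proof.
move=> us hs; have [u1 h1] : uniq (dsupp D) /\ forall P, D P != 0 -> P \in dsupp D.
  by apply: dsuppP; exists s.
exact: sum_supp.
Qed.

Lemma degB D D' : fsupp D -> fsupp D' -> deg (D - D') = deg D - deg D'.
Proof.
move=> [s hs] [s' hs']; pose r := undup (s ++ s').
have ur : uniq r by apply: undup_uniq.
have h1 P : D P != 0 -> P \in r by move=> /hs h; rewrite mem_undup mem_cat h.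
have h2 P : D' P != 0 -> P \in r by move=> /hs' h; rewrite mem_undup mem_cat h orbT.
rewrite (degE ur h1) (degE ur h2) (degE (D := D - D') ur).
  by rewrite -sumrB; apply: eq_bigr => P _; rewrite dvsB mulrBr.
move=> P; apply: contraR => /[dup] hr nr; rewrite dvsB.
have -> : D P = 0 by apply/eqP; apply: contraR hr => /h1.
have -> : D' P = 0 by apply/eqP; apply: contraR nr => /h2.
by rewrite subrr.
Qed.

Definition Div0 D := fsupp D /\ deg D = 0.

Lemma deg0 : deg (0 : dvs F) = 0.
Proof. by rewrite (degE (s := [::])) ?big_nil. Qed.

Lemma subg_Div0 : subg Div0.
Proof.
split; first by split; [apply: subg0 subg_fsupp|apply: deg0].
move=> D D' [h1 e1] [h2 e2]; split; last by rewrite degB // e1 e2.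
exact: (subgB subg_fsupp).
Qed.

Lemma principalP D : principal_divisor D <-> exists x : munit F, D = dv x.
Proof.
split=> [[x [x0 h]]|[x ->]].
  by exists (mu x0); apply: funext => P; rewrite /dv (vl_eq (h P)).
by exists (val x); split=> [|P]; [exact: (valP x)|apply: vlP; rewrite ?(valP x)].
Qed.

Lemma vlXz P x (n : int) : x != 0 -> vl P (x ^ n) = n * vl P x.
Proof.
move=> x0; case: n => n; first by rewrite -exprnP vlX // -mulr_natl natz.
by rewrite NegzE -exprnN vlV ?expf_neq0 // vlX // -mulr_natl natz mulNr.
Qed.

End Divisors.

(** * Restriction of places and extension of divisors *)

Section Pull.
Variables (A B : fieldType) (f : {rmorphism A -> B}) (GA : gl A) (GB : gl B).
Hypothesis Hf : forall P : place B, exists a, ~ sval P (f a).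
Implicit Types (P : place B) (p : place A).

Lemma pull_valring P : valring (fun a => sval P (f a)).
Proof.
split.
- by rewrite rmorph0 rmorph1; split; [apply: pl0|apply: pl1].
- by move=> x y; rewrite rmorphB; apply: plB.
- by move=> x y; rewrite rmorphM; apply: plM.
- move=> x x0; rewrite fmorphV; have [|/plV] := pselect (sval P (f x)); [by left|by right].
- exact: Hf.
Qed.
Definition pull P : place A := exist _ _ (pull_valring P).

Lemma pullE P a : sval (pull P) a = sval P (f a). Proof. by []. Qed.
Lemma pull_unit P a : vunit (sval (pull P)) a <-> vunit (sval P) (f a).
Proof. by rewrite /vunit /= fmorphV fmorph_eq0. Qed.
Lemma pull_mx P a : mx (pull P) a <-> mx P (f a).
Proof. by rewrite /mx pull_unit. Qed.

Definition ram P : int :=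
  xget 0 [set n | exists2 t, uniformizer (sval (pull P)) t & n = vl P (f t)]%classic.

Lemma vl_pull_unif P t a : uniformizer (sval (pull P)) t -> a != 0 ->
  vl P (f a) = vl P (f t) * vl (pull P) a.
Proof.
move=> ut a0; have [mt t0 _] := (uniformizerP _ _).1 ut.
have ua := vl_unif GA ut a0; have tn0 : t ^ vl (pull P) a != 0 by rewrite expfz_neq0.
have /pull_unit ufa := ua.
rewrite -{1}(divfK tn0 a) rmorphM vlM // ?fmorph_eq0 ?mulf_neq0 ?invr_eq0 //.
move/(vl_eq0 GB) : ufa => ->; last by rewrite fmorph_eq0 mulf_neq0 ?invr_eq0.
by rewrite add0r rmorphXz ?unitfE // vlXz ?fmorph_eq0 // mulrC.
Qed.

Lemma ramP P t : uniformizer (sval (pull P)) t -> ram P = vl P (f t).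
Proof.
move=> ut; apply: xget_unique; first by exists t.
move=> n [t' ut' ->]; have [_ t0 _] := (uniformizerP _ _).1 ut'.
by rewrite (vl_pull_unif ut t0) (vl_t ut') mulr1.
Qed.

Lemma vl_pull P a : a != 0 -> vl P (f a) = ram P * vl (pull P) a.
Proof.
by move=> a0; have [t ut] := unif_ex GA (pull P); rewrite (ramP ut); apply: vl_pull_unif.
Qed.

Lemma ram_gt0 P : 0 < ram P.
Proof.
have [t ut] := unif_ex GA (pull P); rewrite (ramP ut).
have [mt t0 _] := (uniformizerP _ _).1 ut.
by apply/(vl_gt0 GB); rewrite ?fmorph_eq0 //; apply/pull_mx.
Qed.

(** Extension of divisors, also called the conorm. The ramification index as factor makes it
    compatible with principal divisors, see [jd_dv]. *)
Definition jd (D : dvs A) : dvs B := fun P => ram P * D (pull P).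

Lemma jdB D D' : jd (D - D') = jd D - jd D'.
Proof. by apply: funext => P; rewrite /jd dvsB mulrBr. Qed.

Lemma jd_dv (x : munit A) : jd (dv x) = dv (mu_map f x).
Proof. by apply: funext => P; rewrite /jd /dv /= vl_pull // (valP x). Qed.

Lemma fibre_fin p : exists s : seq (place B), forall P, pull P = p -> P \in s.
Proof.
have [t ut] := unif_ex GA p; have [mt t0 _] := (uniformizerP _ _).1 ut.
have ft0 : f t != 0 by rewrite fmorph_eq0.
have [s hs] := gl_supp GB ft0.
exists s => P e; apply: hs; apply/pull_unit; rewrite e => h.
exact: vunit_notmx h mt.
Qed.

Lemma fsupp_jd D : fsupp D -> fsupp (jd D).
Proof.
move=> [s hs]; have [l lP] := choice_ex fibre_fin.
exists (flatten [seq l p | p <- s]) => P; rewrite /jd mulf_eq0 negb_or => /andP [_ /hs h].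
by apply/flatten_mapP; exists (pull P) => //; apply: lP.
Qed.

(** A place above p is a valuation ring dominating the image of p together with the image of its
    maximal ideal. *)
Lemma pull_surj p : exists P, pull P = p.
Proof.
pose R b := exists2 a, sval p a & b = f a.
pose m b := exists2 a, mx p a & b = f a.
have [t ut] := unif_ex GA p; have [mt t0 _] := (uniformizerP _ _).1 ut.
have sR : sring R.
  split; first by exists 1; [apply: pl1|rewrite rmorph1].
    by move=> _ _ [a pa ->] [b pb ->]; exists (a - b); [apply: plB|rewrite rmorphB].
  by move=> _ _ [a pa ->] [b pb ->]; exists (a * b); [apply: plM|rewrite rmorphM].
have sm : sideal R m.
  split; first by exists 0; [apply: mx0|rewrite rmorph0].
  - by move=> _ [a [pa _] ->]; exists a.
  - by move=> _ _ [a pa ->] [b pb ->]; exists (a - b); [apply: mxB|rewrite rmorphB].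
  - by move=> _ _ [a pa ->] [b pb ->]; exists (a * b); [apply: mxM|rewrite rmorphM].
have [||P [h1 h2]] := place_dominating sR sm.
- move=> [a ma e]; apply: (@mx1F _ p); suff -> : 1 = a by [].
  by apply: (fmorph_inj f); rewrite rmorph1.
- by exists (f t); rewrite ?fmorph_eq0 //; exists t.
exists P; apply: place_eq => a; split=> [Pa|pa]; last by apply: h1; exists a.
apply: contrapT => npa; have ma := mxV npa.
have /h2 h : m (f a^-1) by exists a^-1.
have a0 : a != 0 by apply/eqP => e; apply: npa; rewrite e; apply: pl0.
apply: (@mx1F _ P); rewrite -(divff (x := f a)) ?fmorph_eq0 //.
by apply: mxM => //; rewrite -fmorphV.
Qed.

Lemma jd_inj D : jd D = 0 -> D = 0.
Proof.
move=> e; apply: funext => p; have [P <-] := pull_surj p.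
have : jd D P = 0 by rewrite e.
by rewrite /jd => /eqP; rewrite mulf_eq0 gt_eqF ?ram_gt0 //= => /eqP.
Qed.

End Pull.

Lemma int_mul1 (a b : int) : 0 < a -> a * b = 1 -> a = 1.
Proof.
move=> a0 /(congr1 absz)/eqP; rewrite abszM muln_eq1 => /andP [/eqP h _]; lia.
Qed.

Lemma dedekind (B C : fieldType) (n : nat) (chi : 'I_n -> {rmorphism B -> C}) (c : 'I_n -> C) :
  (forall i j, i != j -> exists y, chi i y != chi j y) ->
  (forall x, \sum_i c i * chi i x = 0) -> forall i, c i = 0.
Proof.
move=> dis; move: {2}(#|[set i | c i != 0]|).+1 (ltnSn #|[set i | c i != 0]|) => m.
elim: m c => // m IH c; rewrite ltnS => cm sum0 i; apply/eqP/negPn/negP => ci.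
have [[j [ji cj]]|h] := pselect (exists j, j != i /\ c j != 0).
  have [y hy] := dis j i ji.
  have e k : c k * (chi k y - chi i y) = 0.
    apply: (IH (fun k => c k * (chi k y - chi i y))) => [|x].
      apply: leq_trans cm; apply: proper_card; apply/properP; split.
        by apply/fintype.subsetP => l; rewrite !inE mulf_eq0 negb_or => /andP [].
      by exists i; rewrite !inE ?ci // subrr mulr0 eqxx.
    have e1 := sum0 (y * x); have e2 := sum0 x.
    transitivity (\sum_k c k * chi k (y * x) - chi i y * \sum_k c k * chi k x).
      rewrite mulr_sumr -sumrB; apply: eq_bigr => l _; rewrite rmorphM; ring.
    by rewrite e1 e2 mulr0 subrr.
  by have /eqP := e j; rewrite mulf_eq0 (negbTE cj) subr_eq0 (negbTE hy).
have := sum0 1; rewrite (bigD1 i) //= big1 => [|j ji]; last first.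
  suff -> : c j = 0 by rewrite mul0r.
  by apply/eqP/negPn/negP => cj; apply: h; exists j.
by rewrite rmorph1 mulr1 addr0 => /eqP; rewrite (negbTE ci).
Qed.

Lemma big_cyc_shift (R : Type) (idx : R) (op : Monoid.com_law idx) g (F : nat -> R) :
  F g = F 0%N -> \big[op/idx]_(i < g) F i.+1 = \big[op/idx]_(i < g) F i.
Proof.
case: g => [|g] e; first by rewrite !big_ord0.
by rewrite big_ord_recr [RHS]big_ord_recl /= e Monoid.mulmC.
Qed.

(** Iterates bundled as ring morphisms, so that places can be pulled back along them. *)
Fixpoint irm (B : fieldType) (s : {rmorphism B -> B}) (i : nat) : {rmorphism B -> B} :=
  if i is j.+1 then (s \o irm s j : {rmorphism B -> B}) else (idfun : {rmorphism B -> B}).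

Lemma irmE (B : fieldType) (s : {rmorphism B -> B}) i x : irm s i x = iter i s x.
Proof. by elim: i => //= i <-. Qed.
Lemma irmD (B : fieldType) (s : {rmorphism B -> B}) i j x : irm s (i + j) x = irm s i (irm s j x).
Proof. by rewrite !irmE iterD. Qed.

(** * Places under a cyclic Galois group, and Hilbert 90 *)

Section Cyc.
Variables (A B : fieldType) (f : {rmorphism A -> B}) (s : {rmorphism B -> B}) (g : nat).
Hypothesis g0 : (0 < g)%N.
Hypothesis sg : forall x, irm s g x = x.
Hypothesis sfix : forall x, s x = x <-> exists a, x = f a.

Let S i := irm s i.
Definition Nr x := \prod_(i < g) irm s i x.
Definition Tr x := \sum_(i < g) irm s i x.

Lemma s_f a : s (f a) = f a. Proof. by apply/sfix; exists a. Qed.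
Lemma S_f i a : irm s i (f a) = f a. Proof. by elim: i => //= i ->; exact: s_f. Qed.
Lemma S_mod i x : irm s (i %% g) x = irm s i x.
Proof.
rewrite [in RHS](divn_eq i g) addnC irmD; congr (irm s _ _).
by elim: (i %/ g)%N x => // k ih x; rewrite mulSn irmD sg -ih.
Qed.

Lemma Nr_f x : exists a, Nr x = f a.
Proof.
apply/sfix; rewrite /Nr rmorph_prod /=.
by rewrite -[RHS](big_cyc_shift _ (F := fun i => irm s i x)) ?sg.
Qed.
Lemma Tr_f x : exists a, Tr x = f a.
Proof.
apply/sfix; rewrite /Tr rmorph_sum /=.
by rewrite -[RHS](big_cyc_shift _ (F := fun i => irm s i x)) ?sg.
Qed.

Lemma char_poly_f x : exists q : {poly A}, map_poly f q = \prod_(i < g) ('X - (irm s i x)%:P).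
Proof.
set r := \prod_(i < g) _.
have sr : map_poly s r = r.
  rewrite /r rmorph_prod /= -[RHS](big_cyc_shift _ (F := fun i => 'X - (irm s i x)%:P)) ?sg //.
  by apply: eq_bigr => i _; rewrite rmorphB /= map_polyX map_polyC.
have [c hc] : exists c : nat -> A, forall i, r`_i = f (c i).
  by apply: (@choice_ex nat A (fun i a => r`_i = f a)) => i; apply/sfix; rewrite -[in RHS]sr coef_map.
exists (\poly_(i < size r) c i); apply/polyP => i; rewrite coef_map coef_poly /=.
by case: ltnP => h; [rewrite -hc|rewrite rmorph0 nth_default].
Qed.

(** Every x is a root of the product of the X - s^i x, a monic polynomial over A; a place containing
    f(A) would therefore contain all of B. *)
Lemma cyc_proper (P : place B) : exists a, ~ sval P (f a).
Proof.
apply: contrapT => h; have Pf a : sval P (f a) by apply: contrapT => na; apply: h; exists a.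
case: (svalP P) => _ _ _ _ [x]; apply.
have [q e] := char_poly_f x.
apply: (place_integral (q := map_poly f q)).
- by rewrite e monic_prod // => i _; apply: monicXsubC.
- by move=> i; rewrite coef_map; exact: Pf.
- by apply/rootP; rewrite e horner_prod (bigD1 (Ordinal g0)) //= hornerXsubC subrr mul0r.
Qed.

Lemma S_proper i (P : place B) : exists a, ~ sval P (irm s i a).
Proof.
case: (svalP P) => _ _ _ _ [x nx]; exists (irm s (i * g.-1) x); rewrite -irmD.
have -> : (i + i * g.-1 = i * g)%N by rewrite -mulnS prednK.
by rewrite -S_mod modnMl.
Qed.

Definition spull i (P : place B) : place B := pull (S_proper i) P.
Definition fpull (P : place B) : place A := pull cyc_proper P.

Lemma spullE i P x : sval (spull i P) x = sval P (irm s i x). Proof. by []. Qed.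
Lemma spullD i j P : spull i (spull j P) = spull (j + i) P.
Proof. by apply: place_eq => x; rewrite !spullE irmD. Qed.
Lemma spull0 P : spull 0 P = P. Proof. by apply: place_eq. Qed.
Lemma spull_mod i P : spull (i %% g) P = spull i P.
Proof. by apply: place_eq => x; rewrite !spullE S_mod. Qed.
Lemma fpull_spull i P : fpull (spull i P) = fpull P.
Proof. by apply: place_eq => x; rewrite /= S_f. Qed.
Lemma spull_mx i P x : mx (spull i P) x <-> mx P (irm s i x).
Proof. exact: pull_mx. Qed.
Lemma spull_cancel i P : (i <= g)%N -> spull (g - i) (spull i P) = P.
Proof. by move=> h; rewrite spullD subnKC // -spull_mod modnn spull0. Qed.

Hypotheses (GA : gl A) (GB : gl B).

Lemma spull_vl i P x : x != 0 -> vl P (irm s i x) = vl (spull i P) x.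
Proof.
move=> x0; rewrite (vl_pull GB GB (S_proper i)) //.
suff -> : ram (S_proper i) P = 1 by rewrite mul1r.
have [t ut] := unif_ex GB P; have [_ t0 _] := (uniformizerP _ _).1 ut.
have e := vl_t ut.
have st0 : irm s (i * g.-1) t != 0 by rewrite fmorph_eq0.
have := vl_pull GB GB (S_proper i) P st0; rewrite -irmD.
have -> : (i + i * g.-1 = i * g)%N by rewrite -mulnS prednK.
rewrite -S_mod modnMl /= e => h.
have := ram_gt0 GB GB (S_proper i) P; move=> ha; exact: (int_mul1 ha (esym h)).
Qed.

(** If Q were not conjugate to P, some x would be congruent to 0 at the conjugates of Q and to 1 at
    those of P. Its norm comes from A, yet lies in the maximal ideal of Q and is a unit at P,
    although P and Q restrict to the same place. *)
Lemma pull_trans P Q : fpull P = fpull Q -> exists2 i, (i < g)%N & Q = spull i P.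
Proof.
move=> e; apply: contrapT => h.
have dis i j : spull i Q <> spull j P.
  move=> e2; apply: h; exists ((j + (g - i %% g)) %% g)%N; first by rewrite ltn_mod.
  rewrite spull_mod -spullD -e2 -[spull i Q]spull_mod spull_cancel //.
  by rewrite ltnW // ltn_mod.
pose s1 := undup ([seq spull i Q | i <- iota 0 g] ++ [seq spull i P | i <- iota 0 g]).
have [x hx] := weak_approx_vl GB (fun R => if `[< exists i, R = spull i Q >] then 0 else 1) (fun=> 1)
  (undup_uniq ([seq spull i Q | i <- iota 0 g] ++ [seq spull i P | i <- iota 0 g])).
have xQ i : (i < g)%N -> mx (spull i Q) x.
  move=> ig; have /hx : spull i Q \in s1.
    by rewrite mem_undup mem_cat; apply/orP; left; apply/mapP; exists i; rewrite ?mem_iota.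
  rewrite asboolT; last by exists i.
  by rewrite subr0 vge1.
have xP i : (i < g)%N -> vunit (sval (spull i P)) x.
  move=> ig; have /hx : spull i P \in s1.
    by rewrite mem_undup mem_cat; apply/orP; right; apply/mapP; exists i; rewrite ?mem_iota.
  rewrite asboolF; last by move=> [j ej]; apply: (dis j i).
  rewrite vge1 // => m1; rewrite -(subrK 1 x) addrC -[x - 1]opprK.
  by apply: vunitBm; [apply: vunit1|apply: mxN].
have [a ea] := Nr_f x.
have mQ : mx Q (Nr x).
  rewrite /Nr; case: (g) g0 xQ => // k _ xQ'.
  rewrite big_ord_recl; apply: mxMr; first by have := xQ' 0 isT; rewrite spull0.
  by apply: pl_prod => i _; have /spull_mx/mx_pl := xQ' i.+1 (ltn_ord i).
have uP : vunit (sval P) (Nr x).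
  apply: (big_ind (vunit (sval P))) => [|y z|i _]; [exact: vunit1|exact: vunitM|].
  by apply/(pull_unit (S_proper i)); apply: xP.
apply: (vunit_notmx uP); rewrite ea; apply/(pull_mx cyc_proper).
by rewrite -/(fpull P) e; apply/(pull_mx cyc_proper); rewrite -ea.
Qed.

Definition framf P := ram cyc_proper P.

Lemma vl_fpull P a : a != 0 -> vl P (f a) = framf P * vl (fpull P) a.
Proof. exact: vl_pull. Qed.

Lemma framf_spull i P : framf (spull i P) = framf P.
Proof.
have [t ut] := unif_ex GA (fpull P); have [_ t0 _] := (uniformizerP _ _).1 ut.
have e := vl_t ut.
have := vl_fpull (spull i P) t0; rewrite -spull_vl ?fmorph_eq0 // S_f fpull_spull e mulr1 => <-.
by rewrite vl_fpull // e mulr1.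
Qed.

Definition sV (D : dvs B) : dvs B := fun P => D (spull 1 P).
Lemma sVB D D' : sV (D - D') = sV D - sV D'. Proof. by []. Qed.
Lemma iter_sV k D P : iter k sV D P = D (spull k P).
Proof. by elim: k P => [|k ih] P; rewrite ?spull0 //= /sV ih spullD add1n. Qed.
Lemma sV_g D : iter g sV D = D.
Proof. by apply: funext => P; rewrite iter_sV -spull_mod modnn spull0. Qed.
Lemma sV_dv (x : munit B) : dv (mu_map s x) = sV (dv x).
Proof. by apply: funext => P; rewrite /dv /sV -spull_vl // (valP x). Qed.
Lemma sV_jd D : sV (jd cyc_proper D) = jd cyc_proper D.
Proof.
apply: funext => P; rewrite /sV /jd; congr (_ * D _); first exact: framf_spull.
exact: fpull_spull.
Qed.
Lemma sV_fsupp D : fsupp D -> fsupp (sV D).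
Proof.
move=> [l hl]; exists [seq spull g.-1 P | P <- l] => P /hl h.
by apply/mapP; exists (spull 1 P) => //; rewrite spullD addnC addn1 prednK // -spull_mod modnn spull0.
Qed.

Lemma mu_iter i (x : munit B) : val (iter i (mu_map s) x) = irm s i (val x).
Proof. by elim: i => //= i ->. Qed.
Lemma mu_map_g x : iter g (mu_map s) x = x.
Proof. by apply: val_inj; rewrite mu_iter sg. Qed.
Lemma mu_trc (x : munit B) : val (trc (mu_map s) g x) = Nr (val x).
Proof. by rewrite /trc mu_sum; apply: eq_bigr => i _; rewrite mu_iter. Qed.

Hypothesis sfaith : forall i, (0 < i < g)%N -> exists x, irm s i x != x.

Lemma S_dis (i j : 'I_g) : i != j -> exists y, irm s i y != irm s j y.
Proof.
wlog ij : i j / (i < j)%N.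
  move=> w ne; case: (ltngtP i j) => [h|h|/val_inj e]; first exact: w.
    by have [|y hy] := w j i h; [rewrite eq_sym|exists y; rewrite eq_sym].
  by rewrite e eqxx in ne.
move=> _; have [|x hx] := sfaith (i := j - i).
  by rewrite subn_gt0 ij (leq_ltn_trans (leq_subr _ _)).
exists x; rewrite -[in X in _ != X](subnKC (ltnW ij)) irmD; apply: contra hx => /eqP h.
by apply/eqP; apply: (fmorph_inj (irm s i)).
Qed.

(** The resolvent y = sum of b_i s^i(c), with b_i the partial norms of x, satisfies x s(y) = y; some
    c makes it nonzero by independence of the s^i. *)
Lemma hilbert90 (x : munit B) : trc (mu_map s) g x = 0 -> exists y, x = mu_map s y - y.
Proof.
move=> /(congr1 val); rewrite mu_trc mu0 => N1.
pose b i := \prod_(j < i) irm s j (val x).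
have [c hc] : exists c, \sum_(i < g) b i * irm s i c != 0.
  apply: contrapT => h.
  have H x' : \sum_(i < g) b i * irm s i x' = 0.
    by apply/eqP/negPn/negP => hy; apply: h; exists x'.
  have := @dedekind B B g (fun i => irm s i) (fun i => b i) S_dis H (Ordinal g0).
  by rewrite /b big_ord0 => /eqP; rewrite oner_eq0.
set y := \sum_(i < g) _ in hc.
have e : val x * s y = y.
  rewrite /y rmorph_sum mulr_sumr.
  rewrite -[RHS](big_cyc_shift _ (F := fun i => b i * irm s i c)); last first.
    by rewrite sg /b big_ord0 -[\prod_(j < g) _]/(Nr (val x)) N1.
  apply: eq_bigr => i _; rewrite rmorphM mulrA; congr (_ * _).
  by rewrite /b rmorph_prod [RHS]big_ord_recl.
exists (- mu hc); apply: val_inj; rewrite muB muN /= fmorphV invrK.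
have sy0 : s y != 0 by rewrite fmorph_eq0.
by rewrite -{2}e mulrCA mulVf // mulr1.
Qed.

End Cyc.

(** * Ramification *)

Lemma coprime_inv u g : coprime u g -> (0 < u)%N -> exists v, (u * v = 1 %[mod g])%N.
Proof.
move=> /eqP cu u0; case: (egcdnP g u0) => a b e _; exists a.
by rewrite mulnC e cu modnMDl.
Qed.

Lemma coprime_inv1 p k i : prime p -> (0 < k)%N -> coprime (1 + p ^ k * i) (p ^ k.+1).
Proof.
by move=> pp k0; rewrite coprimeXr // coprime_sym prime_coprime // -(prednK k0) expnS -mulnA addnC
  dvdn_addr ?dvdn_mulr // dvdn1 neq_ltn prime_gt1 ?orbT.
Qed.

(** Membership of s in the inertia group of P. That s fixes P follows when s has finite order, see
    [inert_stab]. *)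
Definition inert (B : fieldType) (s : {rmorphism B -> B}) (P : place B) :=
  forall x, sval P x -> mx P (s x - x).

Lemma pl_det (B : fieldType) (P : place B) n (M : 'M[B]_n) :
  (forall i j, sval P (M i j)) -> sval P (\det M).
Proof.
move=> h; apply: pl_sum => i _; apply: plM; last by apply: pl_prod.
by case: (odd_perm i); rewrite ?expr0 ?expr1; [apply/plN/pl1|apply: pl1].
Qed.

Lemma frob_add (B : fieldType) (P : place B) p x y : prime p -> mx P p%:R ->
  sval P x -> sval P y -> mx P ((x + y) ^+ p - x ^+ p - y ^+ p).
Proof.
move=> pp mp Px Py; rewrite exprDn.
case: p pp mp => [|[|p]] // pp mp.
rewrite big_ord_recl big_ord_recr /= subn0 bin0 subnn binn !expr0 mulr1 mul1r !mulr1n.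
have E (a b c : B) : a + (b + c) - a - c = b by ring.
rewrite E.
apply: mx_sum => i _; rewrite /bump /= add1n.
have /dvdnP [k ->] : (p.+2 %| 'C(p.+2, i.+1))%N.
  by apply: prime_dvd_bin => //; have := ltn_ord i; lia.
rewrite mulrnA -[_ *+ p.+2]mulr_natr; apply: mxM => //.
by rewrite -mulr_natr; apply: plM; [apply: plM; apply: plX|apply: pl_nat].
Qed.

(** The residue field is finite, so the injective p-th power map permutes a set of
    representatives. *)
Lemma frob_surj (B : fieldType) (G : gl B) (P : place B) p x : prime p -> mx P p%:R ->
  sval P x -> exists2 y, sval P y & mx P (x - y ^+ p).
Proof.
move=> pp mp Px; have [q [r [Pr_ Ir cr]]] := gl_res G P.
have [c cP] := choice_ex (fun i => cr _ (plX p (Pr_ i))).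
have ci : injective c.
  move=> i j e; apply: Ir; apply: (@mxX_inv _ _ _ p); first exact: plB.
  have h := frob_add pp mp (plB (Pr_ i) (Pr_ j)) (Pr_ j).
  rewrite subrK in h; have h2 := mxB (cP i) (cP j).
  rewrite e opprB addrA subrK in h2.
  have -> : (r i - r j) ^+ p = - ((r i ^+ p - (r i - r j) ^+ p - r j ^+ p) - (r i ^+ p - r j ^+ p)).
    by ring.
  exact/mxN/mxB.
have [i xi] := cr _ Px; have [d cd dc] := injF_bij ci.
exists (r (d i)) => //.
have := mxB xi (cP (d i)); rewrite dc.
by rewrite opprB addrA subrK.
Qed.

Section Ramif.
Variables (A B : fieldType) (f : {rmorphism A -> B}) (s : {rmorphism B -> B}) (g : nat).
Hypothesis g0 : (0 < g)%N.
Hypothesis sg : forall x, irm s g x = x.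
Hypothesis sfix : forall x, s x = x <-> exists a, x = f a.
Hypotheses (GA : gl A) (GB : gl B).
Implicit Types P : place B.

Local Notation spull := (spull g0 sg).
Local Notation fpull := (fpull g0 sg sfix).
Local Notation framf := (framf g0 sg sfix).

Lemma stab_coprime u P : (0 < u)%N -> coprime u g -> spull u P = P -> spull 1 P = P.
Proof.
move=> u0 cu h; have [v hv] := coprime_inv cu u0.
have : spull (u * v) P = P.
  by elim: v {hv} => [|v ih]; rewrite ?muln0 ?spull0 // mulnS -spullD h.
by rewrite -spull_mod hv spull_mod.
Qed.

Lemma stab_all i P : spull 1 P = P -> spull i P = P.
Proof. by move=> h; elim: i => [|i ih]; rewrite ?spull0 // -addn1 -spullD ih. Qed.

Lemma S_mx i P x : spull 1 P = P -> mx P x -> mx P (irm s i x).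
Proof. by move=> h mX; apply/(spull_mx g0 sg); rewrite stab_all. Qed.
Lemma S_pl i P x : spull 1 P = P -> sval P x -> sval P (irm s i x).
Proof. by move=> h Px; rewrite -(spullE g0 sg) stab_all. Qed.

Lemma res_fix_gen u P x : (0 < u)%N -> coprime u g -> spull 1 P = P ->
  mx P (irm s u x - x) -> mx P (s x - x).
Proof.
move=> u0 cu h hx; have [v hv] := coprime_inv cu u0.
suff : mx P (irm s (u * v) x - x) by rewrite -(S_mod sg) hv (S_mod sg).
elim: v {hv} => [|v ih]; first by rewrite muln0 /= subrr; apply: mx0.
rewrite mulnS irmD -(subrK (irm s u x) (irm s u _)) -addrA; apply: mxD => //.
by rewrite -rmorphB; apply: S_mx.
Qed.

Lemma inert_stab P : inert s P -> spull 1 P = P.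
Proof.
move=> h; apply/esym; apply: arch_max; first exact: gl_arch.
move=> x Px; rewrite spullE /= -(subrK x (s x)); apply: plD => //.
exact/mx_pl/h.
Qed.

Lemma inert_irm i P : inert s P -> inert (irm s i) P.
Proof.
move=> h x Px; elim: i => [|i ih] /=; first by rewrite subrr; apply: mx0.
rewrite -(subrK (irm s i x) (s _)) -addrA; apply: mxD => //; apply: h.
by rewrite -(subrK x (irm s i x)); apply: plD => //; apply: mx_pl.
Qed.

Lemma inert_N P x : inert s P -> sval P x -> mx P (Nr s g x - x ^+ g).
Proof.
move=> h Px; rewrite /Nr; have Pi i : sval P (irm s i x) by apply: S_pl => //; apply: inert_stab.
elim: (g) => [|n ih]; first by rewrite big_ord0 subrr; apply: mx0.
rewrite big_ord_recr /= exprSr.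
have -> : \prod_(i < n) irm s i x * irm s n x - x ^+ n * x =
   (\prod_(i < n) irm s i x - x ^+ n) * irm s n x + x ^+ n * (irm s n x - x) by ring.
by apply: mxD; [apply: mxMr|apply: mxM; [apply: plX|apply: inert_irm]].
Qed.

Lemma inert_T P x : inert s P -> sval P x -> mx P (Tr s g x - x *+ g).
Proof.
move=> h Px; rewrite /Tr -[in X in _ *+ X](card_ord g) -sumr_const -sumrB.
by apply: mx_sum => i _; apply: inert_irm.
Qed.

(** Inertia makes the norm of y congruent to y^g and the trace of x to g x. If p is in the maximal
    ideal, x is a g-th power y^g in the residue field and the norm of y serves; otherwise the trace
    of x is divided by g. *)
Lemma inert_residue p P x : prime p -> (exists k, g = p ^ k)%N -> inert s P -> sval P x ->
  exists a, mx P (x - f a).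
Proof.
move=> pp [k gk] h Px; have [mp|np] := pselect (mx P p%:R).
  have [y Py hy] : exists2 y, sval P y & mx P (x - y ^+ g).
    rewrite gk; elim: k {gk} => [|k [y Py hy]].
      by exists x; rewrite // expn0 expr1 subrr; apply: mx0.
    have [z Pz hz] := frob_surj GB pp mp Py; exists z => //.
    rewrite -(subrK (y ^+ (p ^ k)) x) -addrA; apply: mxD => //.
    rewrite expnS exprM -[y ^+ _ - _]mul1r subrXX mulrA mul1r.
    by apply: mxMr => //; apply: pl_sum => i _; apply: plM; apply: plX => //; apply: plX.
  have [a ea] := Nr_f sg sfix y; exists a; rewrite -ea.
  rewrite -(subrK (y ^+ g) x) -addrA; apply: mxD => //.
  by rewrite -opprB; apply: mxN; apply: inert_N.
have up : vunit (sval P) (g%:R : B).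
  by rewrite gk natrX; apply: vunitX; case: (vunit_mx (pl_nat P p)).
have [a ea] := Tr_f sg sfix x; exists (a / g%:R).
have [n0 _ Pv] := up.
have -> : x - f (a / g%:R) = - (Tr s g x - x *+ g) * (g%:R)^-1.
  by rewrite fmorph_div rmorph_nat -ea -mulr_natr; field.
by apply: mxMr => //; apply: mxN; apply: inert_T.
Qed.

(** In the unramified case the uniformizer t comes from the base and x = a + t x1 with a in the
    base. Then s x - x = t (s x1 - x1), and iterating makes s x - x divisible by every power of t,
    so s would be the identity. *)
Lemma inert_unramified_absurd p P y : prime p -> (exists k, g = p ^ k)%N -> inert s P ->
  s y != y -> framf P = 1 -> False.
Proof.
move=> pp gk h sy e1.
have [t ut] := unif_ex GA (fpull P); have [_ t0 _] := (uniformizerP _ _).1 ut.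
have vt : vl P (f t) = 1 by rewrite (vl_fpull g0 sg sfix GA GB) // e1 (vl_t ut).
have ft0 : f t != 0 by rewrite fmorph_eq0.
have key k x : sval P x -> vge P k%:Z (s x - x).
  elim: k x => [|k ih] x Px; first by apply/(vge0 GB)/mx_pl/h.
  have [a ma] := inert_residue pp gk h Px.
  have Px1 : sval P ((x - f a) / f t).
    by rewrite -[f t]expr1z; apply/(vgeP GB); rewrite // ; apply/(vge1 GB).
  have -> : s x - x = f t * (s ((x - f a) / f t) - (x - f a) / f t).
    by rewrite fmorph_div rmorphB (s_f sfix) (s_f sfix); field.
  by rewrite -add1n PoszD; apply: vgeM => //; [right; rewrite vt|apply: ih].
have key2 x : sval P x -> s x = x.
  move=> Px; apply/eqP; rewrite -subr_eq0; apply/negP => /negP ne.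
  have := key `|vl P (s x - x)|.+1 x Px; case=> [e|]; first by rewrite e eqxx in ne.
  by lia.
case/negP: sy; apply/eqP.
have [Py|nPy] := pselect (sval P y); first exact: key2.
by apply: invr_inj; rewrite -fmorphV; apply: key2; apply: plV.
Qed.

Lemma framf_of_vl P a : a != 0 -> vl P (f a) = 1 -> framf P = 1.
Proof.
move=> a0; rewrite (vl_fpull g0 sg sfix GA GB) // => e; apply: int_mul1 e.
exact: ram_gt0.
Qed.

(** The norm of a uniformizer has valuation g, as all conjugates of P coincide, and it comes from
    the base. *)
Lemma inert_framf_dvd P : inert s P -> exists c, framf P * c = g%:Z.
Proof.
move=> h; have [t t0 vt] := unif_at GB P 1.
have [a ea] := Nr_f sg sfix t.
have a0 : a != 0.
  rewrite -(fmorph_eq0 f) -ea /Nr; apply/prodf_neq0 => i _.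
  by rewrite fmorph_eq0.
exists (vl (fpull P) a); rewrite -(vl_fpull g0 sg sfix GA GB) // -ea /Nr.
rewrite (vl_prod GB) => [|i _]; last by rewrite fmorph_eq0.
rewrite (eq_bigr (fun=> 1)) ?sumr_const ?card_ord ?natz // => i _.
by rewrite (spull_vl g0 sg GB) // stab_all ?vt //; apply: inert_stab.
Qed.

Section Prime.
Hypothesis gp : prime g.

Lemma coprime_lt i : (0 < i < g)%N -> coprime i g.
Proof. by move=> /andP [i0 ig]; rewrite coprime_sym prime_coprime // gtnNdvd. Qed.

(** Take y of valuation 1 at P and 0 at the other conjugates; they are distinct from P since g is
    prime. The norm of y is then an element of the base of valuation 1 at P. *)
Lemma free_framf P : spull 1 P <> P -> framf P = 1.
Proof.
move=> h.
pose l := undup [seq spull i P | i <- iota 0 g].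
have [y y0 hy] := approx_vl GB (fun R => if R == P then 1 else 0) (undup_uniq [seq spull i P | i <- iota 0 g]).
have [a ea] := Nr_f sg sfix y.
have a0 : a != 0.
  by rewrite -(fmorph_eq0 f) -ea /Nr; apply/prodf_neq0 => i _; rewrite fmorph_eq0.
apply: (framf_of_vl a0); rewrite -ea /Nr (vl_prod GB) => [|i _]; last by rewrite fmorph_eq0.
have vi (i : 'I_g) : vl P (irm s i y) = if spull i P == P then 1 else 0.
  rewrite (spull_vl g0 sg GB) // hy // mem_undup; apply/mapP; exists (val i) => //.
  by rewrite mem_iota /= add0n ltn_ord.
rewrite (bigD1 (Ordinal g0)) //= big1 => [|i i0].
  by have := vi (Ordinal g0); rewrite /= spull0 eqxx => ->; rewrite addr0.
rewrite vi; case: eqP => // e; case: h; apply: (stab_coprime _ _ e).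
  by rewrite lt0n; apply: contra i0 => /eqP h; apply/eqP/val_inj.
apply: coprime_lt; rewrite ltn_ord andbT lt0n; apply: contra i0 => /eqP h.
exact/eqP/val_inj.
Qed.

(** Some trace of x^i t, with t of valuation 1, has valuation exactly 1. Here x is moved modulo P,
    so its g conjugates are distinct in the residue field and their Vandermonde determinant is a
    unit; if all these traces had valuation at least 2, the adjugate matrix would give t valuation
    at least 2. *)
Lemma stab_framf P : spull 1 P = P -> ~ inert s P -> framf P = 1.
Proof.
move=> st ni.
have [x [Px nx]] : exists x, sval P x /\ ~ mx P (s x - x).
  apply: contrapT => h; apply: ni => x Px; apply: contrapT => nx; apply: h; by exists x.
have [t t0 vt] := unif_at GB P 1.
have un i j : (i < j)%N -> (j < g)%N -> vunit (sval P) (irm s j x - irm s i x).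
  move=> ij jg; have Pd : sval P (irm s j x - irm s i x) by apply: plB; apply: S_pl.
  case: (vunit_mx Pd) => // md; case: nx.
  apply: (res_fix_gen (u := j - i)) => //; first by rewrite subn_gt0.
    by apply: coprime_lt; rewrite subn_gt0 ij (leq_ltn_trans (leq_subr _ _)).
  rewrite -(stab_all i st); apply/(spull_mx g0 sg).
  by rewrite rmorphB -irmD subnKC // ltnW.
pose a : 'rV[B]_g := \row_j irm s j x; pose V := Vandermonde g a.
have PV i j : sval P (V i j) by rewrite !mxE; apply: plX; apply: S_pl.
have uV : vunit (sval P) (\det V).
  rewrite det_Vandermonde; apply: (big_ind (vunit (sval P))) => [|y z|i _]; [exact: vunit1|exact: vunitM|].
  apply: (big_ind (vunit (sval P))) => [|y z|j ij]; [exact: vunit1|exact: vunitM|].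
  by rewrite !mxE; apply: un.
pose b : 'cV[B]_g := \col_j irm s j t.
have Vb (i : 'I_g) : (V *m b) i 0 = Tr s g (x ^+ i * t).
  by rewrite !mxE /Tr; apply: eq_bigr => j _; rewrite !mxE rmorphM rmorphXn.
have [[i [a' [ea' n2]]]|h] := pselect (exists (i : 'I_g) a', (V *m b) i 0 = f a' /\ ~ vge P 2 (f a')).
  have a0 : a' != 0 by apply/eqP => e; apply: n2; rewrite e rmorph0; left.
  apply: (framf_of_vl a0); apply: (vl_notge (n := 1)); rewrite ?fmorph_eq0 //.
  rewrite -ea' Vb; apply/(vge1 GB); apply: mx_sum => j _; apply: S_mx => //.
  by apply: mxM; [apply: plX|apply/(vl_gt0 GB); rewrite // vt].
exfalso.
have v2 (i : 'I_g) : vge P 2 ((V *m b) i 0).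
  apply: contrapT => h2; apply: h; have [a' ea'] := Tr_f sg sfix (x ^+ i * t).
  by exists i, a'; rewrite Vb ea' -ea' -Vb.
have : vge P 2 (\det V * t).
  have -> : \det V * t = (\adj V *m (V *m b)) (Ordinal g0) 0.
    by rewrite mulmxA mul_adj_mx mul_scalar_mx !mxE.
  rewrite mxE; apply: (@subg_sum _ (vge P 2) _ _ _ _ (subg_vge GB P 2)) => j _.
  rewrite -[2]add0r; apply: (vgeM GB) => //; apply/(vge0 GB).
  rewrite mxE /cofactor; apply: plM; last by apply: pl_det => k l; rewrite !mxE; apply: plX; apply: S_pl.
  by apply: plX; apply/plN/pl1.
have [d0 _ _] := uV.
case=> [/eqP|]; first by rewrite mulf_eq0 (negbTE d0) (negbTE t0).
by rewrite vlM // vt; move/(vl_eq0 GB P d0): uV => ->.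
Qed.

Hypothesis sne : exists y, s y != y.

Lemma framf_inert P : inert s P -> framf P = g%:Z.
Proof.
move=> h; have [c hc] := inert_framf_dvd h.
have f1 : framf P <> 1.
  have [y sy] := sne; apply: (inert_unramified_absurd gp _ h sy).
  by exists 1%N; rewrite expn1.
have r0 := ram_gt0 GA GB (cyc_proper g0 sg sfix) P.
have c0 : 0 < c by have := prime_gt0 gp; move: hc r0; rewrite -/(framf P); nia.
move: hc f1 r0; rewrite -/(framf P); case: (framf P) => // m; case: c c0 => // c c0 /eqP.
rewrite -PoszM eqz_nat => /eqP e f1 m0; congr Posz.
have m1 : m != 1%N by apply/eqP => h1; case: f1; rewrite h1.
by apply/(prime_nt_dvdP gp m1)/dvdnP; exists c; rewrite mulnC.
Qed.

Lemma framf_notinert P : ~ inert s P -> framf P = 1.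
Proof.
by move=> h; have [st|nst] := pselect (spull 1 P = P); [apply: stab_framf|apply: free_framf].
Qed.

Lemma inert_fin : exists l : seq (place B), forall P, inert s P -> P \in l.
Proof.
have [y sy] := sne.
have y0 : y != 0 by apply: contra sy => /eqP ->; rewrite rmorph0.
have d0 : s y - y != 0 by rewrite subr_eq0.
have [l1 h1] := gl_supp GB y0; have [l2 h2] := gl_supp GB d0.
exists (l1 ++ l2) => P h; rewrite mem_cat.
have [Py|nPy] := pselect (sval P y).
  by rewrite (h2 P) ?orbT // => hu; apply: vunit_notmx hu (h _ Py).
by rewrite h1 // => -[].
Qed.
End Prime.
End Ramif.

Lemma irm_irm (B : fieldType) (s : {rmorphism B -> B}) a i x : irm (irm s a) i x = irm s (i * a) x.
Proof. by elim: i => //= i ->; rewrite mulSn irmD. Qed.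

(** * Inertia propagates upwards in a cyclic tower *)

Section InertUp.
Variables (A1 B : fieldType) (iota : {rmorphism A1 -> B}) (s : {rmorphism B -> B})
  (s1 : {rmorphism A1 -> A1}) (p k : nat).
Hypotheses (pp : prime p) (k0 : (0 < k)%N) (p0 : (0 < p)%N) (g0 : (0 < p ^ k.+1)%N).
Hypothesis sg : forall x, irm s (p ^ k.+1) x = x.
Hypothesis comp : forall a, iota (s1 a) = s (iota a).
Hypothesis tp : forall x, irm (irm s (p ^ k)) p x = x.
Hypothesis tfix : forall x, irm s (p ^ k) x = x <-> exists a, x = iota a.
Hypotheses (GA : gl A1) (GB : gl B).
Let t := irm s (p ^ k).

(* The reduction of prod_i (X - t^i x) has s-invariant coefficients, so s x is
   congruent to some t^i x = s^(i p^k) x; as 1 - i p^k generates, s fixes x. *)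
Lemma inert_up (P : place B) : inert s1 (fpull p0 tp tfix P) -> inert s P.
Proof.
move=> h.
have ti i x : irm t i x = irm s (p ^ k * i) x by rewrite /t irm_irm mulnC.
have cop i : coprime (1 + p ^ k * i) (p ^ k.+1) by apply: coprime_inv1.
have pi i : (i < p)%N -> (p ^ k * (p - i) + p ^ k * i = p ^ k.+1)%N.
  by move=> ip; rewrite -mulnDr subnK ?expnSr // ltnW.
have st : spull g0 sg 1 P = P.
  have e1 : fpull p0 tp tfix P = fpull p0 tp tfix (spull g0 sg 1 P).
    apply: arch_max; first exact: gl_arch.
    move=> a Pa; rewrite /= -comp.
    have /mx_pl h2 := h a Pa; rewrite -(subrK a (s1 a)) rmorphD.
    by apply: plD.
  have [i ip e2] := pull_trans GB e1.
  apply: (stab_coprime (u := 1 + p ^ k * (p - i))) => //.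
  rewrite -spullD e2; apply: place_eq => x; rewrite /= ti -irmD addnC pi //.
  by rewrite sg.
move=> x Px.
have Pt i : sval P (irm t i x) by rewrite ti; exact: (S_pl _ st Px).
have [q eq] := char_poly_f tp tfix x.
have qx : (map_poly iota q).[x] = 0.
  by rewrite eq horner_prod (bigD1 (Ordinal p0)) //= hornerXsubC subrr mul0r.
have Pq i : sval P (map_poly iota q)`_i.
  rewrite eq; elim: (index_enum _) i => [|j l ih] i.
    by rewrite big_nil coef1; apply: pl_nat.
  rewrite big_cons mulrBl coefB coefXM coefCM; apply: plB; last exact: plM.
  by case: eqP => _; [apply: pl0|apply: ih].
have Psx : sval P (s x) by exact: (S_pl 1 st Px).
have m1 : mx P (map_poly iota q).[s x].
  have -> : (map_poly iota q).[s x] =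
     - \sum_(i < size (map_poly iota q)) (s (map_poly iota q)`_i - (map_poly iota q)`_i) * s x ^+ i.
    have := congr1 s qx; rewrite rmorph0 !horner_coef rmorph_sum.
    under eq_bigr do rewrite rmorphM rmorphXn.
    move=> e; under [X in _ = - X]eq_bigr do rewrite mulrBl.
    by rewrite sumrB e sub0r opprK.
  apply: mxN; apply: mx_sum => i _; apply: mxMr; last exact: plX.
  rewrite coef_map /= -comp -rmorphB; apply/(pull_mx (cyc_proper p0 tp tfix)).
  by apply: h; have := Pq i; rewrite coef_map.
have [i mi] : exists i : 'I_p, mx P (s x - irm t i x).
  move: m1; rewrite eq horner_prod; elim: (index_enum _) => [|j l ih].
    by rewrite big_nil => /mx1F.
  rewrite big_cons hornerXsubC => /mx_prime [||h1|/ih //].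
  - exact: plB.
  - by apply: pl_prod => j' _; rewrite hornerXsubC; apply: plB.
  - by exists j.
apply: (res_fix_gen (u := 1 + p ^ k * (p - i)) (g0 := g0) (sg := sg)) => //.
rewrite addnC irmD /=.
have := S_mx (p ^ k * (p - i)) st mi.
rewrite rmorphB ti -irmD pi ?sg //.
Qed.

End InertUp.

(** * Tame total ramification is bounded by the residue field *)

Section Tame.
Variables (A A1 B : fieldType) (f : {rmorphism A -> B}) (iota : {rmorphism A1 -> B})
  (s : {rmorphism B -> B}) (p k : nat).
Hypotheses (pp : prime p) (p0 : (0 < p)%N) (g0 : (0 < p ^ k.+1)%N).
Hypothesis sg : forall x, irm s (p ^ k.+1) x = x.
Hypothesis sfix : forall x, s x = x <-> exists a, x = f a.
Hypothesis tp : forall x, irm (irm s (p ^ k)) p x = x.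
Hypothesis tfix : forall x, irm s (p ^ k) x = x <-> exists a, x = iota a.
Hypothesis tne : exists y, irm s (p ^ k) y != y.
Hypotheses (GA : gl A) (GA1 : gl A1) (GB : gl B).
Let t := irm s (p ^ k).

(* In a tamely and totally ramified extension s pi / pi has order p^(k+1)
   in the residue field of the base. *)
Lemma tame_bound (P : place B) q : inert s P -> ~ mx P p%:R ->
  idx (sval (fpull g0 sg sfix P)) (@mx A (fpull g0 sg sfix P)) q -> (p ^ k.+1 <= q)%N.
Proof.
move=> h np [r [Pr_ Ir cr]].
have st := inert_stab g0 sg GB h.
have [y y0 vy] := unif_at GB P 1.
have uy : uniformizer (sval P) y by apply: unif_vl.
pose rr l := irm s l y / y.
have r_unit l : vunit (sval P) (rr l).
  have n0 : irm s l y != 0 by rewrite fmorph_eq0.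
  apply/(vl_eq0 GB); first by rewrite mulf_neq0 ?invr_eq0.
  by rewrite (vlD GB) // (spull_vl g0 sg GB) // stab_all // subrr.
pose u := rr 1.
have Pu : sval P u by case: (r_unit 1).
have ru l : mx P (rr l - u ^+ l).
  elim: l => [|l ih]; first by rewrite /rr /= divff // subrr; apply: mx0.
  have -> : rr l.+1 = s (rr l) * u.
    rewrite /rr /u /rr /= fmorph_div; field.
    by rewrite y0 fmorph_eq0.
  rewrite exprSr -mulrBl; apply: mxMr => //.
  rewrite -(subrK (rr l) (s (rr l))) -addrA; apply: mxD => //; apply: h.
  by case: (r_unit l).
(* Suppose u^(p^k) is 1 modulo P. Then the trace of the uniformizer y to the intermediate layer is p
   y up to higher order, hence of valuation 1, and the last step would be both inert and
   unramified. *)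
have upk : ~ mx P (u ^+ (p ^ k) - 1).
  move=> m1; have m2 : mx P (rr (p ^ k)%N - 1).
    by rewrite -(subrK (u ^+ (p ^ k)) (rr _)) -addrA; apply: mxD.
  have it : inert t P by apply: inert_irm.
  have [a ea] := Tr_f tp tfix y.
  have up : vunit (sval P) (Tr t p y / y).
    have -> : Tr t p y / y = p%:R - - \sum_(i < p) (irm t i y / y - 1).
      rewrite /Tr mulr_suml sumrB sumr_const card_ord; by rewrite opprK addrC subrK.
    apply: vunitBm; first by case: (vunit_mx (pl_nat P p)).
    apply: mxN; apply: mx_sum => i _; rewrite /t irm_irm.
    elim: (nat_of_ord i) => [|j ih]; first by rewrite mul0n /= divff // subrr; apply: mx0.
    have -> : irm s (j.+1 * p ^ k) y / y - 1 =
       (irm s (p ^ k) (irm s (j * p ^ k) y / y) - 1) * rr (p ^ k)%N + (rr (p ^ k)%N - 1).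
      rewrite mulSn irmD /rr fmorph_div; field.
      by rewrite y0 fmorph_eq0.
    apply: mxD => //; apply: mxMr; last by case: (r_unit (p ^ k)%N).
    have -> : (1 : B) = irm s (p ^ k) 1 by rewrite rmorph1.
    by rewrite -rmorphB; apply: (S_mx _ st).
  have [n0 _ _] := up.
  have a0 : a != 0.
    by apply: contraNneq n0 => e; rewrite ea e rmorph0 mul0r.
  have va : vl P (iota a) = 1.
    rewrite -ea -(divfK y0 (Tr t p y)) (vlM GB) // vy.
    by move/(vl_eq0 GB P n0): up => ->.
  have [z tz] := tne.
  apply: (inert_unramified_absurd (f := iota) (g0 := p0) (sg := tp) (sfix := tfix) GA1 GB pp _ it tz).
    by exists 1%N; rewrite expn1.
  exact: (framf_of_vl p0 tp tfix GA1 GB a0 va).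
(* If u^i and u^j agree, the order of u divides the gcd of j - i and p^(k+1), a power p^a with a <=
   k, against [upk]. *)
have uinj i j : (i < j)%N -> (j < p ^ k.+1)%N -> ~ mx P (u ^+ i - u ^+ j).
  move=> ij jk m1; pose l := (j - i)%N.
  have l0 : (0 < l)%N by rewrite subn_gt0.
  have lp : (l < p ^ k.+1)%N by rewrite (leq_ltn_trans (leq_subr _ _)).
  have Puu : vunit (sval P) u by apply: r_unit.
  have ml : mx P (u ^+ l - 1).
    have [_ _ Pv] := vunitX i Puu.
    have -> : u ^+ l - 1 = - (u ^+ i - u ^+ j) * (u ^+ i)^-1.
      have [ui0 _ _] := vunitX i Puu.
      by rewrite -(subnKC (ltnW ij)) exprD -/l; field.
    by apply: mxMr => //; apply: mxN.
  have [c [d ecd]] : exists c d, (c * l = d * p ^ k.+1 + gcdn l (p ^ k.+1))%N.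
    by case: (egcdnP (p ^ k.+1) l0) => c d e _; exists c, d.
  have mpow m n : mx P (u ^+ m - 1) -> mx P (u ^+ (n * m) - 1).
    move=> hm; rewrite mulnC exprM -[1](expr1n _ n) subrXX; apply: mxMr => //.
    by apply: pl_sum => o _; apply: plM; apply: plX; rewrite ?expr1n; [apply: plX|apply: pl1].
  have mtop : mx P (u ^+ (p ^ k.+1) - 1).
    have := ru (p ^ k.+1)%N; rewrite /rr sg divff // => /mxN.
    by rewrite opprB.
  have [a ag] : exists a, (gcdn l (p ^ k.+1) = p ^ a)%N /\ (a <= k)%N.
    have /(dvdn_pfactor _ _ pp) [a ak e] := dvdn_gcdr l (p ^ k.+1).
    exists a; split=> //; rewrite -ltnS -(ltn_exp2l _ _ (prime_gt1 pp)) -e.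
    by apply: leq_ltn_trans lp; apply: dvdn_leq => //; apply: dvdn_gcdl.
  case: ag => ag ak.
  apply: upk; rewrite -(subnK ak) expnD; apply: (mpow); rewrite -ag.
  have h1 := mpow _ c ml; have h2 := mpow _ d mtop; rewrite ecd in h1.
  have [n2 _ Pv2] := vunitX (d * p ^ k.+1) Puu.
  have := mxB h1 h2; rewrite opprB addrA subrK exprD => h3.
  have -> : u ^+ gcdn l (p ^ k.+1) - 1 =
     (u ^+ (d * p ^ k.+1) * u ^+ gcdn l (p ^ k.+1) - u ^+ (d * p ^ k.+1)) * (u ^+ (d * p ^ k.+1))^-1.
    by field.
  exact: mxMr.
have [a ha] := choice_ex (fun i : 'I_(p ^ k.+1) =>
  inert_residue g0 sg sfix GB pp (ex_intro _ k.+1 erefl) h (plX i Pu)).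
have Pa i : sval (fpull g0 sg sfix P) (a i).
  rewrite /= -(subKr (u ^+ i) (f (a i))); apply: plB; first exact: plX.
  exact/mx_pl/ha.
have [c hc] := choice_ex (fun i => cr _ (Pa i)).
suff ci : injective c by have := leq_card c ci; rewrite !card_ord.
have key i j : c i = c j -> mx P (u ^+ i - u ^+ j).
  move=> e; have := subgB (subg_mx _) (hc i) (hc j); rewrite e opprB addrA subrK.
  move/(pull_mx (cyc_proper g0 sg sfix)); rewrite rmorphB => h3.
  have -> : u ^+ i - u ^+ j = (u ^+ i - f (a i)) + (f (a i) - f (a j)) - (u ^+ j - f (a j)) by ring.
  by apply: mxB => //; apply: mxD.
move=> i j e; apply: val_inj => /=; case: (ltngtP i j) => // ij.
  by case: (uinj _ _ ij (ltn_ord j) (key _ _ e)).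
by case: (uinj _ _ ij (ltn_ord i) (key _ _ (esym e))).
Qed.

End Tame.

(** Partial sums E are additive along periods, so g E(d) = E(g d) = d E(g) = 0 and hence E(d) =
    0. *)
Lemma periodic_sum0 (F : nat -> int) d g : (0 < g)%N -> (forall i, F (i + g)%N = F i) ->
  (forall i, F (i + d)%N = F i) -> \sum_(j < g) F j = 0 ->
  forall i, \sum_(j < i + d) F j = \sum_(j < i) F j.
Proof.
move=> g0 hg hd sg; pose E i := \sum_(j < i) F j.
have Ep c : (forall i, F (i + c)%N = F i) -> forall i, E (i + c)%N = E i + E c.
  move=> hc; elim=> [|i ih]; first by rewrite add0n /E big_ord0 add0r.
  by rewrite addSn /E big_ord_recr /= -/(E _) ih hc [in RHS]big_ord_recr /= addrAC.
have Ek c k : (forall i, F (i + c)%N = F i) -> E (k * c)%N = E c *+ k.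
  move=> hc; elim: k => [|k ih]; first by rewrite mul0n /E big_ord0.
  by rewrite mulSn addnC Ep // ih mulrSr.
have e : E d *+ g = 0.
  by rewrite -Ek // mulnC Ek // {1}/E sg mul0rn.
have ed : E d = 0 by move/eqP: e; rewrite mulrn_eq0 eqn0Ngt g0 /= => /eqP.
by move=> i; rewrite -/(E _) Ep // ed addr0.
Qed.

(** * Cohomology of the group of divisors *)

Section DivCoh.
Variables (A B : fieldType) (f : {rmorphism A -> B}) (s : {rmorphism B -> B}) (g : nat).
Hypothesis g0 : (0 < g)%N.
Hypothesis sg : forall x, irm s g x = x.
Hypothesis sfix : forall x, s x = x <-> exists a, x = f a.
Hypotheses (GA : gl A) (GB : gl B).

Local Notation spull := (spull g0 sg).
Local Notation fpull := (fpull g0 sg sfix).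
Local Notation framf := (framf g0 sg sfix).
Local Notation sV := (sV g0 sg).
Local Notation jf := (jd (cyc_proper g0 sg sfix)).

Lemma rep_ex : exists (r : place A -> place B) (i : place B -> nat),
  (forall p, fpull (r p) = p) /\ (forall P, P = spull (i P) (r (fpull P))).
Proof.
have [r hr] := choice_ex (pull_surj GA (cyc_proper g0 sg sfix)).
have ex P : exists i, P = spull i (r (fpull P)).
  by have [|i _ e] := @pull_trans _ _ f s g g0 sg sfix GB (r (fpull P)) P; [exact: hr|exists i].
by have [i hi] := choice_ex ex; exists r, i.
Qed.

Lemma fsupp_fibres (D : dvs B) (l : seq (place A)) :
  (forall P, D P != 0 -> fpull P \in l) -> fsupp D.
Proof.
move=> h; have [m hm] := choice_ex (fibre_fin GA GB (cyc_proper g0 sg sfix)).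
exists (flatten [seq m p | p <- l]) => P /h hP.
by apply/flatten_mapP; exists (fpull P) => //; apply: hm.
Qed.

(** Divisors form a permutation module: along each fibre, D' is the partial sum of D from a chosen
    representative, and trace zero makes it close up after a full turn. *)
Lemma ker_trc_div (D : dvs B) : fsupp D -> trc sV g D = 0 ->
  exists D', fsupp D' /\ D = sV D' - D'.
Proof.
move=> [l hl] tD; have [r [i [hr hi]]] := rep_ex.
pose F p j := D (spull j (r p)).
have Fg p j : F p (j + g)%N = F p j by rewrite /F -spull_mod modnDr spull_mod.
have F0 p : \sum_(j < g) F p j = 0.
  have : trc sV g D (r p) = 0 by rewrite tD.
  rewrite /trc dvs_sum => e; rewrite -[RHS]e; apply: eq_bigr => j _.
  by rewrite iter_sV.
pose E p j := \sum_(k < j) F p k.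
(* The exponent that carries the representative to a given place is determined only up to the
   stabilizer; the partial sums do not see this by [periodic_sum0]. *)
have Ewd p a b : spull a (r p) = spull b (r p) -> E p a = E p b.
  wlog ab : a b / (a <= b)%N.
    by move=> w e; case/orP: (leq_total a b) => h; [apply: w|apply/esym/w].
  move=> e; rewrite -(subnKC ab) /E; apply/esym; apply: (periodic_sum0 (g := g)) => // j.
  have Fag n : F p (n + a * g)%N = F p n by rewrite /F -spull_mod addnC modnMDl spull_mod.
  have ag : (a <= a * g)%N by rewrite leq_pmulr.
  rewrite -(Fag (j + _)%N) -[RHS]Fag /F.
  have -> : (j + (b - a) + a * g = b + (a * g - a + j))%N by lia.
  have -> : (j + a * g = a + (a * g - a + j))%N by lia.
  by rewrite -!spullD e.
pose D' : dvs B := fun P => E (fpull P) (i P).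
exists D'; split.
  apply: (fsupp_fibres (l := [seq fpull P | P <- l])) => P; rewrite /D' /E => h.
  have [j hj] : exists j : 'I_(i P), F (fpull P) j != 0.
    apply: contrapT => hn; case/negP: h; apply/eqP; apply: big1 => j _.
    by apply/eqP/negPn/negP => hj; apply: hn; exists j.
  by apply/mapP; exists (spull j (r (fpull P))); [exact: hl|rewrite fpull_spull hr].
apply: funext => P; rewrite dvsB /D' /sV fpull_spull.
have -> : E (fpull P) (i (spull 1 P)) = E (fpull P) (i P).+1.
  by apply: Ewd; rewrite -{1}(fpull_spull g0 sg sfix 1 P) -hi {1}(hi P) spullD addn1.
by rewrite /E big_ord_recr /= addrAC subrr add0r /F -hi.
Qed.

Lemma sV_const (D : dvs B) P Q : sV D = D -> fpull P = fpull Q -> D P = D Q.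
Proof.
move=> sD e; have [j _ ->] := pull_trans GB e; rewrite -(iter_sV g0 sg).
by have -> : iter j sV D = D by elim: j => //= j ->.
Qed.

Definition Ifix (D : dvs B) := fsupp D /\ sV D = D.
Definition Jim (D : dvs B) := exists D0, fsupp D0 /\ D = jf D0.

Lemma ram_index p (R : seq (place A)) : (0 < p)%N -> uniq R ->
  (forall P, framf P = if fpull P \in R then p%:Z else 1) ->
  idx Ifix Jim (p ^ size R)%N.
Proof.
move=> p0 uR hR; have [r [i [hr hi]]] := rep_ex.
have -> : (p ^ size R = #|{ffun 'I_(size R) -> 'I_p}|)%N by rewrite card_ffun !card_ord.
pose Dc (c : {ffun 'I_(size R) -> 'I_p}) : dvs B := fun P =>
  if insub (index (fpull P) R) is Some k then (c k : nat)%:Z else 0.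
have DcR c (k : 'I_(size R)) P : fpull P = nth (fpull P) R k -> Dc c P = (c k : nat)%:Z.
  move=> e; have ek : index (fpull P) R = k by rewrite e index_uniq.
  by rewrite /Dc ek valK.
have Dc0 c P : fpull P \notin R -> Dc c P = 0.
  by move=> h; rewrite /Dc insubF // index_mem (negbTE h).
have Ifx c : Ifix (Dc c).
  split.
    apply: (fsupp_fibres (l := R)) => P; apply: contraR => h.
    by rewrite Dc0.
  by apply: funext => P; rewrite /sV /Dc fpull_spull.
have jfr (k : 'I_(size R)) D0 P : fpull P = nth (fpull P) R k -> jf D0 P = p%:Z * D0 (fpull P).
  by move=> e; rewrite /jd -/(framf P) hR {1}e mem_nth.
apply: (nc_card (f := Dc)) => [c|c c' [D0 [_ e]]|D [fD sD]]; first exact: Ifx.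
- apply/ffunP => k; apply/val_inj.
  have [p1|] := leqP (size R) 0; first by have := ltn_ord k; rewrite ltnNge (leq_trans p1).
  move=> R0; pose v := nth (head (fpull (r (nth (fpull (r (tnth (in_tuple R) k))) R k))) R) R k.
  have ev x0 : nth x0 R k = v by apply: set_nth_default.
  have fv : fpull (r v) = nth (fpull (r v)) R k by rewrite ev hr.
  have := congr1 (fun D : dvs B => D (r v)) e.
  rewrite /= dvsB !(DcR _ _ _ fv) (jfr _ _ _ fv) => e2.
  have h1 := ltn_ord (c k); have h2 := ltn_ord (c' k).
  move: e2; move: (D0 _) => z; have [z1|z1|->] := ltrgtP z 0.
  - have z2 : z <= -1 by lia.
    by have := ler_wpM2l (isT : 0 <= p%:Z) z2; rewrite mulrN1; move: (p%:Z * z) => w; move: h1 h2; move: (nat_of_ord (c k)) (nat_of_ord (c' k)) => u1 u2; lia.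
  - have z2 : 1 <= z by lia.
    by have := ler_wpM2l (isT : 0 <= p%:Z) z2; rewrite mulr1; move: (p%:Z * z) => w; move: h1 h2; move: (nat_of_ord (c k)) (nat_of_ord (c' k)) => u1 u2; lia.
  - by rewrite mulr0 /=; lia.
- have cex (k : 'I_(size R)) : exists c : 'I_p, forall P, fpull P = nth (fpull P) R k ->
      exists z, D P - (c : nat)%:Z = p%:Z * z.
    pose v := tnth (in_tuple R) k.
    have pz : p%:Z != 0 by rewrite eqz_nat -lt0n.
    have lt : (`|(D (r v) %% p)%Z| < p)%N.
      by rewrite -ltz_nat gez0_abs ?modz_ge0 // ltz_pmod.
    exists (Ordinal lt) => P e; exists (D (r v) %/ p)%Z.
    have -> : D P = D (r v).
      by apply: sV_const => //; rewrite hr e /v (tnth_nth (fpull P)).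
    by rewrite /= gez0_abs ?modz_ge0 // {1}(divz_eq (D (r v)) p) addrK mulrC.
  have [c hc] := choice_ex cex.
  pose c' := [ffun k => c k].
  exists c'; pose D1 := D - Dc c'.
  have sD1 : sV D1 = D1 by rewrite /D1 sVB sD; have [_ ->] := Ifx c'.
  have fD1 : fsupp D1 by apply: (subgB (@subg_fsupp B) fD); have [] := Ifx c'.
  have dvd P : exists z, D1 P = framf P * z.
    rewrite hR; case: ifP => h; last by exists (D1 P); rewrite mul1r.
    have ki : (index (fpull P) R < size R)%N by rewrite index_mem.
    have e : fpull P = nth (fpull P) R (Ordinal ki) by rewrite /= nth_index.
    have [z ez] := hc _ P e; exists z; rewrite /D1 dvsB (DcR _ _ _ e) ffunE.
    exact: ez.
  have [z hz] := choice_ex dvd.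
  exists (fun p => z (r p)); split.
    have [l hl] := fD1; exists [seq fpull P | P <- l] => q h.
    apply/mapP; exists (r q); last by rewrite hr.
    apply: hl; rewrite hz mulf_neq0 //.
    by rewrite gt_eqF // (ram_gt0 GA GB).
  apply: funext => P; rewrite -/D1 /jd -/(framf P).
  have -> : framf P = framf (r (fpull P)).
    by rewrite {1}(hi P); apply: framf_spull.
  by rewrite -hz; apply: sV_const => //; rewrite hr.
Qed.

Lemma Jim_Ifix D : Jim D -> Ifix D.
Proof.
move=> [D0 [h ->]]; split; first exact: fsupp_jd.
exact: sV_jd.
Qed.

Lemma subg_Ifix : subg Ifix.
Proof.
split; first by split; [apply: subg0 (@subg_fsupp B)|].
move=> D D' [h1 e1] [h2 e2]; split; first exact: (subgB (@subg_fsupp B)).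
by rewrite sVB e1 e2.
Qed.

Lemma subg_Jim : subg Jim.
Proof.
split; first by exists 0; split; [apply: subg0 (@subg_fsupp A)|apply: funext => P; rewrite /jd mulr0].
move=> _ _ [D [h1 ->]] [D' [h2 ->]]; exists (D - D'); split; first exact: (subgB (@subg_fsupp A)).
by rewrite jdB.
Qed.

(** Every ramification index is 1 or g, so multiplication by g makes all coefficients divisible by
    it. *)
Lemma fix_mul_Jim D : Ifix D -> prime g -> (exists y, s y != y) -> Jim (D *+ g).
Proof.
move=> [fD sD] gp sne; have [r [i [hr hi]]] := rep_ex.
have ex P : exists z, (D *+ g) P = framf P * z.
  have [h|h] := pselect (inert s P).
    by exists (D P); rewrite framf_inert // dvsMn -mulr_natl natz.
  by exists ((D *+ g) P); rewrite framf_notinert // mul1r.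
have sDg : sV (D *+ g) = D *+ g.
  by apply: funext => P; rewrite /sV !dvsMn; congr (_ *+ _); rewrite -[RHS](congr1 (fun E : dvs B => E P) sD).
have [z hz] := choice_ex ex.
exists (fun p => z (r p)); split.
  have [l hl] := fD; exists [seq fpull P | P <- l] => q h.
  apply/mapP; exists (r q); last by rewrite hr.
  apply: hl; have : (D *+ g) (r q) != 0 by rewrite hz mulf_neq0 // gt_eqF // (ram_gt0 GA GB).
  by rewrite dvsMn; apply: contra => /eqP ->; rewrite mul0rn.
apply: funext => P; rewrite /jd -/(framf P).
have -> : framf P = framf (r (fpull P)) by rewrite {1}(hi P); apply: framf_spull.
by rewrite -hz; apply: sV_const => //; rewrite hr.
Qed.

End DivCoh.

(** * Number fields: places and integral bases *)

(** The integral closure is the intersection of the valuation rings over A. If 1/x generates a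
    proper ideal of A[1/x], a place dominating it omits x; otherwise 1 is 1/x times a polynomial in
    1/x, which clears to a monic equation. *)
Lemma place_avoid (F : fieldType) (A : F -> Prop) (x : F) : sring A ->
  (forall P : place F, (forall y, A y -> sval P y) -> sval P x) ->
  exists q : {poly F}, [/\ q \is monic, cf A q & root q x].
Proof.
move=> sA h; have A0 := sring0 sA; have [A1 AB AM] := sA.
have [->|x0] := eqVneq x 0.
  exists 'X; split; rewrite ?monicX ?rootX // => i.
  by rewrite coefX; case: eqP.
pose B := adj A x^-1.
pose I y := exists2 z, B z & y = x^-1 * z.
have sB : sring B by apply: adj_sring.
have [B1 BB BM] := sB.
have Bx : B x^-1.
  by exists 'X; rewrite ?hornerX // => i; rewrite coefX; case: eqP.
have AinB y : A y -> B y by apply: adj_incl.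
have sI : sideal B I.
  split.
  - by exists 0; [apply: sring0|rewrite mulr0].
  - by move=> _ [z Bz ->]; apply: BM.
  - by move=> _ _ [z Bz ->] [w Bw ->]; exists (z - w); [apply: BB|rewrite mulrBr].
  - by move=> y _ By [w Bw ->]; exists (y * w); [apply: BM|rewrite mulrCA].
have [[_ [q Aq ->] e]|nI] := pselect (I 1); last first.
  have [|P [h1 h2]] := place_dominating sB sI nI.
    by exists x^-1; rewrite ?invr_eq0 //; exists 1; rewrite ?mulr1.
  exfalso; have Px : sval P x by apply: h => y Ay; apply/h1/AinB.
  have [] : mx P x^-1 by apply: h2; exists 1; rewrite ?mulr1.
  by move=> _; apply; apply: vunitV; split=> //; apply/mx_pl/h2; exists 1; rewrite ?mulr1.
(* The relation 1 = q(1/x) / x is multiplied by x^n with n = [size q]. *)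
pose n := size q; pose r := \poly_(i < n) q`_(n - i.+1).
have sr : (size r < size ('X^n : {poly F}))%N by rewrite size_polyXn ltnS size_poly.
exists ('X^n - r); split.
- by rewrite monicE lead_coefDl ?size_polyN // lead_coefXn.
- move=> i; rewrite coefB coefXn coef_poly; apply: AB; first by case: eqP.
  by case: ifP.
rewrite rootE hornerD hornerN hornerXn horner_poly subr_eq0; apply/eqP.
rewrite -[LHS]mulr1 {}e horner_coef !mulr_sumr [RHS](reindex_inj rev_ord_inj) /=.
apply: eq_bigr => i _.
have -> : (n - (n - i.+1).+1)%N = i by have := ltn_ord i; rewrite -/n; lia.
have -> : x ^+ n = x ^+ (n - i.+1) * (x * x ^+ i).
  by rewrite -exprS -exprD subnK.
have xi : x ^+ i != 0 by rewrite expf_neq0.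
by rewrite exprVn; field; rewrite ?x0 ?xi.
Qed.

Section IdomBase.
Variables (F : fieldType) (E : idomainType) (psi : {rmorphism E -> F}).
Hypothesis inj : forall a, psi a = 0 -> a = 0.
Definition imr x := exists a, x = psi a.

Lemma sring_imr : sring imr.
Proof.
split; first by exists 1; rewrite rmorph1.
- by move=> _ _ [a ->] [b ->]; exists (a - b); rewrite rmorphB.
- by move=> _ _ [a ->] [b ->]; exists (a * b); rewrite rmorphM.
Qed.

(** The coordinates of n + 1 vectors form a square matrix once a zero column is added; being
    singular over a domain, it has a nonzero kernel vector, with no division. *)
Lemma dep_of_span n (b : 'I_n -> F) :
  (forall x, exists d (a : 'I_n -> E), d != 0 /\ psi d * x = \sum_j psi (a j) * b j) ->
  forall x : nat -> F, exists c : nat -> E,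
    (exists2 i, (i <= n)%N & c i != 0) /\ \sum_(i < n.+1) psi (c i) * x i = 0.
Proof.
move=> sp x; have [d hd] := choice_ex (fun i : 'I_n.+1 => sp (x i)).
have [a ha] := choice_ex hd.
pose M : 'M[E]_n.+1 := \matrix_(i, j) if unlift ord_max j is Some k then a i k else 0.
have : \det M == 0.
  rewrite (expand_det_col _ ord_max) big1 // => i _.
  by rewrite mxE unlift_none mul0r.
case/det0P => v v0 vM; pose c i := if insub i is Some k then v 0 k * d k else 0.
exists c; split.
  have [i vi] : exists i, v 0 i != 0.
    apply/existsP; apply: contraNT v0; rewrite negb_exists => /forallP h.
    by apply/eqP/rowP => i; rewrite mxE; apply/eqP; move: (h i); rewrite negbK.
  exists (val i); first exact: (ltn_ord i).
  by have [di _] := ha i; rewrite /c valK; apply: mulf_neq0.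
have -> : \sum_(i < n.+1) psi (c i) * x i = \sum_i \sum_j psi (v 0 i) * (psi (a i j) * b j).
  apply: eq_bigr => i _; rewrite /c valK rmorphM -mulrA.
  by case: (ha i) => _ ->; rewrite mulr_sumr.
rewrite exchange_big big1 // => j _.
under eq_bigr => i _ do rewrite mulrA -rmorphM.
rewrite -mulr_suml -rmorph_sum.
have : (v *m M) 0 (lift ord_max j) = 0 by rewrite vM mxE.
by rewrite mxE; under eq_bigr => i _ do rewrite mxE liftK; move=> ->; rewrite rmorph0 mul0r.
Qed.

Lemma ebase_idom n (sz : E -> nat) :
  (forall x : nat -> F, exists c : nat -> E,
    (exists2 i, (i <= n)%N & c i != 0) /\ \sum_(i < n.+1) psi (c i) * x i = 0) ->
  (forall a, sz a = 0%N -> a = 0) ->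
  (forall a b, a != 0 -> b != 0 -> sz (a * b) = (sz a * sz b)%N) ->
  (forall a b, b != 0 -> exists q, (sz (a - q * b)%R < sz b)%N) ->
  (forall m, exists s : seq E, forall e, (sz e < m)%N -> e \in s) -> ebase imr n.
Proof.
move=> dep sz0 szM szE szF.
have pinj a b : psi a = psi b -> a = b.
  by move=> e; apply/subr0_eq/inj; rewrite rmorphB e subrr.
pose gg (y : F) : E := xget 0 [set a | y = psi a]%classic.
have ggK a : gg (psi a) = a.
  rewrite /gg; case: xgetP => [c _ e|/(_ a)/(_ erefl)//]; by apply/pinj; rewrite -e.
have p0 a : (psi a != 0) = (a != 0).
  by rewrite -(rmorph0 psi) (inj_eq pinj).
split; first exact: sring_imr.
- move=> x; have [c [[i il ci] e]] := dep x; exists (fun i => psi (c i)); split=> //.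
    by move=> j; exists (c j).
  by exists i; rewrite // p0.
exists (fun y => sz (gg y)); split.
- by move=> _ [a ->]; rewrite ggK => /sz0 ->; rewrite rmorph0.
- by move=> _ _ [a ->] [b ->]; rewrite -rmorphM !ggK !p0; apply: szM.
- move=> _ _ [a ->] [b ->]; rewrite p0 => b0; have [q hq] := szE a b b0.
  by exists (psi q); [exists q|rewrite -rmorphM -rmorphB !ggK].
- move=> m; have [s hs] := szF m; exists (map psi s) => _ [a ->]; rewrite ggK => h.
  by apply/map_f/hs.
Qed.
End IdomBase.

Section NumberField.
Variable F : fieldType.
Hypothesis nF : number_field F.

Lemma char0_natr n : (n%:R == 0 :> F) = (n == 0)%N.
Proof.
case: nF => c0 _; case: n => [|n]; first by rewrite mulr0n !eqxx.
by apply/negbTE/c0.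
Qed.

Lemma char0_intr (z : int) : (z%:~R == 0 :> F) = (z == 0).
Proof.
case: z => n; first by rewrite -pmulrn char0_natr.
by rewrite NegzE rmorphN oppr_eq0 /= -pmulrn char0_natr.
Qed.

Lemma ratr_charE (c : rat) : ratr c * (denq c)%:~R = (numq c)%:~R :> F.
Proof. by rewrite /ratr divfK // char0_intr denq_neq0. Qed.

Lemma nf_ebase : exists n, ebase (imr (intr : {rmorphism int -> F})) n.
Proof.
have [_ [n [b sp]]] := nF; exists n; have inj (a : int) : (intr a : F) = 0 -> a = 0 by move=> /eqP; rewrite char0_intr => /eqP.
apply: (@ebase_idom F int intr inj n absz).
- apply: (@dep_of_span F int intr n b) => x; have [c ->] := sp x.
  exists (\prod_i denq (c i)), (fun i => numq (c i) * \prod_(j | j != i) denq (c j)); split.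
    by apply/prodf_neq0 => i _; apply: denq_neq0.
  rewrite mulr_sumr; apply: eq_bigr => i _.
  rewrite (bigD1 i) //= !rmorphM /= -ratr_charE; ring.
- by move=> a /eqP; rewrite absz_eq0 => /eqP.
- by move=> a b' _ _; rewrite abszM.
- move=> a d d0; exists (a %/ d)%Z; have := modz_ge0 a d0; have := ltz_mod a d0.
  by rewrite /modz; lia.
- move=> m; exists ([seq Posz i | i <- iota 0 m] ++ [seq - Posz i | i <- iota 0 m]) => e h.
  rewrite mem_cat; case: e h => k h.
    by rewrite map_f // mem_iota.
  by rewrite NegzE [X in _ || X]map_f ?orbT // mem_iota.
Qed.

Lemma place_int (P : place F) (z : int) : sval P z%:~R.
Proof. by case: z => k; [apply: pl_nat|rewrite NegzE rmorphN; apply/plN/pl_nat]. Qed.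

Lemma nf_gl : gl F.
Proof.
have [n eb] := nf_ebase; apply: (gl_ebase eb eb) => P; left => _ [z ->].
exact: place_int.
Qed.

Lemma integralP x : integral x <-> forall P : place F, sval P x.
Proof.
split=> [[q [mq rq]] P|h].
  apply: (@place_integral F P (map_poly intr q) x) rq; first exact: (monic_map intr mq).
  by move=> i; rewrite (coef_map intr); apply: place_int.
have [|q [mq cq rq]] := @place_avoid F (imr (intr : {rmorphism int -> F})) x (sring_imr _).
  by move=> P _; apply: h.
have [c hc] := choice_ex cq; pose n := (size q).-1.
have sq : size q = n.+1 by rewrite /n prednK // size_poly_gt0 monic_neq0.
pose r : {poly int} := 'X^n + \poly_(i < n) c i.
have sr : (size (\poly_(i < n) c i) < size ('X^n : {poly int}))%N.
  by rewrite size_polyXn ltnS size_poly.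
exists r; split; first by rewrite monicE lead_coefDl // lead_coefXn.
have -> // : map_poly (fun z : int => z%:~R) r = q.
apply/polyP => i; rewrite (coef_map intr) coefD coefXn coef_poly.
have [ltin|] := ltnP i n; first by rewrite ltn_eqF // add0r; apply/esym/hc.
rewrite leq_eqVlt => /predU1P[<-|lt]; rewrite addr0.
  by rewrite eqxx; move: mq; rewrite monicE lead_coefE sq => /eqP ->.
by rewrite gtn_eqF // nth_default // sq.
Qed.
End NumberField.

Definition rm_of (A B : nzRingType) (f : A -> B) (fB : zmod_morphism f) (fM : monoid_morphism f) :
  {rmorphism A -> B} :=
  HB.pack f (GRing.isZmodMorphism.Build A B f fB) (GRing.isMonoidMorphism.Build A B f fM).

Section RatField.
Variable F : fieldType.
Hypothesis nF : number_field F.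

Lemma ratr_inj_eq (a : F) (c : rat) : a * (denq c)%:~R = (numq c)%:~R -> a = ratr c.
Proof.
move=> e; have d0 : (denq c)%:~R != 0 :> F by rewrite char0_intr // denq_neq0.
by apply: (mulIf d0); rewrite e ratr_charE.
Qed.

Lemma int_eqF (a b : int) : a%:~R = b%:~R :> rat -> a%:~R = b%:~R :> F.
Proof. by move=> /eqP; rewrite eqr_int => /eqP ->. Qed.

Lemma ratr_zmod : zmod_morphism (@ratr F).
Proof.
move=> a b; apply/esym/ratr_inj_eq.
have da : (denq a)%:~R != 0 :> F by rewrite char0_intr // denq_neq0.
have db : (denq b)%:~R != 0 :> F by rewrite char0_intr // denq_neq0.
apply: (mulIf da); apply: (mulIf db).
have -> : (ratr a - ratr b) * (denq (a - b))%:~R * (denq a)%:~R * (denq b)%:~R =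
  ((ratr a * (denq a)%:~R) * (denq b)%:~R - (ratr b * (denq b)%:~R) * (denq a)%:~R) *
  (denq (a - b))%:~R :> F by ring.
rewrite !ratr_charE // -!rmorphM -rmorphB -!rmorphM; apply: int_eqF.
by rewrite !(rmorphM, rmorphB) /= !numqE; ring.
Qed.

Lemma ratr_monoid : monoid_morphism (@ratr F).
Proof.
split; first by apply/esym/ratr_inj_eq; rewrite mul1r.
move=> a b; apply/esym/ratr_inj_eq.
have da : (denq a)%:~R != 0 :> F by rewrite char0_intr // denq_neq0.
have db : (denq b)%:~R != 0 :> F by rewrite char0_intr // denq_neq0.
apply: (mulIf da); apply: (mulIf db).
have -> : (ratr a * ratr b) * (denq (a * b))%:~R * (denq a)%:~R * (denq b)%:~R =
  (ratr a * (denq a)%:~R) * (ratr b * (denq b)%:~R) * (denq (a * b))%:~R :> F by ring.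
rewrite !ratr_charE // -!rmorphM; apply: int_eqF.
by rewrite !rmorphM /= !numqE; ring.
Qed.

Fact rF_ex : {f : {rmorphism rat -> F} | forall a, f a = ratr a}.
Proof. by exists (rm_of ratr_zmod ratr_monoid). Qed.
Definition rF : {rmorphism rat -> F} := sval rF_ex.
Lemma rFE a : rF a = ratr a. Proof. exact: svalP rF_ex a. Qed.

Lemma rF_int (z : int) : rF z%:~R = z%:~R.
Proof. by rewrite rmorph_int. Qed.

Lemma drop_span n (b : 'I_n.+1 -> F) (c : 'I_n.+1 -> rat) k : c k != 0 ->
  \sum_i rF (c i) * b i = 0 ->
  forall a : 'I_n.+1 -> rat, exists a' : 'I_n -> rat,
    \sum_i rF (a i) * b i = \sum_i rF (a' i) * b (lift k i).
Proof.
move=> ck e a; have rk : rF (c k) != 0 by rewrite fmorph_eq0.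
exists (fun i => a (lift k i) - a k * c (lift k i) / c k).
move: e; rewrite !(bigD1_ord k) //= => e.
have bk : b k = - (\sum_(i < n) rF (c (lift k i)) * b (lift k i)) / rF (c k).
  by apply: (mulIf rk); rewrite divfK // mulrC; apply/eqP; rewrite -addr_eq0 e.
rewrite addrC; under [RHS]eq_bigr => i _ do rewrite rmorphB mulrBl.
rewrite sumrB; congr (_ + _).
have -> : \sum_(i < n) rF (a k * c (lift k i) / c k) * b (lift k i) =
    rF (a k) / rF (c k) * \sum_(i < n) rF (c (lift k i)) * b (lift k i).
  by rewrite mulr_sumr; apply: eq_bigr => i _; rewrite !rmorphM fmorphV; ring.
by rewrite bk; ring.
Qed.

(** [m] is the lowest coefficient of an integral relation of 1/x. At a place containing 1/x the
    element m x is a polynomial in 1/x; at any other place x itself is regular. *)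
Lemma integral_scale (x : F) : exists2 m : int, m != 0 & integral (m%:~R * x).
Proof.
have [n eb] := nf_ebase nF; have [->|x0] := eqVneq x 0.
  by exists 1; rewrite // mulr0; apply: (proj2 (integralP _)) => P; apply: pl0.
have [|_ [[m ->] m0] h] := @algrel_low F _ x^-1 _ (eb_algrel eb x^-1).
  by rewrite invr_eq0.
exists m; first by rewrite -(char0_intr nF).
apply: (proj2 (integralP _)) => P; have Pz : forall y, imr (intr : {rmorphism int -> F}) y -> sval P y.
  by move=> _ [z ->]; apply: place_int.
have [Px|nPx] := pselect (sval P x^-1); first by rewrite -[x]invrK; apply: h.
by apply: plM; [apply: place_int|rewrite -[x]invrK; apply: plV].
Qed.
End RatField.

(** A basis over the rationals made of algebraic integers. The lattice it spans over the integers
    serves in place of the full ring of integers in the pigeonhole arguments. *)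
Record nfb (F : fieldType) (n : nat) (w : 'I_n.+1 -> F) (co : F -> 'rV[rat]_n.+1) : Prop := Nfb {
  nfb_nf : number_field F;
  nfb_int : forall i, integral (w i);
  nfb_K : forall x, x = \sum_i ratr (co x 0 i) * w i;
  nfb_U : forall c : 'I_n.+1 -> rat, \sum_i ratr (c i) * w i = 0 -> forall i, c i = 0 }.

Lemma nfb_ex (F : fieldType) : number_field F -> exists n (w : 'I_n.+1 -> F) co, nfb w co.
Proof.
move=> nF; pose sp m := exists b : 'I_m -> F, forall x, exists c : 'I_m -> rat, x = \sum_i rF nF (c i) * b i.
have [_ [m0 [b0 sp0]]] := nF.
have ex : exists m, `[< sp m >].
  exists m0; apply/asboolP; exists b0 => x.
  have [c ->] := sp0 x; exists c; apply: eq_bigr => i _; by rewrite rFE.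
case: (ex_minnP ex) => m /asboolP[b spb] mn.
case: m => [|n] in b spb mn *.
  by have [c] := spb 1; rewrite big_ord0 => /eqP; rewrite oner_eq0.
have indep (c : 'I_n.+1 -> rat) : \sum_i rF nF (c i) * b i = 0 -> forall i, c i = 0.
  move=> e k; apply/eqP/negPn/negP => ck; suff /asboolP/mn : sp n by rewrite ltnn.
  exists (fun i => b (lift k i)) => x; have [a ->] := spb x.
  exact: (drop_span ck e).
have [m hm] := choice_ex (fun i => (let: ex_intro2 m p q := integral_scale nF (b i) in ex_intro _ m (conj p q))).
pose w i := (m i)%:~R * b i.
have m0' i : (m i)%:~R != 0 :> rat by rewrite intr_eq0; case: (hm i).
have [c0 hc0] := choice_ex spb.
exists n, w, (fun x => \row_i (c0 x i / (m i)%:~R)); split=> //.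
- by move=> i; case: (hm i).
- move=> x; rewrite {1}(hc0 x); apply: eq_bigr => i _; rewrite mxE -(rFE nF) /w mulrA.
  by rewrite -(rF_int nF) -rmorphM divfK.
- move=> c e i; apply: (mulIf (m0' i)); rewrite mul0r.
  apply: (indep (fun i => c i * (m i)%:~R)); rewrite -[RHS]e; apply: eq_bigr => j _.
  by rewrite rmorphM rF_int rFE -mulrA.
Qed.

(** * Regular representation, norm and trace *)

Section MulMx.
Variables (F : fieldType) (n : nat) (w : 'I_n.+1 -> F) (co : F -> 'rV[rat]_n.+1).
Hypothesis H : nfb w co.
Let nF := nfb_nf H.
Let r := rF nF.

Lemma coK x : x = \sum_i r (co x 0 i) * w i.
Proof. by rewrite {1}(nfb_K H x); apply: eq_bigr => i _; rewrite /r rFE. Qed.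

Lemma co_uniq x (c : 'I_n.+1 -> rat) : x = \sum_i r (c i) * w i -> forall i, co x 0 i = c i.
Proof.
move=> e i; apply/subr0_eq; apply: (nfb_U H (c := fun i => co x 0 i - c i)).
transitivity (x - x); last by rewrite subrr.
rewrite [X in _ = X - _]coK [X in _ = _ - X]e -sumrB; apply: eq_bigr => j _.
by rewrite -(rFE nF) -mulrBl -rmorphB.
Qed.

Lemma coD x y : co (x + y) = co x + co y.
Proof.
apply/rowP => i; apply: (@co_uniq _ (fun i => (co x + co y) 0 i)).
rewrite {1}(coK x) {1}(coK y) -big_split; apply: eq_bigr => j _.
by rewrite mxE rmorphD mulrDl.
Qed.

Lemma coZ a x : co (r a * x) = a *: co x.
Proof.
apply/rowP => i; apply: (@co_uniq _ (fun i => (a *: co x) 0 i)).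
rewrite {1}(coK x) mulr_sumr; apply: eq_bigr => j _.
by rewrite mxE rmorphM mulrA.
Qed.

Lemma co0 : co 0 = 0. Proof. by have := coZ 0 0; rewrite rmorph0 mul0r scale0r. Qed.
Lemma coB x y : co (x - y) = co x - co y.
Proof. by apply/eqP; rewrite eq_sym subr_eq -coD subrK. Qed.
Lemma co_sum I (s : seq I) (f : I -> F) : co (\sum_(i <- s) f i) = \sum_(i <- s) co (f i).
Proof. by elim/big_rec2: _ => [|i a b _ <-]; rewrite ?co0 ?coD. Qed.
Lemma co_inj x y : co x = co y -> x = y.
Proof. by move=> e; rewrite [x]coK [y]coK e. Qed.

Definition Mx x : 'M[rat]_n.+1 := \matrix_i co (w i * x).

Lemma co_mul x y : co (x * y) = co x *m Mx y.
Proof.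
rewrite {1}(coK x) mulr_suml co_sum; apply/rowP => j; rewrite summxE mxE.
by apply: eq_bigr => i _; rewrite -mulrA coZ !mxE.
Qed.

Lemma Mx_ext (A B : 'M[rat]_n.+1) : (forall y, co y *m A = co y *m B) -> A = B.
Proof.
move=> h; apply/row_matrixP => i; rewrite -[A]mul1mx -[B]mul1mx !row_mul.
have <- : co (w i) = row i 1%:M; last exact: h.
apply/rowP => j; apply: co_uniq (fun j => row i 1%:M 0 j) _ _.
rewrite (bigD1 i) //= !mxE eqxx rmorph1 mul1r big1 ?addr0 // => k ki.
by rewrite !mxE eq_sym (negbTE ki) rmorph0 mul0r.
Qed.

Lemma MxB x y : Mx (x - y) = Mx x - Mx y.
Proof. by apply: Mx_ext => z; rewrite mulmxBr -!co_mul mulrBr coB. Qed.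
Lemma MxM x y : Mx (x * y) = Mx x *m Mx y.
Proof. by apply: Mx_ext => z; rewrite mulmxA -!co_mul mulrA. Qed.
Lemma Mx1 : Mx 1 = 1%:M.
Proof. by apply: Mx_ext => z; rewrite mulmx1 -!co_mul mulr1. Qed.
Lemma Mx_zmod : zmod_morphism Mx. Proof. exact: MxB. Qed.
Lemma Mx_monoid : monoid_morphism Mx. Proof. by split; [apply: Mx1|apply: MxM]. Qed.
Definition MxR : {rmorphism F -> 'M[rat]_n.+1} := rm_of Mx_zmod Mx_monoid.
Lemma Mx_r a : Mx (r a) = a%:M.
Proof. by apply: Mx_ext => z; rewrite -!co_mul mulrC coZ mul_mx_scalar. Qed.
Lemma Mx_inj x : Mx x = 0 -> x = 0.
Proof. by move=> e; apply: co_inj; rewrite -[x]mul1r co_mul e mulmx0 co0. Qed.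
Lemma Mx_sum x : Mx x = \sum_i co x 0 i *: Mx (w i).
Proof.
rewrite -[Mx]/(MxR : _ -> _) {1}(coK x) rmorph_sum; apply: eq_bigr => i _.
by rewrite -[LHS]/(Mx _) MxM Mx_r mul_scalar_mx.
Qed.

Lemma horner_Mx x (h : {poly rat}) : horner_mx (Mx x) h = Mx (map_poly r h).[x].
Proof.
elim/poly_ind: h => [|h c IH]; first by rewrite !rmorph0 horner0 -[Mx 0]/(MxR 0) rmorph0.
rewrite (rmorphD (map_poly r)) (rmorphM (map_poly r)) /= map_polyX map_polyC hornerMXaddC.
rewrite rmorphD rmorphM /= horner_mx_X horner_mx_C IH -[RHS]/(MxR _) rmorphD rmorphM.
by rewrite -[X in _ = _ + X]/(Mx _) Mx_r.
Qed.

(** Let g be the gcd of the minimal polynomial p and p'. As F is a field and p = (p / g) g kills x,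
    one of the two factors does; minimality of p rules out g, since deg g < deg p, and then forces g
    to be constant. *)
Lemma Mx_coprime x : coprimep (mxminpoly (Mx x)) (mxminpoly (Mx x))^`().
Proof.
set p := mxminpoly _; have mp : p \is monic := mxminpoly_monic _.
have p0 := monic_neq0 mp; have sp : (1 < size p)%N by rewrite /p size_mxminpoly ltnS mxminpoly_nonconstant.
have sd : (size p^`() < size p)%N := lt_size_deriv p0.
have d0 : p^`() != 0.
  apply/eqP => /(congr1 (fun h : {poly rat} => h`_(size p).-2)); rewrite coef_deriv coef0 => /eqP.
  rewrite mulrn_eq0 /=; apply/negP; suff -> : (size p).-2.+1 = (size p).-1 by rewrite -lead_coefE lead_coef_eq0.
  by case: (size p) sp => [|[]].
pose g := gcdp p p^`(); have gp : g %| p := dvdp_gcdl _ _; have gd : g %| p^`() := dvdp_gcdr _ _.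
have := mx_root_minpoly (Mx x); rewrite -/p -{1}(divpK gp) rmorphM /= !horner_Mx -[_ * _]/(_ *m _) -MxM.
move=> /Mx_inj/eqP; rewrite mulf_eq0 => /orP[] /eqP e.
  have dv : p %| p %/ g by apply: mxminpoly_min; rewrite horner_Mx e -[Mx 0]/(MxR 0) rmorph0.
  have q0 : p %/ g != 0 by apply: contra_neq p0 => q0e; rewrite -(divpK gp) q0e mul0r.
  have := dvdp_leq q0 dv; rewrite size_divp ?gcdp_eq0 ?(negbTE p0) // => le.
  have sg : (0 < size g)%N by rewrite size_poly_gt0 gcdp_eq0 (negbTE p0).
  suff sg1 : size g = 1%N by rewrite /coprimep -[gcdp _ _]/g sg1.
  by move: le sg sp; move: (size p) (size g) => a b; lia.
have dv : p %| g by apply: mxminpoly_min; rewrite horner_Mx e -[Mx 0]/(MxR 0) rmorph0.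
by have := dvdp_leq d0 (dvdp_trans dv gd); rewrite leqNgt sd.
Qed.

(** The eigenvalues are roots of the integral equation of x, so the coefficients are algebraic
    integers as well as rational numbers. *)
Lemma char_poly_int x : integral x ->
  exists q : {poly int}, char_poly (Mx x) = map_poly intr q.
Proof.
case=> q [mq rq]; pose A := map_mx (ratr : rat -> algC) (Mx x).
have mA : map_poly (ratr : rat -> algC) (char_poly (Mx x)) = char_poly A by rewrite map_char_poly.
have [rs ers] := closed_field_poly_normal (char_poly A).
move: ers; rewrite (eqP (char_poly_monic A)) scale1r => ers.
have qA : horner_mx A (map_poly (intr : int -> algC) q) = 0.
  have e : horner_mx (Mx x) (map_poly (intr : int -> rat) q) = 0.
    rewrite horner_Mx -map_poly_comp /=.
    have -> : map_poly (r \o intr) q = map_poly (fun z : int => z%:~R) q.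
      by apply: eq_map_poly => z /=; rewrite rF_int.
    by rewrite (rootP rq) -[Mx 0]/(MxR 0) rmorph0.
  have := congr1 (map_mx (ratr : rat -> algC)) e; rewrite map_horner_mx map_mx0 -map_poly_comp => <-.
  by congr horner_mx; apply: eq_map_poly => z /=; rewrite ratr_int.
have Ai z : z \in rs -> z \in Aint.
  move=> zr; have : root (char_poly A) z by rewrite ers root_prod_XsubC.
  rewrite -root_mxminpoly => rz; apply: (@root_monic_Aint (map_poly intr q)).
  - by apply: root_dvdp rz; apply: mxminpoly_min.
  - exact: (monic_map intr mq).
  - by apply/polyOverP => i; rewrite (coef_map intr) /= intr_int.
have Ac i : (char_poly A)`_i \in Aint.
  suff /polyOverP : char_poly A \is a polyOver Aint by apply.
  rewrite ers big_seq; apply: rpred_prod => z zr; rewrite polyOverXsubC; exact: Ai.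
have [c hc] : exists c : nat -> int, forall i, (char_poly (Mx x))`_i = (c i)%:~R.
  apply: (@choice_ex _ _ (fun i (c : int) => (char_poly (Mx x))`_i = c%:~R)) => i; have h := Ac i.
  have /intrP[m em] : (char_poly A)`_i \is a Num.int.
    by apply: Cint_rat_Aint => //; rewrite -mA coef_map Crat_rat.
  exists m; apply: (fmorph_inj (ratr : {rmorphism rat -> algC})).
  by rewrite [RHS]rmorph_int -em -mA coef_map.
exists (\poly_(i < size (char_poly (Mx x))) c i); apply/polyP => i.
rewrite (coef_map intr) coef_poly; case: ltnP => [_|le]; first by rewrite hc.
by rewrite nth_default.
Qed.

Definition Nm x : rat := \det (Mx x).
Lemma NmM x y : Nm (x * y) = Nm x * Nm y. Proof. by rewrite /Nm MxM det_mulmx. Qed.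
Lemma Nm1 : Nm 1 = 1. Proof. by rewrite /Nm Mx1 det1. Qed.
Lemma Nm_neq0 x : x != 0 -> Nm x != 0.
Proof.
move=> x0; apply/eqP => e; have /eqP := Nm1.
by rewrite -(mulfV x0) NmM e mul0r eq_sym oner_eq0.
Qed.

Lemma Nm_int x : integral x -> exists z : int, Nm x = z%:~R.
Proof.
move=> /char_poly_int[q eq]; exists ((-1) ^+ n.+1 * q`_0).
have := char_poly_det (Mx x); rewrite eq (coef_map intr) /= rmorphM /= => ->.
by rewrite rmorphXn rmorphN1 mulrA -exprMn mulrNN mulr1 expr1n mul1r.
Qed.

Lemma Tr_int x : integral x -> exists z : int, \tr (Mx x) = z%:~R.
Proof.
move=> /char_poly_int[q eq]; exists (- q`_n).
have := @char_poly_trace _ n.+1 (Mx x) isT; rewrite eq (coef_map intr) /= rmorphN /= => ->.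
by rewrite opprK.
Qed.

(** By Cayley-Hamilton, the constant coefficient of the characteristic polynomial divided by x is an
    integral polynomial in x. *)
Lemma Nm_div x : integral x -> x != 0 -> integral (r (Nm x) / x).
Proof.
move=> ix x0; have [q eq] := char_poly_int ix.
have mq0 : map_poly r (char_poly (Mx x)) = map_poly intr q.
  by rewrite eq -map_poly_comp; apply: eq_map_poly => z /=; rewrite rF_int.
have e : (map_poly intr q).[x] = 0 :> F.
  by apply: Mx_inj; rewrite -mq0 -horner_Mx Cayley_Hamilton.
have e0 : r (Nm x) = (-1) ^+ n.+1 * (map_poly intr q)`_0.
  rewrite -mq0 coef_map /= char_poly_det rmorphM rmorphXn rmorphN1 mulrA -exprMn.
  by rewrite mulrNN mulr1 expr1n mul1r.
pose Q : {poly F} := map_poly intr q.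
have : Q`_0 / x = - (\sum_(i < (size Q).-1) Q`_i.+1 * x ^+ i).
  apply: (mulIf x0); rewrite divfK //; apply/eqP; rewrite -subr_eq0 mulNr opprK -[X in _ == X]e.
  rewrite horner_coef; case: (posnP (size Q)) => [s0|/prednK <-] /=.
    by rewrite s0 !big_ord0 mul0r addr0 nth_default // s0.
  rewrite big_ord_recl mulr1 mulr_suml; apply/eqP; congr (_ + _).
  by apply: eq_bigr => i _; rewrite /bump /= exprSr mulrA.
move=> eQ; apply: (proj2 (integralP _)) => P; have Px := proj1 (integralP x) ix P.
rewrite e0 -mulrA eQ; apply: plM; first by apply/plX/plN/pl1.
apply/plN/pl_sum => i _; apply: plM; last exact: plX.
by rewrite (coef_map intr); apply: place_int.
Qed.

Lemma Nm_small : exists2 K : rat, 0 <= K & forall x e, 0 <= e ->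
  (forall i, `|co x 0 i| <= e) -> `|Nm x| <= K * e ^+ n.+1.
Proof.
pose S := \sum_i \sum_j \sum_k `|Mx (w i) j k|.
have S0 : 0 <= S by do !apply: sumr_ge0 => ? _.
exists ((n.+1)`!%:R * S ^+ n.+1) => [|x e e0 hx]; first by rewrite mulr_ge0 ?exprn_ge0.
have ent j k : `|Mx x j k| <= S * e.
  rewrite Mx_sum summxE; apply: le_trans (ler_norm_sum _ _ _) _.
  rewrite /S mulr_suml; apply: ler_sum => i _; rewrite mxE normrM mulrC.
  apply: ler_pM => //; rewrite (bigD1 j) //= (bigD1 k) //= -addrA lerDl.
  by rewrite addr_ge0 //; do !apply: sumr_ge0 => ? _.
rewrite /Nm /determinant; apply: le_trans (ler_norm_sum _ _ _) _.
have -> : (n.+1)`!%:R * S ^+ n.+1 * e ^+ n.+1 = \sum_(s : 'S_n.+1) (S * e) ^+ n.+1.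
  by rewrite sumr_const card_Sn exprMn -mulrA mulr_natl.
apply: ler_sum => s _; rewrite normrM normrX normrN1 expr1n mul1r normr_prod.
rewrite -[X in _ <= _ ^+ X]card_ord -prodr_const; apply: ler_prod => i _.
by rewrite normr_ge0 ent.
Qed.
End MulMx.

(** * Embeddings into an algebraically closed field *)

Section Embeddings.
Variables (F : fieldType) (n : nat) (w : 'I_n.+1 -> F) (co : F -> 'rV[rat]_n.+1).
Hypothesis H : nfb w co.
Variable C : numClosedFieldType.
Let nF := nfb_nf H.
Let rq : {rmorphism rat -> C} := ratr.
Let M x : 'M[C]_n.+1 := map_mx rq (Mx w co x).

Lemma MC_B x y : M (x - y) = M x - M y.
Proof. by rewrite /M (MxB H) map_mxB. Qed.
Lemma MC_M x y : M (x * y) = M x *m M y.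
Proof. by rewrite /M (MxM H) map_mxM. Qed.
Lemma MC_sum x : M x = \sum_i rq (co x 0 i) *: M (w i).
Proof.
by rewrite /M {1}(Mx_sum H) map_mx_sum; apply: eq_bigr => i _; rewrite map_mxZ.
Qed.

Lemma MC_diagonalizable x : exists2 P, P \in unitmx & diagonalizable_for P (M x).
Proof.
apply/diagonalizableP; set p := mxminpoly (Mx w co x).
have [rs] := closed_field_poly_normal (map_poly rq p).
have mp : map_poly rq p \is monic by rewrite map_monic mxminpoly_monic.
rewrite (eqP mp) scale1r => ers; exists rs; last first.
  by rewrite -ers; apply: mxminpoly_min; rewrite -map_horner_mx mx_root_minpoly map_mx0.
rewrite -separable_prod_XsubC -ers separable_map separable_poly.unlock.
exact: Mx_coprime H x.
Qed.

Lemma codiag : exists2 P, P \in unitmx & forall x i j, i != j -> (P *m M x *m invmx P) i j = 0.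
Proof.
have [P Pu Pd] : exists2 P, P \in unitmx & all [pred A | diagonalizable_for P A] [seq M (w i) | i <- enum 'I_n.+1].
  apply/codiagonalizableP; split=> [_ _ /mapP[i _ ->] /mapP[j _ ->]|_ /mapP[i _ ->]].
    by rewrite /comm_mx -!MC_M mulrC.
  exact: MC_diagonalizable.
exists P => // x i j ij; rewrite MC_sum mulmx_sumr mulmx_suml summxE big1 // => k _.
rewrite -scalemxAr -scalemxAl mxE; have hk : M (w k) \in [seq M (w i) | i <- enum 'I_n.+1] by apply/mapP; exists k; rewrite ?mem_enum.
by have /= /(diagonalizable_forP _ Pu) -> := allP Pd _ hk; rewrite ?mulr0.
Qed.

(** Multiplication matrices commute and are diagonalizable, hence simultaneously so; the embeddings
    are the diagonal entries. Determinant and trace then give norm and trace at once. *)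
Lemma embed_ex : exists phi : 'I_n.+1 -> {rmorphism F -> C},
  [/\ forall x, rq (Nm w co x) = \prod_j phi j x,
      forall x, rq (\tr (Mx w co x)) = \sum_j phi j x
    & forall z : 'I_n.+1 -> C, (forall j, \sum_i z i * phi j (w i) = 0) -> forall i, z i = 0].
Proof.
have [P Pu Pd] := codiag; pose B x := P *m M x *m invmx P.
have BB x y : B (x - y) = B x - B y by rewrite /B MC_B mulmxBr mulmxBl.
have BM x y : B (x * y) = B x *m B y.
  by rewrite /B MC_M !mulmxA mulmxKV.
have B1 : B 1 = 1%:M by rewrite /B /M (Mx1 H) map_mx1 mulmx1 mulmxV.
have fB j : zmod_morphism (fun x => B x j j) by move=> x y; rewrite BB !mxE.
have fM j : monoid_morphism (fun x => B x j j).
  split; first by rewrite B1 mxE eqxx.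
  move=> x y; rewrite BM mxE (bigD1 j) //= big1 ?addr0 // => k kj.
  by rewrite [B x j k]Pd ?mul0r // eq_sym.
have Bd x : B x = diag_mx (\row_j B x j j).
  apply/matrixP => i j; rewrite [RHS]mxE; case: eqVneq => [->|ij]; first by rewrite mulr1n [RHS]mxE.
  by rewrite mulr0n; apply: Pd.
exists (fun j => rm_of (fB j) (fM j)); split.
- move=> x; transitivity (\det (B x)); last first.
    by rewrite Bd det_diag; apply: eq_bigr => j _; rewrite mxE.
  rewrite /B !det_mulmx det_inv mulrAC mulfV ?mul1r /M ?det_map_mx //.
  by rewrite -unitfE -unitmxE.
- move=> x; transitivity (\tr (B x)) => //.
  rewrite /B mxtrace_mulC mulmxA mulVmx // mul1mx /mxtrace rmorph_sum.
  by rewrite /M; apply: eq_bigr => i _; rewrite [RHS]mxE.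
- move=> z hz k.
  have e0 : \sum_i z i *: B (w i) = 0.
    apply/matrixP => i j; rewrite summxE mxE; have [<-|ij] := eqVneq i j.
      by rewrite -[RHS](hz i); apply: eq_bigr => l _; rewrite mxE.
    by rewrite big1 // => l _; rewrite mxE [B _ i j]Pd // mulr0.
  have e1 : \sum_i z i *: M (w i) = 0.
    have := congr1 (fun A => invmx P *m A *m P) e0; rewrite /= mulmx0 mul0mx => e0'.
    apply: etrans e0'; rewrite mulmx_sumr mulmx_suml; apply: eq_bigr => i _.
    by rewrite -scalemxAr -scalemxAl /B !mulmxA mulmxKV // mulVmx // mul1mx.
  have := congr1 (fun A => (map_mx rq (co 1) *m A) 0 k) e1.
  rewrite /= mulmx0 [RHS]mxE mulmx_sumr summxE => e2; apply: etrans e2; rewrite (bigD1 k) //= big1 ?addr0.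
    rewrite -scalemxAr mxE /M -map_mxM -(co_mul H) mul1r mxE (@co_uniq _ _ _ _ H _ (fun i => (i == k)%:R)).
      by rewrite eqxx rmorph1 mulr1.
    by rewrite (bigD1 k) //= eqxx rmorph1 mul1r big1 ?addr0 // => i /negbTE->; rewrite rmorph0 mul0r.
  move=> i ik; rewrite -scalemxAr mxE /M -map_mxM -(co_mul H) mul1r mxE (@co_uniq _ _ _ _ H _ (fun j => (j == i)%:R)).
    by rewrite eq_sym (negbTE ik) rmorph0 mulr0.
  by rewrite (bigD1 i) //= eqxx rmorph1 mul1r big1 ?addr0 // => j /negbTE->; rewrite rmorph0 mul0r.
Qed.

Section All.
Variable phi : 'I_n.+1 -> {rmorphism F -> C}.
Hypothesis hN : forall x, rq (Nm w co x) = \prod_j phi j x.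
Hypothesis hU : forall z : 'I_n.+1 -> C, (forall j, \sum_i z i * phi j (w i) = 0) -> forall i, z i = 0.

Lemma hom_rat (chi : {rmorphism F -> C}) x : chi x = \sum_i rq (co x 0 i) * chi (w i).
Proof.
rewrite {1}(coK H x) rmorph_sum; apply: eq_bigr => i _; rewrite rmorphM; congr (_ * _).
rewrite -[chi _]/((chi \o rF nF) _); set c := co x 0 i.
have d0 : (denq c)%:~R != 0 :> C by rewrite intr_eq0 denq_neq0.
apply: (mulIf d0); rewrite -[X in _ = _ * X]/(_) -{1}(rmorph_int (chi \o rF nF : {rmorphism rat -> C})).
rewrite -rmorphM -numqE rmorph_int.
by rewrite -(rmorph_int rq) -rmorphM -numqE rmorph_int.
Qed.

Lemma embed_unit : \matrix_(i, j) phi j (w i) \in unitmx.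
Proof.
rewrite unitmxE unitfE; apply/negP => /det0P[v v0 e].
have z0 : forall i, v 0 i = 0.
  apply: hU => j; have := congr1 (fun A : 'rV__ => A 0 j) e; rewrite !mxE => e'; apply: etrans e'.
  by apply: eq_bigr => i _; rewrite mxE.
by move/eqP: v0; apply; apply/rowP => i; rewrite z0 mxE.
Qed.

Lemma embed_dis i j : i != j -> exists y, phi i y != phi j y.
Proof.
move=> ij; apply/not_existsP => h; have := embed_unit; rewrite unitmxE unitfE -det_tr => /eqP; apply.
apply: (determinant_alternate ij) => k; rewrite !mxE; apply/eqP/negPn/negP; exact: h.
Qed.

(** The n + 1 embeddings span the linear forms, so any further homomorphism would be a combination
    of them, against Dedekind's independence. *)
Lemma embed_all (chi : {rmorphism F -> C}) : exists j, forall x, chi x = phi j x.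
Proof.
apply/not_existsP => no; pose W := \matrix_(i, j) phi j (w i).
pose c := invmx W *m \col_i chi (w i).
have ec i : chi (w i) = \sum_j c j 0 * phi j (w i).
  have : (W *m c) i 0 = chi (w i) by rewrite mulKVmx ?embed_unit // mxE.
  by move=> <-; rewrite mxE; apply: eq_bigr => j _; rewrite mxE mulrC.
have e x : chi x = \sum_j c j 0 * phi j x.
  rewrite hom_rat; under eq_bigr => i _ do rewrite ec mulr_sumr.
  rewrite exchange_big; apply: eq_bigr => j _ /=; rewrite (hom_rat (phi j)) mulr_sumr.
  by apply: eq_bigr => i _; rewrite mulrCA.
pose ch (i : 'I_n.+2) := if unlift ord0 i is Some j then phi j else chi.
pose d (i : 'I_n.+2) := if unlift ord0 i is Some j then c j 0 else -1.
have : d ord0 = 0.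
  apply: (@dedekind F C n.+2 ch d) => [i j|x]; last first.
    rewrite big_ord_recl (eq_bigr (fun j => c j 0 * phi j x)) => [|j _]; last by rewrite /d /ch liftK.
    by rewrite /d /ch unlift_none e mulN1r addNr.
  rewrite /ch; case: unliftP => [i' ->|->]; case: unliftP => [j' ->|->] ij.
  - by apply: embed_dis; apply: contraNneq ij => ->.
  - apply/not_existsP => h; apply: (no i') => y; apply/eqP/negPn/negP => h'; apply: (h y).
    by rewrite eq_sym.
  - apply/not_existsP => h; apply: (no j') => y; apply/eqP/negPn/negP => h'; exact: (h y).
  - by rewrite eqxx in ij.
by rewrite /d unlift_none => /eqP; rewrite oppr_eq0 oner_eq0.
Qed.
End All.
End Embeddings.

(** * Number fields: ideals and the class number *)

Section StrongApprox.
Variable F : fieldType.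
Hypothesis nF : number_field F.
Let G := nf_gl nF.

Lemma mx_prime_div (P : place F) a : (0 < a)%N -> mx P a%:R -> exists q, [/\ prime q, (q %| a)%N & mx P q%:R].
Proof.
elim/ltn_ind: a => a IH a0 ma; have [a1|a1] := leqP a 1.
  by have e : a = 1%N by [lia]; move: ma; rewrite e => /mx1F.
have pq := pdiv_prime a1; have qa := pdiv_dvd a.
move: ma; rewrite -(divnK qa) natrM; case/mx_prime => [||m|m]; try exact: pl_nat.
  have [||q [pq' qd mq]] := IH (a %/ pdiv a)%N _ _ m; first by rewrite ltn_Pdiv // prime_gt1.
    by rewrite divn_gt0 ?prime_gt0 // dvdn_leq.
  by exists q; split=> //; rewrite divnK //; apply: dvdn_trans qd (dvdn_div qa).
by exists (pdiv a); rewrite divnK.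
Qed.

Lemma mx_dvdn (P : place F) a b : (a %| b)%N -> mx P a%:R -> mx P b%:R.
Proof. by move=> /dvdnP[k ->] ma; rewrite natrM; apply: mxM => //; apply: pl_nat. Qed.

Lemma coprime_mx (P : place F) a b : coprime a b -> mx P a%:R -> ~ mx P b%:R.
Proof.
have [->|b0] := posnP b; first by rewrite /coprime gcdn0 => /eqP-> /mx1F.
move=> cop ma mb; have [k l e _] := egcdnP a b0.
move: cop; rewrite /coprime gcdnC => /eqP g1; rewrite g1 in e.
apply: (@mx1F _ P); have -> : 1 = k%:R * b%:R - l%:R * a%:R :> F.
  by rewrite -!natrM e natrD addrC addKr.
by apply: mxB; apply: mxM => //; apply: pl_nat.
Qed.

Lemma below (P : place F) : exists2 N : nat, (0 < N)%N & mx P N%:R.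
Proof.
have [n eb] := nf_ebase nF; have [|_ [[z ->] z0 mz]] := eb_mx eb (P := P).
  by move=> _ [z ->]; apply: place_int.
exists `|z|%N; first by rewrite absz_gt0 -(char0_intr nF).
case: z {z0} mz => k //; rewrite NegzE rmorphN abszN => /mxN; by rewrite opprK.
Qed.

(** Weak approximation prescribes y at the places over an integer N that lies in the maximal ideals
    of the support of D and of P0. Multiplication by the part of a denominator prime to N then
    removes the poles elsewhere without touching these places. *)
Lemma strong_approx (D : dvs F) (P0 : place F) : fsupp D ->
  exists x : munit F, (forall P, D P <= vl P (val x)) /\ vl P0 (val x) = D P0.
Proof.
case=> s hs; have [Nf hN] := choice_ex (fun P => (let: ex_intro2 N p q := below P in ex_intro _ N (conj p q))).
pose N := (\prod_(P <- P0 :: s) Nf P)%N.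
have N0 : (0 < N)%N by apply: prodn_gt0 => P; case: (hN P).
have mN (P : place F) : P \in P0 :: s -> mx P N%:R.
  by move=> Ps; apply: (mx_dvdn _ (proj2 (hN P))); rewrite /N (big_rem P) //= dvdn_mulr.
have [S0 hS0] := gl_supp G (x := N%:R) ltac:(by rewrite char0_natr // -lt0n).
pose S := undup S0.
have mS (P : place F) : mx P N%:R -> P \in S by move=> [_ h]; rewrite mem_undup; apply: hS0.
have [y y0 hy] := approx_vl G D (undup_uniq S0).
have [m m0 im] := integral_scale nF y.
pose a := `|m|%N; have a0 : (0 < a)%N by rewrite absz_gt0.
have ia : integral (a%:R * y).
  move: im; rewrite /a; case: (m) => k //; rewrite NegzE rmorphN abszN mulNr => /integralP h.
  by apply/integralP => P; rewrite -[_ * _]opprK; apply/plN/h.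
(* [m2] is a unit at the places over N and [m1] at all others, so m2 y has the valuation of y at the
   former and of the integral element a y at the latter. *)
pose m2 := (a`_(\pi(N)^'))%N; pose m1 := (a`_(\pi(N)))%N.
have am : a = (m1 * m2)%N by rewrite partnC.
have [m10 m20] : (0 < m1)%N /\ (0 < m2)%N by rewrite !part_gt0.
have nz k : (0 < k)%N -> k%:R != 0 :> F by rewrite char0_natr // -lt0n.
have u2 (P : place F) : P \in S -> mx P N%:R -> vl P m2%:R = 0.
  move=> _ mP; apply/(vl_eq0 G P (nz _ m20)); case: (vunit_mx (pl_nat P m2)) => // mm; case: (coprime_mx _ mP mm).
  apply: (@pnat_coprime \pi(N)); last exact: part_pnat.
  by rewrite pnat_pi.
have u1 (P : place F) : ~ mx P N%:R -> vl P m1%:R = 0.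
  move=> nP; apply/(vl_eq0 G P (nz _ m10)); case: (vunit_mx (pl_nat P m1)) => // /(mx_prime_div m10)[q [pq qd mq]].
  case: nP; apply: mx_dvdn mq; have := part_pnat \pi(N) a; rewrite -/m1 => /pnatP => /(_ m10 q pq qd).
  by rewrite mem_primes => /and3P[].
have x0 : m2%:R * y != 0 by rewrite mulf_neq0 ?nz.
exists (mu x0); have vx P : vl P (val (mu x0)) = vl P m2%:R + vl P y by rewrite /= (vlM G) // nz.
have onS (P : place F) : mx P N%:R -> vl P (val (mu x0)) = D P.
  by move=> mP; rewrite vx u2 ?mS // add0r hy // mS.
split=> [P|]; last by apply/onS/mN; rewrite mem_head.
have [mP|nP] := pselect (mx P N%:R); first by rewrite onS.
have -> : D P = 0.
  by apply/eqP/negPn/negP => dP; apply/nP/mN; rewrite inE hs ?orbT.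
rewrite vx; have /(vl_ge0 G) := proj1 (integralP _) ia P.
by rewrite mulf_neq0 ?nz // => /(_ isT); rewrite am natrM -mulrA (vlM G) ?nz // ?mulf_neq0 ?nz // u1 // add0r (vlM G) ?nz.
Qed.

Definition idl (D : dvs F) x := forall P, vge P (D P) x.

Lemma idl_val (D : dvs F) P : fsupp D -> exists x : munit F, idl D (val x) /\ vl P (val x) = D P.
Proof.
by move=> /(strong_approx P)[x [h1 h2]]; exists x; split=> // Q; right.
Qed.

Lemma idl0 x : idl 0 x <-> integral x.
Proof. by split=> [h|/integralP h]; [apply/integralP => P|move=> P]; apply/(vge0 G). Qed.

Lemma div_code (E : dvs F) : fsupp E -> exists (I : finType) (c : dvs F -> I), forall D D',
  (forall P, 0 <= D P <= E P) -> (forall P, 0 <= D' P <= E P) -> c D = c D' -> D = D'.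
Proof.
move=> /fsuppP[s [us hs]]; pose b := (\sum_(P <- s) `|E P|)%N.
exists {ffun 'I_(size s) -> 'I_b.+1}, (fun D => [ffun i => inord `|D (tnth (in_tuple s) i)|%N]).
move=> D D' h h' /ffunP e; apply/funext => P; have [Ps|nPs] := boolP (P \in s); last first.
  have E0 : E P = 0 by apply/eqP; apply: contraNT nPs => /hs.
  by have := h P; have := h' P; rewrite E0; lia.
have lt : (index P s < size s)%N by rewrite index_mem.
have := e (Ordinal lt); rewrite !ffunE (tnth_nth P) /= nth_index // => /(congr1 val).
have le : (`|E P| <= b)%N by rewrite /b (big_rem P) //= leq_addr.
have := h P; have := h' P => b1 b2.
have [l1 l2] : (`|D P| < b.+1)%N /\ (`|D' P| < b.+1)%N by split; lia.
rewrite /= !inordK // => e1; lia.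
Qed.
End StrongApprox.

(** * Hurwitz's finiteness of the class number *)

Section ClassNumber.
Variables (F : fieldType) (n : nat) (w : 'I_n.+1 -> F) (co : F -> 'rV[rat]_n.+1).
Hypothesis H : nfb w co.
Let nF := nfb_nf H.
Let G := nf_gl nF.

Lemma lattice_integral (z : 'I_n.+1 -> int) : integral (\sum_i (z i)%:~R * w i).
Proof.
apply/integralP => P; apply: pl_sum => i _; apply: plM; first exact: place_int.
exact: (proj1 (integralP _) (nfb_int H i) P).
Qed.

(** A substitute for Euclidean division, up to a bounded multiplier t: by pigeonhole two multiples
    of x have fractional coordinates in the same box of side 1/L. *)
Lemma hurwitz : exists2 M : nat, (0 < M)%N & forall x, exists t y,
  [/\ (0 < t <= M)%N, integral y & `|Nm w co (t%:R * x - y)| < 1].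
Proof.
(* L exceeds the constant K of [Nm_small], so coordinates of size 1/L give norm at most K / L^(n+1)
   < 1. *)
have [K K0 hK] := Nm_small H; pose L := (Num.truncn K).+1.
have KL : K < L%:R by apply: truncnS_gt.
exists (#|{ffun 'I_n.+1 -> 'I_L}|)%N; first by apply/card_gt0P; exists [ffun=> ord0].
move=> x; pose fr (t : nat) i : rat := let a := (t%:R * co x 0 i) in a - (Num.floor a)%:~R.
have fr01 t i : 0 <= fr t i < 1.
  by rewrite /fr /=; have := ge_floor (t%:R * co x 0 i); have := lt_succ_floor (t%:R * co x 0 i); rewrite intrD; lra.
have L0 : 0 < L%:R :> rat by rewrite ltr0n.
pose bx t : {ffun 'I_n.+1 -> 'I_L} := [ffun i => inord (Num.truncn (L%:R * fr t i))].
have bxE t i : ((bx t i : nat)%:R <= L%:R * fr t i < (bx t i : nat).+1%:R).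
  have [f0 f1] := andP (fr01 t i); rewrite ffunE inordK; first by rewrite truncn_itv // mulr_ge0 // ltW.
  rewrite -(ltr_nat rat) -/L; apply: le_lt_trans (_ : L%:R * fr t i < _).
    by rewrite truncn_le mulr_ge0 // ltW.
  by rewrite -[X in _ < X]mulr1 ltr_pM2l.
have [t1 [t2 [lt12 le2 eb]]] : exists t1 t2, [/\ (t1 < t2)%N, (t2 <= #|{ffun 'I_n.+1 -> 'I_L}|)%N & bx t1 = bx t2].
  pose f (i : 'I_(#|{ffun 'I_n.+1 -> 'I_L}|).+1) := bx i.
  have /injectivePn[i [j ij e]] : ~~ injectiveb f.
    apply/negP => /injectiveP/leq_card; by rewrite card_ord ltnn.
  have [lt|lt|/val_inj e'] := ltngtP i j; last by rewrite e' eqxx in ij.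
    by exists i, j; split=> //; rewrite -ltnS.
  by exists j, i; split=> //; rewrite -ltnS.
pose z i : int := Num.floor (t2%:R * co x 0 i) - Num.floor (t1%:R * co x 0 i).
exists (t2 - t1)%N, (\sum_i (z i)%:~R * w i); split; first by lia.
  exact: lattice_integral.
have coE i : co ((t2 - t1)%:R * x - \sum_i (z i)%:~R * w i) 0 i = fr t2 i - fr t1 i.
  apply: (@co_uniq _ _ _ _ H _ (fun i => fr t2 i - fr t1 i)).
  rewrite {1}(coK H x) mulr_sumr -sumrB; apply: eq_bigr => j _.
  rewrite mulrA -mulrBl; congr (_ * _); rewrite -(rF_int nF) -[(t2 - t1)%:R](rmorph_nat (rF nF)) -rmorphM -rmorphB.
  by congr (rF _ _); rewrite /fr /z /= natrB 1?ltnW // rmorphB /=; ring.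
apply: le_lt_trans (hK _ L%:R^-1 _ _) _; first by rewrite invr_ge0 ltW.
  move=> i; rewrite coE -(ler_pM2l L0) mulfV ?gt_eqF // -{1}[L%:R]gtr0_norm // -normrM mulrBr.
  have := bxE t1 i; have := bxE t2 i; rewrite eb -!natr1.
  by move: (L%:R * fr t2 i) (L%:R * fr t1 i) ((bx t2 i : nat)%:R) => u v c; rewrite ler_norml; lra.
rewrite -ltr_pdivlMr ?exprn_gt0 ?invr_gt0 // mul1r exprVn invrK.
apply: lt_le_trans KL _; rewrite exprS; apply: ler_peMr; [exact: ltW|by apply: exprn_ege1; rewrite ler1n].
Qed.

(** Let b be a nonzero element of least norm in an ideal. For c in the ideal some t <= M0 makes t c
    - y b of smaller norm, hence zero, so M0! c / b is always integral: the ideal divided by b lies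
    between the ring of integers and its multiple by 1 / M0!. *)
Lemma hurwitz_div : exists2 M : nat, (0 < M)%N & forall D, fsupp D ->
  exists x : munit F, forall P, 0 <= D P + vl P M%:R - vl P (val x) <= vl P M%:R.
Proof.
have [M0 M00 hM] := hurwitz; exists M0`!; first exact: fact_gt0.
have nM : (M0`!)%:R != 0 :> F by rewrite char0_natr // -lt0n fact_gt0.
move=> D0 fD0.
have ne (D : dvs F) : fsupp D -> exists x : munit F, forall P, D P <= vl P (val x).
  move=> fD; have [[P0 _]|no] := pselect (exists P : place F, True).
    by have [x [h _]] := strong_approx nF P0 fD; exists x.
  by exists 0 => P; case: no; exists P.
have [x0 hx0] := ne _ (subgN (@subg_fsupp F) fD0).
pose D := D0 + dv x0; have fD : fsupp D by apply: subgD (@subg_fsupp F) fD0 (fsupp_dv G x0).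
have D_ge0 P : 0 <= D P by have := hx0 P; rewrite dvsN /D dvsD /dv; lia.
have idl_int x : idl D x -> integral x.
  by move=> h; apply/integralP => P; apply/(vge0 G); case: (h P) => [->|le]; [left|right; apply: le_trans le; apply: D_ge0].
pose Q k := exists b : munit F, idl D (val b) /\ `|Nm w co (val b)| = k%:R.
have QI (b : munit F) : idl D (val b) -> exists2 k : nat, Q k & `|Nm w co (val b)| = k%:R.
  move=> ib; have [z ez] := Nm_int H (idl_int _ ib).
  have e : `|Nm w co (val b)| = `|z|%N%:R by rewrite ez -intr_norm -abszE -pmulrn.
  by exists `|z|%N => //; exists b.
have exQ : exists k, `[< Q k >].
  by have [b hb] := ne _ fD; have [|k hk _] := QI b; [move=> P; right|exists k; apply/asboolP].
case: (ex_minnP exQ) => k /asboolP[b [ib eb]] mink.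
have key (c : munit F) : idl D (val c) -> integral ((M0`!)%:R * val c / val b).
  move=> ic; have [t [y [/andP[t0 tM] iy small]]] := hM (val c / val b).
  have b0 := valP b; pose z := t%:R * val c - y * val b.
  have iz : idl D z.
    move=> P; apply: subgB; [exact: subg_vge| |].
      by rewrite -[D P]add0r; apply: (vgeM G); [apply/(vge0 G)/pl_nat|apply: ic].
    by rewrite -[D P]add0r; apply: (vgeM G); [apply/(vge0 G)/(proj1 (integralP _) iy)|apply: ib].
  have ez : z = val b * (t%:R * (val c / val b) - y) by rewrite /z; field.
  have z0 : z = 0.
    apply/eqP/negPn/negP => z0; have [k' Qk' ek'] := QI (mu z0) iz.
    have /mink : `[< Q k' >] by apply/asboolP.
    rewrite leqNgt -(ltr_nat rat) -ek' -eb /= ez (NmM H) normrM => /negP; apply.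
    by rewrite -[X in _ < X]mulr1 ltr_pM2l // normr_gt0 (Nm_neq0 H).
  have ey : y = t%:R * val c / val b.
    by apply: (mulIf b0); rewrite divfK //; apply/esym/subr0_eq.
  have /dvdnP[l el] : (t %| M0`!)%N by apply: dvdn_fact; rewrite t0.
  apply/integralP => P; rewrite el natrM -!mulrA [X in _ * X]mulrA -ey.
  by apply: plM; [apply: pl_nat|apply: (proj1 (integralP _) iy)].
exists (b - x0) => P; rewrite muB (vlD G) ?(valP b) ?(valP x0) //.
have -> : D0 P = D P - vl P (val x0) by rewrite /D dvsD /dv addrK.
have [c [ic vc]] := idl_val nF P fD.
have := proj1 (integralP _) (key c ic) P; have := valP b; have := valP c => /= c0 b0.
move/(vl_ge0 G) => /(_ _); rewrite !mulf_neq0 ?invr_eq0 // => /(_ isT).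
rewrite (vlD G) ?mulf_neq0 // (vlM G) // vc.
case: (ib P) => [e|]; first by rewrite e eqxx in b0.
move: (vl P (val b)) (vl P (val x0)) (vl P _) (D P) => p q r s; lia.
Qed.

Lemma class_number : exists h, idx (@fsupp F) (fun D => exists x, D = dv x) h.
Proof.
have [M M0 hM] := hurwitz_div; have nM : M%:R != 0 :> F by rewrite char0_natr // -lt0n.
have [I [c hc]] := div_code (fsupp_dv G (mu nM)).
pose red (D : dvs F) (x : munit F) := D + dv (mu nM) - dv x.
have redP D x P : red D x P = D P + vl P M%:R - vl P (val x) by [].
have [|||h _ hh] := @nc_cover (dvs F) I (fun D D' => exists x, D - D' = dv x) (@fsupp F)
  (fun D i => exists x, (forall P, 0 <= red D x P <= vl P M%:R) /\ c (red D x) = i).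
- split=> [D|D D' [x e]|D D' D'' [x e] [y e']].
  + by exists 0; rewrite subrr; apply/funext => P; rewrite /dv mu0 (vl1 G).
  + by exists (- x); rewrite -opprB e -[- x]sub0r (dvB G); apply/funext => P; rewrite dvsN dvsB /dv mu0 (vl1 G) sub0r.
  + exists (x + y); rewrite -(subrKA D') e e'; apply/funext => P.
    by rewrite /dv muD (vlM G) ?(valP x) ?(valP y).
- by move=> D fD; have [x hx] := hM D fD; exists (c (red D x)), x.
- move=> D D' i [x [hx ex]] [y [hy ey]]; exists (x - y).
  have := hc _ _ hx hy; rewrite ex ey => /(_ erefl) e.
  rewrite (dvB G); apply/eqP; rewrite -subr_eq0; apply/eqP.
  move: e; rewrite /red => /eqP; rewrite -subr_eq0 => /eqP <-; rewrite !opprB; ring.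
by exists h.
Qed.
End ClassNumber.

(** * Ideals as effective divisors *)

Section Ideals.
Variable F : fieldType.
Hypothesis nF : number_field F.
Let G := nf_gl nF.

Lemma nz_idl (D : dvs F) : fsupp D -> (forall P, 0 <= D P) -> nz_ideal (idl D).
Proof.
move=> fD D0; have ii x : idl D x -> integral x.
  by move=> h; apply/integralP => P; apply/(vge0 G); case: (h P) => [->|le]; [left|right; apply: le_trans le].
split=> //.
- by move=> P; left.
- by move=> x y hx hy P; apply: (subgD (subg_vge G P (D P))).
- by move=> r x /integralP ir hx P; rewrite -[D P]add0r; apply: (vgeM G) (hx P); apply/(vge0 G).
- have [[P0 _]|no] := pselect (exists P : place F, True).
    by have [x [hx _]] := idl_val nF P0 fD; exists (val x); split=> //; apply: valP x.
  by exists 1; split; [move=> P; case: no; exists P|apply: oner_neq0].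
Qed.

(** D takes the least valuations on I. For x satisfying the local conditions, the integral y with y
    x in I form an ideal; if it were proper, a place P would dominate it, while strong approximation
    yields a member that is a unit at P. *)
Lemma nz_divisor (I : F -> Prop) : nz_ideal I -> exists D : dvs F, [/\ fsupp D, forall P, 0 <= D P,
  forall x, I x <-> idl D x & forall P, exists2 x : munit F, I (val x) & vl P (val x) = D P].
Proof.
case=> Iint I0 ID IM [x0 [Ix0 x00]].
have intv (x : F) (P : place F) : integral x -> x != 0 -> 0 <= vl P x.
  by move=> /integralP h x0'; apply/(vl_ge0 G P x0').
have [D hD] : exists D : dvs F, forall P, (exists2 x : munit F, I (val x) & vl P (val x) = D P) /\
    forall x : munit F, I (val x) -> D P <= vl P (val x).
  apply: (@choice_ex _ _ (fun P d => (exists2 x : munit F, I (val x) & vl P (val x) = d) /\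
    forall x : munit F, I (val x) -> d <= vl P (val x))) => P.
  pose Q (k : nat) := exists2 x : munit F, I (val x) & vl P (val x) = k.
  have exQ : exists k, `[< Q k >].
    exists `|vl P x0|%N; apply/asboolP; exists (mu x00) => //=.
    by have := intv x0 P (Iint _ Ix0) x00; lia.
  case: (ex_minnP exQ) => k /asboolP Qk mk; exists k; split=> // x Ix.
  have := intv _ P (Iint _ Ix) (valP x) => h.
  have /mk : `[< Q `|vl P (val x)|%N >] by apply/asboolP; exists x => //; lia.
  by lia.
have D_ge0 P : 0 <= D P by have [[x Ix <-] _] := hD P; apply: intv (valP x); apply: Iint.
have fD : fsupp D.
  have [s hs] := fsupp_dv G (mu x00); exists s => P DP; apply: hs; have [_ /(_ (mu x00) Ix0) le] := hD P.
  by have := D_ge0 P; rewrite /dv /=; move: le; rewrite /=; lia.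
exists D; split=> //; last by move=> P; case: (hD P).
move=> x; split=> [Ix P|ix].
  have [->|x1] := eqVneq x 0; first by left.
  by right; apply: (proj2 (hD P) (mu x1)).
have [->//|x1] := eqVneq x 0.
pose A := @integral F; pose a y := integral y /\ I (y * x).
have sA : sring A.
  split; first by apply/integralP => P; apply: pl1.
    by move=> y z /integralP hy /integralP hz; apply/integralP => P; apply: plB.
  by move=> y z /integralP hy /integralP hz; apply/integralP => P; apply: plM.
have [_ AB AM] := sA.
have ix' : integral x.
  by apply/integralP => P; apply/(vge0 G); case: (ix P) => [->|le]; [left|right; apply: le_trans le].
have [[_]|na1] := pselect (a 1); first by rewrite mul1r.
have sI : sideal A a.
  split.
  - by split; [apply: sring0|rewrite mul0r].
  - by move=> y [].
  - move=> y z [iy Iy] [iz Iz]; split; first exact: AB.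
    rewrite mulrBl; apply: ID => //; rewrite -mulN1r; apply: IM => //.
    by apply/integralP => P; apply/plN/pl1.
  - by move=> y z iy [iz Iz]; split; [apply: AM|rewrite -mulrA; apply: IM].
have [|P [_ hP]] := place_dominating sA sI na1.
  by exists x0 => //; split; [apply: Iint|rewrite mulrC; apply: IM].
have [[y Iy vy] _] := hD P; have y0 := valP y.
(* An element c with these valuations makes c x / y integral, so that c x is in I. At P the
   prescribed value is 0, because y has the least valuation on I there. *)
pose E : dvs F := fun Q => Num.max 0 (- vl Q (x / val y)).
have fE : fsupp E.
  have xy0 : x / val y != 0 by rewrite mulf_neq0 ?invr_eq0.
  have [s hs] := fsupp_dv G (mu xy0); exists s => Q EQ; apply: hs; rewrite /dv /=.
  by apply: contraNneq EQ; rewrite /E => ->; rewrite oppr0 maxxx.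
have [c [hc vc]] := strong_approx nF P fE; have c0 := valP c.
have vyx : vl P (x / val y) = vl P x - vl P (val y) by rewrite (vlD G).
have DP : D P <= vl P x by case: (ix P) => [e|//]; rewrite e eqxx in x1.
exfalso; have : mx P (val c).
  apply: hP; split.
    by apply/integralP => Q; apply/(vl_ge0 G Q c0); apply: le_trans (hc Q); rewrite /E le_max lexx.
  have -> : val c * x = (val c * (x / val y)) * val y by rewrite -mulrA divfK.
  apply: IM => //; apply/integralP => Q; have xy0 : x / val y != 0 by rewrite mulf_neq0 ?invr_eq0.
  apply/(vl_ge0 G Q); rewrite ?mulf_neq0 ?invr_eq0 // (vlM G) //.
  have := hc Q; rewrite /E; move: (vl Q (val c)) (vl Q (x / val y)) => u v; lia.
move/(vl_gt0 G P c0); rewrite vc /E vyx vy; lia.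
Qed.

Lemma idl_inj (D E : dvs F) : fsupp D -> fsupp E -> (forall x, idl D x <-> idl E x) -> D = E.
Proof.
move=> fD fE h; apply/funext => P; apply/le_anti/andP; split.
  have [x [ix <-]] := idl_val nF P fE; have := (proj2 (h _) ix) P => -[e|//].
  by have := valP x; rewrite e eqxx.
have [x [ix <-]] := idl_val nF P fD; have := (proj1 (h _) ix) P => -[e|//].
by have := valP x; rewrite e eqxx.
Qed.

Lemma idl_scale (D : dvs F) (a : munit F) x : idl (D + dv a) x <-> exists2 y, idl D y & x = val a * y.
Proof.
have a0 := valP a; split=> [h|[y hy ->] P]; last by rewrite addrC; apply: (vgeM G) (hy P); right.
exists (x / val a); last by rewrite mulrC divfK.
move=> P; have -> : D P = (D + dv a) P + - vl P (val a) by rewrite dvsD /dv addrK.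
by apply: (vgeM G) (h P) _; right; rewrite (vlV G).
Qed.

Lemma idl_equiv (D E : dvs F) : fsupp D -> fsupp E ->
  ideal_equiv (idl D) (idl E) <-> exists x, D - E = dv x.
Proof.
move=> fD fE; split=> [[a [b [a0 b0 h]]]|[x e]].
  exists (mu b0 - mu a0); rewrite (dvB G).
  suff e : D + dv (mu a0) = E + dv (mu b0).
    by apply/eqP; rewrite subr_eq addrAC -subr_eq opprK addrC e addrC eqxx.
  have fS := @subg_fsupp F; apply: idl_inj => [||x].
  - exact: subgD fS fD (fsupp_dv G _).
  - exact: subgD fS fE (fsupp_dv G _).
  split=> /idl_scale[y hy ey]; apply/idl_scale.
    by have [|z [hz ez]] := proj1 (h x); [exists y|exists z].
  by have [|z [hz ez]] := proj2 (h x); [exists y|exists z].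
exists 1, (val x); split; rewrite ?oner_neq0 ?(valP x) // => y.
have e' : D = E + dv x by rewrite -e addrC subrK.
split=> [[z [hz ->]]|[z [hz ->]]].
  by rewrite mul1r; move: hz; rewrite e' => /idl_scale[t ht ->]; exists t.
by exists (val x * z); rewrite mul1r; split=> //; rewrite e'; apply/idl_scale; exists z.
Qed.

Lemma ideal_mul_nz (I J : F -> Prop) : nz_ideal I -> nz_ideal J -> nz_ideal (ideal_mul I J).
Proof.
case=> Ii I0 ID IM [x [Ix x0]] [Ji J0 JD JM [y [Jy y0]]]; split.
- move=> _ [s [hs ->]]; apply/integralP => P; rewrite big_seq; apply: pl_sum => pr /hs[/Ii/integralP h1 /Ji/integralP h2].
  exact: plM.
- by exists [::]; rewrite big_nil; split.
- move=> _ _ [s [hs ->]] [t [ht ->]]; exists (s ++ t); rewrite big_cat; split=> // pr.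
  by rewrite mem_cat => /orP[/hs|/ht].
- move=> r _ ir [s [hs ->]]; exists [seq (r * pr.1, pr.2) | pr <- s]; split.
    by move=> _ /mapP[pr /hs[h1 h2] ->] /=; split=> //; apply: IM.
  by rewrite big_map mulr_sumr; apply: eq_bigr => pr _ /=; rewrite mulrA.
- exists (x * y); split; last exact: mulf_neq0.
  by exists [:: (x, y)]; rewrite big_seq1; split=> // pr; rewrite inE => /eqP ->.
Qed.

Lemma ideal_mul_idl (D E : dvs F) : fsupp D -> fsupp E -> (forall P, 0 <= D P) -> (forall P, 0 <= E P) ->
  forall x, ideal_mul (idl D) (idl E) x <-> idl (D + E) x.
Proof.
move=> fD fE D0 E0; have [K [fK K0 hK vK]] := nz_divisor (ideal_mul_nz (nz_idl fD D0) (nz_idl fE E0)).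
suff -> : D + E = K by [].
apply/funext => P; rewrite dvsD; apply/le_anti/andP; split.
  have [x [s [hs ex]] <-] := vK P.
  have : vge P (D P + E P) (val x).
    rewrite ex big_seq; apply: (@subg_sum F (vge P (D P + E P)) _ s (fun pr => pr \in s) _ (subg_vge G P _)) => pr /hs[h1 h2].
    exact: (vgeM G).
  by case=> // e; have := valP x; rewrite e eqxx.
have [x [ix <-]] := idl_val nF P fD; have [y [iy <-]] := idl_val nF P fE.
have /hK /(_ P) : ideal_mul (idl D) (idl E) (val x * val y).
  by exists [:: (val x, val y)]; rewrite big_seq1; split=> // pr; rewrite inE => /eqP ->.
case=> [/eqP|]; first by rewrite mulf_eq0 (negbTE (valP x)) (negbTE (valP y)).
by rewrite (vlM G) ?(valP x) ?(valP y).
Qed.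

Lemma ideal_pow_idl (D : dvs F) k : fsupp D -> (forall P, 0 <= D P) ->
  forall x, ideal_pow (idl D) k x <-> idl (D *+ k) x.
Proof.
move=> fD D0; elim: k => [|k IH] x; first by rewrite mulr0n; split=> /(idl0 nF).
rewrite mulrS -ideal_mul_idl //.
- have e : ideal_pow (idl D) k = idl (D *+ k).
    by apply/funext => y; apply/propext.
  by rewrite /ideal_pow iterS -/(ideal_pow _ _) e.
- exact: subgMn (@subg_fsupp F) fD.
- by move=> P; rewrite dvsMn mulrn_wge0.
Qed.

Lemma principal_idl (D : dvs F) : fsupp D -> principal_ideal (idl D) <-> exists x, D = dv x.
Proof.
move=> fD; split=> [[a [a0 h]]|[x e]].
  exists (mu a0); apply: idl_inj => //; first exact: fsupp_dv G _.
  move=> x; rewrite -[dv _]add0r idl_scale h; split.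
    by case=> r [/(idl0 nF) ir ->]; exists r.
  by case=> r /(idl0 nF) ir ->; exists r.
exists (val x); split; first exact: valP x.
move=> y; rewrite e -[dv _]add0r idl_scale; split.
  by case=> r /(idl0 nF) ir ->; exists r.
by case=> r [/(idl0 nF) ir ->]; exists r.
Qed.

Lemma ideal_equiv_equivr : equivr (@ideal_equiv F).
Proof.
split=> [I|I J [a [b [a0 b0 h]]]|I J K [a [b [a0 b0 h]]] [c [d [c0 d0 h']]]].
- by exists 1, 1; split; rewrite ?oner_neq0.
- by exists b, a; split=> // x; split=> /h.
- exists (a * c), (b * d); split; rewrite ?mulf_neq0 // => x; split.
    case=> y [Iy ->]; have [|z [Jz ez]] := proj1 (h (a * y)); first by exists y.
    have [|t [Kt et]] := proj1 (h' (c * z)); first by exists z.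
    by exists t; split=> //; rewrite mulrAC ez mulrAC -mulrA et mulrA.
  case=> y [Ky ->]; have [|z [Jz ez]] := proj2 (h' (d * y)); first by exists y.
  have [|t [It et]] := proj2 (h (b * z)); first by exists z.
  by exists t; split=> //; rewrite -mulrA ez mulrCA et mulrCA mulrA.
Qed.

(** Each divisor class contains an effective divisor, so restricting to effective ones keeps the
    count, and these correspond to the nonzero integral ideals. *)
Lemma C_card_nf S N :
  idx (fun D => @fsupp F D /\ match S with None => True
    | Some Q => exists m, Q m /\ exists x, D *+ m = dv x end) (fun D => exists x, D = dv x) N ->
  C_card F S N.
Proof.
move=> hN; split=> [_|[]]; last by case: nF.
pose X0 (D : dvs F) := [/\ fsupp D, forall P, 0 <= D P & match S with None => True
    | Some Q => exists m, Q m /\ exists x, D *+ m = dv x end].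
have fS := @subg_fsupp F.
have eqv : equivr (fun D D' : dvs F => exists x, D - D' = dv x).
  split=> [D|D D' [x e]|D D' D'' [x e] [y e']].
  + by exists 0; rewrite subrr; apply/funext => P; rewrite /dv mu0 (vl1 G).
  + by exists (- x); rewrite -opprB e -[- x]sub0r (dvB G); apply/funext => P; rewrite dvsN dvsB /dv mu0 (vl1 G) sub0r.
  + exists (x + y); rewrite -(subrKA D') e e'; apply/funext => P.
    by rewrite /dv muD (vlM G) ?(valP x) ?(valP y).
have pos D : fsupp D /\ match S with None => True
    | Some Q => exists m, Q m /\ exists x, D *+ m = dv x end -> exists2 D', X0 D' & exists x, D - D' = dv x.
  case=> fD sD.
  have [x hx] : exists x : munit F, forall P, - D P <= vl P (val x).
    have [[P0 _]|no] := pselect (exists P : place F, True).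
      by have [x [h _]] := strong_approx nF P0 (subgN fS fD); exists x.
    by exists 0 => P; case: no; exists P.
  exists (D + dv x); last by exists (- x); rewrite opprD addNKr -[- x]sub0r (dvB G); apply/funext => P; rewrite dvsN dvsB /dv mu0 (vl1 G) sub0r.
  split.
  - exact: subgD fS fD (fsupp_dv G x).
  - by move=> P; have := hx P; rewrite dvsD /dv; lia.
  - case: (S) sD => // Q [m [Qm [y ey]]]; exists m; split=> //; exists (y + x *+ m).
    rewrite mulrnDl ey; apply/funext => P; rewrite dvsD dvsMn /dv muD muMn (vlM G) ?(valP y) ?expf_neq0 ?(valP x) //.
    by rewrite (vlX G) // (valP x).
have [_ /(_ hN) h1] := @nc_iso _ _ (fun D D' : dvs F => exists x, D - D' = dv x)
    (fun D D' : dvs F => exists x, D - D' = dv x) X0 (fun D => @fsupp F D /\ match S with None => True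
    | Some Q => exists m, Q m /\ exists x, D *+ m = dv x end) id N eqv
    (fun D '(And3 a b c) => conj a c) (fun D D' _ _ => conj id id)
    pos.
have powE (D : dvs F) m : fsupp D -> (forall P, 0 <= D P) -> ideal_pow (idl D) m = idl (D *+ m).
  by move=> fD D0; apply/funext => x; apply/propext; apply: ideal_pow_idl.
pose XI (I : F -> Prop) := nz_ideal I /\ match S with None => True
    | Some Q => exists m, Q m /\ principal_ideal (ideal_pow I m) end.
suff [h2 _] : nclasses (fun D D' : dvs F => exists x, D - D' = dv x) X0 N <->
  nclasses (@ideal_equiv F) XI N by apply: h2.
apply: (@nc_iso _ _ _ _ X0 XI (@idl F) N ideal_equiv_equivr).
- move=> D [fD D0 sD]; split; first exact: nz_idl.
  case: (S) sD => // Q [m [Qm hx]]; exists m; split=> //; rewrite powE //.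
  by apply/principal_idl => //; apply: subgMn.
- by move=> D D' [fD _ _] [fD' _ _]; apply: iff_sym; apply: idl_equiv.
- move=> I [nI sI]; have [D [fD D0 hD _]] := nz_divisor nI.
  have eI : I = idl D by apply/funext => x; apply/propext.
  exists D; last by rewrite eI; case: ideal_equiv_equivr.
  split=> //; case: (S) sI => // Q [m [Qm]]; rewrite eI powE // => /principal_idl h; exists m; split=> //.
  by apply: h; apply: subgMn.
Qed.
End Ideals.

(** * Number fields: units *)

Section FreePerm.
Variables (m g : nat) (t : 'I_m -> 'I_m).
Hypothesis g0 : (0 < g)%N.
Hypothesis tg : forall i, iter g t i = i.
Hypothesis tfree : forall k i, (0 < k < g)%N -> iter k t i != i.

Lemma free_inj : injective t.
Proof.
move=> i j e; rewrite -(tg i) -(tg j) -(prednK g0) !iterSr e //.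
Qed.

Lemma free_uniq a b i : (a < g)%N -> (b < g)%N -> iter a t i = iter b t i -> a = b.
Proof.
wlog ab : a b / (a <= b)%N.
  by move=> h la lb e; case: (leqP a b) => [/h|/ltnW/h h']; [apply|apply/esym/h'].
move=> _ lb e; have [->//|ne] := eqVneq a b.
have inj : injective (iter a t) by elim: (a) => // k IH x y /= /free_inj/IH.
have [] := negP (@tfree (b - a) i _); first lia.
by apply/eqP/inj; rewrite -iterD subnKC // e.
Qed.

Lemma free_rep : exists (r : 'I_m -> 'I_m) (k : 'I_m -> nat),
  [/\ forall i, r (t i) = r i, forall i, (k i < g)%N & forall i, i = iter (k i) t (r i)].
Proof.
have cs := fconnect_sym free_inj; pose r := froot t.
have h i : exists k, (k < g)%N /\ i = iter k t (r i).
  have c : fconnect t (r i) i by rewrite cs connect_root.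
  exists (findex t (r i) i %% g)%N; rewrite ltn_mod; split=> //.
  rewrite -{1}(iter_findex c) {1}(divn_eq (findex t (r i) i) g) addnC iterD; congr (iter _ _ _).
  by elim: (_ %/ g)%N => // q IH; rewrite mulSn iterD IH tg.
have [k hk] := choice_ex h; exists r, k; split=> i; try by case: (hk i).
by apply/eqP; rewrite eq_sym /r (root_connect cs) fconnect1.
Qed.

Let T (f : 'I_m -> int) : 'I_m -> int := fun i => f (t i).

Lemma iter_T k f i : iter k T f i = f (iter k t i).
Proof. by elim: k i => //= k IH i; rewrite /T IH -iterSr. Qed.

Lemma trc_T k f i : trc T k f i = \sum_(j < k) f (iter j t i).
Proof.
rewrite /trc; elim: k => [|k IH]; first by rewrite !big_ord0.
by rewrite !big_ord_recr -IH /= -iter_T.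
Qed.

(** An invariant function is the trace of its restriction to a set of orbit representatives. *)
Lemma free_H0 f : T f = f -> exists f', f = trc T g f'.
Proof.
move=> Tf; have [r [k [rt kg kE]]] := free_rep.
exists (fun i => if k i == 0%N then f i else 0); apply/funext => i; rewrite trc_T.
have iT j : iter j T f = f by elim: j => //= j ->.
have ft j i' : f (iter j t i') = f i' by rewrite -iter_T iT.
have kt j : (j < g)%N -> k (iter j t i) = ((k i + j) %% g)%N.
  move=> jg; apply: (@free_uniq _ _ (r i)); rewrite ?ltn_mod //.
  have rj : r (iter j t i) = r i by elim: (j) => //= j' <-.
  rewrite -{1}rj -kE {1}(kE i) -iterD addnC {1}(divn_eq (k i + j) g) addnC iterD; congr (iter _ _ _).
  by elim: (_ %/ g)%N => // q IH; rewrite mulSn iterD IH tg.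
pose j0 := ((g - k i) %% g)%N; have j0g : (j0 < g)%N by rewrite ltn_mod.
rewrite (bigD1 (Ordinal j0g)) //= big1 ?addr0.
  rewrite kt // /j0 modnDmr subnKC ?modnn ?ft // ltnW //; exact: kg.
move=> j jj0; rewrite kt //; case: eqP => // e; case/eqP: jj0; apply: val_inj => /=.
have /dvdnP[q eq] : (g %| k i + j)%N by apply/eqP.
have := kg i; have := ltn_ord j; rewrite /j0 => lj lk.
have [k0|k0] := posnP (k i).
  by rewrite k0 subn0 modnn; move: eq; rewrite k0; case: q => [|q]; rewrite ?mulSn; lia.
by rewrite modn_small; move: eq; case: q => [|[|q]]; rewrite ?mulSn; lia.
Qed.

(** The preimage consists of partial sums along each orbit, starting at the representative. *)
Lemma free_H1 f : trc T g f = 0 -> exists f', f = T f' - f'.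
Proof.
move=> N0; have [r [k [rt kg kE]]] := free_rep.
exists (fun i => \sum_(j < k i) f (iter j t (r i))); apply/funext => i.
rewrite -[RHS]/(\sum_(j < k (t i)) f (iter j t (r (t i))) - \sum_(j < k i) f (iter j t (r i))) rt.
have [lt|ge] := ltnP (k i).+1 g.
  have -> : k (t i) = (k i).+1.
    by apply: (@free_uniq _ _ (r i)) => //; rewrite -{1}rt -kE iterS -kE.
  by rewrite big_ord_recr /= addrAC subrr add0r -kE.
have eg : (k i).+1 = g by apply/eqP; rewrite eqn_leq kg.
have -> : k (t i) = 0%N.
  by apply: (@free_uniq _ _ (r i)) => //; rewrite -{1}rt -kE {1}(kE i) -iterS eg tg.
rewrite big_ord0 sub0r; apply/eqP; rewrite -addr_eq0 addrC; apply/eqP.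
have := congr1 (fun h => h (r i)) N0; rewrite /= trc_T -eg big_ord_recr /= -kE.
by [].
Qed.
End FreePerm.

(** * Herbrand quotients and subgroups of finite index *)

Section HerbrandIndex.
Variables (W : zmodType) (s : W -> W) (g : nat) (E E' : W -> Prop).
Hypothesis sB : forall x y, s (x - y) = s x - s y.
Hypothesis sg : forall x, iter g s x = x.
Hypotheses (sE : subg E) (sE' : subg E') (EE : forall x, E' x -> E x).
Hypotheses (Es : forall x, E x -> E (s x)) (E's : forall x, E' x -> E' (s x)).

Lemma idx_image (u : W -> W) n : (forall x y, u (x - y) = u x - u y) ->
  idx E E' n -> exists a b, [/\ idx (fun y => exists2 x, E x & y = u x) (fun y => exists2 x, E' x & y = u x) a,
    idx (fun x => E x /\ u x = 0) (fun x => E' x /\ u x = 0) b & n = (a * b)%N].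
Proof.
move=> uB hn; have u0 := morB0 uB; have uD := morBD uB.
pose K x := u x = 0; have sK : subg K by split=> // x y Kx Ky; rewrite /K uB Kx Ky subrr.
pose EK x := exists a b, [/\ E' a, E b /\ K b & x = a + b].
have sEI : subg (fun x => E x /\ K x) by apply: subgI.
have sEI' : subg (fun x => E' x /\ K x) by apply: subgI.
have sEK : subg EK by apply: subgP.
have E'EK x : E' x -> EK x.
  by move=> h; exists x, 0; rewrite addr0; split=> //; split; rewrite ?/K ?u0 //; apply: subg0.
have EKE x : EK x -> E x by case=> a [b [/EE Ea [Eb _] ->]]; apply: subgD.
have [a [b [ha hb e]]] := idx_sub sE sEK sE' E'EK EKE hn.
exists a, b; split=> //.
- have sI : subg (fun y => exists2 x, E' x & y = u x).
    split; first by exists 0; [apply: subg0|rewrite u0].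
    by move=> _ _ [x hx ->] [y hy ->]; exists (x - y); [apply: subgB|rewrite uB].
  apply: (proj1 (@idx_hom _ _ u E EK _ _ a sE sI uB _ _ _)) ha => [x Ex|x Ex|y [x Ex ->]].
  + by exists x.
  + split=> [[c [d [Ec [_ Kd] ->]]]|[c Ec e']].
      by exists c; rewrite // uD Kd addr0.
    exists c, (x - c); split=> //; last by rewrite addrC subrK.
    split; first by apply: subgB => //; apply: EE.
    by rewrite /K uB e' subrr.
  + by exists x; rewrite ?subrr //; exists 0; [apply: subg0|rewrite u0].
- apply: (proj2 (@idx_hom _ _ id (fun x => E x /\ K x) (fun x => E' x /\ K x) EK E' b sEI sE' _ _ _ _)) hb => //.
  + by move=> x [Ex Kx]; exists 0, x; rewrite add0r; split=> //; apply: subg0.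
  + by move=> x [Ex Kx]; split=> // -[].
  + by move=> y [c [d [Ec hd ->]]]; exists d; rewrite // addrK.
Qed.

(** The Herbrand quotient of a finite module is 1: the index of E' in E is factored through s - 1
    and through the norm, and the two factorizations are compared. Thus E inherits the quotient r of
    E', whose H^0 is trivial. *)
Lemma herbrand_finite n r : idx E E' n ->
  idx (fun x => E' x /\ trc s g x = 0) (fun x => exists y, E' y /\ x = s y - y) r ->
  idx (fun x => E' x /\ s x = x) (fun x => exists y, E' y /\ x = trc s g y) 1 ->
  exists2 h0, idx (fun x => E x /\ s x = x) (fun x => exists y, E y /\ x = trc s g y) h0
  & idx (fun x => E x /\ trc s g x = 0) (fun x => exists y, E y /\ x = s y - y) (r * h0)%N.
Proof.
move=> hn h1' h0'; pose D x := s x - x; pose N := trc s g.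
have DB x y : D (x - y) = D x - D y by apply: sub_comm.
have NB := trcB sB g; have N0 := morB0 NB; have D0 := morB0 DB.
have [a [b [ha hb e1]]] := idx_image DB hn; have [c [d [hc hd e2]]] := idx_image NB hn.
have NE x : E x -> E (N x).
  move=> Ex; apply: subg_sum => // i _; elim: (val i) => //= k; exact: Es.
have NE' x : E' x -> E' (N x).
  move=> Ex; apply: subg_sum => // i _; elim: (val i) => //= k; exact: E's.
have sN x : s (N x) = N x by apply/eqP; rewrite -subr_eq0 trc_s // sg subrr.
have ND x : N (D x) = 0 by rewrite /N /D trc_sub // sg subrr.
have Ds x : D x = 0 <-> s x = x.
  by rewrite /D; split=> [/eqP|->]; rewrite ?subrr // subr_eq0 => /eqP.
have sDs x : s x = x -> D x = 0 by move=> /Ds.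
pose im (u : W -> W) (X : W -> Prop) y := exists2 x, X x & y = u x.
have sim (u : W -> W) X : (forall x y, u (x - y) = u x - u y) -> subg X -> subg (im u X).
  move=> uB sX; split; first by exists 0; [apply: subg0|rewrite (morB0 uB)].
  by move=> _ _ [x hx ->] [y hy ->]; exists (x - y); [apply: subgB|rewrite uB].
have sker (u : W -> W) X : (forall x y, u (x - y) = u x - u y) -> subg X -> subg (fun x => X x /\ u x = 0).
  by move=> uB sX; apply: subgI => //; split=> [|x y ux uy]; rewrite ?(morB0 uB) // uB ux uy subrr.
have imE (u : W -> W) X y : (exists x, X x /\ y = u x) <-> im u X y.
  by split=> [[x [h ->]]|[x h ->]]; exists x.
have h1'2 : idx (fun x => E' x /\ N x = 0) (im D E') r.
  by apply: idx_ext h1' => // x; apply: imE.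
have h0'2 : idx (fun x => E' x /\ D x = 0) (im N E') 1.
  by apply: idx_ext h0' => x; [split=> -[? /Ds]|apply: imE].
have i1 : idx (fun x => E x /\ N x = 0) (im D E') (d * r)%N.
  apply: idx_mul hd h1'2; try exact: sker; try exact: sim.
    by move=> _ [x Ex ->]; split; [apply: subgB => //; apply: E's|apply: ND].
  by move=> x [/EE].
have [h1 [a' [hh1 ha' e3]]] : exists n m, [/\ idx (fun x => E x /\ N x = 0) (im D E) n, idx (im D E) (im D E') m & (d * r)%N = (n * m)%N].
  apply: idx_sub i1; try exact: sker; try exact: sim.
    by move=> _ [x /EE Ex ->]; exists x.
  by move=> _ [x Ex ->]; split; [apply: subgB => //; apply: Es|apply: ND].
have i0 : idx (fun x => E x /\ D x = 0) (im N E') (b * 1)%N.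
  apply: idx_mul hb h0'2; try exact: sker; try exact: sim.
    by move=> _ [x Ex ->]; split; [apply: NE'|apply/Ds/sN].
  by move=> x [/EE].
have [h0 [c' [h02 hc' bb]]] : exists h0 c', [/\ idx (fun x => E x /\ D x = 0) (im N E) h0, idx (im N E) (im N E') c' & (b * 1 = h0 * c')%N].
  apply: idx_sub i0; try exact: sker; try exact: sim.
    by move=> _ [x /EE Ex ->]; exists x.
  by move=> _ [x Ex ->]; split; [apply: NE|apply/Ds/sN].
have ec : c' = c by apply: idx_uniq hc' hc; apply: sim.
rewrite {}ec {hc'} in bb.
have aa : a' = a by apply: idx_uniq ha' ha; apply: sim.
have n0 := idx_pos sE hn.
exists h0.
  by apply: idx_ext h02 => x; [split=> -[? /Ds]|apply: iff_sym; apply: imE].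
suff -> : (r * h0)%N = h1 by apply: idx_ext hh1 => // x; apply: iff_sym; apply: imE.
have c0 : (0 < c)%N by move: n0; rewrite e2; case: (c).
have a0 : (0 < a)%N by move: n0; rewrite e1; case: (a).
have d0 : (0 < d)%N by move: n0; rewrite e2 muln_gt0 => /andP[].
move: e3 e1 e2 bb; rewrite aa muln1 => e3 e1 e2 bb.
have : (a * (h0 * c) = c * d)%N by rewrite -bb -e1.
rewrite mulnCA [RHS]mulnC mulnCA mulnC => /eqP.
rewrite mulnAC eqn_pmul2r // => /eqP ed.
by apply/eqP; rewrite -(eqn_pmul2r a0) -e3 -ed -mulnA mulnC.
Qed.
End HerbrandIndex.

Lemma morB_Mz (W W' : zmodType) (s : W -> W') : (forall x y, s (x - y) = s x - s y) ->
  forall x (z : int), s (x *~ z) = s x *~ z.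
Proof.
move=> sB x; case=> k; first by rewrite -!pmulrn (morB_Mn sB).
by rewrite !NegzE !mulrNz (morBN sB) -!pmulrn (morB_Mn sB).
Qed.

(** * The Herbrand quotient of a unit lattice *)

Section UnitLattice.
Variables (R : archiRealFieldType) (W : zmodType) (s : W -> W) (g m : nat) (E : W -> Prop).
Variables (l : 'I_m -> W -> R) (t : 'I_m -> 'I_m).
Hypothesis sB : forall x y, s (x - y) = s x - s y.
Hypothesis sg : forall x, iter g s x = x.
Hypotheses (sE : subg E) (Es : forall x, E x -> E (s x)).
Hypothesis g0 : (0 < g)%N.
Hypothesis tg : forall i, iter g t i = i.
Hypothesis tfree : forall k i, (0 < k < g)%N -> iter k t i != i.
Hypothesis m0 : (0 < m)%N.
Hypothesis lB : forall j x y, l j (x - y) = l j x - l j y.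
Hypothesis l_s : forall j x, l j (s x) = l (t j) x.
Hypothesis l_sum : forall x, E x -> \sum_j l j x = 0.
Hypothesis l_fin : forall B, exists L : seq W, forall x, E x -> (forall j, `|l j x| <= B) -> x \in L.
Variable eta : 'I_m -> W.
Hypothesis E_eta : forall i, E (eta i).
Hypothesis eta_neg : forall i j, i != j -> l j (eta i) < 0.

Lemma l0 j : l j 0 = 0.
Proof. by rewrite -(subrr 0) lB subrr. Qed.
Lemma lD j x y : l j (x + y) = l j x + l j y.
Proof. by rewrite -[y in LHS]opprK lB -[- y]sub0r lB l0 sub0r opprK. Qed.
Lemma l_iter k j x : l j (iter k s x) = l (iter k t j) x.
Proof. by elim: k j => //= k IH j; rewrite l_s IH -iterSr. Qed.
Lemma l_bigsum I (r : seq I) (f : I -> W) j : l j (\sum_(i <- r) f i) = \sum_(i <- r) l j (f i).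
Proof. by elim/big_rec2: _ => [|i a b _ <-]; rewrite ?l0 ?lD. Qed.
Lemma lMz j x (z : int) : l j (x *~ z) = z%:~R * l j x.
Proof.
have h k : l j (x *+ k) = k%:R * l j x.
  by elim: k => [|k IH]; rewrite ?mulr0n ?l0 ?mul0r // mulrS lD IH -natr1 mulrDl mul1r addrC.
case: z => k; first by rewrite -!pmulrn h.
by rewrite NegzE mulrNz -[- _]sub0r lB l0 sub0r -pmulrn h rmorphN /= mulNr -pmulrn.
Qed.
Lemma E_iter k x : E x -> E (iter k s x).
Proof. by move=> Ex; elim: k => //= k; apply: Es. Qed.

(* averaging the given units over the group makes the family equivariant *)
Definition eps i := \sum_(k < g) iter k s (eta (iter k t i)).

Lemma eps_E i : E (eps i).
Proof. by apply: subg_sum => // k _; apply: E_iter. Qed.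

Lemma t_inj : injective t. Proof. exact: (free_inj g0 tg). Qed.

Lemma eps_neg i j : i != j -> l j (eps i) < 0.
Proof.
move=> ij; rewrite /eps l_bigsum; have inj k : injective (iter k t) by elim: k => // k IH x y /= /t_inj/IH.
have h (k : 'I_g) : l j (iter k s (eta (iter k t i))) < 0.
  by rewrite l_iter eta_neg // (inj_eq (inj k)).
case: (g) g0 h => // g' _ h; rewrite big_ord_recl.
by apply: ltr_wnDr; [apply: sumr_le0 => k _; apply/ltW/h|apply: h].
Qed.

Lemma s_eps i : s (eps (t i)) = eps i.
Proof.
rewrite /eps (morB_sum sB).
rewrite -[RHS](@big_cyc_shift W 0 +%R g (fun k => iter k s (eta (iter k t i)))) ?sg ?tg //.
by apply: eq_bigr => k _; rewrite -iterSr.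
Qed.

Definition theta (f : 'I_m -> int) : W := \sum_i eps i *~ f i.
Lemma thetaB f h : theta (f - h) = theta f - theta h.
Proof. by rewrite /theta -sumrB; apply: eq_bigr => i _; rewrite -mulrzBr. Qed.
Lemma theta_E f : E (theta f).
Proof. by apply: subg_sum => // i _; apply: subgMz (eps_E i). Qed.
Lemma s_theta f : s (theta f) = theta (fun i => f (t i)).
Proof.
rewrite /theta (morB_sum sB) (reindex_inj t_inj) /=; apply: eq_bigr => i _.
by rewrite (morB_Mz sB) s_eps.
Qed.
Lemma l_theta f j : l j (theta f) = \sum_i (f i)%:~R * l j (eps i).
Proof. by rewrite /theta l_bigsum; apply: eq_bigr => i _; rewrite lMz. Qed.

(** Minkowski's criterion: the logarithms l_j(eps_i) are negative off the diagonal and sum to zero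
    over j. Summed over the j with v_j > 0, a relation becomes a sum of nonnegative terms, one of
    them positive unless all v_j are. *)
Lemma same_sign (v : 'I_m -> R) : (forall j, \sum_i v i * l j (eps i) = 0) ->
  (exists i, 0 < v i) -> forall i, 0 < v i.
Proof.
move=> h [i0 v0] i1; rewrite ltNge; apply/negP => v1.
have e0 : \sum_(j | 0 < v j) \sum_i v i * l j (eps i) = 0 by rewrite big1.
have e i : \sum_(j | 0 < v j) l j (eps i) = - \sum_(j | ~~ (0 < v j)) l j (eps i).
  by have := l_sum (eps_E i); rewrite (bigID (fun j => 0 < v j)) /= => /eqP; rewrite addr_eq0 => /eqP.
have pos i : 0 <= v i * \sum_(j | 0 < v j) l j (eps i).
  have [vi|vi] := boolP (0 < v i).
    rewrite e mulr_ge0 ?ltW // oppr_gt0; rewrite (bigD1 i1) /= -?leNgt //.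
    apply: ltr_wnDr; last by apply: eps_neg; apply: contraTneq vi => ->; rewrite -leNgt.
    by apply: sumr_le0 => j /andP[vj _]; apply/ltW/eps_neg; apply: contraNneq vj => <-.
  apply: mulr_le0; first by rewrite leNgt.
  apply: sumr_le0 => j vj; apply/ltW/eps_neg.
  by apply: contraNneq vi => ->.
move: e0; rewrite exchange_big /=; under eq_bigr => i _ do rewrite -mulr_sumr.
move/eqP; rewrite psumr_eq0 // => /allP /(_ i0); rewrite mem_index_enum => /(_ isT).
rewrite implyTb mulf_eq0 gt_eqF //= e oppr_eq0 => /eqP e1.
have : \sum_(j | ~~ (0 < v j)) l j (eps i0) < 0.
  rewrite (bigD1 i1) /= -?leNgt //; apply: ltr_wnDr; last first.
    by apply: eps_neg; apply: contraTneq v0 => ->; rewrite -leNgt.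
  by apply: sumr_le0 => j /andP[vj _]; apply/ltW/eps_neg; apply: contraNneq vj => <-.
by rewrite e1 ltxx.
Qed.

Lemma zero_sum_zero (v : 'I_m -> R) : (forall j, \sum_i v i * l j (eps i) = 0) ->
  \sum_i v i = 0 -> forall i, v i = 0.
Proof.
move=> h s0; have np w : (forall j, \sum_i w i * l j (eps i) = 0) -> \sum_i w i = 0 -> forall i, w i <= 0.
  move=> hw sw i; rewrite leNgt; apply/negP => wi; have p := same_sign hw (ex_intro _ i wi).
  have : 0 < \sum_i w i.
    rewrite (bigD1 i) //=; apply: ltr_wpDr; last exact: p.
    by apply: sumr_ge0 => j _; apply/ltW/p.
  by rewrite sw ltxx.
move=> i; apply/le_anti; rewrite np //= -oppr_le0; apply: (np (fun i => - v i)).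
  by move=> j; under eq_bigr => k _ do rewrite mulNr; rewrite sumrN h oppr0.
by rewrite sumrN s0 oppr0.
Qed.

Definition lbound := \sum_i \sum_j `|l j (eps i)|.

Lemma l_theta_bound (x : 'I_m -> R) u : (forall j, l j u = \sum_i x i * l j (eps i)) ->
  forall j, `|l j (u - theta (fun i => Num.floor (x i)))| <= lbound.
Proof.
move=> hx j; rewrite lB hx l_theta -sumrB; apply: le_trans (ler_norm_sum _ _ _) _.
apply: ler_sum => i _; rewrite -mulrBl normrM.
apply: (@le_trans _ _ (1 * `|l j (eps i)|)).
  apply: ler_wpM2r => //; have := ge_floor (x i); have := lt_succ_floor (x i).
  rewrite intrD ler_norml; lra.
by rewrite mul1r (bigD1 j) //= lerDl sumr_ge0.
Qed.

(** Logarithm vectors of units are real combinations of those of the [eps i]. Rounding the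
    coefficients leaves units with logarithms at most [lbound], of which there are finitely many. *)
Lemma theta_index : exists n, idx E (fun x => exists f, x = theta f) n.
Proof.
have [L hL] := l_fin lbound.
have sT : subg (fun x => exists f, x = theta f).
  split; first by exists 0; rewrite -[0 in RHS](subrr 0) thetaB subrr.
  by move=> _ _ [f ->] [h ->]; exists (f - h); rewrite thetaB.
(* The matrix of logarithms is singular because its rows sum to zero. Adding 1 to each entry makes
   it invertible, and summing over j shows that solutions found with A have coefficient sum zero, so
   that they solve the original system. *)
pose A : 'M[R]_m := \matrix_(i, j) (l j (eps i) + 1).
have Au : A \in unitmx.
  rewrite unitmxE unitfE; apply/negP => /det0P[v v0 e].
  have ev j : \sum_i v 0 i * l j (eps i) + \sum_i v 0 i = 0.
    have := congr1 (fun B : 'rV__ => B 0 j) e; rewrite !mxE => e'; apply: etrans e'.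
    by rewrite -big_split; apply: eq_bigr => i _; rewrite mxE mulrDr mulr1.
  have s0 : \sum_i v 0 i = 0.
    have : \sum_j (\sum_i v 0 i * l j (eps i) + \sum_i v 0 i) = 0 by rewrite big1.
    rewrite big_split /= exchange_big /= [X in X + _]big1 ?add0r.
      by rewrite sumr_const card_ord => /eqP; rewrite mulrn_eq0 eqn0Ngt m0 => /eqP.
    by move=> i _; rewrite -mulr_sumr l_sum ?mulr0 //; apply: eps_E.
  case/negP: v0; apply/eqP/rowP => i; rewrite mxE; apply: (zero_sum_zero (v := fun i => v 0 i)) => // j.
  by have := ev j; rewrite s0 addr0.
have solve u : E u -> exists x : 'I_m -> R, forall j, l j u = \sum_i x i * l j (eps i).
  move=> Eu; pose v := (\row_j l j u) *m invmx A.
  have vA : v *m A = \row_j l j u by rewrite mulmxKV.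
  have ev j : l j u = \sum_i v 0 i * l j (eps i) + \sum_i v 0 i.
    have := congr1 (fun B : 'rV__ => B 0 j) vA; rewrite /= [RHS]mxE mxE => <-.
    by rewrite -big_split; apply: eq_bigr => i _; rewrite [A i j]mxE mulrDr mulr1.
  have s0 : \sum_i v 0 i = 0.
    have := l_sum Eu; under eq_bigr => j _ do rewrite ev.
    rewrite big_split /= exchange_big /= [X in X + _]big1 ?add0r.
      by rewrite sumr_const card_ord => /eqP; rewrite mulrn_eq0 eqn0Ngt m0 => /eqP.
    by move=> i _; rewrite -mulr_sumr l_sum ?mulr0 //; apply: eps_E.
  by exists (fun i => v 0 i) => j; rewrite ev s0 addr0.
have [|||n _ hn] := @nc_cover W 'I_(size L) (fun x y => exists f, x - y = theta f) E
    (fun x i => exists f, x - theta f = nth 0 L i).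
- exact: subg_eqv sT.
- move=> u Eu; have [x hx] := solve u Eu; have b := l_theta_bound hx.
  have uL := hL _ (subgB sE Eu (theta_E _)) b.
  have lt : (index (u - theta (fun i => Num.floor (x i)))%R L < size L)%N by rewrite index_mem.
  by exists (Ordinal lt), (fun i => Num.floor (x i)); rewrite nth_index.
- move=> x y i [f ef] [h eh]; exists (f - h); rewrite thetaB.
  move: ef; rewrite -eh => /eqP; rewrite subr_eq => /eqP ->.
  by rewrite addrAC [X in X + _]addrAC subrr add0r addrC.
by exists n.
Qed.

(** By [same_sign] a nonzero relation has all its coordinates nonzero and of one sign, so one
    coordinate determines it and the relations form a cyclic group. A nonzero relation exists by
    pigeonhole on the rounded multiples of a real one. *)
Lemma theta_kernel : exists2 k : 'I_m -> int, (forall i, 0 < k i) /\ theta k = 0 &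
  forall f, theta f = 0 -> exists c : int, f = k *~ c.
Proof.
pose i0 := Ordinal m0.
have sgn f : theta f = 0 -> (exists i, 0 < f i) -> forall i, 0 < f i.
  move=> e [i fi] j; have := @same_sign (fun i => (f i)%:~R) _ (ex_intro _ i _) j.
  by rewrite !ltr0z; apply=> // j'; rewrite -l_theta e l0.
have thN f : theta (- f) = - theta f.
  exact: morBN thetaB f.
have z0 f : theta f = 0 -> f i0 = 0 -> f = 0.
  move=> e f0; apply/funext => i; apply/eqP; rewrite eq_le; apply/andP; split.
    rewrite leNgt; apply/negP => fi; have := sgn _ e (ex_intro _ i fi) i0; by rewrite f0 ltxx.
  rewrite leNgt; apply/negP => fi; have eN : theta (- f) = 0 by rewrite thN e oppr0.
  have fi' : 0 < (- f) i by rewrite -[(- f) i]/(- f i) oppr_gt0.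
  have := sgn _ eN (ex_intro _ i fi') i0; by rewrite -[(- f) i0]/(- f i0) f0 oppr0 ltxx.
have [v [vi vl]] : exists v : 'I_m -> R, (forall i, 0 < v i) /\ forall j, \sum_i v i * l j (eps i) = 0.
  pose A : 'M[R]_m := \matrix_(i, j) l j (eps i).
  have : \det A == 0.
    rewrite -det_tr; apply/det0P; exists (const_mx 1).
      by apply/eqP => /rowP/(_ i0)/eqP; rewrite !mxE oner_eq0.
    apply/rowP => i; rewrite !mxE -[RHS](l_sum (eps_E i)); apply: eq_bigr => j _.
    by rewrite !mxE mul1r.
  case/det0P => v v0 e; have ev j : \sum_i v 0 i * l j (eps i) = 0.
    have := congr1 (fun B : 'rV__ => B 0 j) e; rewrite !mxE => e'; apply: etrans e'.
    by apply: eq_bigr => i _; rewrite mxE.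
  have [i vi] : exists i, v 0 i != 0.
    apply/existsP; apply: contraNT v0; rewrite negb_exists => /forallP h.
    by apply/eqP/rowP => i; rewrite mxE; apply/eqP; move: (h i); rewrite negbK.
  move: vi; rewrite neq_lt => /orP[vi|vi].
    have evN j : \sum_i (- v 0 i) * l j (eps i) = 0.
      by under eq_bigr => k _ do rewrite mulNr; rewrite sumrN ev oppr0.
    exists (fun i => - v 0 i); split=> //; apply: (same_sign evN); exists i; by rewrite oppr_gt0.
  by exists (fun i => v 0 i); split=> //; apply: (same_sign ev); exists i.
have [L hL] := l_fin lbound.
(* With T v(i0) >= 1 the rounded multiples [F a] have strictly increasing coordinate at i0, so two
   of them with the same image differ. *)
pose T := (Num.truncn (v i0)^-1).+1.
have Tv : 1 <= T%:R * v i0.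
  by rewrite -ler_pdivrMr // mul1r ltW // truncnS_gt.
pose F (a : nat) (i : 'I_m) : int := Num.floor ((a * T)%:R * v i).
have FL a : theta (F a) \in L.
  apply: hL => [|j]; first exact: theta_E.
  have := @l_theta_bound (fun i => (a * T)%:R * v i) 0 _ j; rewrite sub0r -[- _]sub0r lB l0 sub0r normrN; apply.
  by move=> j'; rewrite l0; under eq_bigr => i _ do rewrite -mulrA; rewrite -mulr_sumr vl mulr0.
have Fmon a b : (a < b)%N -> F a i0 < F b i0.
  move=> ab; rewrite -(ltr_int R); have := ge_floor ((a * T)%:R * v i0).
  have := lt_succ_floor ((b * T)%:R * v i0); rewrite intrD /F.
  have : (a * T)%:R * v i0 + 1 <= (b * T)%:R * v i0.
    apply: (@le_trans _ _ ((a * T)%:R * v i0 + T%:R * v i0)); first by rewrite lerD2l.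
    by rewrite -mulrDl -natrD -mulSnr; apply: ler_wpM2r; [exact/ltW|rewrite ler_nat leq_mul2r ab orbT].
  lra.
have [a [b [ab eab]]] : exists a b, (a < b)%N /\ theta (F a) = theta (F b).
  pose f (i : 'I_(size L).+1) := index (theta (F i)) L.
  have fl i : (f i < size L)%N by rewrite index_mem.
  have /injectivePn[i [j ij e]] : ~~ injectiveb (fun i => Ordinal (fl i)).
    by apply/negP => /injectiveP/leq_card; rewrite !card_ord ltnn.
  have e' : theta (F i) = theta (F j).
    by rewrite -(nth_index 0 (FL i)) -(nth_index 0 (FL j)); congr nth; case: e.
  have [lt|lt|/val_inj e''] := ltngtP i j; last by rewrite e'' eqxx in ij.
    by exists i, j.
  by exists j, i.
pose Q (n : nat) := (0 < n)%N /\ exists2 k, theta k = 0 & k i0 = n.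
have exQ : exists n, `[< Q n >].
  exists `|F b i0 - F a i0|%N; apply/asboolP; have := Fmon _ _ ab => lt; split; first lia.
  exists (F b - F a); first by rewrite thetaB eab subrr.
  by rewrite -[(F b - F a) i0]/(F b i0 - F a i0); lia.
case: (ex_minnP exQ) => n /asboolP[n0 [k k0 kn]] mn; exists k.
  by split=> //; apply: sgn => //; exists i0; rewrite kn.
move=> f f0; exists (f i0 %/ n)%Z; apply/eqP; rewrite -subr_eq0; apply/eqP; apply: z0.
  by rewrite thetaB f0 (morB_Mz thetaB) k0 mul0rz subrr.
have kz z i : (k *~ z) i = k i * z.
  by rewrite (@morB_Mz _ _ (fun h : 'I_m -> int => h i)) // mulrzz.
rewrite -[(_ - _) i0]/(f i0 - (k *~ _) i0) kz kn; apply/eqP/negPn/negP => ne.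
have n0' : (n : int) != 0 by rewrite eqz_nat -lt0n.
pose rr := (f i0 %% n)%Z.
have re : rr = f i0 - n%:Z * (f i0 %/ n)%Z by rewrite /rr /modz mulrC.
have r0 : 0 <= rr by apply: modz_ge0.
have rn : rr < n by apply: ltz_pmod; rewrite ltz_nat.
have : `[< Q `|rr|%N >].
  apply/asboolP; split; first by rewrite absz_gt0 re.
  exists (f - k *~ (f i0 %/ n)%Z); last first.
    by rewrite -[(_ - _) i0]/(f i0 - (k *~ _) i0) kz kn -re; lia.
  by rewrite thetaB f0 (morB_Mz thetaB) k0 mul0rz subrr.
by move/mn; lia.
Qed.

(** The image of [theta] is Z^m / Z k with Z^m cohomologically trivial and k invariant. Dimension
    shifting gives H^0 = H^1(Z) = 0 and H^-1 = H^0(Z) of order g; E contains it with finite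
    index. *)
Lemma unit_herbrand : exists2 h0,
  idx (fun x => E x /\ s x = x) (fun x => exists y, E y /\ x = trc s g y) h0 &
  idx (fun x => E x /\ trc s g x = 0) (fun x => exists y, E y /\ x = s y - y) (g * h0)%N.
Proof.
have [n hn] := theta_index; have [k [kpos k0] kgen] := theta_kernel.
pose T (f : 'I_m -> int) : 'I_m -> int := fun i => f (t i).
have TB f h : T (f - h) = T f - T h by [].
have sT f : s (theta f) = theta (T f) by apply: s_theta.
have th0 : theta 0 = 0 := morB0 thetaB.
have trT f : trc s g (theta f) = theta (trc T g f).
  rewrite /trc (morB_sum thetaB); apply: eq_bigr => i _.
  by elim: (val i) => //= j ->; rewrite sT.
pose tot (f : 'I_m -> int) := \sum_i f i.
have totT f : tot (T f) = tot f by rewrite /tot /T [RHS](reindex_inj t_inj).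
have totB f h : tot (f - h) = tot f - tot h by rewrite /tot -sumrB.
have totk : 0 < tot k.
  rewrite /tot (bigD1 (Ordinal m0)) //=; apply: ltr_wpDr; last exact: kpos.
  by apply: sumr_ge0 => i _; apply/ltW/kpos.
have totMz f z : tot (f *~ z) = tot f * z by rewrite (morB_Mz totB) mulrzz.
(* T k is again a relation, hence T k - k is a multiple of k; its total is zero while that of k is
   positive. *)
have Tk : T k = k.
  have [c ec] := kgen (T k - k) ltac:(by rewrite thetaB -sT k0 subr0 (morB0 sB)).
  apply: subr0_eq; rewrite ec; have := totMz k c; rewrite -ec totB totT subrr => /esym/eqP.
  by rewrite mulf_eq0 gt_eqF //= => /eqP c0; rewrite ec c0 mulr0z.
have sE' : subg (fun x => exists f, x = theta f).
  split; first by exists 0.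
  by move=> _ _ [f ->] [h ->]; exists (f - h); rewrite thetaB.
apply: (@herbrand_finite W s g E (fun x => exists f, x = theta f) sB sg sE sE' _ Es _ n g hn) => //.
- by move=> _ [f ->]; apply: theta_E.
- by move=> _ [f ->]; exists (T f); rewrite sT.
(* The trace of kk is k. A function whose trace is c k equals c kk up to a coboundary, and g kk
   equals k, which [theta] kills, up to a coboundary; so the multiples of kk below g represent the
   classes. *)
- have [kk ekk] := free_H0 g0 tg tfree Tk.
  exists (fun i : 'I_g => theta (kk *+ i)); split.
  + move=> i; split; first by exists (kk *+ i).
    by rewrite (morB_Mn thetaB) (morB_Mn (trcB sB g)) trT -ekk k0 mul0rn.
  + move=> i j [_ [[f ->]]]; rewrite sT -!thetaB => /eqP; rewrite -subr_eq0 -thetaB => /eqP /kgen[c ec].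
    have trTB := trcB TB g.
    have Tg x : iter g T x = x by apply/funext => a; rewrite (iter_T t) tg.
    have tD h : trc T g (T h - h) = 0 by rewrite trc_sub // Tg subrr.
    have e1 := congr1 (trc T g) ec; move: e1.
    rewrite trTB tD subr0 trTB !(morB_Mn trTB) -ekk (morB_Mz trTB) trc_fix //.
    rewrite !pmulrn -mulrzBr -mulrzA => /(congr1 tot); rewrite !totMz => /(mulfI (lt0r_neq0 totk)) e.
    apply: val_inj; have := ltn_ord i; have := ltn_ord j => lj li; move: e.
    have [-> |[c1|c1]] : c = 0 \/ (1 <= c \/ c <= -1) by lia.
    * by rewrite mulr0 /=; lia.
    * have : g%:Z <= g%:Z * c by rewrite ler_peMr.
      by move: (g%:Z * c) => y; lia.
    * have : g%:Z * c <= - g%:Z by rewrite -mulrN1 ler_pM2l ?ltz_nat.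
      by move: (g%:Z * c) => y; lia.
  + move=> _ [[f ->]]; rewrite trT => /kgen[c ec].
    have g0' : (g : int) != 0 by rewrite eqz_nat -lt0n.
    pose q := (c %/ g)%Z; pose r := `|(c %% g)%Z|%N.
    have rE : (r : int) = (c %% g)%Z by rewrite /r abszE ger0_norm ?modz_ge0.
    have rg : (r < g)%N by rewrite -ltz_nat rE ltz_pmod // ltz_nat.
    exists (Ordinal rg) => /=.
    have z0 : trc T g (f - kk *+ r - k *~ q) = 0.
      have trTB := trcB TB g; rewrite !trTB ec (morB_Mn trTB) -ekk (morB_Mz trTB) trc_fix //.
      rewrite !pmulrn -!mulrzA -!mulrzBr; have -> : c - r%:Z - g%:Z * q = 0; last by rewrite mulr0z.
      by rewrite rE /q /modz; lia.
    have [f' ef'] := free_H1 g0 tg tfree z0.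
    exists (theta f'); split; first by exists f'.
    rewrite sT -thetaB -[T f' - f']ef' !thetaB (morB_Mz thetaB) k0 mul0rz subr0 //.
- apply: idx_ext (idx1 (A := fun x => (exists f, x = theta f) /\ s x = x) _) => [//|x|].
    split=> [[[f ->]]|[y [[f ->] ->]]]; last first.
      rewrite trT; split; first by exists (trc T g f).
      by apply/eqP; rewrite -trT -subr_eq0 trc_s // sg subrr.
    rewrite sT => /eqP; rewrite -subr_eq0 -thetaB => /eqP/kgen[c ec].
    have Tf : T f = f.
      apply: subr0_eq; rewrite ec; have := totMz k c; rewrite -ec totB totT subrr => /esym/eqP.
      by rewrite mulf_eq0 gt_eqF //= => /eqP c0; rewrite ec c0 mulr0z.
    have [f' ef'] := free_H0 g0 tg tfree Tf.
    by exists (theta f'); split; [exists f'|rewrite trT -ef'].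
  by apply: subgI => //; split=> [|x y ex ey]; rewrite ?(morB0 sB) // sB ex ey.
Qed.
End UnitLattice.

(** * Geometry of numbers and the units of a number field *)

Section Archimedean.
Variables (R : realType) (F : fieldType) (n : nat) (w : 'I_n.+1 -> F) (co : F -> 'rV[rat]_n.+1).
Hypothesis H : nfb w co.
Let C := R[i].
Variable phi : 'I_n.+1 -> {rmorphism F -> C}.
Hypothesis hN : forall x, ratr (Nm w co x) = \prod_j phi j x.
Hypothesis hT : forall x, ratr (\tr (Mx w co x)) = \sum_j phi j x.
Hypothesis hU : forall z : 'I_n.+1 -> C, (forall j, \sum_i z i * phi j (w i) = 0) -> forall i, z i = 0.
Let nF := nfb_nf H.
Let G := nf_gl nF.

Lemma emb_inj i j : (forall x, phi i x = phi j x) -> i = j.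
Proof.
move=> h; apply/eqP/negPn/negP => ij; have [y] := embed_dis hU ij.
by rewrite h eqxx.
Qed.

Definition cj_ex j := embed_all H hU (conjc \o phi j : {rmorphism F -> C}).
Definition cj j : 'I_n.+1 := sval (cid (cj_ex j)).
Lemma cjE j x : phi (cj j) x = conjc (phi j x).
Proof. by rewrite /cj; case: cid => k /= ->. Qed.
Lemma cjK j : cj (cj j) = j.
Proof. by apply: emb_inj => x; rewrite !cjE conjcK. Qed.

Definition av (j : 'I_n.+1) (x : F) : R := Normc.normc (phi j x).
Lemma normc_ge0 (z : C) : 0 <= Normc.normc z.
Proof. by case: z => a b; apply: sqrtr_ge0. Qed.
Lemma avM j x y : av j (x * y) = av j x * av j y.
Proof. by rewrite /av rmorphM Normc.normcM. Qed.
Lemma avV j x : av j x^-1 = (av j x)^-1.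
Proof. by rewrite /av fmorphV Normc.normcV. Qed.
Lemma av_ge0 j x : 0 <= av j x. Proof. exact: normc_ge0. Qed.
Lemma av_gt0 j x : x != 0 -> 0 < av j x.
Proof.
move=> x0; rewrite lt_def av_ge0 andbT; apply: contraNneq x0 => /Normc.eq0_normc/eqP.
by rewrite fmorph_eq0.
Qed.
Lemma normc_conj (z : C) : Normc.normc (conjc z) = Normc.normc z.
Proof. by case: z => a b /=; rewrite sqrrN. Qed.
Lemma av_cj j x : av (cj j) x = av j x.
Proof. by rewrite /av cjE normc_conj. Qed.
Lemma normc_int (z : int) : Normc.normc (z%:~R : C) = (`|z|%N)%:R.
Proof.
rewrite -(rmorph_int (real_complex R)) /= expr0n addr0 sqrtr_sqr -intr_norm.
by rewrite -abszE -pmulrn.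
Qed.
Lemma normc_prod (f : 'I_n.+1 -> C) : Normc.normc (\prod_j f j) = \prod_j Normc.normc (f j).
Proof. by elim/big_rec2: _ => [|i a b _ <-]; rewrite ?Normc.normc1 ?Normc.normcM. Qed.
Lemma normc_sum (f : 'I_n.+1 -> C) : Normc.normc (\sum_j f j) <= \sum_j Normc.normc (f j).
Proof.
elim/big_rec2: _ => [|i a b _ h]; first by rewrite Normc.normc0.
by apply: le_trans (le_normcD _ _) _; rewrite lerD2l.
Qed.

Lemma Nav x (z : int) : Nm w co x = z%:~R -> \prod_j av j x = (`|z|%N)%:R.
Proof. by move=> e; rewrite -normc_prod -hN e ratr_int normc_int. Qed.

Lemma Tav x (z : int) : \tr (Mx w co x) = z%:~R -> (`|z|%N)%:R <= \sum_j av j x.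
Proof. by move=> e; rewrite -normc_int -(ratr_int C) -e hT; apply: normc_sum. Qed.

Let zt y : int := numq (\tr (Mx w co y)).

Lemma ztP y : integral y -> \tr (Mx w co y) = (zt y)%:~R.
Proof. by move=> /(Tr_int H)[z e]; rewrite /zt e numq_int. Qed.

Lemma integralM (x y : F) : integral x -> integral y -> integral (x * y).
Proof. by move=> /integralP hx /integralP hy; apply/integralP => P; apply: plM. Qed.

(** Bounded conjugates leave finitely many values for the integers Tr(x w_i), and these determine x:
    if z pairs to zero with every w_i, then Tr(z / z) would vanish. *)
Lemma bounded_fin (B : R) : exists L : seq F, forall x, integral x -> (forall j, av j x <= B) -> x \in L.
Proof.
pose T := \sum_i \sum_j av j (w i).
pose N := (Num.truncn (B * T)).+1.
have BN : B * T < N%:R by apply: truncnS_gt.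
pose code x : {ffun 'I_n.+1 -> 'I_(N + N)} := [ffun i => insubd (Ordinal (ltn0Sn _ : 0 < N + N)%N) `|(zt (x * w i) + N%:Z)%R|%N].
have small x i : integral x -> (forall j, av j x <= B) -> (`|zt (x * w i)| < N)%N.
  move=> ix hx; rewrite -(ltr_nat R); apply: le_lt_trans BN.
  apply: le_trans (Tav (ztP (integralM ix (nfb_int H i)))) _.
  have B0 : 0 <= B := le_trans (av_ge0 ord0 x) (hx ord0).
  rewrite /T mulr_sumr [X in _ <= X](bigD1 i) //= -[X in X <= _]addr0; apply: lerD.
    by rewrite mulr_sumr; apply: ler_sum => j _; rewrite avM ler_wpM2r ?av_ge0.
  by apply: sumr_ge0 => k _; rewrite mulr_ge0 // sumr_ge0 // => j _; apply: av_ge0.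
have codeP x y : integral x -> (forall j, av j x <= B) -> integral y -> (forall j, av j y <= B) -> code x = code y -> x = y.
  move=> ix hx iy hy /ffunP e.
  have ez i : zt (x * w i) = zt (y * w i).
    have := small _ i ix hx; have := small _ i iy hy; have := congr1 val (e i); rewrite !ffunE !val_insubd.
    by move: (zt _) (zt _) => a b; case: ifP; case: ifP; lia.
  apply/eqP; rewrite -subr_eq0; apply/negPn/negP => d0.
  have t0 i : \tr (Mx w co ((x - y) * w i)) = 0.
    by rewrite mulrBl (MxB H) raddfB /= !ztP ?ez ?subrr //; apply: integralM => //; apply: (nfb_int H).
  have : \tr (Mx w co ((x - y) * (x - y)^-1)) = 0.
    rewrite [X in Mx _ _ (_ * X)](coK H) mulr_sumr -[Mx _ _ _]/(MxR H _) rmorph_sum raddf_sum big1 // => i _.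
    rewrite -[LHS]/(\tr (Mx w co ((x - y) * (rF nF (co (x - y)^-1 0 i) * w i)))).
    by rewrite mulrCA (MxM H) (Mx_r H) mul_scalar_mx mxtraceZ t0 mulr0.
  by rewrite mulfV // (Mx1 H) mxtrace1 => /eqP; rewrite pnatr_eq0.
exists [seq xget 0 [set x | [/\ integral x, forall j, av j x <= B & code x = c]]%classic | c <- enum {ffun 'I_n.+1 -> 'I_(N + N)}].
move=> x ix hx; apply/mapP; exists (code x); first by rewrite mem_enum.
case: xgetP => [y _ [iy hy ey]|/(_ x)[]//].
by apply: codeP.
Qed.

(** Real coordinates on the Minkowski space: of two conjugate embeddings the one with the smaller
    index contributes the real part, the other one the imaginary part. *)
Definition yv (j : 'I_n.+1) (x : F) : R := if (j <= cj j)%N then complex.Re (phi j x) else complex.Im (phi j x).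

Lemma abs_Re (z : C) : `|complex.Re z| <= Normc.normc z.
Proof.
by case: z => a b /=; rewrite -sqrtr_sqr ler_wsqrtr // lerDl sqr_ge0.
Qed.
Lemma abs_Im (z : C) : `|complex.Im z| <= Normc.normc z.
Proof.
by case: z => a b /=; rewrite -sqrtr_sqr ler_wsqrtr // lerDr sqr_ge0.
Qed.
Lemma normc_le (z : C) (e : R) : `|complex.Re z| <= e -> `|complex.Im z| <= e -> Normc.normc z <= 2 * e.
Proof.
case: z => a b /= ha hb; have e0 : 0 <= e := le_trans (normr_ge0 _) ha.
rewrite -[2 * e]ger0_norm ?mulr_ge0 // -sqrtr_sqr ler_wsqrtr //.
have : a ^+ 2 <= e ^+ 2 by rewrite -[a ^+ 2]real_normK ?num_real // ler_sqr ?nnegrE.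
have : b ^+ 2 <= e ^+ 2 by rewrite -[b ^+ 2]real_normK ?num_real // ler_sqr ?nnegrE.
rewrite exprMn; nra.
Qed.

Lemma yvB j x y : yv j (x - y) = yv j x - yv j y.
Proof. by rewrite /yv rmorphB; case: ifP => _; rewrite raddfB. Qed.

Lemma yv_av j x : `|yv j x| <= av j x.
Proof. by rewrite /yv /av; case: ifP => _; [apply: abs_Re|apply: abs_Im]. Qed.

Lemma av_yv (d : 'I_n.+1 -> R) x : (forall j, d (cj j) = d j) -> (forall j, `|yv j x| <= d j) ->
  forall j, av j x <= 2 * d j.
Proof.
move=> dc h j; have hr (k : 'I_n.+1) : (k <= cj k)%N -> av k x <= 2 * d k.
  move=> le; have hk := h k; have hck := h (cj k); rewrite /av; apply: normc_le.
    by move: hk; rewrite /yv le.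
  move: hck; rewrite /yv cjK dc; case: leqP => [le'|_].
    have e : cj k = k by apply/val_inj/eqP; rewrite eqn_leq le' le.
    have := cjE k x; rewrite e; case: (phi k x) => a b [eb] _ /=.
    have -> : b = 0 by lra.
    by rewrite normr0; apply: le_trans (h k); apply: normr_ge0.
  by rewrite cjE; case: (phi k x) => a b /=; rewrite normrN.
case: (leqP j (cj j)) => [/hr//|lt]; rewrite -av_cj -dc; apply: hr.
by rewrite cjK ltnW.
Qed.

(** A weak form of Minkowski's theorem by pigeonhole: the lattice points with coordinates between 0
    and [hh] outnumber the boxes with sides d_j needed to hold them. *)
Lemma lattice_box : exists2 S : R, 1 <= S & forall d : 'I_n.+1 -> R, (forall j, 0 < d j) ->
  S ^+ n.+1 <= \prod_j d j -> exists x, [/\ integral x, x != 0 & forall j, `|yv j x| <= d j].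
Proof.
pose S0 := 1 + \sum_j \sum_i av j (w i).
have S01 : 1 <= S0 by rewrite lerDl; do 2 apply: sumr_ge0 => ? _; apply: av_ge0.
have S00 : 0 < S0 by apply: lt_le_trans S01.
exists (4 * S0); first by lra.
(* [hh] is at least every d_j, so rounding up the number of boxes in a direction at most doubles it;
   this is why the constant is 4 S0. *)
move=> d d0 hd; pose hh := (Num.truncn (\sum_j d j)).+1.
have hhd j : d j <= 2 * S0 * hh%:R.
  apply: (@le_trans _ _ (1 * hh%:R)); last by rewrite ler_wpM2r //; lra.
  rewrite mul1r; apply: le_trans (ltW (truncnS_gt _)); rewrite (bigD1 j) //= lerDl.
  by apply: sumr_ge0 => k _; apply/ltW.
have hh0 : 0 < hh%:R :> R by rewrite ltr0n.
pose xa (a : {ffun 'I_n.+1 -> 'I_hh.+1}) := \sum_i ((a i : nat)%:Z)%:~R * w i.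
have bnd a j : `|yv j (xa a)| <= S0 * hh%:R.
  apply: le_trans (yv_av _ _) _; rewrite /av /xa rmorph_sum; apply: le_trans (normc_sum _) _.
  apply: (@le_trans _ _ ((\sum_i av j (w i)) * hh%:R)).
    rewrite mulr_suml; apply: ler_sum => i _; rewrite rmorphM Normc.normcM rmorph_int normc_int mulrC.
    by apply: ler_wpM2l; [exact: normc_ge0|rewrite ler_nat absz_nat -ltnS ltn_ord].
  apply: ler_wpM2r; first exact: ltW.
  have : \sum_i av j (w i) <= \sum_j \sum_i av j (w i).
    rewrite [X in _ <= X](bigD1 j) //= lerDl.
    by do 2 apply: sumr_ge0 => ? _; apply: av_ge0.
  by rewrite /S0; lra.
pose v a j := (yv j (xa a) + S0 * hh%:R) / d j.
have v0 a j : 0 <= v a j.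
  by apply: divr_ge0; last exact/ltW; have := bnd a j; rewrite ler_norml => /andP[]; lra.
pose nb j := (Num.truncn (2 * S0 * hh%:R / d j)).+1.
have vn a j : (Num.truncn (v a j) < nb j)%N.
  rewrite ltnS; apply: le_truncn; rewrite /v ler_pM2r ?invr_gt0 //.
  by have := bnd a j; rewrite ler_norml => /andP[]; lra.
have nbE j : (nb j)%:R <= 4 * S0 * hh%:R / d j.
  have q1 : 1 <= 2 * S0 * hh%:R / d j by rewrite ler_pdivlMr ?mul1r.
  rewrite /nb -natr1; have := truncn_le (2 * S0 * hh%:R / d j); rewrite (le_trans ler01 q1) => /idP le.
  have -> : 4 * S0 * hh%:R / d j = 2 * S0 * hh%:R / d j + 2 * S0 * hh%:R / d j by ring.
  by apply: lerD.
pose f a : {dffun forall j, 'I_(nb j)} := [ffun j => Ordinal (vn a j)].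
have [a [b [ab eab]]] : exists a b, a != b /\ forall j, Num.truncn (v a j) = Num.truncn (v b j).
  have : ~~ injectiveb f.
    apply/negP => /injectiveP/leq_card; rewrite card_ffun !card_ord card_dep_ffun foldrE big_map big_enum /=.
    under eq_bigr => j _ do rewrite card_ord.
    rewrite leqNgt -(ltr_nat R) natr_prod natrX => /negP; apply.
    have le : \prod_j (nb j)%:R <= \prod_j (4 * S0 * hh%:R / d j).
      by apply: ler_prod => j _; rewrite ler0n nbE.
    apply: le_lt_trans le _; rewrite prodf_div prodr_const card_ord ltr_pdivrMr ?prodr_gt0 //.
    rewrite exprMn mulrC; apply: (@lt_le_trans _ _ (hh.+1%:R ^+ n.+1 * (4 * S0) ^+ n.+1)).
      by rewrite ltr_pM2r ?exprn_gt0 //; [rewrite ltrXn2r ?ler0n // ltr_nat|lra].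
    by rewrite ler_wpM2l ?exprn_ge0.
  case/injectivePn => a [b ab e]; exists a, b; split=> // j.
  by have := congr1 (fun h : {dffun forall j, 'I_(nb j)} => val (h j)) e; rewrite !ffunE.
exists (xa a - xa b); split.
- by apply/integralP => P; apply: plB; apply: (proj1 (integralP _) (lattice_integral H _)).
- apply: contraNneq ab => /(congr1 co); rewrite (coB H) (co0 H) => /eqP; rewrite subr_eq0 => /eqP e.
  apply/eqP/ffunP => i; apply: val_inj; have := congr1 (fun r : 'rV[rat]_n.+1 => r 0 i) e.
  have coE c : co (xa c) 0 i = ((c i : nat)%:Z)%:~R.
    by apply: (@co_uniq _ _ _ _ H _ (fun i => ((c i : nat)%:Z)%:~R)); apply: eq_bigr => k _; rewrite rF_int.
  by rewrite /= !coE => /eqP; rewrite eqr_int => /eqP [].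
- move=> j; rewrite yvB; have e := eab j.
  have := truncn_itv (v0 a j); have := truncn_itv (v0 b j); rewrite -e -natr1.
  have -> : yv j (xa a) - yv j (xa b) = (v a j - v b j) * d j.
    by rewrite /v -mulrBl divfK ?gt_eqF //; ring.
  rewrite normrM (gtr0_norm (d0 j)) => h1 h2; apply: ler_piMl; first exact/ltW.
  by rewrite ler_norml; move: h1 h2; lra.
Qed.

Section Step.
Variable p : 'I_n.+1.
Let A := [set j | (j == p) || (j == cj p)].

(** Dirichlet's step: the norm bound M does not depend on y, which allows iteration. *)
Lemma unit_step : exists2 M : nat, (0 < M)%N & forall y : munit F, exists x : munit F,
  [/\ integral (val x), exists2 z : int, Nm w co (val x) = z%:~R & (`|z| <= M)%N
    & forall j, j \notin A -> av j (val x) < av j (val y)].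
Proof.
have [S S1 box] := lattice_box; have S0 : 0 < S by apply: lt_le_trans S1.
pose D := S ^+ n.+1; have D1 : 1 <= D by apply: exprn_ege1.
have D0 : 0 < D by apply: lt_le_trans D1.
pose a := #|A|; pose u := #|~: A|.
have a0 : (0 < a)%N by apply/card_gt0P; exists p; rewrite inE eqxx.
exists (Num.truncn (2 ^+ n.+1 * D ^+ a)).+1 => // y.
pose q := 1 + \sum_j 2 / av j (val y).
have q1 : 1 <= q by rewrite lerDl; apply: sumr_ge0 => j _; rewrite divr_ge0 ?av_ge0.
have q0 : 0 < q by apply: lt_le_trans q1.
(* The sides off A are made small through q, those on A compensate: the product is D^a whatever q
   is. *)
pose d j := if j \in A then D * q ^+ u else q ^- a.
have d0 j : 0 < d j by rewrite /d; case: ifP => _; rewrite ?mulr_gt0 ?invr_gt0 ?exprn_gt0.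
have dc j : d (cj j) = d j.
  have e : (cj j == p) = (j == cj p) by rewrite -(can_eq cjK) cjK.
  by rewrite /d !inE e (can_eq cjK) orbC.
have pd : \prod_j d j = D ^+ a.
  rewrite (bigID (mem A)) /=.
  rewrite (eq_bigr (fun=> D * q ^+ u)) => [|j jA]; last by rewrite /d jA.
  rewrite [X in _ * X](eq_bigr (fun=> q ^- a)) => [|j /negbTE jA]; last by rewrite /d jA.
  rewrite !prodr_const -/a (_ : #|_| = u); last by apply: eq_card => j; rewrite [RHS]inE.
  have e : q ^+ u ^+ a * q ^- a ^+ u = 1 by rewrite exprVn -!exprM mulnC mulfV // expf_neq0 // gt_eqF.
  by rewrite exprMn -mulrA e mulr1.
have [|x [ix x0 hx]] := box d d0.
  by rewrite pd -/D -[X in X <= _]expr1; apply: ler_weXn2l.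
have hav := av_yv dc hx.
exists (mu x0); split=> //=.
- have [z ez] := Nm_int H ix; exists z => //.
  rewrite -(ler_nat R); apply: le_trans (ltW (truncnS_gt _)); rewrite -(Nav ez) -pd.
  have -> : 2 ^+ n.+1 * \prod_j d j = \prod_j (2 * d j).
    by rewrite big_split /= prodr_const card_ord.
  by apply: ler_prod => j _; rewrite av_ge0 hav.
- move=> j jA; apply: le_lt_trans (hav j) _; rewrite /d (negbTE jA).
  have y0 : 0 < av j (val y) by apply: av_gt0 (valP y).
  apply: (@le_lt_trans _ _ (2 / q)).
    by rewrite ler_wpM2l // lef_pV2 ?posrE ?exprn_gt0 // -[X in X <= _]expr1; apply: ler_weXn2l.
  rewrite ltr_pdivrMr // mulrC -ltr_pdivrMr //; apply: (@le_lt_trans _ _ (\sum_j 2 / av j (val y))).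
    by rewrite (bigD1 j) //= lerDl; apply: sumr_ge0 => k _; rewrite divr_ge0 ?av_ge0.
  by rewrite ltrDr.
Qed.

(** The iterates have norm at most M and hence divide M!, which leaves finitely many divisors. Two
    iterates with equal divisors have a unit as quotient, and it is less than 1 off A because the
    absolute values decrease. *)
Lemma unit_at : exists eta : munit F, dv eta = 0 /\ forall j, j \notin A -> av j (val eta) < 1.
Proof.
have [M M0 hM] := unit_step; have [st hst] := choice_ex hM.
pose xs k := iter k st 0.
have mono j a b : j \notin A -> (a < b)%N -> av j (val (xs b)) < av j (val (xs a)).
  move=> jA; elim: b => // b IH; rewrite ltnS leq_eqVlt => /predU1P[->|/IH].
    by have [_ _ ->] := hst (xs b).
  by apply: lt_trans; have [_ _ ->] := hst (xs b).
have nM : (M`!)%:R != 0 :> F by rewrite char0_natr // -lt0n fact_gt0.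
have [I [c hc]] := div_code (fsupp_dv G (mu nM)).
have bd k P : 0 <= dv (xs k.+1) P <= dv (mu nM) P.
  have [ix [z ez zM] _] := hst (xs k); rewrite -[st _]/(xs k.+1) in ix ez.
  have x0 := valP (xs k.+1); have N0 := Nm_neq0 H x0.
  have zp : (0 < `|z|)%N by rewrite absz_gt0; apply: contraNneq N0 => e; rewrite ez e.
  apply/andP; split; first by apply/(vl_ge0 G P x0); apply: (proj1 (integralP _) ix).
  have /dvdnP[l el] : (`|z| %| M`!)%N by apply: dvdn_fact; rewrite zp.
  have iN := Nm_div H ix x0; rewrite ez rF_int in iN.
  have : integral ((M`!)%:R / val (xs k.+1)).
    apply/integralP => P'; rewrite el natrM -mulrA; apply: plM; first exact: pl_nat.
    have := proj1 (integralP _) iN P'; case: (z) => t /=; first by rewrite -pmulrn.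
    by rewrite NegzE rmorphN mulNr /= -pmulrn => /plN; rewrite opprK.
  move/integralP/(_ P)/(vl_ge0 G P); rewrite mulf_neq0 ?invr_eq0 // (vlD G) // subr_ge0.
  by apply.
pose f (i : 'I_(#|I|).+1) := c (dv (xs i.+1)).
have /injectivePn[i [j ij e]] : ~~ injectiveb f.
  by apply/negP => /injectiveP/leq_card; rewrite card_ord ltnn.
wlog lt : i j ij e / (i < j)%N.
  move=> h; have [lt|lt|/val_inj e''] := ltngtP i j; last by rewrite e'' eqxx in ij.
    exact: h lt.
  by apply: (h j i); rewrite // eq_sym.
exists (xs j.+1 - xs i.+1); split.
  by rewrite (dvB G) -(hc _ _ (bd i) (bd j) e) subrr.
move=> k kA; rewrite muB avM avV ltr_pdivrMr ?av_gt0 ?(valP (xs i.+1)) // mul1r.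
exact: mono.
Qed.
End Step.

Variables (s : {rmorphism F -> F}) (g : nat).
Hypothesis g0 : (0 < g)%N.
Hypothesis sg : forall x, irm s g x = x.
Hypothesis sfaith : forall i, (0 < i < g)%N -> exists x, irm s i x != x.
Hypothesis Hcc : forall i (psi : {rmorphism F -> C}), (0 < i < g)%N -> ~ forall x, psi (irm s i x) = conjc (psi x).

Lemma unit_fact (u : munit F) : dv u = 0 -> \prod_j av j (val u) = 1.
Proof.
move=> du; have vu P : vl P (val u) = 0 by rewrite -[LHS]/(dv u P) du.
have iu (x : munit F) : dv x = 0 -> integral (val x).
  by move=> dx; apply/integralP => P; apply/(vl_ge0 G P (valP x)); rewrite -[vl _ _]/(dv x P) dx.
have dN : dv (- u) = 0 by rewrite -sub0r (dvB G) du subr0; apply/funext => P; rewrite /dv mu0 (vl1 G).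
have [z ez] := Nm_int H (iu _ du); have [z' ez'] := Nm_int H (iu _ dN).
have e : z * z' = 1.
  apply/eqP; rewrite -(eqr_int rat) rmorphM /= -ez -ez' -(NmM H) muN mulfV ?(valP u) //.
  by rewrite (Nm1 H).
rewrite (Nav ez); move/(congr1 absz): e; rewrite abszM => /eqP; rewrite muln_eq1 => /andP[/eqP -> _].
by [].
Qed.

(** Infinite places are embeddings up to complex conjugation, represented by [rep]. By [Hcc] no
    nontrivial power of s acts as a conjugation, so the group permutes them freely and
    [unit_herbrand] applies. *)
Lemma units_herbrand : exists2 h0,
  idx (fun x : munit F => dv x = 0 /\ mu_map s x = x) (fun x => exists y, dv y = 0 /\ x = trc (mu_map s) g y) h0 &
  idx (fun x : munit F => dv x = 0 /\ trc (mu_map s) g x = 0) (fun x => exists y, dv y = 0 /\ x = mu_map s y - y) (g * h0)%N.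
Proof.
have [tau htau] := choice_ex (fun j => embed_all H hU (phi j \o s : {rmorphism F -> C})).
have tauE j x : phi (tau j) x = phi j (s x) by rewrite -htau.
have tauk k j x : phi (iter k tau j) x = phi j (irm s k x).
  elim: k j x => //= k IH j x; rewrite tauE IH; congr (phi j _).
  by rewrite -[s x]/(irm s 1 x) -irmD addn1.
have taug j : iter g tau j = j by apply: emb_inj => x; rewrite tauk sg.
have tau_cj j : tau (cj j) = cj (tau j) by apply: emb_inj => x; rewrite tauE !cjE tauE.
pose rep (j : 'I_n.+1) := if (j <= cj j)%N then j else cj j.
have rep_cj j : rep (cj j) = rep j.
  rewrite /rep cjK; case: leqP => h1; case: leqP => h2 //; last by lia.
  by apply/val_inj/eqP; rewrite eqn_leq h1 h2.
have repE j : rep j = j \/ rep j = cj j by rewrite /rep; case: ifP; auto.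
have rep_eq j k : rep j = rep k -> k = j \/ k = cj j.
  move=> e; case: (repE j) (repE k) => e1 [] e2; rewrite e1 e2 in e; auto.
  - by right; rewrite e cjK.
  - by left; apply: (can_inj cjK).
pose A0 := [pred j : 'I_n.+1 | j <= cj j]%N; pose m := #|A0|.
have repA j : rep j \in A0.
  by rewrite inE /rep; case: ifP => // /negbT; rewrite -ltnNge cjK => /ltnW.
have rep_id j : j \in A0 -> rep j = j by rewrite inE /rep => ->.
pose pl (i : 'I_m) := enum_val i.
pose rk j : 'I_m := enum_rank_in (repA j) (rep j).
have plrk j : pl (rk j) = rep j by rewrite /pl enum_rankK_in.
have rkpl i : rk (pl i) = i.
  by apply: enum_val_inj; rewrite -/(pl _) plrk rep_id // enum_valP.
have rkP j k : rk j = rk k <-> k = j \/ k = cj j.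
  split=> [e|[->//|->]]; first by apply: rep_eq; rewrite -!plrk e.
  by rewrite -[RHS]rkpl plrk rep_cj -plrk rkpl.
pose t i := rk (tau (pl i)).
have trk j : t (rk j) = rk (tau j).
  rewrite /t plrk; apply/rkP; case: (repE j) => ->; first by left.
  by right; rewrite tau_cj cjK.
have trkk k j : iter k t (rk j) = rk (iter k tau j) by elim: k => //= k ->; rewrite trk.
have tg i : iter g t i = i by rewrite -{1}(rkpl i) trkk taug rkpl.
have tfree k i : (0 < k < g)%N -> iter k t i != i.
  move=> hk; apply/eqP => e; have : rk (pl i) = rk (iter k tau (pl i)) by rewrite -trkk rkpl e.
  move/rkP => [] e'.
    have [x hx] := sfaith hk; case/eqP: hx; apply: (fmorph_inj (phi (pl i))).
    by rewrite -tauk e'.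
  by apply: (@Hcc k (phi (pl i)) hk) => x; rewrite -tauk e' cjE.
have tinj : injective t := free_inj g0 tg.
have tauinj : injective tau.
  by move=> j k e; rewrite -(taug j) -(taug k) -(prednK g0) !iterSr e.
(* Both embeddings of a conjugate pair are counted, so the sum over all places is the logarithm of
   the absolute norm, which vanishes on units. *)
pose l (i : 'I_m) (u : munit F) : R := \sum_(j | rk j == i) ln (av j (val u)).
have m0 : (0 < m)%N := leq_ltn_trans (leq0n _) (ltn_ord (rk ord0)).
have avp j (u : munit F) : av j (val u) \is Num.pos by rewrite posrE av_gt0 // (valP u).
have [eta heta] := choice_ex (fun i : 'I_m => unit_at (pl i)).
have sE : subg (fun x : munit F => dv x = 0).
  split=> [|x y ex ey]; last by rewrite (dvB G) ex ey subrr.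
  by apply/funext => P; rewrite /dv mu0 (vl1 G).
apply: (@unit_herbrand R (munit F) (mu_map s) g m (fun x => dv x = 0) l t _ _ sE _ g0 tg tfree m0 _ _ _ _ eta).
- exact: mu_mapB.
- exact: (mu_map_g sg).
- move=> x ex; apply/funext => P; have P' := P.
  by rewrite (sV_dv g0 sg G x) /sV ex.
- move=> i x y; rewrite /l -sumrB; apply: eq_bigr => j _.
  by rewrite muB avM avV lnM ?lnV ?avp // posrE invr_gt0 av_gt0 // (valP y).
- move=> i x; rewrite /l [RHS](reindex_inj tauinj) /=; apply: eq_big => [j|j _].
    by rewrite -trk (inj_eq tinj).
  by rewrite /av tauE.
- move=> u du; have := unit_fact du; rewrite /l => pu.
  transitivity (\sum_j ln (av j (val u))).
    by rewrite [RHS](partition_big rk predT).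
  have : ln (\prod_j av j (val u)) = \sum_j ln (av j (val u)).
    elim: (index_enum _) => [|j r IH]; first by rewrite !big_nil ln1.
    rewrite !big_cons lnM ?avp ?IH // posrE; apply: prodr_gt0 => k _; apply: av_gt0 (valP u).
  by rewrite pu ln1.
- move=> B; have [L hL] := bounded_fin (expR B); exists (pmap insub L) => x ex hx.
  rewrite mem_pmap_sub; apply: hL.
    by apply/integralP => P; apply/(vl_ge0 G P (valP x)); rewrite -[vl _ _]/(dv x P) ex.
  move=> j; rewrite -ler_ln ?posrE ?expR_gt0 ?av_gt0 ?(valP x) // expRK.
  apply: le_trans (hx (rk j)); apply: le_trans (ler_norm _) _; rewrite /l.
  have -> : \sum_(k | rk k == rk j) ln (av k (val x)) = ln (av j (val x)) *+ #|[pred k | rk k == rk j]|.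
    rewrite -sumr_const; apply: eq_bigr => k /eqP/esym/rkP[->//|->].
    by rewrite av_cj.
  rewrite normrMn -[X in X <= _]mulr1n; apply: ler_wpMn2l => //.
  by apply/card_gt0P; exists j; rewrite inE.
- by move=> i; case: (heta i).
- move=> i j ij; rewrite /l (bigD1 (pl j)) /= ?rkpl //; have [_ h] := heta i.
  have neg k : rk k = j -> ln (av k (val (eta i))) < 0.
    move=> ek; apply: ln_lt0; rewrite av_gt0 ?(valP (eta i)) //= h // inE.
    apply: contra ij => hh; rewrite -(rkpl i) -ek; apply/eqP/rkP.
    by case/orP: hh => /eqP; auto.
  by apply: ltr_wnDr; [apply: sumr_le0 => k /andP[/eqP ek _]; apply/ltW/neg|apply: neg].
Qed.
End Archimedean.

(** * Function fields *)

Section PrimeField.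
Variables (F : fieldType) (q : nat).
Hypotheses (pq : prime q) (q0 : q%:R = 0 :> F).

Lemma natr_modq n : (n %% q)%:R = n%:R :> F.
Proof. by rewrite {2}(divn_eq n q) natrD natrM q0 mulr0 add0r. Qed.

Let modE x : (x %% (Zp_trunc (pdiv q)).+2)%N = (x %% q)%N.
Proof. by rewrite Fp_cast. Qed.

Lemma inF_zmod : zmod_morphism (fun a : 'F_q => (a : nat)%:R : F).
Proof.
have D (a b : 'F_q) : (nat_of_ord (a + b)%R)%:R = (a : nat)%:R + (b : nat)%:R :> F.
  by rewrite /= modE natr_modq natrD.
by move=> a b; apply: (addIr ((b : nat)%:R)); rewrite -D !subrK.
Qed.
Lemma inF_monoid : monoid_morphism (fun a : 'F_q => (a : nat)%:R : F).
Proof.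
split; first by rewrite /= modE natr_modq.
by move=> a b; rewrite /= modE natr_modq natrM.
Qed.
Fact inF_ex : {f : {rmorphism 'F_q -> F} | forall a, f a = (a : nat)%:R}.
Proof. by exists (rm_of inF_zmod inF_monoid). Qed.
Definition inF : {rmorphism 'F_q -> F} := sval inF_ex.
Lemma inFE a : inF a = (a : nat)%:R. Proof. exact: svalP inF_ex a. Qed.

Fact psi_ex (x : F) : {f : {rmorphism {poly 'F_q} -> F} | forall h, f h = (map_poly inF h).[x]}.
Proof. by exists (horner_eval x \o map_poly inF : {rmorphism {poly 'F_q} -> F}). Qed.
Definition psi (x : F) : {rmorphism {poly 'F_q} -> F} := sval (psi_ex x).
Lemma psi_horner x h : psi x h = (map_poly inF h).[x]. Proof. exact: svalP (psi_ex x) h. Qed.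
Lemma psiE x h : psi x h = \sum_(i < size h) inF h`_i * x ^+ i.
Proof.
rewrite psi_horner horner_coef size_map_poly.
by apply: eq_bigr => i _; rewrite coef_map.
Qed.
Lemma psiX x : psi x 'X = x.
Proof. by rewrite psi_horner map_polyX hornerX. Qed.
Lemma psiC x c : psi x c%:P = inF c.
Proof. by rewrite psi_horner map_polyC hornerC. Qed.

Definition trans (x : F) := forall h, psi x h = 0 -> h = 0.

Lemma pl_inF (P : place F) c : sval P (inF c). Proof. by rewrite inFE; apply: pl_nat. Qed.
Lemma inF_vunit (P : place F) c : c != 0 -> vunit (sval P) (inF c).
Proof. by move=> c0; split; rewrite ?fmorph_eq0 // -?fmorphV; apply: pl_inF. Qed.
Lemma inF_mx (P : place F) c : mx P (inF c) -> c = 0.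
Proof. by move=> [_ h]; apply/eqP/negPn/negP => /(inF_vunit P)/h. Qed.

Lemma psi_factor (h : {poly 'F_q}) : h != 0 -> exists k r, h = 'X^k * r /\ r`_0 != 0.
Proof.
elim: {h}(size h) {-2}h (leqnn (size h)) => [|n IH] h; first by rewrite leqn0 size_poly_eq0 => /eqP-> /eqP.
move=> sn h0; have [c0|c0] := eqVneq h`_0 0; last by exists 0%N, h; rewrite expr0 mul1r.
pose r := \poly_(i < (size h).-1) h`_i.+1.
have e : h = 'X * r.
  apply/polyP => i; rewrite coefXM; case: i => [|i] //=; rewrite coef_poly.
  by case: ltnP => // le; rewrite nth_default //; move: le; case: (size h).
have r0 : r != 0 by apply: contra_neq h0 => r0; rewrite e r0 mulr0.
have [|k [r' [er r'0]]] := IH r _ r0.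
  by rewrite (leq_trans (size_poly _ _)) //; move: sn; case: (size h).
by exists k.+1, r'; rewrite e er exprS mulrA.
Qed.

(** After cancelling powers of x, an algebraic relation would place its nonzero constant term, a
    unit, in the maximal ideal. *)
Lemma mx_trans (P : place F) x : x != 0 -> mx P x -> trans x.
Proof.
move=> x0 mxx h e; apply/eqP/negPn/negP => h0.
have [k [r [eh r0]]] := psi_factor h0.
have {}e : psi x r = 0.
  apply/eqP; move/eqP: e; rewrite eh rmorphM rmorphXn psiX mulf_eq0 expf_eq0 (negbTE x0) andbF.
  by [].
have s0 : (0 < size r)%N by rewrite size_poly_gt0; apply: contra_neq r0 => ->; rewrite coef0.
move: e; rewrite psiE; case: (size r) s0 => // n _; rewrite big_ord_recl expr0 mulr1 => /eqP.
rewrite addr_eq0 => /eqP e; case/eqP: r0; apply: (@inF_mx P); rewrite e; apply: mxN.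
by apply: mx_sum => i _; apply: mxM; [apply: pl_inF|rewrite exprS; apply: mxMr => //; apply/plX/mx_pl].
Qed.

Lemma psi_inv (x : F) (h : {poly 'F_q}) N : x != 0 -> (size h <= N.+1)%N ->
  psi x h = x ^+ N * psi x^-1 (\poly_(i < N.+1) h`_(N - i)).
Proof.
move=> x0 sh; have E y (g : {poly 'F_q}) : (size g <= N.+1)%N -> psi y g = \sum_(i < N.+1) inF g`_i * y ^+ i.
  move=> sg; rewrite psiE (big_ord_widen _ (fun i => inF g`_i * y ^+ i) sg) big_mkcond.
  apply: eq_bigr => i _; case: ltnP => // le; by rewrite nth_default // rmorph0 mul0r.
rewrite !E ?size_poly // mulr_sumr [RHS](reindex_inj rev_ord_inj) /=; apply: eq_bigr => i _.
have iN : (i <= N)%N by rewrite -ltnS.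
rewrite coef_poly subSS ltnS leq_subr subKn // mulrCA; congr (_ * _).
have e : x ^+ N = x ^+ i * x ^+ (N - i) by rewrite -exprD subnKC.
by rewrite exprVn e mulfK // expf_neq0.
Qed.

Lemma trans_inv x : x != 0 -> trans x^-1 -> trans x.
Proof.
move=> x0 tx h e; apply/eqP/negPn/negP => h0; have s0 : (0 < size h)%N by rewrite size_poly_gt0.
have sN : (size h <= (size h).-1.+1)%N by rewrite prednK.
move: e; rewrite (psi_inv x0 sN) => /eqP; rewrite mulf_eq0 expf_eq0 (negbTE x0) andbF /= => /eqP/tx.
move/(congr1 (fun g : {poly 'F_q} => g`_0)); rewrite coef_poly coef0 /= subn0 -lead_coefE => /eqP.
by rewrite lead_coef_eq0 (negbTE h0).
Qed.

(** The number of residues modulo h; unlike the degree it is multiplicative, as [ebase] demands. *)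
Definition szp (h : {poly 'F_q}) : nat := if h == 0 then 0%N else (q ^ (size h).-1)%N.

Lemma ebase_psi x n : trans x ->
  (forall y : nat -> F, exists c : nat -> {poly 'F_q},
    (exists2 i, (i <= n)%N & c i != 0) /\ \sum_(i < n.+1) psi x (c i) * y i = 0) ->
  ebase (imr (psi x)) n.
Proof.
move=> tx dep; have q1 := prime_gt1 pq; have qp : (0 < q)%N := prime_gt0 pq.
apply: (@ebase_idom F _ (psi x) tx n szp) => //.
- by move=> a; rewrite /szp; case: eqP => // _ /eqP; rewrite expn_eq0 eqn0Ngt qp.
- move=> a b a0 b0; rewrite /szp mulf_eq0 (negbTE a0) (negbTE b0) /= size_mul // -expnD.
  have sa : (0 < size a)%N by rewrite size_poly_gt0.
  have sb : (0 < size b)%N by rewrite size_poly_gt0.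
  by congr (_ ^ _)%N; move: (size a) (size b) sa sb => [|k] [|l] // _ _; rewrite addnS.
- move=> a b b0; exists (a %/ b); have -> : a - a %/ b * b = a %% b.
    by apply/eqP; rewrite subr_eq addrC -divp_eq.
  rewrite /szp (negbTE b0); case: eqP => [_|/eqP m0]; first by rewrite expn_gt0 qp.
  rewrite ltn_exp2l //; have := ltn_modp a b; rewrite b0; move: m0; rewrite -size_poly_gt0.
  by case: (size _) => // k _; case: (size b).
- move=> m; exists (map (fun s : m.+1.-tuple 'F_q => Poly s) (enum {: m.+1.-tuple 'F_q})) => e; rewrite /szp.
  case: eqP => [-> _|/eqP e0 h]; apply/mapP.
    by exists [tuple of nseq m.+1 0]; rewrite ?mem_enum //; apply/polyP => i; rewrite coef_Poly nth_nseq coef0 if_same.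
  have se : (size e <= m.+1)%N.
    have := ltn_trans (ltn_expl (size e).-1 q1) h; by case: (size e) => // k /ltnW.
  have sz : size (mkseq (fun i => e`_i) m.+1) == m.+1 by rewrite size_mkseq.
  exists (Tuple sz); rewrite ?mem_enum //; apply/polyP => i; rewrite coef_Poly /=.
  have [lt|le] := ltnP i m.+1; first by rewrite nth_mkseq.
  by rewrite !nth_default ?size_mkseq // (leq_trans se).
Qed.
End PrimeField.

Record ffield (F : fieldType) (q : nat) (t : F) : Prop := FField {
  ff_prime : prime q;
  ff_char : q%:R = 0 :> F;
  ff_trans : trans ff_prime ff_char t;
  ff_span : exists n (b : 'I_n -> F), forall x, exists d (a : 'I_n -> {poly 'F_q}),
     d != 0 /\ psi ff_prime ff_char t d * x = \sum_j psi ff_prime ff_char t (a j) * b j }.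

Lemma ffield_ex (F : fieldType) : function_field F -> exists q (t : F), ffield q t.
Proof.
case=> q [pq q0 [t [tt [n [b sp]]]]]; exists q, t; exists pq q0.
  move=> h e; have ev : evalN [seq nat_of_ord c | c <- h] t = 0.
    rewrite -e psiE /evalN size_map; apply: eq_bigr => i _.
    by rewrite (nth_map 0) // inFE.
  apply/eqP/negPn/negP => h0; have /allP/(_ (nat_of_ord (lead_coef h))) := tt _ ev.
  have lh : lead_coef h \in (h : seq _) by rewrite lead_coefE mem_nth // prednK // size_poly_gt0.
  rewrite map_f // => /(_ isT) dv.
  have lt : (nat_of_ord (lead_coef h) < q)%N by rewrite -[X in (_ < X)%N](Fp_cast pq) ltn_ord.
  have : nat_of_ord (lead_coef h) != 0%N.
    by apply: contra h0 => /eqP e0; rewrite -lead_coef_eq0; apply/eqP/val_inj.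
  by rewrite -lt0n => /dvdn_leq/(_ dv); rewrite leqNgt lt.
have evP (s : seq nat) : evalN s t = psi pq q0 t (\poly_(i < size s) (nth 0%N s i)%:R).
  rewrite poly_def rmorph_sum; apply: eq_bigr => i _.
  by rewrite -mul_polyC rmorphM rmorphXn psiX psiC rmorph_nat.
exists n, b => x; have [c [hc ->]] := sp x.
have [f hf] := choice_ex hc; have [gg hg] := choice_ex hf.
pose pf i := \poly_(k < size (f i)) (nth 0%N (f i) k)%:R : {poly 'F_q}.
pose pg i := \poly_(k < size (gg i)) (nth 0%N (gg i) k)%:R : {poly 'F_q}.
have g0 i : psi pq q0 t (pg i) != 0 by rewrite -evP; case: (hg i).
exists (\prod_i pg i), (fun i => pf i * \prod_(j | j != i) pg j); split.
  apply/prodf_neq0 => i _; apply: contraTneq (g0 i) => ->; by rewrite rmorph0 eqxx.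
rewrite mulr_sumr; apply: eq_bigr => i _; rewrite (bigD1 i) //= !rmorphM.
have [_ ->] := hg i; rewrite !evP -/(pf i) -/(pg i).
by field; apply: g0.
Qed.

Section FF.
Variables (F : fieldType) (q : nat) (t : F).
Hypothesis H : ffield q t.
Let pq := ff_prime H.
Let q0 := ff_char H.
Let psi x := psi pq q0 x.
Let iF := inF pq q0.

Lemma ff_t0 : t != 0.
Proof.
apply/eqP => e; have : psi t 'X = 0 by rewrite /psi psiX e.
by move/(@ff_trans _ _ _ H 'X)/eqP; rewrite polyX_eq0.
Qed.

Lemma trans_inv' x : x != 0 -> trans pq q0 x -> trans pq q0 x^-1.
Proof. by move=> x0 tx; apply: trans_inv; rewrite ?invr_eq0 // invrK. Qed.

Lemma ff_dep : exists n, forall y : nat -> F, exists c : nat -> {poly 'F_q},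
    (exists2 i, (i <= n)%N & c i != 0) /\ \sum_(i < n.+1) psi t (c i) * y i = 0.
Proof.
have [n [b sp]] := ff_span H; exists n; exact: (@dep_of_span _ _ _ n b sp).
Qed.

Lemma dep_inv x n : x != 0 -> trans pq q0 x -> (forall y : nat -> F, exists c : nat -> {poly 'F_q},
    (exists2 i, (i <= n)%N & c i != 0) /\ \sum_(i < n.+1) psi x (c i) * y i = 0) ->
  forall y : nat -> F, exists c : nat -> {poly 'F_q},
    (exists2 i, (i <= n)%N & c i != 0) /\ \sum_(i < n.+1) psi x^-1 (c i) * y i = 0.
Proof.
move=> x0 tx h y; have [c [[i il ci] e]] := h y.
pose N := (\sum_(i < n.+1) size (c i))%N.
pose c' k : {poly 'F_q} := \poly_(j < N.+1) (c k)`_(N - j).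
have pe (k : 'I_n.+1) : psi x (c k) = x ^+ N * psi x^-1 (c' k).
  by apply: psi_inv => //; apply: ltnW; rewrite ltnS /N (bigD1 k) //= leq_addr.
exists c'; split.
  exists i => //; apply: contraTneq ci => c'0; rewrite negbK; apply/eqP/tx.
  have lt : (i < n.+1)%N by rewrite ltnS.
  by rewrite -[LHS]/(psi x (c (Ordinal lt))) pe /= c'0 rmorph0 mulr0.
apply: (mulfI (expf_neq0 N x0)); rewrite mulr0 -[RHS]e mulr_sumr; apply: eq_bigr => k _.
by rewrite pe mulrA.
Qed.

Lemma psi_pl (P : place F) x h : sval P x -> sval P (psi x h).
Proof.
move=> Px; rewrite /psi psiE; apply: pl_sum => i _; apply: plM; [exact: pl_inF|exact: plX].
Qed.

Lemma ff_gl : gl F.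
Proof.
have [n dep] := ff_dep; have e1 := ebase_psi (@ff_trans _ _ _ H) dep.
have e2 := ebase_psi (trans_inv' ff_t0 (@ff_trans _ _ _ H)) (dep_inv ff_t0 (@ff_trans _ _ _ H) dep).
apply: (gl_ebase e1 e2) => P; have [Pt|/plV Pt] := pselect (sval P t); [left|right] => _ [h ->]; exact: psi_pl.
Qed.
Let G := ff_gl.

Lemma natmul_q (x : F) : x *+ q = 0.
Proof. by rewrite -mulr_natr q0 mulr0. Qed.

Lemma place_deg_ex (P : place F) : exists d, idx (sval P) (@mx F P) (q ^ d)%N.
Proof.
have [N hN] := gl_res G P; have h : q.-nat N.
  apply: idx_pnat hN => //; [exact: subg_pl|exact: subg_mx|by move=> x /mx_pl|].
  by move=> x _; exists 1%N; rewrite expn1 natmul_q; apply: mx0.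
by have [d e] := p_natP h; exists d; rewrite -e.
Qed.

Lemma not_char0 : ~ char0 F.
Proof. by move=> h; have := h q.-1; rewrite prednK ?prime_gt0 // q0 eqxx. Qed.

Lemma place_degP (P : place F) d : place_deg P d <-> idx (sval P) (@mx F P) (q ^ d)%N.
Proof.
split=> [[p' [pp p0 h]]|h]; last by exists q.
have e : p' = q.
  apply/eqP; rewrite -dvdn_prime2 //; have chF : q \in [pchar F] by rewrite inE pq q0 eqxx.
  have chF' : p' \in [pchar F] by rewrite inE pp p0 eqxx.
  by rewrite (dvdn_pcharf chF') q0 eqxx.
by rewrite -e.
Qed.

Lemma wtP (P : place F) : exists d, wt P = d%:Z /\ idx (sval P) (@mx F P) (q ^ d)%N.
Proof.
rewrite /wt; case: asboolP => [/not_char0//|_]; case: xgetP => [d _ /place_degP h|no]; first by exists d.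
by have [d /place_degP h] := place_deg_ex P; case: (no d).
Qed.

Definition wtn (P : place F) : nat := `|wt P|%N.
Lemma wtnE P : wt P = (wtn P)%:Z.
Proof. by have [d [e _]] := wtP P; rewrite /wtn e. Qed.
Lemma wtn_idx P : idx (sval P) (@mx F P) (q ^ wtn P)%N.
Proof. by have [d [e h]] := wtP P; rewrite /wtn e. Qed.
Lemma wtn_gt0 P : (0 < wtn P)%N.
Proof.
case: posnP => // e; have := wtn_idx P; rewrite e expn0 => h.
case: (@mx1F _ P); apply: (idx1P (subg_pl P) (@subg_mx _ P) h); exact: pl1.
Qed.
End FF.

(** * Riemann spaces and the degree of a principal divisor *)

Section FFCount.
Variables (F : fieldType) (q : nat) (t : F).
Hypothesis H : ffield q t.
Let pq := ff_prime H.
Let q0 := ff_char H.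
Let G := ff_gl H.
Notation psi := (psi pq q0).
Notation iF := (inF pq q0).
Let q1 : (1 < q)%N := prime_gt1 pq.
Let qp : (0 < q)%N := prime_gt0 pq.

Definition ind (l : seq (place F)) : dvs F := fun P => (count_mem P l)%:Z.
Lemma ind_cat l l' : ind (l ++ l') = ind l + ind l'.
Proof. by apply/funext => P; rewrite /ind dvsD count_cat. Qed.
Lemma ind_cons P l : ind (P :: l) = ind [:: P] + ind l.
Proof. exact: (ind_cat [:: P] l). Qed.
Lemma fsupp_ind l : fsupp (ind l).
Proof.
by exists l => P; rewrite /ind eqz_nat; apply: contraR => h; apply/eqP/count_memPn.
Qed.
Definition wsum (l : seq (place F)) : nat := \sum_(P <- l) wtn P.
Lemma degD (D D' : dvs F) : fsupp D -> fsupp D' -> deg (D + D') = deg D + deg D'.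
Proof.
move=> fD fD'; have := degB (subgD (@subg_fsupp F) fD fD') fD'; rewrite addrK => ->.
by rewrite subrK.
Qed.
Lemma deg_ind l : deg (ind l) = (wsum l)%:Z.
Proof.
elim: l => [|P l IH]; first by rewrite /wsum big_nil; apply: deg0.
rewrite ind_cons degD ?IH; try exact: fsupp_ind.
rewrite /wsum big_cons PoszD; congr (_ + _).
rewrite (degE (s := [:: P])) //; last by move=> Q; rewrite /ind /= addn0 inE [Q == P]eq_sym; case: (P == Q).
by rewrite big_seq1 /ind /= eqxx addn0 mulr1 (wtnE H).
Qed.

Lemma eff_list (E : dvs F) : fsupp E -> (forall P, 0 <= E P) -> exists l, E = ind l.
Proof.
move=> /fsuppP[s [us hs]] E0; exists (flatten [seq nseq `|E P|%N P | P <- s]).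
apply/funext => P; rewrite /ind count_flatten -map_comp sumnE big_map.
have [Ps|nPs] := boolP (P \in s).
  rewrite (bigD1_seq P) //= count_nseq /= eqxx mul1n big1 ?addn0 => [|Q /negbTE QP].
    by have := E0 P; lia.
  by rewrite count_nseq /= QP.
rewrite big1_seq; last by move=> Q /= Qs; rewrite count_nseq /=; case: eqP => // e; rewrite -e Qs in nPs.
by apply/eqP; apply: contraR nPs => /hs.
Qed.

(** The Riemann space L(D). Its elements are counted, rather than its dimension taken, since the
    field of constants may be larger than F_q. *)
Definition LL (D : dvs F) (x : F) := forall P, vge P (- D P) x.
Lemma subg_LL D : subg (LL D).
Proof.
split=> [P|x y hx hy P]; first by left.
exact: (subgB (subg_vge G P _)).
Qed.
Lemma LL_le (D D' : dvs F) x : (forall P, D P <= D' P) -> LL D x -> LL D' x.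
Proof. by move=> le hx P; apply: vge_le (hx P); rewrite lerN2. Qed.
Lemma LL_mul (D D' : dvs F) x y : LL D x -> LL D' y -> LL (D + D') (x * y).
Proof. by move=> hx hy P; rewrite dvsD opprD; apply: (vgeM G). Qed.

Lemma LL_step (D : dvs F) P : exists2 n, (n <= q ^ wtn P)%N & idx (LL (D + ind [:: P])) (LL D) n.
Proof.
have indP Q : ind [:: P] Q = (P == Q)%:Z by rewrite /ind /= addn0 eq_sym.
have [u u0 vu] := unif_at G P (D P + 1).
have ge x : vge P (- (D P + 1)) x -> sval P (x * u).
  move=> hx; apply/(vge0 G); have -> : 0 = - (D P + 1) + (D P + 1) by lia.
  by apply: (vgeM G) => //; right; rewrite vu.
apply: (@nc_inj _ _ _ _ _ _ (fun x => x * u) _ _ _ _ _ (wtn_idx H P)).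
- exact: subg_eqv (subg_LL _).
- exact: subg_eqv (@subg_mx _ P).
- by move=> x /(_ P); rewrite dvsD indP eqxx => /ge.
- move=> x y hx hy; rewrite -mulrBl => m Q; have [<-|PQ] := eqVneq P Q.
    have [->|d0] := eqVneq (x - y) 0; first by left.
    right; move/(vge1 G): m => -[/eqP|]; first by rewrite mulf_eq0 (negbTE d0) (negbTE u0).
    by rewrite (vlM G) // vu; move: (vl P (x - y)) (D P) => a b; lia.
  have := subgB (subg_LL _) hx hy => /(_ Q); rewrite dvsD indP (negbTE PQ) addr0; apply.
Qed.

Lemma LL_list (D : dvs F) l : exists2 n, (n <= q ^ wsum l)%N & idx (LL (D + ind l)) (LL D) n.
Proof.
elim: l => [|P l [n ln hn]].
  exists 1%N; rewrite ?expn_gt0 ?qp //; have -> : D + ind [::] = D by apply/funext => P; rewrite dvsD addr0.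
  by apply: idx1 (subg_LL _).
have [m lm hm] := LL_step (D + ind l) P.
exists (m * n)%N; first by rewrite /wsum big_cons expnD leq_mul.
rewrite ind_cons addrCA addrC.
apply: (idx_mul (B := LL (D + ind l))) hm hn; try exact: subg_LL.
  by move=> x; apply: LL_le => Q; rewrite dvsD lerDl.
by move=> x; apply: LL_le => Q; rewrite dvsD lerDl.
Qed.

(** If x had no zero, 1/x would lie in every place and so be integral over the constants by
    [place_avoid]. *)
Lemma has_zero x : x != 0 -> trans pq q0 x -> exists P : place F, mx P x.
Proof.
move=> x0 tx; apply/not_existsP => no.
have [|h [mh ch rh]] := @place_avoid F (imr iF) x^-1 (sring_imr _).
  move=> P _; have [Px|nPx] := pselect (sval P x); last exact: plV.
  by have [[]|/no] := vunit_mx Px.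
have [c hc] := choice_ex ch; pose g : {poly 'F_q} := \poly_(i < size h) c i.
have e : map_poly iF g = h.
  apply/polyP => i; rewrite coef_map coef_poly; case: ltnP => [_|le]; first by rewrite hc.
  by rewrite [RHS]nth_default //; apply: (rmorph0 iF).
have g0 : g = 0.
  by apply: (trans_inv' x0 tx); rewrite psi_horner e; apply/rootP.
by move: (monic_neq0 mh); rewrite -e g0 rmorph0 eqxx.
Qed.

Lemma const_zero P x : LL 0 x -> mx P x -> x = 0.
Proof.
move=> hx m; apply/eqP/negPn/negP => x0; have tx := mx_trans (pq := pq) (q0 := q0) x0 m.
have [|Q mQ] := @has_zero x^-1 _ (trans_inv' x0 tx); first by rewrite invr_eq0.
have Qx : sval Q x by apply/(vge0 G); have := hx Q; rewrite oppr0.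
by apply: (@mx1F _ Q); rewrite -(mulfV x0); apply: mxM.
Qed.

Lemma const_fin : exists N, idx (LL 0) (fun x => x = 0) N.
Proof.
have [P _] := has_zero (ff_t0 H) (@ff_trans _ _ _ H).
have [||||n _ hn] := @nc_inj F F (fun x y => x - y = 0) (fun x y => mx P (x - y)) (LL 0) (sval P) id _ _ _ _ _ (wtn_idx H P).
- split=> [x|x y e|x y z e e']; rewrite ?subrr //; first by rewrite -opprB e oppr0.
  by rewrite -(subrKA y) e e' addr0.
- exact: subg_eqv (@subg_mx _ P).
- by move=> x /(_ P); rewrite oppr0 => /(vge0 G).
- by move=> x y hx hy; apply: const_zero; apply: (subgB (subg_LL _)).
by exists n.
Qed.

Lemma LL_fin : exists2 N, (0 < N)%N & forall l, exists2 n, (n <= N * q ^ wsum l)%N & idx (LL (ind l)) (fun x => x = 0) n.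
Proof.
have [N hN] := const_fin; exists N; first exact: idx_pos (subg_LL _) hN.
move=> l; have [n ln] := LL_list 0 l; rewrite add0r => hn; exists (n * N)%N; first by rewrite mulnC leq_mul.
apply: (idx_mul (B := LL 0)) hn hN; try exact: subg_LL.
- by split=> // x y -> ->; rewrite subrr.
- by move=> x -> P; left.
- by move=> x; apply: LL_le => Q.
Qed.

Lemma units_fin : exists N, idx (fun x : munit F => dv x = 0) (fun x => x = 0) N.
Proof.
have [N hN] := const_fin.
have [||||n _ hn] := @nc_inj (munit F) F (fun x y => x - y = 0) (fun x y => x - y = 0) (fun x => dv x = 0) (LL 0) val _ _ _ _ _ hN.
- by apply: (@subg_eqv (munit F) (fun x => x = 0)); split=> // x y -> ->; rewrite subrr.
- by apply: (@subg_eqv F (fun x => x = 0)); split=> // x y -> ->; rewrite subrr.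
- by move=> x e P; right; rewrite -[vl _ _]/(dv x P) e.
- by move=> x y _ _ /eqP; rewrite subr_eq0 => /eqP/val_inj ->; rewrite subrr.
by exists n.
Qed.

Definition pol (x : munit F) : dvs F := fun P => Num.max 0 (- dv x P).
Definition zer (x : munit F) : dvs F := fun P => Num.max 0 (dv x P).
Lemma fsupp_pol x : fsupp (pol x).
Proof.
have [s hs] := fsupp_dv G x; exists s => P h; apply: hs; apply: contraNneq h.
by rewrite /pol => ->; rewrite oppr0 maxxx.
Qed.
Lemma zer_pol x : zer x = pol (- x).
Proof. by apply/funext => P; rewrite /zer /pol /dv muN (vlV G) ?opprK ?(valP x). Qed.
Lemma dv_zp x : dv x = zer x - pol x.
Proof. by apply/funext => P; rewrite dvsB /zer /pol; lia. Qed.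
Lemma LL_pol x : LL (pol x) (val x).
Proof. by move=> P; right; rewrite /pol -[vl _ _]/(dv x P); lia. Qed.

Lemma LLX D x k : LL D x -> LL (D *+ k) (x ^+ k).
Proof.
move=> hx; elim: k => [|k IH]; last by rewrite exprS mulrS; apply: LL_mul.
by move=> P; rewrite dvsMn mulr0n oppr0; apply/(vge0 G)/pl1.
Qed.

Definition comb x k m (y : nat -> F) (c : {ffun 'I_k * 'I_m -> 'F_q}) : F :=
  \sum_(i < k) psi x (\poly_(j < m) (if insub j is Some j' then c (i, j') else 0)) * y i.

Lemma comb_LL (x : munit F) k m (y : nat -> F) l C (c : {ffun 'I_k * 'I_m.+1 -> 'F_q}) : ind l = pol x -> (forall i : 'I_k, LL (ind C) (y i)) ->
  LL (ind (flatten (nseq m l) ++ C)) (comb (val x) y c).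
Proof.
move=> el hC; have il : ind (flatten (nseq m l)) = ind l *+ m.
  by elim: (m) => [|m' IH]; [apply/funext|rewrite /= ind_cat IH mulrS].
rewrite ind_cat il; apply: (@subg_sum F (LL _) _ _ _ _ (subg_LL _)) => i _; apply: LL_mul (hC i).
rewrite psiE; apply: (@subg_sum F (LL _) _ _ _ _ (subg_LL _)) => j _.
have jm : (j <= m)%N by rewrite -ltnS; apply: leq_trans (ltn_ord j) (size_poly _ _).
apply: (@LL_le (0 + ind l *+ j)).
  by move=> P; rewrite add0r !dvsMn; apply: ler_wpMn2l.
apply: LL_mul; first by move=> P; rewrite oppr0; apply/(vge0 G)/pl_inF.
by rewrite el; apply/LLX/LL_pol.
Qed.

Lemma comb_inj_dep (x : F) k m (y : nat -> F) (c c' : {ffun 'I_k.+1 * 'I_m -> 'F_q}) : c != c' ->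
  comb x y c = comb x y c' -> exists d : nat -> {poly 'F_q},
    (exists2 i, (i <= k)%N & d i != 0) /\ \sum_(i < k.+1) psi x (d i) * y i = 0.
Proof.
move=> cc e; pose P (c : {ffun 'I_k.+1 * 'I_m -> 'F_q}) (i : nat) : {poly 'F_q} :=
  \poly_(j < m) (if insub i is Some i' then if insub j is Some j' then c (i', j') else 0 else 0).
exists (fun i => P c i - P c' i); split; last first.
  apply/eqP; move/eqP: e; rewrite -subr_eq0 /comb -sumrB; congr (_ == _); apply: eq_bigr => i _.
  by rewrite rmorphB mulrBl /P !valK.
have [[i j] hij] : exists ij, c ij != c' ij.
  by apply/existsP; apply: contraNT cc; rewrite negb_exists => /forallP h; apply/eqP/ffunP => ij; apply/eqP; move: (h ij); rewrite negbK.
exists i; first exact: (ltn_ord i).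
apply: contraNneq hij => /(congr1 (fun g : {poly 'F_q} => g`_j)).
by rewrite coefB coef0 !coef_poly ltn_ord !valK => /eqP; rewrite subr_eq0.
Qed.

Lemma in_LL_list k (y : nat -> F) : exists C, forall i, (i < k)%N -> LL (ind C) (y i).
Proof.
elim: k => [|k [C hC]]; first by exists [::].
have [z|z] := eqVneq (y k) 0.
  exists C => i; rewrite ltnS leq_eqVlt => /predU1P[->|/hC//] P; by left; rewrite z.
have [C' eC'] := eff_list (fsupp_pol (mu z)) ltac:(by move=> P; rewrite /pol; lia).
exists (C ++ C') => i; rewrite ltnS leq_eqVlt => /predU1P[->|/hC h].
  apply: LL_le (LL_pol (mu z)) => P; rewrite eC' ind_cat dvsD lerDr /ind; lia.
by apply: LL_le h => P; rewrite ind_cat dvsD lerDl /ind; lia.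
Qed.

Lemma class_pigeon (T : finType) (L : F -> Prop) n (f : T -> F) : idx L (fun x => x = 0) n ->
  (forall c, L (f c)) -> (n < #|T|)%N -> exists c c', c != c' /\ f c = f c'.
Proof.
case=> r [_ _ hr] Lf lt; have [k hk] := choice_ex (fun c => hr (f c) (Lf c)).
have /injectivePn[c [c' cc e]] : ~~ injectiveb k.
  by apply/negP => /injectiveP/leq_card; rewrite card_ord leqNgt lt.
by exists c, c'; split=> //; have := hk c; rewrite e => /subr0_eq ->; have /subr0_eq -> := hk c'.
Qed.

Lemma wsum_cat l l' : wsum (l ++ l') = (wsum l + wsum l')%N.
Proof. by rewrite /wsum big_cat. Qed.
Lemma wsum_nseq m l : wsum (flatten (nseq m l)) = (m * wsum l)%N.
Proof. by elim: m => [|m IH]; rewrite /= ?wsum_cat ?IH ?mulSn // /wsum big_nil. Qed.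

(** The degree of F over F_q(x) is at most the degree of the pole divisor. Combinations of 1 + deg
    elements with polynomial coefficients of degree at most m have poles bounded by m times that
    divisor plus a constant; for large m there are more of them than elements of the Riemann
    space. *)
Lemma dep_count (x : munit F) l : ind l = pol x -> forall y : nat -> F, exists d : nat -> {poly 'F_q},
    (exists2 i, (i <= wsum l)%N & d i != 0) /\ \sum_(i < (wsum l).+1) psi (val x) (d i) * y i = 0.
Proof.
move=> el y; have [N N0 hN] := LL_fin; have [C hC] := in_LL_list (wsum l).+1 y.
pose m := (N + wsum C)%N.
have [n ln hn] := hN (flatten (nseq m l) ++ C).
have [||c [c' [cc e]]] := class_pigeon (f := fun c : {ffun 'I_(wsum l).+1 * 'I_m.+1 -> 'F_q} => comb (val x) y c) hn.
- by move=> c; apply: comb_LL => // i; apply: hC.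
- apply: leq_ltn_trans ln _; rewrite card_ffun card_prod !card_ord (Fp_cast pq) wsum_cat wsum_nseq.
  apply: (@leq_trans (q ^ N * q ^ (m * wsum l + wsum C))%N).
    by rewrite ltn_pmul2r ?expn_gt0 ?qp // ltn_expl.
  by rewrite -expnD leq_pexp2l // /m; nia.
exact: comb_inj_dep cc e.
Qed.

Lemma polyX_dvd0 (h : {poly 'F_q}) : h`_0 = 0 -> exists r, h = 'X * r.
Proof.
move=> h0; exists (\poly_(i < (size h).-1) h`_i.+1); apply/polyP => i; rewrite coefXM.
case: i => [|i] //=; rewrite coef_poly.
by case: ltnP => // le; rewrite nth_default //; move: le; case: (size h).
Qed.

(** The opposite inequality, for the divisor of zeros: modulo x, the semilocal ring of the zeros has
    q^deg elements, while [fin_quot] over F_q[x] at the prime x allows at most q^n. *)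
Lemma zer_bound (x : munit F) n l : ind l = zer x ->
  (forall y : nat -> F, exists c : nat -> {poly 'F_q},
    (exists2 i, (i <= n)%N & c i != 0) /\ \sum_(i < n.+1) psi (val x) (c i) * y i = 0) ->
  (wsum l <= n)%N.
Proof.
move=> el dep; have x0 := valP x; pose Z := undup l.
(* [S [::]] is the semilocal ring of the zeros of x and [S l] is its multiple by x; adding one place
   at a time to the list multiplies the index by the order of a residue field. *)
pose S l' (y : F) := forall P, P \in Z -> vge P (ind l' P) y.
have sS l' : subg (S l').
  by split=> [P _|y z hy hz P PZ]; [left|apply: (subgB (subg_vge G P _)); auto].
have step l' : {subset l' <= Z} -> idx (S [::]) (S l') (q ^ wsum l')%N.
  elim: l' => [|P l' IH] sub; first by rewrite /wsum big_nil; apply: idx1.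
  rewrite /wsum big_cons addnC expnD.
  have PZ : P \in Z by apply: sub; rewrite mem_head.
  have mono y : S (P :: l') y -> S l' y.
    by move=> h Q QZ; apply: vge_le (h Q QZ); rewrite ind_cons dvsD lerDr /ind; lia.
  apply: (idx_mul (B := S l')) => //.
  - by move=> y h Q QZ; apply: vge_le (h Q QZ); rewrite /ind /=; lia.
  - by apply: IH => Q Ql; apply: sub; rewrite inE Ql orbT.
  have indE Q : ind (P :: l') Q = (P == Q)%:Z + ind l' Q by rewrite ind_cons dvsD {1}/ind /= addn0.
  have [u u0 vu] := unif_at G P (- ind l' P).
  have ge y k : vge P (ind l' P + k) y <-> vge P k (y * u).
    split=> [h|h].
      have -> : k = (ind l' P + k) + - ind l' P by lia.
      by apply: (vgeM G); [exact: h|right; rewrite vu].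
    have -> : y = (y * u) * u^-1 by rewrite mulfK.
    rewrite addrC; apply: (vgeM G); [exact: h|right; rewrite (vlV G) // vu; lia].
  apply: (proj2 (@idx_hom _ _ (fun y => y * u) (S l') (S (P :: l')) (sval P) (@mx F P) _ (sS l') (@subg_mx _ P) _ _ _ _)) (wtn_idx H P).
  - by move=> y z; rewrite mulrBl.
  - by move=> y /(_ P PZ) h; apply/(vge0 G)/ge; rewrite addr0.
  - move=> y hy; split=> [/(_ P PZ)|/(vge1 G) m Q QZ].
      by rewrite indE eqxx addrC => /ge/(vge1 G).
    rewrite indE; case: eqP => [<-|_]; last by rewrite add0r; apply: hy.
    by rewrite addrC; apply/ge.
  - move=> r Pr; pose k Q := ind l' Q + 1.
    have [z hz] := weak_approx_vl G (fun Q => if Q == P then r / u else 0) k (undup_uniq l).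
    exists z.
      move=> Q QZ; have := hz Q QZ; case: eqP => [->|_]; last by rewrite subr0; apply: vge_le; rewrite /k; lia.
      move=> h; have -> : z = (z - r / u) + r / u by rewrite subrK.
      apply: (subgD (subg_vge G P _)); first by apply: vge_le h; rewrite /k; lia.
      by rewrite -[ind l' P]addr0; apply/ge; rewrite divfK //; apply/(vge0 G).
    have := hz P PZ; rewrite eqxx /k => /ge/(vge1 G) /(mxN (x := _)).
    by rewrite mulrBl divfK // opprB.
have sub : {subset l <= Z} by move=> P; rewrite mem_undup.
have i1 := step l sub.
have [|Z0] := boolP (Z == [::]).
  by move/eqP => e; have -> : l = [::]; [case: (l) e sub => // P l' e /(_ P); rewrite e mem_head => /(_ isT)|rewrite /wsum big_nil].
have [P PZ] : exists P, P \in Z by case: (Z) Z0 => // P ? _; exists P; rewrite mem_head.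
have pos (Q : place F) : Q \in Z -> 0 < vl Q (val x).
  rewrite mem_undup => Ql; have c0 : (0 < count_mem Q l)%N by rewrite -has_count has_pred1.
  have := congr1 (fun D : dvs F => D Q) el; rewrite /zer /ind /dv /=.
  by move: c0; move: (count_mem Q l) (vl Q _) => a b c0; case: leP => // b0 e; lia.
have vx (Q : place F) : Q \in Z -> vl Q (val x) = ind l Q.
  by move=> QZ; rewrite el /zer; have := pos Q QZ; rewrite /dv; lia.
have mxx : mx P (val x) by apply/(vl_gt0 G P x0)/pos.
have tx : trans pq q0 (val x) := mx_trans x0 mxx.
pose A := imr (psi (val x)).
have sA : sring A := sring_imr _.
have piA h : piS (val x) A (psi (val x) h) <-> h`_0 = 0.
  split=> [[_ [r ->]] e|/polyX_dvd0[r ->]].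
    have /tx/subr0_eq -> : psi (val x) (h - 'X * r) = 0 by rewrite rmorphB rmorphM psiX e subrr.
    by rewrite coefXM.
  by exists (psi (val x) r); [exists r|rewrite rmorphM psiX].
pose s := [seq iF c | c <- enum 'F_q].
have ss : size s = q by rewrite size_map -cardE card_Fp.
have [|||||N lN hN] := @fin_quot F A (val x) s n (S [::]) sA.
- move=> _ [h ->]; exists (iF h`_0); first by apply: map_f; rewrite mem_enum.
  split; first by exists (h`_0)%:P; rewrite psiC.
  by rewrite -(psiC pq q0 (val x)) -rmorphB; apply/piA; rewrite coefB coefC subrr.
- move=> _ [h ->]; have [h0|h0] := eqVneq h`_0 0; [by left; apply/piA|right].
  exists (psi (val x) (h`_0)^-1%:P); first by exists (h`_0)^-1%:P.
  rewrite -rmorphM -[1](rmorph1 (psi (val x))) -rmorphB; apply/piA.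
  by rewrite coefB coefMC mulfV // coef1 subrr.
- move=> y; have [c [[i il ci] e]] := dep y.
  elim: {c}(size (c i)) {-2}c (leqnn (size (c i))) ci e => [|k IH] c; first by rewrite leqn0 size_poly_eq0 => ->.
  move=> sc ci e; have [[j jl cj]|no] := pselect (exists2 j, (j <= n)%N & (c j)`_0 != 0).
    exists (fun j => psi (val x) (c j)); split=> //; first by move=> j'; exists (c j').
    by exists j => //; move/piA => e0; rewrite e0 eqxx in cj.
  have hc j : exists r, (j <= n)%N -> c j = 'X * r.
    have [jl|jl] := leqP j n; last by exists 0.
    have [|r er] := @polyX_dvd0 (c j); last by exists r.
    by apply/eqP/negPn/negP => cj; apply: no; exists j.
  have [r hr] := choice_ex hc; apply: (IH r).
  - have ri : r i != 0 by apply: contra_neq ci => r0; rewrite hr // r0 mulr0.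
    by move: sc; rewrite hr // size_mul ?polyX_eq0 // size_polyX add2n /= ltnS.
  - by apply: contra_neq ci => r0; rewrite hr // r0 mulr0.
  - apply: (mulfI x0); rewrite mulr0 -[RHS]e mulr_sumr; apply: eq_bigr => j _.
    by rewrite mulrA (hr j (leq_ord j)) rmorphM psiX.
- exact: sS.
- move=> _ y [h ->] Sy Q QZ; have := Sy Q QZ; rewrite -[ind _ Q]add0r; apply: (vgeM G).
  by apply/(vge0 G); apply: psi_pl; apply/mx_pl/(vl_gt0 G Q x0)/pos.
have e : N = (q ^ wsum l)%N.
  apply: idx_uniq (sS l) _ i1; apply: idx_ext hN => // y; split=> [[z Sz ->] Q QZ|h].
    by rewrite -[ind l Q]addr0; apply: (vgeM G); [right; rewrite vx|apply: Sz].
  exists (y / val x); last by rewrite mulrC divfK.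
  move=> Q QZ; have -> : ind [::] Q = ind l Q + - ind l Q by rewrite subrr.
  by apply: (vgeM G); [apply: h|right; rewrite (vlV G) // vx].
by move: lN; rewrite e ss leq_exp2l.
Qed.

(** Zeros are bounded by poles through the degree of F over F_q(x); applied to x and to 1/x this
    gives equality. *)
Lemma deg_dv (x : munit F) : deg (dv x) = 0.
Proof.
have le (z : munit F) : deg (zer z) <= deg (pol z).
  have [l el] := eff_list (fsupp_pol z) ltac:(by move=> P; rewrite /pol; lia).
  have fz : fsupp (zer z) by rewrite zer_pol; apply: fsupp_pol.
  have [l' el'] := eff_list fz ltac:(by move=> P; rewrite /zer; lia).
  rewrite el el' !deg_ind lez_nat; apply: (zer_bound (x := z)); first by rewrite el'.
  by apply: dep_count; rewrite el.
have e : deg (zer x) = deg (pol x).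
  apply/le_anti; rewrite le /=; have := le (- x); rewrite zer_pol opprK.
  by have -> : pol (- x) = zer x by rewrite -zer_pol.
rewrite dv_zp degB ?e ?subrr // ?zer_pol; exact: fsupp_pol.
Qed.
End FFCount.

(** * Riemann's inequality and the degree-zero class group *)

Section FFClass.
Variables (F : fieldType) (q : nat) (t : F).
Hypothesis H : ffield q t.
Let pq := ff_prime H.
Let q0 := ff_char H.
Let G := ff_gl H.
Notation psi := (psi pq q0).
Let q1 : (1 < q)%N := prime_gt1 pq.
Let qp : (0 < q)%N := prime_gt0 pq.
Let t0 := ff_t0 H.
Let ut : munit F := mu t0.

(** By [zer_bound] there are as many elements independent over F_q[t] as the degree of the pole
    divisor of t. Their combinations with coefficients of degree at most m lie in the space and are
    pairwise distinct. *)
Lemma riemann_seed : exists l C : seq (place F), (0 < wsum l)%N /\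
  forall m, exists2 n, (q ^ (m.+1 * wsum l) <= n)%N &
    idx (LL (ind (flatten (nseq m l) ++ C))) (fun x => x = 0) n.
Proof.
have fz : fsupp (zer ut) by rewrite (zer_pol H); apply: (fsupp_pol H).
have [l el] := eff_list H (fsupp_pol H ut) ltac:(by move=> P; rewrite /pol; lia).
have [lz elz] := eff_list H fz ltac:(by move=> P; rewrite /zer; lia).
have ez : wsum lz = wsum l.
  have := deg_dv H ut; rewrite (dv_zp H) elz el (degB (fsupp_ind _) (fsupp_ind _)) !(deg_ind H).
  by move/eqP; rewrite subr_eq0 eqz_nat => /eqP.
have tt : trans pq q0 t := @ff_trans _ _ _ H.
have l0 : (0 < wsum l)%N.
  rewrite -ez; have [P mP] := has_zero t0 tt; have Pl : P \in lz.
    have := congr1 (fun D : dvs F => D P) elz; rewrite /zer /ind /dv /=; have /(vl_gt0 G P t0) := mP.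
    rewrite -has_pred1 has_count; move: (count _ lz) (vl P _) => a b b0; case: leP => c; lia.
  by rewrite /wsum (big_rem P) //= addn_gt0 (wtn_gt0 H).
have [y hy] : exists y : nat -> F, forall c : nat -> {poly 'F_q},
    \sum_(i < wsum l) psi t (c i) * y i = 0 -> forall i, (i < wsum l)%N -> c i = 0.
  apply/not_existsP => no; have := prednK l0; set n := (wsum l).-1 => en.
  have : (wsum lz <= n)%N.
    have zb := @zer_bound F q t H ut n lz; apply: zb; first by rewrite elz.
    move=> y; apply/not_existsP => noc; apply: (no y) => c e i il; apply/eqP/negPn/negP => ci.
    by apply: (noc c); rewrite en; split=> //; exists i => //; rewrite -ltnS en.
  by rewrite ez -en ltnn.
have [C hC] := in_LL_list H (wsum l) y.
exists l, C; split=> // m; have [N N0 hN] := LL_fin H; have [n ln hn] := hN (flatten (nseq m l) ++ C).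
exists n => //; rewrite leqNgt; apply/negP => lt.
have [||c [c' [cc e]]] := class_pigeon (f := fun c : {ffun 'I_(wsum l) * 'I_m.+1 -> 'F_q} => comb H t y c) hn.
- move=> c; apply: (comb_LL H (x := ut)); [by rewrite el|by move=> i; apply: hC].
- by rewrite card_ffun card_prod !card_ord (Fp_cast pq) mulnC.
move: hy c c' cc e; move: {lt ez}(wsum l) l0 => [//|k] _ hy c c' cc e.
by have [d [[i ik di] ed]] := comb_inj_dep cc e; rewrite (hy d ed) ?eqxx in di.
Qed.

Lemma LL_idx_fin (D : dvs F) : fsupp D -> exists n, idx (LL D) (fun x => x = 0) n.
Proof.
move=> fD; have [l el] : exists l, forall P, D P <= ind l P.
  have fz : fsupp (fun P => Num.max 0 (D P)).
    by case: fD => s hs; exists s => P h; apply: hs; apply: contraNneq h => ->; rewrite maxxx.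
  have [l el] := eff_list H fz ltac:(by move=> P /=; lia).
  by exists l => P; rewrite -el /=; lia.
have [N _ hN] := LL_fin H; have [n _ hn] := hN l.
have z : subg (fun x : F => x = 0) by split=> // x y -> ->; rewrite subrr.
have [||k [m [_ hm _]]] := @idx_sub _ (LL (ind l)) (LL D) (fun x : F => x = 0) n (subg_LL H _) (subg_LL H D) z _ _ hn.
- by move=> x -> P; left.
- by move=> x; apply: (LL_le).
by exists m.
Qed.

Lemma LL_compare (D D' : dvs F) n n' : fsupp D -> fsupp D' -> (forall P, D P <= D' P) ->
  idx (LL D) (fun x => x = 0) n -> idx (LL D') (fun x => x = 0) n' ->
  exists2 k : nat, deg D' - deg D = k%:Z & (n' <= q ^ k * n)%N.
Proof.
move=> fD fD' le hn hn'; have f2 : fsupp (D' - D) := subgB (@subg_fsupp F) fD' fD.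
have [l el] := eff_list H f2 ltac:(by move=> P; rewrite dvsB subr_ge0).
exists (wsum l); first by rewrite -(degB fD' fD) el (deg_ind H).
have eD : D' = D + ind l by rewrite -el addrC subrK.
have z : subg (fun x : F => x = 0) by split=> // x y -> ->; rewrite subrr.
have [k lk hk] := LL_list H D l; rewrite -eD in hk.
have h2 : idx (LL D') (fun x => x = 0) (k * n)%N.
  apply: (idx_mul (B := LL D)) hk hn => //; try exact: (subg_LL H).
    by move=> x -> P; left.
  by move=> x; apply: (LL_le).
by rewrite (idx_uniq z hn' h2) leq_mul.
Qed.

Lemma nonzero_LL (D : dvs F) n : idx (LL D) (fun x => x = 0) n -> (1 < n)%N -> exists x : munit F, LL D (val x).
Proof.
case: n => [|[|n]] // [f [fi fu _]] _.
have ne : f ord0 != f (Ordinal (isT : (1 < n.+2)%N)).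
  by apply/eqP => e; have := fu ord0 (Ordinal (isT : (1 < n.+2)%N)); rewrite e subrr => /(_ erefl).
have d0 : f ord0 - f (Ordinal (isT : (1 < n.+2)%N)) != 0 by rewrite subr_eq0.
by exists (mu d0); apply: (subgB (subg_LL H _)).
Qed.

(** D' is first moved by a principal divisor below some [Dm m]. The lower bound known for the space
    of [Dm m] then passes to D', because the sizes of nested spaces differ by at most q to the
    difference of degrees. *)
Lemma riemann : exists D1 : dvs F, fsupp D1 /\ forall D, Div0 D ->
  exists x : munit F, forall P, 0 <= D P + D1 P + dv x P.
Proof.
have [l [C [l0 hl]]] := riemann_seed; pose Dm m := flatten (nseq m l) ++ C.
have wDm m : wsum (Dm m) = (m * wsum l + wsum C)%N by rewrite wsum_cat wsum_nseq.
pose m1 := (wsum C).+1.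
exists (ind (Dm m1)); split; first exact: fsupp_ind.
move=> D [fD dD]; have fS := @subg_fsupp F; pose D' := D + ind (Dm m1).
have fD' : fsupp D' by apply: subgD fS fD (fsupp_ind _).
have dD' : deg D' = (wsum (Dm m1))%:Z by rewrite /D' (degD fD (fsupp_ind _)) dD add0r (deg_ind H).
have fE : fsupp (fun P => Num.max 0 (D' P)).
  by case: fD' => s hs; exists s => P h; apply: hs; apply: contraNneq h => ->; rewrite maxxx.
have [e ee] := eff_list H fE ltac:(by move=> P /=; lia).
(* This m makes the space of [Dm m] larger than q^deg(e), so that of [Dm m] - e is nonzero and
   supplies the function z that moves D'. *)
pose m := (wsum C + wsum e).+1; have [n ln hn] := hl m; rewrite -/(Dm m) in hn.
have fDe : fsupp (ind (Dm m) - ind e) := subgB fS (fsupp_ind _) (fsupp_ind _).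
have [n2 hn2] := LL_idx_fin fDe.
have lee P : (ind (Dm m) - ind e) P <= ind (Dm m) P by rewrite dvsB lerBlDr lerDl /ind; lia.
have [k ek lk] := LL_compare fDe (fsupp_ind _) lee hn2 hn.
have ke : k = wsum e.
  by move: ek; rewrite (degB (fsupp_ind _) (fsupp_ind _)) !(deg_ind H) => ek; lia.
have [|z hz] := nonzero_LL hn2.
  rewrite ltnNge; apply/negP => n21.
  have : (q ^ (m.+1 * wsum l) <= q ^ wsum e)%N.
    by apply: leq_trans ln _; apply: leq_trans lk _; rewrite ke -[X in (_ <= X)%N]muln1 leq_mul.
  rewrite leq_exp2l // /m; nia.
pose D2 := D' - dv z.
have fD2 : fsupp D2 by apply: subgB fS fD' (fsupp_dv G z).
have leD2 P : D2 P <= ind (Dm m) P.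
  have := hz P; rewrite /D2 !dvsB; have : D' P <= ind e P by rewrite -ee /=; lia.
  move=> De; case=> [e0|]; first by have := valP z; rewrite e0 eqxx.
  by rewrite /dv; lia.
have [n3 hn3] := LL_idx_fin fD2; have [k2 ek2 lk2] := LL_compare fD2 (fsupp_ind _) leD2 hn3 hn.
have dD2 : deg D2 = (wsum (Dm m1))%:Z by rewrite /D2 (degB fD' (fsupp_dv G z)) dD' (deg_dv H) subr0.
have [|u hu] := nonzero_LL hn3.
  rewrite ltnNge; apply/negP => n31; rewrite (deg_ind H) dD2 in ek2.
  have : (q ^ (m.+1 * wsum l) <= q ^ k2)%N.
    by apply: leq_trans ln _; apply: leq_trans lk2 _; rewrite -[X in (_ <= X)%N]muln1 leq_mul.
  rewrite leq_exp2l // => le; have w1 := wDm m1; have w := wDm m.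
  have : (k2 + wsum (Dm m1) = wsum (Dm m))%N by lia.
  rewrite w w1 => e3; move: le e3; rewrite /m1 mulSn; move: l0; move: (m * wsum l)%N (wsum l) (wsum C) => a b c; nia.
exists (u - z) => P; rewrite (dvB G) dvsB; have := hu P; rewrite /D2 /D' !dvsB !dvsD.
case=> [e0|]; first by have := valP u; rewrite e0 eqxx.
by rewrite -/(dv u P); lia.
Qed.

(** If the residue field has at most N = q^d elements and t is regular at P, two of the powers t^0,
    ..., t^N agree there. So P is among the finitely many places where the nonzero product z of all
    their differences is not a unit. *)
Lemma bounded_places d : exists s : seq (place F), forall P, (wtn P <= d)%N -> P \in s.
Proof.
pose N := (q ^ d)%N; have tt : trans pq q0 t := @ff_trans _ _ _ H.
have tX i j : (i < j)%N -> t ^+ j - t ^+ i != 0.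
  move=> ij; apply/eqP => e; have : psi t ('X^j - 'X^i) = 0 by rewrite rmorphB !rmorphXn psiX.
  move/tt/eqP; rewrite subr_eq0 => /eqP/(congr1 (fun p : {poly 'F_q} => size p)).
  by rewrite !size_polyXn => -[e']; rewrite e' ltnn in ij.
pose z := \prod_(j < N.+1) \prod_(i < j) (t ^+ j - t ^+ i).
have z0 : z != 0.
  by apply/prodf_neq0 => j _; apply/prodf_neq0 => i _; apply: tX.
have [s1 h1] := gl_supp G z0; have [s2 h2] := gl_supp G t0.
exists (s1 ++ s2) => P wP; rewrite mem_cat; have [Pt|nPt] := pselect (sval P t); last first.
  by rewrite h2 ?orbT // => -[].
rewrite h1 // => /vunit_notmx; apply.
have [f [_ _ hf]] := wtn_idx H P; have [k hk] := choice_ex (fun j => hf _ (plX j Pt)).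
pose g (j : 'I_N.+1) := k j.
have /injectivePn[a [b ab e]] : ~~ injectiveb g.
  apply/negP => /injectiveP/leq_card; rewrite !card_ord leqNgt ltnS /N leq_exp2l // wP //.
have mm (i j : 'I_N.+1) : g i = g j -> mx P (t ^+ j - t ^+ i).
  move=> e'; have := mxB (hk j) (hk i); rewrite -/(g i) -/(g j) e' opprB addrA subrK; by [].
wlog lt : a b ab e / (a < b)%N.
  move=> h; have [lt|lt|/val_inj e''] := ltngtP a b; last by rewrite e'' eqxx in ab.
    exact: h lt.
  by apply: (h b a); rewrite // eq_sym.
rewrite /z (bigD1 b) //=; apply: mxMr; last first.
  by apply: pl_prod => j _; apply: pl_prod => i _; apply: plB; apply: plX.
rewrite (bigD1 (Ordinal lt)) //=; apply: mxMr; first exact: mm.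
by apply: pl_prod => i _; apply: plB; apply: plX.
Qed.

Lemma ff_class_number : exists h, idx (@Div0 F) (fun D => exists x, D = dv x) h.
Proof.
have [D1 [fD1 hD1]] := riemann; pose d := `|deg D1|%N; have [s hs] := bounded_places d.
pose E : dvs F := fun P => if P \in s then d%:Z else 0.
have fE : fsupp E by exists s => P; rewrite /E; case: ifP.
have [I [c hc]] := div_code fE.
pose red (D : dvs F) (x : munit F) := D + D1 + dv x.
have fS := @subg_fsupp F.
have bd D x : Div0 D -> (forall P, 0 <= red D x P) -> forall P, 0 <= red D x P <= E P.
  move=> [fD dD] h P; rewrite h /=; have fr : fsupp (red D x).
    exact: (subgD fS (subgD fS fD fD1) (fsupp_dv G x)).
  have [l el] := eff_list H fr h.
  have wl : wsum l = d.
    have := deg_ind H l; rewrite -el /red (degD (subgD fS fD fD1) (fsupp_dv G x)).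
    by rewrite (degD fD fD1) dD (deg_dv H) add0r addr0 /d => ->.
  have [Pl|nPl] := boolP (P \in l); last first.
    rewrite el /ind (count_memPn nPl) /E; by case: ifP.
  have le : (count_mem P l * wtn P <= wsum l)%N.
    rewrite /wsum; elim: (l) => [|Q l' IH]; first by rewrite big_nil.
    rewrite big_cons /= mulnDl; apply: leq_add => //.
    by case: eqP => [->|_]; rewrite ?mul1n.
  have w0 := wtn_gt0 H P; have c0 : (0 < count_mem P l)%N by rewrite -has_count has_pred1.
  rewrite el /ind /E hs ?lez_nat -?wl; last by nia.
  by apply: leq_trans le; rewrite leq_pmulr.
have [|||h _ hh] := @nc_cover (dvs F) I (fun D D' => exists x, D - D' = dv x) (@Div0 F)
  (fun D i => exists x, (Div0 D -> forall P, 0 <= red D x P <= E P) /\ c (red D x) = i /\ Div0 D).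
- split=> [D|D D' [x e]|D D' D'' [x e] [y e']].
  + by exists 0; rewrite subrr; apply/funext => P; rewrite /dv mu0 (vl1 G).
  + by exists (- x); rewrite -opprB e -[- x]sub0r (dvB G); apply/funext => P; rewrite dvsN dvsB /dv mu0 (vl1 G) sub0r.
  + exists (x + y); rewrite -(subrKA D') e e'; apply/funext => P.
    by rewrite /dv muD (vlM G) ?(valP x) ?(valP y).
- by move=> D D0; have [x hx] := hD1 D D0; exists (c (red D x)), x; split=> // _; apply: bd.
- move=> D D' i [x [hx [ex dx]]] [y [hy [ey dy]]]; exists (y - x).
  have := hc _ _ (hx dx) (hy dy); rewrite ex ey => /(_ erefl) /(congr1 (fun E : dvs F => fun P => E P)) e.
  have eP P : (D - D') P = (dv y - dv x) P.
    have : (red D x) P = (red D' y) P by exact: (congr1 (fun f : place F -> int => f P) e).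
    change (D P + D1 P + dv x P = D' P + D1 P + dv y P -> D P - D' P = dv y P - dv x P).
    move: (D P) (D' P) (D1 P) (dv x P) (dv y P) => a b c' d1 d2; lia.
  by rewrite (dvB G); apply/funext => P; apply: eP.
by exists h.
Qed.

Lemma C_card_ff S N :
  idx (fun D => @Div0 F D /\ match S with None => True
    | Some Q => exists m, Q m /\ exists x, D *+ m = dv x end) (fun D => exists x, D = dv x) N ->
  C_card F S N.
Proof.
move=> hN; split=> [/(not_char0 H)//|_].
apply: nc_ext hN => [D E|D]; first exact: iff_sym (principalP G _).
have e1 : Div0 D <-> deg0_divisor D.
  split=> [[fD dD]|[m [f [dg [fi fc hd e]]]]].
    have [s [us hs]] := (fsuppP D).1 fD; exists (size s), (fun i => tnth (in_tuple s) i), (fun i => wtn (tnth (in_tuple s) i)).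
    split.
    - exact/tuple_uniqP.
    - by move=> P /hs Ps; have /tnthP[i ->] : P \in in_tuple s by []; exists i.
    - move=> i; exact: (proj2 (place_degP H _ _) (wtn_idx H _)).
    - have -> : \sum_i D (tnth (in_tuple s) i) * (wtn (tnth (in_tuple s) i))%:Z = \sum_(P <- s) D P * (wtn P)%:Z by rewrite [RHS]big_tnth.
      by rewrite -[LHS]dD (degE us hs); apply: eq_bigr => P _; rewrite (wtnE H) mulrC.
  have us : uniq [seq f i | i <- enum 'I_m] by rewrite map_inj_uniq ?enum_uniq.
  have hs P : D P != 0 -> P \in [seq f i | i <- enum 'I_m].
    by move=> /fc[i <-]; apply: map_f; rewrite mem_enum.
  split; first by exists [seq f i | i <- enum 'I_m].
  apply: etrans (esym e); rewrite (degE us hs) big_map big_enum /=; apply: eq_bigr => i _.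
  rewrite (wtnE H) mulrC; congr (_ * Posz _); have := (place_degP H _ _).1 (hd i) => h.
  have := idx_uniq (@subg_mx _ _) h (wtn_idx H (f i)) => /eqP; rewrite eqn_exp2l // => /eqP ->.
  by [].
split=> [[/e1 dD sD]|[/e1 dD sD]]; split=> //; case: (S) sD => // Q [m [Qm h]]; exists m; split=> //.
  by apply/(principalP G); case: h => x ex; exists x; rewrite -ex; apply/funext => P; rewrite dvsMn -mulr_natl natz.
move/(principalP G): h => [x ex]; exists x; rewrite -ex; apply/funext => P; by rewrite dvsMn -mulr_natl natz.
Qed.
End FFClass.

(** * Cyclic steps *)

(** What the tower argument uses of a layer, in one format for both kinds of field. In
    characteristic 0 all degrees vanish, so that conditions on degrees hold trivially. *)
Record gdata (F : fieldType) : Prop := Gdata {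
  gd_gl : gl F;
  gd_h : exists h, idx (@Div0 F) (Pr (@dv F)) h;
  gd_deg : forall x : munit F, deg (dv x) = 0;
  gd_wt : char0 F \/ forall P : place F, 0 < wt P;
  gd_card : forall S N, idx (fun D => @Div0 F D /\ match S with None => True
    | Some Q => exists m, Q m /\ Pr (@dv F) (D *+ m) end) (Pr (@dv F)) N -> C_card F S N }.

Lemma deg_char0 (F : fieldType) (D : dvs F) : char0 F -> deg D = 0.
Proof.
move=> c; rewrite /deg big1 // => P _; rewrite /wt; case: asboolP => // _; exact: mul0r.
Qed.

Lemma nf_gdata (F : fieldType) : number_field F -> gdata F.
Proof.
move=> nF; have c : char0 F by case: nF.
have e D : @fsupp F D <-> Div0 D by split=> [fD|[]//]; split=> //; apply: deg_char0.
have [n [w [co H]]] := nfb_ex nF; have [h hh] := class_number H.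
split; [exact: nf_gl|exists h; exact: idx_ext hh|by move=> x; apply: deg_char0|by left|].
move=> S N hN; apply: (C_card_nf nF); apply: idx_ext hN => // D.
by split=> -[/e].
Qed.

Lemma ff_gdata (F : fieldType) : function_field F -> gdata F.
Proof.
move=> fF; have [q [t H]] := ffield_ex fF.
split; [exact: ff_gl H|exact: ff_class_number H|exact: deg_dv H| |exact: C_card_ff H].
by right=> P; rewrite (wtnE H) ltz_nat (wtn_gt0 H).
Qed.

Lemma idx_exp (V : zmodType) (A B : V -> Prop) n x : subg A -> subg B -> (forall y, B y -> A y) ->
  idx A B n -> A x -> exists2 r, (0 < r)%N & B (x *+ r).
Proof.
move=> sA sB BA hn Ax; have [Bx|nBx] := pselect (B x); first by exists 1.
by have [r r1 [_ [h _]]] := idx_cyclic sA sB hn Ax nBx BA; exists r => //; apply: ltnW.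
Qed.

Lemma subg_bezout (V : zmodType) (B : V -> Prop) a b x : subg B -> (0 < a)%N -> coprime a b ->
  B (x *+ a) -> B (x *+ b) -> B x.
Proof.
move=> sB a0 /(coprimeP _ a0)[[u v] /= e] ha hb.
have e1 : (a * u = (b * v).+1)%N by lia.
have -> : x = x *+ (a * u) - x *+ (b * v) by rewrite e1 mulrS addrK.
by apply: subgB => //; rewrite mulrnA; apply: subgMn.
Qed.

Lemma deg_Mn (F : fieldType) (D : dvs F) r : fsupp D -> deg (D *+ r) = deg D *+ r.
Proof.
move=> fD; elim: r => [|r IH]; first by rewrite !mulr0n deg0.
by rewrite !mulrS degD ?IH //; apply: (subgMn _ (@subg_fsupp F)).
Qed.

Lemma deg_Mz (F : fieldType) (D : dvs F) (z : int) : fsupp D -> deg (D *~ z) = deg D * z.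
Proof.
move=> fD; case: z => r; first by rewrite -pmulrn deg_Mn // -mulr_natr natz.
rewrite NegzE mulrNz -[- (_ *~ _)]sub0r (degB (subg0 (@subg_fsupp F))).
  by rewrite deg0 sub0r -pmulrn deg_Mn // mulrN -mulr_natr natz.
by rewrite -pmulrn; apply: (subgMn _ (@subg_fsupp F)).
Qed.

Lemma deg_gt0 (F : fieldType) (D : dvs F) P : (forall P : place F, 0 < wt P) -> fsupp D ->
  (forall P, 0 <= D P) -> D P != 0 -> 0 < deg D.
Proof.
move=> w fD D0 DP; have [us hs] := dsuppP fD; rewrite /deg.
have nn Q : 0 <= wt Q * D Q by rewrite mulr_ge0 // ltW.
rewrite lt0r sumr_ge0 ?andbT //; rewrite psumr_eq0 //; apply/negP => /allP/(_ P (hs P DP)) /=.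
by rewrite mulf_eq0 (gt_eqF (w P)) /= (negPf DP).
Qed.

Section GStep.
Variables (A B : fieldType) (f : {rmorphism A -> B}) (s : {rmorphism B -> B}) (g : nat).
Hypothesis g0 : (0 < g)%N.
Hypothesis sg : forall x, irm s g x = x.
Hypothesis sfix : forall x, s x = x <-> exists a, x = f a.
Hypothesis sfaith : forall i, (0 < i < g)%N -> exists x, irm s i x != x.
Hypotheses (DA : gdata A) (DB : gdata B).
Let GA := gd_gl DA.
Let GB := gd_gl DB.
Local Notation spull := (spull g0 sg).
Local Notation fpull := (fpull g0 sg sfix).
Local Notation framf := (framf g0 sg sfix).
Local Notation sV := (sV g0 sg).
Local Notation jf := (jd (cyc_proper g0 sg sfix)).
Local Notation Ifix := (Ifix g0 sg).
Local Notation Jim := (Jim g0 sg sfix).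
Local Notation sm := (mu_map s).
Local Notation PA := (Pr (@dv A)).
Local Notation PB := (Pr (@dv B)).
Local Notation I0 := (@Div0 B).

Lemma subg_PA : subg PA. Proof. exact: sgPr (dvB GA). Qed.
Lemma subg_PB : subg PB. Proof. exact: sgPr (dvB GB). Qed.
Lemma Div0_PA D : PA D -> Div0 D.
Proof. by move=> [x ->]; split; [apply: fsupp_dv|apply: gd_deg]. Qed.
Lemma Div0_PB D : PB D -> I0 D.
Proof. by move=> [x ->]; split; [apply: fsupp_dv|apply: gd_deg]. Qed.

Lemma jfB D D' : jf (D - D') = jf D - jf D'. Proof. exact: jdB. Qed.
Lemma jf_dv x : jf (dv x) = dv (mu_map f x). Proof. exact: (jd_dv GA GB). Qed.
Lemma jf_inj D D' : jf D = jf D' -> D = D'.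
Proof. by move=> e; apply/subr0_eq/(jd_inj GA GB (Hf := cyc_proper g0 sg sfix)); rewrite jfB e subrr. Qed.
Lemma sVB' D D' : sV (D - D') = sV D - sV D'. Proof. by []. Qed.

Lemma jf_PA D : PA D -> PB (jf D).
Proof. by move=> [x ->]; exists (mu_map f x); rewrite jf_dv. Qed.

(** Finiteness of the class group replaces a degree formula: a positive multiple of D is principal,
    hence so is its extension, and principal divisors have degree 0. *)
Lemma jf_Div0 D : Div0 D -> I0 (jf D).
Proof.
move=> D0; have [h hh] := gd_h DA.
have [r r0 /jf_PA/Div0_PB[_]] := idx_exp (subg_Div0 A) subg_PA Div0_PA hh D0.
have fJ : fsupp (jf D) by apply: fsupp_jd; case: D0.
rewrite (morB_Mn jfB) deg_Mn // => /eqP; rewrite mulrn_eq0 -leqn0 leqNgt r0 /= => /eqP e.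
by split.
Qed.

(** In positive characteristic D is compared with a single place e: the combination of e and D of
    degree 0 extends to degree 0, so deg(jf e) deg D = 0, and the extension of e is effective and
    nonzero. *)
Lemma jf_deg0 D : fsupp D -> deg (jf D) = 0 -> deg D = 0.
Proof.
move=> fD dj; have [c|nc] := pselect (char0 A); first exact: deg_char0.
have wA : forall P : place A, 0 < wt P by case: (gd_wt DA).
have wB : forall P : place B, 0 < wt P.
  case: (gd_wt DB) => // c; case: nc => n; apply/eqP => e; have := c n.
  by rewrite -(rmorph_nat f) e rmorph0 eqxx.
apply/eqP/negPn/negP => dn.
have [P DP] : exists P, D P != 0.
  by apply/not_existsP => no; move/eqP: dn; apply; rewrite /deg big1 // => P _; have /negP/negPn/eqP -> := no P; rewrite mulr0.
pose e : dvs A := fun Q => if Q == P then 1 else 0.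
have fe : fsupp e by exists [:: P] => Q; rewrite /e mem_seq1; case: (Q == P); rewrite ?eqxx.
have e0 : 0 < deg e by apply: (deg_gt0 (P := P)) => // [Q|]; rewrite /e ?eqxx //; case: eqP.
have fS := @subg_fsupp A.
have fMz (z : int) (D' : dvs A) : fsupp D' -> fsupp (D' *~ z) by move=> h; exact: (@subgMz _ (@fsupp A) _ z fS h).
have [fJ] : I0 (jf (e *~ deg D - D *~ deg e)).
  apply: jf_Div0; split; first by apply: (subgB fS); apply: fMz.
  by rewrite degB ?deg_Mz //; [rewrite mulrC subrr|apply: fMz|apply: fMz].
have fSB := @subg_fsupp B.
have fje : fsupp (jf e) by apply: fsupp_jd.
have fjD : fsupp (jf D) by apply: fsupp_jd.
rewrite jfB !(morB_Mz jfB) degB; try by apply: subgMz.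
rewrite !deg_Mz // dj mul0r subr0 => /eqP; rewrite mulf_eq0 (negPf dn) orbF.
have [Q eQ] := pull_surj GA (cyc_proper g0 sg sfix) P.
rewrite gt_eqF //; apply: (deg_gt0 (P := Q)) => // [R|]; rewrite /jd /e.
  by apply: mulr_ge0; [apply/ltW/(ram_gt0 GA GB)|case: eqP].
by rewrite eQ eqxx mulr1 gt_eqF // (ram_gt0 GA GB).
Qed.

Lemma wt_spull P : wt (spull 1 P) = wt P.
Proof.
have eN N : nclasses (fun x y => mx (spull 1 P) (x - y)) (sval (spull 1 P)) N <->
  nclasses (fun x y => mx P (x - y)) (sval P) N.
  apply: (@nc_iso _ _ _ _ _ _ s N) => [|x hx|x y _ _|y hy].
  - exact: subg_eqv (subg_mx P).
  - exact: hx.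
  - by rewrite -rmorphB; apply: (spull_mx g0 sg 1).
  - exists (irm s g.-1 y); last first.
      by rewrite -[s _]/(irm s 1 _) -irmD add1n prednK // sg subrr; apply: subg0 (subg_mx P).
    by change (sval P (irm s 1 (irm s g.-1 y))); rewrite -irmD add1n prednK // sg.
rewrite /wt; case: asboolP => // _; congr (Posz (xget 0%N _)); apply/funext => d; apply/propext.
by split=> -[p' [pp pz h]]; exists p'; split=> //; apply/eN.
Qed.

Lemma sV_deg D : fsupp D -> deg (sV D) = deg D.
Proof.
move=> fD; have [us hs] := dsuppP fD.
have c1 P : spull 1 (spull (g - 1) P) = P by rewrite spullD subnK // -(spull_mod g0 sg) modnn spull0.
have c2 P : spull (g - 1) (spull 1 P) = P by apply: spull_cancel.
rewrite (degE (s := [seq spull (g - 1) P | P <- dsupp D])).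
- rewrite big_map; apply: eq_bigr => P _; have -> : wt (spull (g - 1) P) = wt P by rewrite -{2}(c1 P) wt_spull.
  congr (_ * _); exact: (congr1 D (c1 P)).
- by rewrite map_inj_uniq //; apply: can_inj c1.
- by move=> P /hs h; rewrite -(c2 P); apply: map_f.
Qed.

Lemma fsupp_iter k D : fsupp D -> fsupp (iter k sV D).
Proof. by move=> fD; elim: k => //= k IH; apply: sV_fsupp. Qed.

Lemma fsupp_trc k D : fsupp D -> fsupp (trc sV k D).
Proof. by move=> fD; apply: (@subg_sum _ (@fsupp B) _ _ _ _ (@subg_fsupp B)) => i _; apply: fsupp_iter. Qed.

Lemma deg_trc k D : fsupp D -> deg (trc sV k D) = deg D *+ k.
Proof.
move=> fD; elim: k => [|k IH]; first by rewrite /trc big_ord0 deg0.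
have e : trc sV k.+1 D = trc sV k D + iter k sV D by rewrite /trc big_ord_recr.
rewrite e (degD (fsupp_trc k fD) (fsupp_iter k fD)) IH mulrSr; congr (_ + _).
by elim: k {IH e} => //= k IH; rewrite sV_deg ?IH //; apply: fsupp_iter.
Qed.

Lemma sV_Div0 D : I0 D -> I0 (sV D).
Proof. by move=> [fD dD]; split; [apply: sV_fsupp|rewrite sV_deg]. Qed.

Lemma sV_PB D : PB D -> PB (sV D).
Proof. by move=> [x ->]; exists (sm x); rewrite (sV_dv g0 sg GB). Qed.

Definition Jim0 (v : dvs B) := exists D, Div0 D /\ v = jf D.

Lemma subg_Jim0 : subg Jim0.
Proof.
split; first by exists 0; split; [apply: subg0 (subg_Div0 A)|rewrite (morB0 jfB)].
by move=> _ _ [x [h ->]] [y [k ->]]; exists (x - y); rewrite jfB; split=> //; apply: (subgB (subg_Div0 A)).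
Qed.

Lemma Jim0P v : Jim0 v <-> I0 v /\ Jim v.
Proof.
split=> [[D [D0 ->]]|[[_ dv0] [D [fD e]]]].
  by split; [apply: jf_Div0|exists D; split=> //; case: D0].
by exists D; split=> //; split=> //; apply: jf_deg0; rewrite -?e.
Qed.

Lemma Jim0_fix v : Jim0 v -> I0 v /\ sV v = v.
Proof. by move=> [D [D0 ->]]; split; [apply: jf_Div0|apply: (sV_jd g0 sg sfix GA GB)]. Qed.

Lemma fixed_dv (x : munit B) : sm x = x -> exists y, x = mu_map f y.
Proof.
move=> /(congr1 val) /= /sfix[a ea].
have a0 : a != 0 by rewrite -(fmorph_eq0 f) -ea (valP x).
by exists (mu a0); apply: val_inj.
Qed.

Lemma fixed_Jim0 (x : munit B) : sm x = x -> Jim0 (dv x).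
Proof.
by move=> /fixed_dv[y ->]; exists (dv y); rewrite jf_dv; split=> //; apply: Div0_PA; exists y.
Qed.

Lemma idx_Jim0 h : idx (@Div0 A) PA h -> idx Jim0 (Pr' (@dv B) sm) h.
Proof.
have sP' : subg (Pr' (@dv B) sm) by apply: sgPr' => //; [exact: dvB|exact: mu_mapB].
apply: (proj1 (@idx_hom _ _ (jf : dvs A -> dvs B) (@Div0 A) PA Jim0 (Pr' (@dv B) sm) h (subg_Div0 A) sP' jfB _ _ _)).
- by move=> D D0; exists D.
- move=> D D0; split=> [[x ->]|[x [/fixed_dv[y ->]]]].
    exists (mu_map f x); split; last by rewrite jf_dv.
    by apply: val_inj; rewrite /= (s_f sfix).
  by rewrite -jf_dv => /jf_inj ->; exists y.
- move=> _ [D [D0 ->]]; exists D => //; rewrite subrr; exact: subg0.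
Qed.

Let sMg := mu_map_g sg.
Let sVg := sV_g g0 sg.
Let ds (x : munit B) : dv (sm x) = sV (dv x) := sV_dv g0 sg GB x.
Let H90 := hilbert90 g0 sg sfaith.

Definition step_chevalley h W0 H0 H1 y (hh : idx (@Div0 A) PA h) :=
  @chevalley (munit B) (dvs B) (@dv B) sm sV g (dvB GB) (mu_mapB s) sVB' ds sMg sVg H90
  I0 Jim0 (subg_Div0 B) subg_Jim0 (fun x => Div0_PB (ex_intro _ x erefl)) Jim0_fix fixed_Jim0
  h W0 H0 H1 y (idx_Jim0 hh).

Definition step_H1 h W0 (hh : idx (@Div0 A) PA h) :=
  @chev_H1 (munit B) (dvs B) (@dv B) sm sV g (dvB GB) (mu_mapB s) sVB' ds sMg
  H90 I0 Jim0 (subg_Div0 B) subg_Jim0 (fun x => Div0_PB (ex_intro _ x erefl)) Jim0_fix fixed_Jim0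
  h W0 (idx_Jim0 hh).
End GStep.

Section GStep2.
Variables (A B : fieldType) (f : {rmorphism A -> B}) (s : {rmorphism B -> B}) (g : nat).
Hypothesis g0 : (0 < g)%N.
Hypothesis sg : forall x, irm s g x = x.
Hypothesis sfix : forall x, s x = x <-> exists a, x = f a.
Hypothesis sfaith : forall i, (0 < i < g)%N -> exists x, irm s i x != x.
Hypotheses (DA : gdata A) (DB : gdata B).
Let GA := gd_gl DA.
Let GB := gd_gl DB.
Local Notation spull := (spull g0 sg).
Local Notation fpull := (fpull g0 sg sfix).
Local Notation framf := (framf g0 sg sfix).
Local Notation sV := (sV g0 sg).
Local Notation jf := (jd (cyc_proper g0 sg sfix)).
Local Notation Ifix := (Ifix g0 sg).
Local Notation Jim := (Jim g0 sg sfix).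
Local Notation sm := (mu_map s).
Local Notation PA := (Pr (@dv A)).
Local Notation PB := (Pr (@dv B)).
Local Notation I0 := (@Div0 B).
Local Notation Jim0 := (Jim0 g0 sg sfix).
Let jB : forall D D', jf (D - D') = jf D - jf D' := fun D D' => jfB g0 sg sfix D D'.
Let sVB2 : forall D D', sV (D - D') = sV D - sV D' := sVB' g0 sg.
Let sPA := subg_PA DA.
Let sPB := subg_PB DB.

(** The divisor u has arbitrary degree. For number fields this already gives X = 1; for function
    fields X measures the failure to choose u of degree 0. *)
Lemma kerNP_sub v : kerNP (@dv B) sV g v -> exists u, fsupp u /\ v = sV u - u.
Proof.
move=> [[x ->] t]; exact: (ker_trc_div sfix GA GB (fsupp_dv GB x) t).
Qed.

Lemma dv_trc k (b : munit B) : dv (trc sm k b) = trc sV k (dv b).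
Proof.
rewrite /trc (morB_sum (dvB GB)); apply: eq_bigr => i _.
by elim: (nat_of_ord i) => //= j <-; apply: (sV_dv g0 sg GB).
Qed.

(** Capitulation is killed by the degree: the norm of a generator of the extended divisor generates
    g D. *)
Lemma jf_PB D : PB (jf D) -> PA (D *+ g).
Proof.
move=> [b eb]; have e : jf (D *+ g) = dv (trc sm g b).
  by rewrite dv_trc -eb (trc_fix _ (sV_jd g0 sg sfix GA GB D)) (morB_Mn jB).
have [a ea] : exists a, trc sm g b = mu_map f a.
  apply: (fixed_dv sfix); apply/eqP; rewrite -subr_eq0 trc_s; last exact: mu_mapB.
  by rewrite (mu_map_g sg) subrr.
exists a; apply: (jf_inj (g0 := g0) (sg := sg) (sfix := sfix) DA DB).
by rewrite e ea (jf_dv g0 sg sfix DA DB).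
Qed.

Section Prime.
Hypothesis gp : prime g.

Lemma sne : exists y, s y != y.
Proof. by have [|x hx] := sfaith (i := 1); [rewrite prime_gt1|exists x]. Qed.

(** Extension is injective here because its kernel is killed by g while the classes have order prime
    to g; a fixed class is recovered from its norm. *)
Lemma step_fixed_classes (Q : nat -> Prop) N M : (forall m, Q m -> (0 < m)%N /\ coprime m g) ->
  idx (fun D => Div0 D /\ exists m, Q m /\ PA (D *+ m)) PA N ->
  nclasses (fun x y => PB (x - y))
    (fun D => (I0 D /\ exists m, Q m /\ PB (D *+ m)) /\ PB (sV D - D)) M -> N = M.
Proof.
move=> hQ hN hM; have eqB := subg_eqv sPB.
apply: (nc_uniq eqB) hM; refine (proj1 (@nc_iso _ _ (fun x y => PA (x - y)) (fun x y => PB (x - y)) _ _ (jf : dvs A -> dvs B) N _ _ _ _) hN).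
- exact: eqB.
- move=> D [D0 [m [Qm h]]]; split; last by rewrite (sV_jd g0 sg sfix GA GB) subrr; apply: subg0.
  split; first exact: (jf_Div0 g0 sg sfix DA DB).
  by exists m; split=> //; rewrite -(morB_Mn jB); apply: (jf_PA g0 sg sfix DA DB).
- move=> D D' [D0 [m [Qm h]]] [D0' [m' [Qm' h']]].
  rewrite -jB; split=> [h2|h2]; first exact: (jf_PA g0 sg sfix DA DB).
  apply: (subg_bezout (b := (m * m')%N) sPA g0 _ (jf_PB h2)).
    by rewrite coprimeMr ![coprime g _]coprime_sym; case: (hQ _ Qm) (hQ _ Qm') => _ -> [_ ->].
  rewrite mulrnBl; apply: subgB => //; first by rewrite mulrnA; apply: subgMn.
  by rewrite mulnC mulrnA; apply: subgMn.
move=> D [[D0 [m [Qm h]]] hs]; have [fD dD] := D0; have [m0 cm] := hQ m Qm.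
pose T := trc sV g D.
have hT : PB (T - D *+ g).
  have -> : T - D *+ g = \sum_(i < g) (iter i sV D - D).
    by rewrite sumrB sumr_const card_ord.
  apply: (@subg_sum _ PB _ _ _ _ sPB) => i _; elim: (nat_of_ord i) => /= [|k IH].
    by rewrite subrr; apply: subg0.
  have -> : sV (iter k sV D) - D = sV (iter k sV D - D) + (sV D - D) by rewrite sVB2 addrA subrK.
  by apply: subgD => //; apply: (sV_PB g0 sg DB).
have sT : sV T = T by apply/eqP; rewrite -subr_eq0 trc_s // (sV_g g0 sg) subrr.
have fT : fsupp T by apply: fsupp_trc.
have [E0 [fE eE]] := fix_mul_Jim sfix GA GB (conj fT sT) gp sne.
have dE : deg E0 = 0.
  by apply: (jf_deg0 (g0 := g0) (sg := sg) (sfix := sfix) DA DB) => //; rewrite -eE deg_Mn // deg_trc // dD !mul0rn.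
have hTm : PB (T *+ g *+ m).
  rewrite mulrnAC; apply: subgMn => //.
  have -> : T *+ m = (T - D *+ g) *+ m + D *+ m *+ g by rewrite mulrnBl -!mulrnA [(g * m)%N]mulnC subrK.
  by apply: subgD => //; apply: subgMn.
have hE : PA (E0 *+ g *+ m).
  by rewrite mulrnAC; apply: jf_PB; rewrite (morB_Mn jB) -eE.
(* Three factors g: the norm T is equivalent to g D, only g T is known to be extended from the base,
   and the extended E0 is known to have order prime to g only after another multiplication by g. *)
have cg : coprime (g ^ 3) m by rewrite coprimeXl // coprime_sym.
have g30 : (0 < g ^ 3)%N by rewrite expn_gt0 g0.
have [[u v] /= euv] := coprimeP m g30 cg.
have e1 : (g ^ 3 * u = (m * v).+1)%N by rewrite mulnC [(m * v)%N]mulnC; lia.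
exists (E0 *+ g *+ u).
  split; last by exists m; split=> //; rewrite mulrnAC; apply: subgMn.
  by split; [do 2!apply: (subgMn _ (@subg_fsupp A))|rewrite !deg_Mn ?dE ?mul0rn //; apply: (subgMn _ (@subg_fsupp A))].
rewrite !(morB_Mn jB) -eE.
have -> : D - T *+ g *+ g *+ u = - ((T - D *+ g) *+ (g * g * u)) - D *+ m *+ v.
  rewrite mulrnBl -!mulrnA opprB addrAC; congr (_ - _); last by rewrite mulnA.
  have -> : (g * (g * g * u) = (m * v).+1)%N by rewrite -e1 !expnS expn0 muln1; ring.
  by rewrite mulrS addrK.
by apply: subgB => //; [apply: subgN => //; apply: subgMn|apply: subgMn].
Qed.

Lemma ram_list : exists R : seq (place A), [/\ uniq R,
  forall P0, P0 \in R <-> exists2 P, inert s P & fpull P = P0 & idx Ifix Jim (g ^ size R)%N].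
Proof.
have [l hl] := inert_fin GB sne.
pose R := undup [seq fpull P | P <- l & `[< inert s P >]].
have RP P0 : P0 \in R <-> exists2 P, inert s P & fpull P = P0.
  rewrite mem_undup; split=> [/mapP[P]|[P iP <-]].
    by rewrite mem_filter => /andP[/asboolP iP _] ->; exists P.
  by apply: map_f; rewrite mem_filter hl // andbT; exact/asboolP.
exists R; split=> //; first exact: undup_uniq.
apply: (ram_index GA GB g0 (undup_uniq _)) => P; case: ifP => [/RP[P' iP' e]|h].
  have [i _ ->] := pull_trans GB e; rewrite (framf_spull g0 sg sfix GA GB); exact: (framf_inert g0 sg sfix GA GB gp sne iP').
apply: (framf_notinert g0 sg sfix GA GB gp) => iP.
by move/negP: (negbT h); apply; apply/RP; exists P.
Qed.

(** At an inert place the coefficient of the trace is g times that of D, and g is the ramification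
    index; at the other places that index is 1. *)
Lemma trc_Jim D : fsupp D -> Jim (trc sV g D).
Proof.
move=> fD; have [r [k [hr _]]] := rep_ex g0 sg sfix GA GB.
pose D0 : dvs A := fun P0 => if `[< inert s (r P0) >] then D (r P0) else trc sV g D (r P0).
have fT := fsupp_trc g0 sg g fD.
exists D0; split.
  have [l1 h1] := fD; have [l2 h2] := fT; exists [seq fpull P | P <- l1 ++ l2] => P0.
  rewrite /D0 -{4}(hr P0) map_cat mem_cat; case: asboolP => _ h.
    by rewrite map_f ?h1.
  by rewrite orbC map_f ?h2.
apply/funext => P; rewrite /jd -/(framf P) -/(fpull P).
have sT : sV (trc sV g D) = trc sV g D by apply/eqP; rewrite -subr_eq0 trc_s // (sV_g g0 sg) subrr.
have [i _ eP] := pull_trans GB (hr (fpull P)).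
have eF : framf P = framf (r (fpull P)) by rewrite [in LHS]eP (framf_spull g0 sg sfix GA GB).
rewrite (sV_const GB sT (esym (hr (fpull P)))) eF /D0; move: (r _) => Q.
case: asboolP => iQ; last by rewrite (framf_notinert g0 sg sfix GA GB gp iQ) mul1r.
rewrite (framf_inert g0 sg sfix GA GB gp sne iQ) /trc dvs_sum.
have -> : \sum_(j < g) iter j sV D Q = \sum_(j < g) D Q.
  apply: eq_bigr => j _; rewrite iter_sV; congr (D _); by apply: stab_all; apply: (inert_stab g0 sg GB).
by rewrite sumr_const card_ord -mulr_natl natz.
Qed.

(** As K contains the divisors of degree 0, the quotient is generated by a divisor of least positive
    degree; being killed by the prime g, it has order 1 or g. *)
Lemma idx_prime_cyc (K : dvs B -> Prop) : subg K -> (forall D, I0 D -> K D) ->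
  (forall D, K D -> fsupp D) -> (forall D, fsupp D -> K (D *+ g)) ->
  exists2 b, idx (@fsupp B) K b & b = 1%N \/ b = g.
Proof.
move=> sK IK KI pK; have fS := @subg_fsupp B.
have [all|nall] := pselect (forall D, fsupp D -> K D).
  by exists 1%N; [apply: idx_ext (idx1 sK) => // D; split; auto|left].
have [D1 fD1 [d1 hd]] : exists2 D1 : dvs B, fsupp D1 & 0 < deg D1 /\
    forall D : dvs B, fsupp D -> exists k : int, deg D = k * deg D1.
  pose P n := `[< exists2 D : dvs B, fsupp D & deg D = n.+1%:Z >].
  have exP : exists n, P n.
    have [D fD nK] : exists2 D, fsupp D & ~ K D.
      by apply/not_exists2P => h; apply: nall => D fD; have [//|/contrapT] := h D.
    have dD : deg D != 0 by apply/eqP => d0; apply: nK; apply: IK.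
    exists `|deg D|.-1%N; apply/asboolP; have [dp|dn] := leP 0 (deg D).
      by exists D => //; lia.
    exists (- D); first exact: (subgN fS).
    by rewrite -[- D]sub0r (degB (subg0 fS) fD) deg0; lia.
  have [n /asboolP[D1 fD1 e1] mn] := ex_minnP exP; exists D1 => //; split; first by rewrite e1.
  move=> D fD; exists (deg D %/ deg D1)%Z.
  have e : deg D = (deg D %/ deg D1)%Z * deg D1 + (deg D %% deg D1)%Z := divz_eq _ _.
  have r0 : 0 <= (deg D %% deg D1)%Z by apply: modz_ge0; rewrite e1.
  have r1 : (deg D %% deg D1)%Z < deg D1 by apply: ltz_pmod; rewrite e1.
  have fD2 : fsupp (D - D1 *~ (deg D %/ deg D1)%Z) by apply: (subgB fS fD); apply: subgMz.
  have dD2 : deg (D - D1 *~ (deg D %/ deg D1)%Z) = (deg D %% deg D1)%Z.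
    by rewrite degB // ?deg_Mz //; [rewrite {1}e mulrC; lia|apply: subgMz].
  case: (posnP `|(deg D %% deg D1)%Z|%N) => [r|r]; first by rewrite {1}e; lia.
  have : (n <= `|(deg D %% deg D1)%Z|.-1)%N.
    by apply: mn; apply/asboolP; exists (D - D1 *~ (deg D %/ deg D1)%Z) => //; rewrite dD2; lia.
  by move: r1; rewrite e1; lia.
have [|||b lb hb] := @nc_cover (dvs B) 'I_g (fun D D' => K (D - D')) (@fsupp B)
  (fun D i => K (D - D1 *+ nat_of_ord i)).
- exact: subg_eqv.
- move=> D fD; have [k ek] := hd D fD.
  have lt : (`|(k %% g%:Z)%Z| < g)%N.
    have := @ltz_pmod k g%:Z; have := @modz_ge0 k g%:Z; rewrite ltz_nat g0 => a b.
    by have := a ltac:(lia); have := b isT; lia.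
  exists (Ordinal lt) => /=.
  have ekk : k = (k %/ g%:Z)%Z * g%:Z + `|(k %% g%:Z)%Z|%N%:Z.
    by have := divz_eq k g%:Z; have := @modz_ge0 k g%:Z; lia.
  have -> : D - D1 *+ `|(k %% g%:Z)%Z| = (D - D1 *~ k) + D1 *~ (k %/ g%:Z)%Z *+ g.
    rewrite [in D1 *~ k]ekk mulrzDr mulrzA -!pmulrn opprD [- _ - _]addrC addrA subrK.
    by [].
  apply: subgD => //; last by apply: pK; apply: subgMz.
  by apply: IK; split; [apply: (subgB fS fD); apply: subgMz|rewrite degB ?deg_Mz ?ek 1?mulrC ?subrr //; apply: subgMz].
- move=> D D' i hD hD'; have -> : D - D' = (D - D1 *+ i) - (D' - D1 *+ i) by rewrite opprB addrA subrK.
  exact: subgB.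
rewrite card_ord in lb; exists b => //.
have : g.-nat b.
  by apply: (idx_pnat gp fS sK KI) hb => D fD; exists 1%N; rewrite expn1; apply: pK.
move/p_natP => -[[|[|e]] eb]; first by left.
  by right; rewrite eb expn1.
move: lb; rewrite eb leqNgt => /negP[]; rewrite -{1}(expn1 g) ltn_exp2l // prime_gt1 //.
Qed.
End Prime.

(** Divisors having the degree of some fixed divisor, and for [K2] of some extended one. Their
    indices among all divisors are the degree defects. *)
Definition K1 (v : dvs B) := exists a b, [/\ I0 a, Ifix b & v = a + b].
Definition K2 (v : dvs B) := exists a b, [/\ I0 a, Jim b & v = a + b].
Lemma subg_K1 : subg K1. Proof. exact: (subgP (subg_Div0 B) (subg_Ifix g0 sg)). Qed.
Lemma subg_K2 : subg K2. Proof. exact: (subgP (subg_Div0 B) (subg_Jim g0 sg sfix)). Qed.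
Lemma K2K1 v : K2 v -> K1 v.
Proof. by move=> [a [b [ha hb ->]]]; exists a, b; split=> //; apply: (Jim_Ifix GA GB hb). Qed.
Lemma K1I v : K1 v -> fsupp v.
Proof. by move=> [a [b [[ha _] [hb _] ->]]]; apply: (subgD (@subg_fsupp B)). Qed.
Lemma I0K2 v : I0 v -> K2 v.
Proof. by move=> h; exists v, 0; rewrite addr0; split=> //; apply: (subg0 (subg_Jim g0 sg sfix)). Qed.
Lemma pK2 (gp : prime g) v : fsupp v -> K2 (v *+ g).
Proof.
move=> fv; have ft := fsupp_trc g0 sg g fv; have fg := subgMn g (@subg_fsupp B) fv.
exists (v *+ g - trc sV g v), (trc sV g v); rewrite subrK; split=> //; last exact: trc_Jim.
by split; [apply: (subgB (@subg_fsupp B))|rewrite degB // deg_Mn // deg_trc // subrr].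
Qed.

(** The number c by which the degree defects of [K2] and [K1] differ is also the factor lost in
    passing from all fixed divisors modulo extended ones to those of degree 0. *)
Lemma deg_indices W w0 b : idx Ifix Jim W -> idx (I0f sV I0) Jim0 w0 -> idx (@fsupp B) K2 b ->
  exists a c, [/\ idx (@fsupp B) K1 a, b = (a * c)%N & W = (c * w0)%N].
Proof.
move=> hW hw hb; have sF := subg_Ifix g0 sg; have sJ := subg_Jim g0 sg sfix.
have [a [c [ha hc eb]]] := idx_sub (@subg_fsupp B) subg_K1 subg_K2 K2K1 K1I hb.
pose JI v := exists a b, [/\ Jim a, I0f sV I0 b & v = a + b].
have sI0f : subg (I0f sV I0) by apply: sgI0f => //; apply: subg_Div0.
have sJI : subg JI by apply: subgP.
have [|v [x [y [hx [[hy _] ey] ->]]]|c' [w' [hc' hw' eW]]] := idx_sub sF sJI sJ _ _ hW.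
- by move=> v hv; exists v, 0; rewrite addr0; split=> //; apply: subg0.
- by apply: subgD => //; apply: (Jim_Ifix GA GB hx).
exists a, c; split=> //; rewrite eW; congr (_ * _)%N.
  apply: (idx_uniq subg_K2) hc; move: hc'; apply: (proj1 (@idx_hom _ _ id Ifix JI K1 K2 c' sF subg_K2 _ _ _ _)) => //.
  - by move=> x hx; exists 0, x; rewrite add0r; split=> //; apply: (subg0 (subg_Div0 B)).
  - move=> x hx; split=> [[u [v [hu [hv _] ->]]]|[u [v [hu hv e]]]].
      by exists v, u; rewrite addrC.
    exists v, u; rewrite addrC; split=> //; split=> //.
    have -> : u = x - v by rewrite e addrK.
    by rewrite sVB2; case: hx => _ ->; have [_ ->] := Jim_Ifix GA GB hv.
  - by move=> y [u [v [hu hv ->]]]; exists v => //; rewrite addrK; apply: I0K2.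
apply: (idx_uniq (subg_Jim0 g0 sg sfix)) hw; move: hw'; apply: (proj2 (@idx_hom _ _ id (I0f sV I0) Jim0 JI Jim w' sI0f sJ _ _ _ _)) => //.
- by move=> x hx; exists 0, x; rewrite add0r; split=> //; apply: subg0.
- by move=> x [hx _]; split=> [/(Jim0P g0 sg sfix DA DB)[]//|hJ]; apply/(Jim0P g0 sg sfix DA DB).
- by move=> y [u [v [hu hv ->]]]; exists v => //; rewrite addrK.
Qed.

(** For T the divisors u with s u - u principal, u -> s u - u identifies T modulo [K1] with [kerNP]
    modulo [sI0P], of order X. What remains, z, embeds into the coinvariants of the class group. *)
Lemma X_dvd X a : idx (kerNP (@dv B) sV g) (sI0P (@dv B) sV I0) X -> idx (@fsupp B) K1 a ->
  exists2 z, a = (z * X)%N & forall y, idx (Qamb (@dv B) sV I0) PB y -> (z <= y)%N.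
Proof.
move=> hX ha; have fS := @subg_fsupp B; have s0 := subg_Div0 B.
have cB : forall x y : dvs B, sV (x - y) - (x - y) = (sV x - x) - (sV y - y) := sub_comm sVB2.
pose T v := @fsupp B v /\ PB (sV v - v).
have sT : subg T.
  split; first by split; [apply: subg0|rewrite (morB0 sVB2) subrr; apply: subg0].
  by move=> x y [fx hx] [fy hy]; split; [apply: subgB|rewrite cB; apply: subgB].
pose TK v := exists a b, [/\ T a, K1 b & v = a + b].
have sTK : subg TK := subgP sT subg_K1.
have sS : subg (sI0P (@dv B) sV I0) by apply: sg_sI0P => //; exact: dvB.
have [||z [X' [hz hX' e]]] := idx_sub fS sTK subg_K1 _ _ ha.
- by move=> v hv; exists 0, v; rewrite add0r; split=> //; apply: subg0.
- by move=> _ [u [v [[fu _] /K1I fv ->]]]; apply: subgD.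
exists z.
  rewrite e; congr (_ * _)%N; apply: (idx_uniq subg_K1) hX' _.
  have h1 : idx T K1 X.
    apply: (proj2 (@idx_hom _ _ (fun u => sV u - u) T K1 (kerNP (@dv B) sV g) _ X sT sS cB _ _ _)) hX.
    - by move=> x [fx hx]; split=> //; rewrite trc_sub // (sV_g g0 sg) subrr.
    - move=> x [fx hx]; split=> [[u [v [hu [fv ev] ex]]]|[_ [u [hu eu]]]].
        have eu : sV (u + v) - (u + v) = sV u - u by rewrite (morBD sVB2) ev opprD addrACA subrr addr0.
        rewrite ex eu in hx *.
        by split=> //; exists u.
      exists u, (x - u); rewrite [u + _]addrC subrK; split=> //; split; first by apply: subgB => //; case: hu.
      by apply/eqP; rewrite -subr_eq0 cB eu subrr.
    - move=> v hv; have [u [fu eu]] := kerNP_sub hv; exists u; last by rewrite -eu subrr; apply: subg0.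
      by split=> //; rewrite -eu; case: hv.
  apply: (proj1 (@idx_hom _ _ id T K1 TK K1 X sT subg_K1 _ _ _ _)) h1 => //.
  - by move=> x hx; exists x, 0; rewrite addr0; split=> //; apply: (subg0 subg_K1).
  - by move=> _ [u [v [hu hv ->]]]; exists u => //; rewrite addrC addKr.
(* [PC] modulo [PB] is the image of s - 1 on the class group, so the index of [PC] in I0 equals y,
   the order of the kernel of s - 1. *)
move=> y hy; have [h hh] := gd_h DB.
pose PC v := exists a b, [/\ PB a, (exists2 w, I0 w & b = sV w - w) & v = a + b].
have sIm : subg (fun b => exists2 w, I0 w & b = sV w - w).
  split; first by exists 0; [apply: subg0|rewrite (morB0 sVB2) subrr].
  by move=> _ _ [u hu ->] [v hv ->]; exists (u - v); [apply: subgB|rewrite cB].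
have sPC : subg PC := subgP sPB sIm.
have sQ : subg (Qamb (@dv B) sV I0) by apply: sgQ => //; exact: dvB.
have PBI v : PB v -> I0 v := Div0_PB DB (D := v).
have sVI v : I0 v -> I0 (sV v - v) by move=> hv; apply: subgB => //; apply: (sV_Div0 g0 sg).
have [|v [] //|n1 [y' [hn1 hy' e1]]] := idx_sub s0 sQ sPB _ _ hh.
  by move=> v hv; split; [apply: PBI|apply: subgB => //; apply: (sV_PB g0 sg DB)].
have [||n2 [n1' [hn2 hn1' e2]]] := idx_sub s0 sPC sPB _ _ hh.
- by move=> v hv; exists v, 0; rewrite addr0; split=> //; exact: (subg0 sIm).
- by move=> _ [u [v [hu [w hw ->] ->]]]; apply: subgD => //; [apply: PBI|apply: sVI].
have en : n1' = n1.
  apply: (idx_uniq sPB) hn1' _; apply: (proj1 (@idx_hom _ _ (fun u => sV u - u) I0 _ PC PB n1 s0 sPB cB _ _ _)) hn1.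
  - by move=> x hx; exists 0, (sV x - x); rewrite add0r; split=> //; [exact: (subg0 sPB)|exists x].
  - by move=> x hx; split=> [[]|].
  - by move=> _ [u [v [hu [w hw ->] ->]]]; exists w => //; rewrite addrK.
have ey : n2 = y.
  have -> : y = y' by apply: (idx_uniq sPB) hy hy'.
  have n0 := idx_pos s0 hn1; rewrite en in e2.
  by apply/eqP; rewrite -(eqn_pmul2r n0) -e2 e1 mulnC.
rewrite ey in hn2.
have [||||n ln hn] := @nc_inj _ _ (fun u v => TK (u - v)) (fun u v => PC (u - v)) (@fsupp B) I0 (fun u => sV u - u) y _ _ _ _ hn2.
- exact: subg_eqv.
- exact: subg_eqv.
- by move=> x fx; split; [apply: subgB => //; apply: sV_fsupp|rewrite degB ?sV_deg ?subrr //; apply: sV_fsupp].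
- move=> u v fu fv; rewrite -cB => -[p [_ [hp [w hw ->] ew]]].
  exists (u - v - w), w; rewrite subrK; split=> //.
    split; first by apply: subgB; [|apply: subgB|case: hw].
    by rewrite cB ew addrK.
  by exists w, 0; rewrite addr0; split=> //; apply: (subg0 (subg_Ifix g0 sg)).
by rewrite (idx_uniq sTK hz hn).
Qed.
End GStep2.

(** * Towers *)

Lemma sV_iter (B : fieldType) (s s' : {rmorphism B -> B}) g g' (g0 : (0 < g)%N) (g0' : (0 < g')%N)
  (sg : forall x, irm s g x = x) (sg' : forall x, irm s' g' x = x) i :
  (forall x, s' x = irm s i x) -> forall D, sV g0' sg' D = iter i (sV g0 sg) D.
Proof.
move=> e D; apply/funext => P; rewrite iter_sV /sV; congr (D _); apply: place_eq => x.
by rewrite !spullE -e.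
Qed.

Section Comp.
Variables (A B C : fieldType) (f : {rmorphism A -> B}) (j : {rmorphism B -> C}) (f' : {rmorphism A -> C}).
Hypothesis ff : forall x, f' x = j (f x).
Variables (GA : gl A) (GB : gl B) (GC : gl C).
Hypothesis Hf : forall P : place B, exists a, ~ sval P (f a).
Hypothesis Hj : forall P : place C, exists a, ~ sval P (j a).
Hypothesis Hf' : forall P : place C, exists a, ~ sval P (f' a).

Lemma jd_comp D : jd Hf' D = jd Hj (jd Hf D).
Proof.
apply/funext => P; have eP : pull Hf (pull Hj P) = pull Hf' P.
  by apply: place_eq => x; rewrite !pullE -ff.
rewrite /jd eP mulrA; congr (_ * _); have [a a0 va] := unif_at GA (pull Hf' P) 1.
have := vl_pull GA GC Hf' P a0; rewrite va mulr1 => <-.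
by rewrite ff (vl_pull GB GC) ?fmorph_eq0 // (vl_pull GA GB) // eP va mulr1.
Qed.
End Comp.

Section Commute.
Variables (A B : fieldType) (f : {rmorphism A -> B}) (s : {rmorphism A -> A}) (s' : {rmorphism B -> B}).
Hypothesis comp : forall x, f (s x) = s' (f x).
Variables (GA : gl A) (GB : gl B) (g g' : nat) (g0 : (0 < g)%N) (g0' : (0 < g')%N).
Hypotheses (sg : forall x, irm s g x = x) (sg' : forall x, irm s' g' x = x).
Hypothesis Hf : forall P : place B, exists a, ~ sval P (f a).

Lemma sV_comm D : sV g0' sg' (jd Hf D) = jd Hf (sV g0 sg D).
Proof.
apply/funext => P; rewrite /sV /jd; set P' := spull g0' sg' 1 P.
have eP : pull Hf P' = spull g0 sg 1 (pull Hf P).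
  by apply: place_eq => x; change (sval P (s' (f x)) <-> sval P (f (s x))); rewrite comp.
rewrite eP; congr (_ * _); have [a a0 va] := unif_at GA (pull Hf P') 1.
have := vl_pull GA GB Hf P' a0; rewrite va mulr1 => <-.
have fa0 : f a != 0 by rewrite fmorph_eq0.
rewrite -(spull_vl g0' sg' GB 1 P fa0) /= -comp (vl_pull GA GB) ?fmorph_eq0 //.
have := spull_vl g0 sg GA 1 (pull Hf P) a0; rewrite -eP va /= => ->; exact: mulr1.
Qed.
End Commute.

Lemma irm_mul_id (B : fieldType) (s : {rmorphism B -> B}) a x : irm s a x = x ->
  forall k, irm s (k * a) x = x.
Proof. by move=> h; elim=> [|k IH] //; rewrite mulSn irmD IH h. Qed.

Lemma irm_gcd_id (B : fieldType) (s : {rmorphism B -> B}) a b : (0 < a)%N ->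
  (forall x, irm s a x = x) -> (forall x, irm s b x = x) -> forall x, irm s (gcdn a b) x = x.
Proof.
move=> a0 ha hb x; have [u _ /dvdnP[v e]] := Bezoutl b a0.
by have := irm_mul_id (ha x) v; rewrite -e irmD (irm_mul_id (hb x)).
Qed.

(** * Towers of cyclic layers with compatible generators *)

Section Tower.
Variables (p : nat) (L : nat -> fieldType) (sig : forall n, {rmorphism L n -> L n})
  (iot : forall n, {rmorphism L n -> L n.+1}).
Hypothesis pp : prime p.
Hypothesis T1 : forall n x, iot n (sig n x) = sig n.+1 (iot n x).
Hypothesis T2 : forall n x, irm (sig n) (p ^ n) x = x.
Hypothesis T3 : forall n x, irm (sig n.+1) (p ^ n) x = x <-> exists a, x = iot n a.
Hypothesis T4 : forall n, exists y, irm (sig n.+1) (p ^ n) y != y.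
Hypothesis GD : forall n, gdata (L n).
Let p0 : (0 < p)%N := prime_gt0 pp.
Let G n := gd_gl (GD n).

Lemma iot_irm n i x : iot n (irm (sig n) i x) = irm (sig n.+1) i (iot n x).
Proof. by elim: i => //= i IH; rewrite T1 IH. Qed.

Lemma sig_faith n j : (0 < j < p ^ n)%N -> exists x, irm (sig n) j x != x.
Proof.
case/andP => j0 jn; apply/not_existsP => no.
have hj x : irm (sig n) j x = x by have /negP/negPn/eqP := no x.
have hg := irm_gcd_id j0 hj (T2 (n := n)).
have /(dvdn_pfactor _ _ pp)[i ile e] : (gcdn j (p ^ n) %| p ^ n)%N := dvdn_gcdr _ _.
case: n j0 jn no hj hg ile e => [|n] j0 jn no hj hg ile e; first by move: jn; rewrite expn0; lia.
have [y /eqP hy] := T4 n; apply: hy.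
have il : (i <= n)%N.
  rewrite -ltnS ltn_neqAle ile andbT; apply/eqP => ei; move: jn; rewrite ltnNge -ei -e.
  by rewrite dvdn_leq // dvdn_gcdl.
have -> : (p ^ n = p ^ (n - i) * gcdn j (p ^ n.+1))%N by rewrite e -expnD subnK.
exact: irm_mul_id.
Qed.

(** Adding k on the left lets the index of the next layer reduce by computation, so no transport
    between layers occurs. *)
Fixpoint fm m k : {rmorphism L m -> L (k + m)} :=
  match k with
  | 0 => (idfun : {rmorphism L m -> L m})
  | k'.+1 => (iot (k' + m) \o fm m k' : {rmorphism L m -> L (k' + m).+1})
  end.

(** The generator of the group of order p^k of layer k + m over layer m. *)
Definition tau m k := irm (sig (k + m)) (p ^ m).

Lemma tau_g0 k : (0 < p ^ k)%N. Proof. by rewrite expn_gt0 p0. Qed.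

Lemma tau_irm m k i x : irm (tau m k) i x = irm (sig (k + m)) (p ^ m * i) x.
Proof. by rewrite /tau irm_irm mulnC. Qed.

Lemma tau_g m k x : irm (tau m k) (p ^ k) x = x.
Proof. by rewrite tau_irm -expnD (addnC m k) T2. Qed.

Lemma tau_faith m k i : (0 < i < p ^ k)%N -> exists x, irm (tau m k) i x != x.
Proof.
move=> /andP[i0 il]; have [|x hx] := @sig_faith (k + m) (p ^ m * i).
  by rewrite muln_gt0 tau_g0 i0 /= addnC expnD ltn_pmul2l // tau_g0.
by exists x; rewrite tau_irm.
Qed.

Lemma tau_iot m k x : iot (k + m) (tau m k x) = tau m k.+1 (iot (k + m) x).
Proof. exact: iot_irm. Qed.

Lemma tau_fix m k x : tau m k x = x <-> exists a, x = fm m k a.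
Proof.
elim: k x => [|k IH] x; first by split=> [_|_]; [exists x|exact: T2].
split=> [h|[a ->]]; last by rewrite /= -tau_iot; congr (iot _ _); apply/IH; exists a.
have [y ey] : exists y, x = iot (k + m) y.
  apply/T3; have -> : (p ^ (k + m) = p ^ k * p ^ m)%N by rewrite expnD.
  exact: (irm_mul_id h).
have /IH[a ea] : tau m k y = y by apply: (fmorph_inj (iot (k + m))); rewrite tau_iot -ey.
by exists a; rewrite ey ea.
Qed.

Notation IfixT m k := (Ifix (tau_g0 k) (@tau_g m k)).
Notation JimT m k := (Jim (tau_g0 k) (@tau_g m k) (@tau_fix m k)).
Notation cp m k := (cyc_proper (tau_g0 k) (@tau_g m k) (@tau_fix m k)).
Notation sVT m k := (sV (tau_g0 k) (@tau_g m k)).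

Lemma jd_step m k D : jd (cp m k.+1) D = jd (cp (k + m) 1) (jd (cp m k) D).
Proof. exact: (jd_comp (f := fm m k) (j := fm (k + m) 1) (f' := fm m k.+1) (fun x => erefl) (G _) (G _) (G _)). Qed.

Lemma sV_step m k D : sVT m k.+1 (jd (cp (k + m) 1) D) = jd (cp (k + m) 1) (sVT m k D).
Proof. exact: (sV_comm (f := fm (k + m) 1) (s := tau m k) (s' := tau m k.+1) (tau_iot (m := m) (k := k)) (G _) (G _)). Qed.

Lemma sVT_top m k D : sVT (k + m) 1 D = iter (p ^ k) (sVT m k.+1) D.
Proof.
apply: (@sV_iter (L (k.+1 + m)) (tau m k.+1) (tau (k + m) 1)) => x.
by rewrite tau_irm -expnD (addnC m k).
Qed.

Lemma Ifix_top m k D : IfixT m k.+1 D -> IfixT (k + m) 1 D.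
Proof.
move=> [fD h]; split=> //; rewrite (@sVT_top m k).
by elim: (p ^ k)%N => //= i ->.
Qed.

(** The indices are submultiplicative along the tower. *)
Lemma ram_product m (w : nat -> nat) : (forall j, idx (IfixT (j + m) 1) (JimT (j + m) 1) (w j)) ->
  forall k, exists2 W, idx (IfixT m k.+1) (JimT m k.+1) W & (W <= \prod_(j < k.+1) w j)%N.
Proof.
move=> hw; elim=> [|k [W hW lW]].
  exists (w 0); last by rewrite big_ord1.
  apply: idx_ext (hw 0) => D; last by [].
  have e : sVT (0 + m) 1 D = sVT m 1 D by rewrite (@sVT_top m 0).
  by split=> -[fD h]; split=> //; rewrite -[RHS]h e.
(* X collects the fixed divisors extended from the layer just below. Modulo X at most w (k + 1)
   classes remain, and X is identified with the fixed divisors of that layer. *)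
pose X D := IfixT m k.+2 D /\ JimT (k.+1 + m) 1 D.
have sI : subg (IfixT m k.+2) by apply: subg_Ifix.
have sJt : subg (JimT (k.+1 + m) 1) by apply: subg_Jim.
have sJ : subg (JimT m k.+2) by apply: subg_Jim.
have sX : subg X := subgI sI sJt.
have [||||n ln hn] := @nc_inj _ _ (fun u v => X (u - v)) (fun u v => JimT (k.+1 + m) 1 (u - v))
  (IfixT m k.+2) (IfixT (k.+1 + m) 1) id (w k.+1) _ _ _ _ (hw k.+1).
- exact: subg_eqv.
- exact: subg_eqv.
- exact: Ifix_top.
- by move=> u v hu hv h; split=> //; apply: subgB.
have JX D : JimT m k.+2 D -> X D.
  move=> h; split; first exact: (Jim_Ifix (G _) (G _) h).
  case: h => D0 [fD0 ->]; exists (jd (cp m k.+1) D0); split; last exact: (@jd_step m k.+1 D0).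
  exact: fsupp_jd (G _) (G _) _ _ fD0.
have hX : idx X (JimT m k.+2) W.
  apply: (proj1 (@idx_hom _ _ (jd (cp (k.+1 + m) 1) : dvs (L (k.+1 + m)) -> dvs (L (k.+2 + m))) (IfixT m k.+1) (JimT m k.+1) X _ W (subg_Ifix _ _) sJ (jdB _) _ _ _)) hW.
  - move=> D [fD hD]; split; last by exists D.
    by split; [exact: fsupp_jd (G _) (G _) _ _ fD|rewrite sV_step hD].
  - move=> D _; split=> [[D0 [fD0 ->]]|[D0 [fD0]]]; first by exists D0; split=> //; exact: (esym (@jd_step m k.+1 D0)).
    rewrite (@jd_step m k.+1 D0) => e; exists D0; split=> //; apply/subr0_eq.
    by apply: (jd_inj (G _) (G _) (Hf := cp (k.+1 + m) 1)); rewrite jdB e subrr.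
  - move=> y [[_ h] [D [fD e]]]; exists D; last by rewrite e subrr; apply: subg0.
    split=> //; apply/subr0_eq; apply: (jd_inj (G _) (G _) (Hf := cp (k.+1 + m) 1)).
    by rewrite jdB -sV_step -e h subrr.
exists (n * W)%N; first by apply: idx_mul sI sX sJ JX _ hn hX => x [].
by rewrite big_ord_recr /= mulnC leq_mul.
Qed.

Definition inertF m n (P : place (L n)) := inert (irm (sig n) (p ^ m)) P.

Lemma inertF_mono m m' n P : (m <= m')%N -> @inertF m n P -> @inertF m' n P.
Proof.
move=> le h; have -> : (m' = m + (m' - m))%N by rewrite subnKC.
by move=> x hx; have := inert_irm (p ^ (m' - m)) h hx; rewrite irm_irm mulnC -expnD.
Qed.

Lemma top_fix m k x : irm (tau m k.+1) (p ^ k) x = x <-> exists a, x = iot (k + m) a.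
Proof. by rewrite tau_irm -expnD (addnC m k); apply: T3. Qed.

Lemma top_p m k x : irm (irm (tau m k.+1) (p ^ k)) p x = x.
Proof. by rewrite irm_irm -expnS; apply: tau_g. Qed.

Lemma iot_proper n (P : place (L n.+1)) : exists a, ~ sval P (iot n a).
Proof. exact: (cp n 1 P). Qed.
Notation ipull n := (pull (@iot_proper n)).

Lemma inertF_up m k (P : place (L (k.+2 + m))) :
  inertF m (ipull (k.+1 + m) P) -> inertF m P.
Proof.
move=> h; refine (@inert_up _ _ (iot (k.+1 + m)) (tau m k.+2) (tau m k.+1) p k.+1 pp isT p0
  (tau_g0 _) (@tau_g m k.+2) (tau_iot (m := m) (k := k.+1)) (@top_p m k.+1) (@top_fix m k.+1) (G _) (G _) P _).
by move=> x hx; apply: h; apply: hx.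
Qed.

Definition Sp n i (P : place (L n)) : place (L n) := spull (tau_g0 n) (@T2 n) i P.

Lemma inertF_spull m n i (P : place (L n)) : inertF m P -> inertF m (Sp i P).
Proof.
move=> h x hx; apply/(spull_mx (tau_g0 n) (@T2 n)); rewrite rmorphB.
have -> : irm (sig n) i (irm (sig n) (p ^ m) x) = irm (sig n) (p ^ m) (irm (sig n) i x).
  by rewrite -!irmD addnC.
exact: h.
Qed.

Lemma pull_conj n (P Q : place (L n.+1)) i : ipull n Q = Sp i (ipull n P) -> exists j, Q = Sp j P.
Proof.
move=> e; pose P1 := Sp i P.
have e1 : fpull (tau_g0 1) (@tau_g n 1) (@tau_fix n 1) P1 = fpull (tau_g0 1) (@tau_g n 1) (@tau_fix n 1) Q.
  apply: place_eq => x; change (sval P (irm (sig n.+1) i (iot n x)) <-> sval (ipull n Q) x).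
  by rewrite e -iot_irm.
have [j _ ->] := pull_trans (G _) e1; exists (j * p ^ n + i)%N.
apply: place_eq => x.
change (sval P (irm (sig n.+1) i (irm (tau n 1) j x)) <-> sval P (irm (sig n.+1) (j * p ^ n + i) x)).
have -> : irm (sig n.+1) (j * p ^ n + i) x = irm (sig n.+1) i (irm (tau n 1) j x).
  by rewrite addnC irmD tau_irm mulnC.
by [].
Qed.

Fixpoint down n : place (L n) -> place (L 0) :=
  match n with 0 => id | n'.+1 => fun P => down (ipull n' P) end.

Lemma down_conj n (P Q : place (L n)) : down P = down Q -> exists i, Q = Sp i P.
Proof.
elim: n P Q => [|n IH] P Q /= e; first by exists 0; rewrite e /Sp spull0.
by have [i /pull_conj] := IH _ _ e.
Qed.

Lemma up_all n (P : place (L n.+1)) : inertF n P -> forall k, exists Pk : place (L (k.+1 + n)),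
  inertF n Pk /\ forall x, sval Pk (fm n k.+1 x) <-> sval P (iot n x).
Proof.
move=> iP; elim=> [|k [Q [iQ hQ]]]; first by exists P.
have [Q' eQ] := pull_surj (G _) (@iot_proper (k.+1 + n)) Q; exists Q'; split.
  by apply: inertF_up; rewrite eQ.
by move=> x; rewrite -hQ -eQ.
Qed.

Lemma ram_ex n : exists R : seq (place (L n)), [/\ uniq R,
  forall P0, P0 \in R <-> exists2 P : place (L n.+1), inertF n P & ipull n P = P0
  & idx (IfixT n 1) (JimT n 1) (p ^ size R)%N].
Proof.
have [R [uR hR iR]] := ram_list (tau_g0 1) (@tau_g n 1) (@tau_fix n 1) (@tau_faith n 1) (GD _) (GD _) pp.
exists R; split=> // P0; rewrite hR.
by split=> -[P iP e]; exists P => //; rewrite -e; apply: place_eq => x.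
Qed.

Definition ramified n v := exists2 P : place (L n.+1), inertF n P & down P = v.

Lemma ramified_up n n' v : (n <= n')%N -> ramified n v -> ramified n' v.
Proof.
move/subnK => <-; elim: (n' - n)%N => [|k IH] // /IH[P iP eP].
have [Q eQ] := pull_surj (G _) (@iot_proper (k + n).+1) P; exists Q; last by rewrite -eP /= -eQ.
apply: (inertF_mono (leqnSn (k + n))); apply: (@inertF_up (k + n) 0); rewrite eQ; exact: iP.
Qed.

(** * Ramification in towers of number fields *)

Section NumberField.
Hypothesis c0 : forall n, char0 (L n).

Lemma down_inv n (P : place (L n)) : sval (down P) (p%:R)^-1 <-> sval P (p%:R)^-1.
Proof.
elim: n P => [|n IH] P //=; rewrite IH.
by rewrite pullE fmorphV rmorph_nat.
Qed.

(** If p were a unit at an inert place of layer n + 1, inertia would persist and [tame_bound] would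
    give p^(k+1) <= q for every k, with q the order of the residue field below; k = q is absurd. *)
Lemma ramified_over n v : ramified n v -> ~ sval v (p%:R)^-1.
Proof.
move=> [P iP <-] /down_inv hv.
have [q hq] := gl_res (G n) (ipull n P).
have q0 : (0 < q)%N := idx_pos (subg_pl _) hq.
pose k := q; have [Q [iQ hQ]] := up_all iP k.
have pn0 m : p%:R != 0 :> L m by have := @c0 m p.-1; rewrite prednK.
have nQ : ~ mx Q p%:R.
  move=> -[Qp]; apply; split=> //.
  have -> : (p%:R : L (k.+1 + n))^-1 = fm n k.+1 (p%:R)^-1 by rewrite fmorphV rmorph_nat.
  by apply/hQ; rewrite fmorphV rmorph_nat.
have eP0 : fpull (tau_g0 k.+1) (@tau_g n k.+1) (@tau_fix n k.+1) Q = ipull n P.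
  by apply: place_eq => x; apply: hQ.
have tne : exists y, irm (tau n k.+1) (p ^ k) y != y.
  by apply: tau_faith; rewrite tau_g0 /= ltn_exp2l // prime_gt1.
have := @tame_bound _ _ _ (fm n k.+1) (iot (k + n)) (tau n k.+1) p k pp p0 (tau_g0 k.+1) (@tau_g n k.+1) (@tau_fix n k.+1)
  (@top_p n k) (@top_fix n k) tne (G _) (G _) Q q iQ nQ.
rewrite eP0 => /(_ hq); apply/negP; rewrite -ltnNge.
by apply: ltn_trans (ltn_expl _ (prime_gt1 pp)) _; rewrite ltn_exp2l // prime_gt1.
Qed.

Lemma ramified_stable : exists n0, forall n v, ramified n v -> ramified n0 v.
Proof.
have pn0 : p%:R != 0 :> L 0 by have := @c0 0 p.-1; rewrite prednK.
have [s hs] := gl_supp (G 0) pn0.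
suff [n0 h0] : exists n0, forall v, v \in s -> (exists n, ramified n v) -> ramified n0 v.
  exists n0 => n v hv; apply: h0; last by exists n.
  apply: hs => -[_ _ h]; exact: (ramified_over hv h).
elim: s {hs} => [|v s [n0 IH]]; first by exists 0.
have [[n1 h1]|no] := pselect (exists n, ramified n v).
  exists (maxn n0 n1) => w; rewrite inE => /orP[/eqP-> _|ws /(IH _ ws)].
    by apply: ramified_up h1; apply: leq_maxr.
  by apply: ramified_up; apply: leq_maxl.
by exists n0 => w; rewrite inE => /orP[/eqP-> //|]; apply: IH.
Qed.

(** Past n0, a place of layer n + 1 that ramifies in the next step is already inert over layer n.
    Hence it is alone above its restriction, and restriction injects the set R (n + 1) into R n. *)
Lemma ram_decreasing : exists n0 (t : nat -> nat), (forall n, idx (IfixT n 1) (JimT n 1) (p ^ t n)%N) /\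
  forall n j, (n0 <= n)%N -> (t (j + n) <= t n)%N.
Proof.
have [n0 h0] := ramified_stable; pose R n := sval (cid (ram_ex n)).
have hR n := svalP (cid (ram_ex n)); rewrite -/(R _) in hR.
exists n0, (fun n => size (R n)); split; first by move=> n; case: (hR n).
move=> n j le; elim: j => [|j IH] //; apply: leq_trans IH; rewrite addSn.
have {}le : (n0 <= j + n)%N by apply: leq_trans le (leq_addl _ _).
move: (j + n)%N le => {}n le; have [u1 m1 _] := hR n.+1; have [u0 m0 _] := hR n.
have iR P' : P' \in R n.+1 -> inertF n P'.
  case/m1 => P iP eP; have [|Q iQ eQ] := ramified_up le (h0 n.+1 (down P') _).
    by exists P => //=; rewrite eP.
  by have [i ->] := down_conj eQ; apply: inertF_spull.
rewrite -(size_map (ipull n)); apply: uniq_leq_size.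
  rewrite map_inj_in_uniq // => P Q /iR iP /iR iQ e.
  have e1 : fpull (tau_g0 1) (@tau_g n 1) (@tau_fix n 1) P = fpull (tau_g0 1) (@tau_g n 1) (@tau_fix n 1) Q.
    by apply: place_eq => x; change (sval (ipull n P) x <-> sval (ipull n Q) x); rewrite e.
  have [i _ ->] := pull_trans (G _) e1; apply/esym/stab_all; exact: (inert_stab (tau_g0 1) (@tau_g n 1) (G _) iP).
by move=> _ /mapP[P /iR iP ->]; apply/m0; exists P.
Qed.
End NumberField.

Notation EfT m k := (Ef (@dv (L (k + m))) (mu_map (tau m k))).
Notation EnormT m k := (Enorm (@dv (L (k + m))) (mu_map (tau m k)) (p ^ k)).
Notation ENET m k := (ENE (@dv (L (k + m))) (mu_map (tau m k)) (p ^ k)).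
Notation EkerT m k := (EkerN (@dv (L (k + m))) (mu_map (tau m k)) (p ^ k)).
Notation EsubT m k := (Esub (@dv (L (k + m))) (mu_map (tau m k))).
Notation QambT m k := (Qamb (@dv (L (k + m))) (sVT m k) (@Div0 (L (k + m)))).
Notation PrT n := (Pr (@dv (L n))).

Lemma sgEfT m k : subg (EfT m k).
Proof. by apply: sgEf; [apply: dvB|apply: mu_mapB]. Qed.
Lemma sgEnormT m k : subg (EnormT m k).
Proof. by apply: sgEnorm; [apply: dvB|apply: mu_mapB]. Qed.
Lemma sgENET m k : subg (ENET m k).
Proof. by apply: sgENE; [apply: dvB|apply: mu_mapB]. Qed.
Lemma ENE_norm m k x : ENET m k x -> EnormT m k x.
Proof.
apply: (@Ef_ENE _ _ (@dv (L (k + m))) (mu_map (tau m k)) (sVT m k)).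
- exact: dvB.
- exact: mu_mapB.
- by [].
- exact: (sV_dv (tau_g0 k) (@tau_g m k) (G _)).
- exact: mu_map_g (@tau_g m k).
Qed.

Lemma norm_idx m k H0 : idx (EfT m k) (ENET m k) H0 -> exists2 s, idx (EfT m k) (EnormT m k) s & (s <= H0)%N.
Proof.
move=> h; have [|s [u [hs hu ->]]] := idx_sub (sgEfT m k) (sgEnormT m k) (sgENET m k) (@ENE_norm m k) _ h.
  by move=> x [].
by exists s => //; rewrite leq_pmulr // (idx_pos _ hu) //; apply: sgEnormT.
Qed.

Lemma units_fixed m k (x : munit (L m)) : dv x = 0 -> EfT m k (mu_map (fm m k) x).
Proof.
move=> Ex; split; last by apply: val_inj; apply/tau_fix; exists (val x).
by rewrite -(jf_dv (tau_g0 k) (@tau_g m k) (@tau_fix m k) (GD _) (GD _)) Ex (morB0 (jdB _)).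
Qed.

Lemma fixed_units m k y : EfT m k y -> exists2 x : munit (L m), dv x = 0 & y = mu_map (fm m k) x.
Proof.
move=> [dy sy]; have [x ex] := fixed_dv (@tau_fix m k) sy; exists x => //.
apply: (jf_inj (g0 := tau_g0 k) (sg := @tau_g m k) (sfix := @tau_fix m k) (GD _) (GD _)).
by rewrite (jf_dv _ _ _ (GD _) (GD _)) -ex dy (morB0 (jdB _)).
Qed.

(** [norm_index_growth] applied inside layer m, whose units are the fixed units above; Hilbert 90
    for the last step and [norm_descent] supply its hypothesis on p-th powers. *)
Lemma norm_growth m (s : nat -> nat) : (forall k, idx (EfT m k) (EnormT m k) (s k)) ->
  forall k, (s 1 ^ k <= s k)%N.
Proof.
move=> hs; pose E (x : munit (L m)) := dv x = 0.
pose Nm k (x : munit (L m)) := exists y, mu_map (fm m k) x = trc (mu_map (tau m k)) (p ^ k) y.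
have mB k : forall x y, mu_map (tau m k) (x - y) = mu_map (tau m k) x - mu_map (tau m k) y by apply: mu_mapB.
have iB k : forall x y, mu_map (iot k) (x - y) = mu_map (iot k) x - mu_map (iot k) y by apply: mu_mapB.
have inj (A B : fieldType) (f : {rmorphism A -> B}) : injective (mu_map f).
  by move=> x y /(congr1 val) /fmorph_inj /val_inj.
have sE : subg E.
  by split=> [|x y ex ey]; rewrite /E ?(dvB (G _)) ?ex ?ey ?subrr // (morB0 (dvB (G _))).
have sN k : subg (Nm k).
  split; first by exists 0; rewrite (morB0 (trcB (mB k) _)) (morB0 (mu_mapB _)).
  by move=> x y [x' ex] [y' ey]; exists (x' - y'); rewrite mu_mapB ex ey (trcB (mB k)).
have itau k (z : munit (L (k + m))) : mu_map (iot (k + m)) (trc (mu_map (tau m k)) (p ^ k) z) =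
    trc (mu_map (tau m k.+1)) (p ^ k) (mu_map (iot (k + m)) z).
  rewrite /trc (morB_sum (iB _)); apply: eq_bigr => i _; elim: (nat_of_ord i) => //= i' <-.
  by apply: val_inj; apply: tau_iot.
have fmS k x : mu_map (fm m k.+1) x = mu_map (iot (k + m)) (mu_map (fm m k) x) by apply: val_inj.
have ttop k x : iter (p ^ k) (mu_map (tau m k.+1)) x = x -> exists z, x = mu_map (iot (k + m)) z.
  move=> /(congr1 val); rewrite mu_iter => /top_fix[a ea].
  have a0 : a != 0 by rewrite -(fmorph_eq0 (iot (k + m))) -ea (valP x).
  by exists (mu a0); apply: val_inj.
have tp k (x : munit (L (k.+1 + m))) : iter p (iter (p ^ k) (mu_map (tau m k.+1))) x = x.
  by rewrite -iterM; apply: val_inj; rewrite mu_iter -expnS; apply: tau_g.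
have ktop k x : Nm k x <-> exists z : munit (L (k.+1 + m)), iter (p ^ k) (mu_map (tau m k.+1)) z = z /\
    mu_map (fm m k.+1) x = trc (mu_map (tau m k.+1)) (p ^ k) z.
  split=> [[y ey]|[z [/ttop[y ->] ez]]].
    exists (mu_map (iot (k + m)) y); rewrite fmS ey itau; split=> //.
    by apply: val_inj; rewrite mu_iter; apply/top_fix; exists (val y).
  by exists y; apply: (@inj _ _ (iot (k + m))); rewrite itau -fmS.
apply: (@norm_index_growth (munit (L m)) E Nm p s sE sN).
- move=> k x [y ey]; apply/ktop.
  exists (trc (iter (p ^ k) (mu_map (tau m k.+1))) p y); split.
    have := @trc_s _ (iter (p ^ k) (mu_map (tau m k.+1))) (iterB (mB k.+1) (p ^ k)) p y.
    by rewrite tp subrr => /eqP; rewrite subr_eq0 => /eqP.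
  by rewrite ey expnSr (trc_comp (mB k.+1)).
- by move=> x _; exists x; rewrite expn0 /trc big_ord1; apply: val_inj.
- move=> k x _; split=> [[y]|/ktop[z [tz ez]]].
    rewrite (morB_Mn (mu_mapB _)) => ey; apply/ktop.
    apply: (@norm_descent _ (mu_map (tau m k.+1)) p k (mB _) _ _ y _ ey).
      move=> u hu; have Htop := @hilbert90 (L (k.+1 + m)) (irm (tau m k.+1) (p ^ k)) p p0 (@top_p m k).
      have eit (w : munit (L (k.+1 + m))) : iter (p ^ k) (mu_map (tau m k.+1)) w = mu_map (irm (tau m k.+1) (p ^ k)) w.
        by apply: val_inj; rewrite mu_iter.
      have [||w ew] := Htop _ u.
      + move=> i /andP[i0 ip]; have [|v hv] := @tau_faith m k.+1 (p ^ k * i).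
          by rewrite muln_gt0 tau_g0 i0 /= expnSr ltn_pmul2l // tau_g0.
        by exists v; rewrite irm_irm mulnC.
      + rewrite -[RHS]hu /trc; apply: eq_bigr => i _; elim: (nat_of_ord i) => //= i' ->; exact: (esym (eit _)).
      by exists w; rewrite eit.
    by apply: val_inj; apply/tau_fix; exists (val x).
  exists z; rewrite (morB_Mn (mu_mapB _)) ez expnSr (trc_comp (mB k.+1)).
  by rewrite (trc_fix _ tz) (morB_Mn (trcB (mB _) _)).
move=> k; have sB := sgEnormT m k.
apply: (proj2 (@idx_hom _ _ (mu_map (fm m k)) E (fun x => E x /\ Nm k x) (EfT m k) (EnormT m k) (s k) sE sB (mu_mapB _) _ _ _)) (hs k).
- exact: units_fixed.
- move=> x Ex; split=> [[_ [y ey]]|[_ [y ey]]]; last by split=> //; exists y.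
  by split; [apply: units_fixed|exists y].
- move=> y /fixed_units[x Ex ->]; exists x => //; rewrite subrr; exact: subg0.
Qed.

Lemma chev m k h W0 H0 H1 y : idx (@Div0 (L m)) (PrT m) h ->
  idx (I0f (sVT m k) (@Div0 (L (k + m)))) (Jim0 (tau_g0 k) (@tau_g m k) (@tau_fix m k)) W0 ->
  idx (EfT m k) (ENET m k) H0 -> idx (EkerT m k) (EsubT m k) H1 -> idx (QambT m k) (PrT (k + m)) y ->
  exists s X, [/\ idx (EfT m k) (EnormT m k) s,
    idx (kerNP (@dv (L (k + m))) (sVT m k) (p ^ k)) (sI0P (@dv (L (k + m))) (sVT m k) (@Div0 (L (k + m)))) X,
    (y * H1 * X * s = W0 * h * H0)%N, (X <= H0)%N & (s <= H0)%N].
Proof.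
move=> hh; exact: (@step_chevalley _ _ (fm m k) (tau m k) (p ^ k) (tau_g0 k) (@tau_g m k) (@tau_fix m k)
  (@tau_faith m k) (GD _) (GD _) h W0 H0 H1 y hh).
Qed.

Lemma chevH1 m k h W0 : idx (@Div0 (L m)) (PrT m) h ->
  idx (I0f (sVT m k) (@Div0 (L (k + m)))) (Jim0 (tau_g0 k) (@tau_g m k) (@tau_fix m k)) W0 ->
  exists a H1, [/\ idx (I0f (sVT m k) (@Div0 (L (k + m)))) (Prf (@dv (L (k + m))) (sVT m k)) a,
     idx (EkerT m k) (EsubT m k) H1 & (W0 * h = a * H1)%N].
Proof.
move=> hh; exact: (@step_H1 _ _ (fm m k) (tau m k) (p ^ k) (tau_g0 k) (@tau_g m k) (@tau_fix m k)
  (@tau_faith m k) (GD _) (GD _) h W0 hh).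
Qed.

Lemma sgEsubT m k : subg (EsubT m k).
Proof. by apply: sgEsub; [apply: dvB|apply: mu_mapB]. Qed.

Lemma sgI0fT m k : subg (I0f (sVT m k) (@Div0 (L (k + m)))).
Proof. by apply: sgI0f => //; apply: subg_Div0. Qed.

(** If b < a, Bernoulli's inequality b^k (b + k) <= (b + 1)^k b at k = b c contradicts the
    hypothesis. *)
Lemma pow_bound a b c : (forall k, a ^ k <= b ^ k * c)%N -> (a <= b)%N.
Proof.
move=> h; rewrite leqNgt; apply/negP => ba.
have [b0|b0] := posnP b; first by have := h 1; rewrite b0 !expn1 mul0n leqNgt -b0 ba.
have bern k : (b ^ k * (b + k) <= b.+1 ^ k * b)%N.
  elim: k => [|k IH]; first by rewrite !expn0 addn0.
  rewrite !expnS -!mulnA; apply: leq_trans (leq_mul (leqnn b.+1) IH).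
  move: (b ^ k)%N => u; have -> : (b.+1 * (u * (b + k)) = b * (u * (b + k.+1)) + u * k)%N by rewrite -addn1 -(addn1 k); ring.
  exact: leq_addr.
have e1 : (b.+1 ^ (b * c) <= a ^ (b * c))%N by rewrite leq_exp2r ?ba // muln_gt0 b0; case: (c) (h 0); rewrite ?muln0.
have := bern (b * c); have := h (b * c)%N; have : (0 < b ^ (b * c))%N by rewrite expn_gt0 b0.
move: e1; move: (b ^ (b * c))%N (a ^ _)%N (b.+1 ^ _)%N => u v w wv u0 le1 le2.
have : (u * (b + b * c) <= u * (c * b))%N.
  by apply: leq_trans le2 _; rewrite mulnA leq_mul2r; apply/orP; right; apply: leq_trans wv le1.
rewrite leq_pmul2l //; lia.
Qed.

Definition divides_at n := forall h y, idx (@Div0 (L n)) (PrT n) h ->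
  idx (QambT n 1) (PrT (1 + n)) y -> (h %| y)%N.

(** * Number field towers: the class number divides the number of fixed classes *)

Section NumberField.
Hypothesis c0 : forall n, char0 (L n).
Hypothesis UN : forall m k, exists2 H0, idx (EfT m k) (ENET m k) H0
  & idx (EkerT m k) (EsubT m k) (p ^ k * H0)%N.

Lemma char0_Div0 n (D : dvs (L n)) : Div0 D <-> fsupp D.
Proof. by split=> [[]|fD] //; split=> //; apply: deg_char0. Qed.

Lemma nf_ram m k W : idx (IfixT m k) (JimT m k) W ->
  idx (I0f (sVT m k) (@Div0 (L (k + m)))) (Jim0 (tau_g0 k) (@tau_g m k) (@tau_fix m k)) W.
Proof.
apply: idx_ext => D; first by split=> -[/char0_Div0 ? ?].
by split=> -[D0 [/char0_Div0 ? ?]]; exists D0.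
Qed.

Lemma nf_step : exists n0, forall n, (n0 <= n)%N -> divides_at n.
Proof.
have [n0 [t [ht hd]]] := ram_decreasing c0; exists n0 => n le h y hh hy.
have [s hs] : exists s, forall k, idx (EfT n k) (EnormT n k) (s k).
  apply: (choice_ex (P := fun k s => idx (EfT n k) (EnormT n k) s)) => k; have [H0 h0 _] := UN n k.
  by have [s hs _] := norm_idx h0; exists s.
have grow := norm_growth hs.
have hpos := idx_pos (subg_Div0 _) hh.
(* From W h = a H1 with H1 = p^(k+1) H0, H0 at least s (k + 1), and W at most the product of the
   one-step indices. *)
have bound k : (p ^ k.+1 * s k.+1 <= p ^ (t n * k.+1) * h)%N.
  have [W /nf_ram hW lW] := @ram_product n (fun j => p ^ t (j + n))%N (fun j => ht (j + n)%N) k.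
  have [H0 h0 h1] := UN n k.+1; have [a [H1 [ha hH1 e]]] := chevH1 hh hW.
  have [s' hs' ls'] := norm_idx h0.
  rewrite (idx_uniq (sgEnormT _ _) (hs k.+1) hs').
  apply: (@leq_trans (p ^ k.+1 * H0)); first by rewrite leq_mul.
  rewrite (idx_uniq (sgEsubT _ _) h1 hH1); apply: (@leq_trans (a * H1)).
    by rewrite leq_pmull // (idx_pos _ ha) //; apply: sgI0fT.
  rewrite -e leq_mul //; apply: leq_trans lW _.
  rewrite expnM -[X in (_ <= _ ^ X)%N](card_ord k.+1) -prod_nat_const; apply: leq_prod => j _.
  by rewrite leq_exp2l ?prime_gt1 // hd.
have ps : (p * s 1 <= p ^ t n)%N.
  apply: (pow_bound (c := h)) => -[|k]; first by rewrite !expn0 mul1n.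
  rewrite expnMn -expnM; apply: leq_trans (bound k); rewrite leq_mul //; exact: grow.
(* The p-th power of a fixed unit is its own norm, so s 1 is a power of p; only then can the
   inequality between p s_1 and p^t be read as a divisibility. *)
have [e es] : exists e, s 1 = (p ^ e)%N.
  suff : p.-nat (s 1) by move/p_natP => [e es]; exists e.
  apply: (idx_pnat pp (sgEfT n 1) (sgEnormT n 1)) (hs 1); first by move=> x [].
  move=> x Ex; exists 1%N; split; first by apply: (subgMn _ (sgEfT n 1)).
  by exists x; rewrite trc_fix //; case: Ex.
have et : (e.+1 <= t n)%N by rewrite -(leq_exp2l _ _ (prime_gt1 pp)) expnS -es.
have [H0 h0 h1] := UN n 1.
have [s' [X [hs' hX ee _ _]]] := chev hh (nf_ram (ht n)) h0 h1 hy.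
have es' := idx_uniq (sgEnormT _ _) hs' (hs 1).
(* All divisors have degree 0 here, so the vanishing of H^-1 of the divisors applies to I0. *)
have X1 : X = 1%N.
  have sI : subg (sI0P (@dv (L (1 + n))) (sVT n 1) (@Div0 (L (1 + n)))).
    by apply: sg_sI0P => //; [apply: dvB|apply: subg_Div0].
  apply: (idx_uniq sI hX); apply: idx_ext (idx1 sI) => // v.
  split=> [[pv [u [_ ev]]]|hv].
    split=> //.
    by rewrite ev trc_sub // (sV_g (tau_g0 1) (@tau_g n 1)) subrr.
  have [u [fu eu]] := kerNP_sub (@tau_fix n 1) (GD _) (GD _) hv.
  by split; [case: hv|exists u; split=> //; apply/char0_Div0].
have H00 : (0 < H0)%N := idx_pos (sgEfT _ _) h0.
have e1 : (y * p ^ e.+1 = p ^ (t n - e.+1) * h * p ^ e.+1)%N.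
  apply/eqP; rewrite -(eqn_pmul2r H00); apply/eqP.
  have -> : (p ^ (t n - e.+1) * h * p ^ e.+1 = p ^ t n * h)%N by rewrite mulnAC -expnD subnK.
  rewrite -ee X1 es' es expn1 expnS; ring.
have pe : (0 < p ^ e.+1)%N by rewrite expn_gt0 p0.
by move/eqP: e1; rewrite eqn_pmul2r // => /eqP ->; apply: dvdn_mull.
Qed.
End NumberField.

(** * Function field towers *)

Section FunctionField.
Hypothesis UF : forall n, exists N, idx (fun x : munit (L n) => dv x = 0) (fun x => x = 0) N.

Lemma sg0 (V : zmodType) : subg (fun x : V => x = 0).
Proof. by split=> // x y -> ->; rewrite subrr. Qed.

Lemma sgE n : subg (fun x : munit (L n) => dv x = 0).
Proof.
by split=> [|x y ex ey]; rewrite ?(dvB (G _)) ?ex ?ey ?subrr // (morB0 (dvB (G _))).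
Qed.

(** The unit group is finite, so the trivial subgroup has finite index and [herbrand_finite] gives
    quotient 1. *)
Lemma ff_units m k : exists2 H0, idx (EfT m k) (ENET m k) H0 & idx (EkerT m k) (EsubT m k) H0.
Proof.
have [N hN] := UF (k + m); have mB := mu_mapB (tau m k).
have [|||||H0 h0] := @herbrand_finite (munit (L (k + m))) (mu_map (tau m k)) (p ^ k) (fun x => dv x = 0) (fun x => x = 0)
  mB (mu_map_g (@tau_g m k)) (sgE _) (@sg0 _) _ _ _ N 1 hN.
- by move=> x ->; apply: (subg0 (sgE _)).
- by move=> x ex; rewrite (sV_dv (tau_g0 k) (@tau_g m k) (G _)) ex; apply/funext.
- by move=> x ->; rewrite (morB0 mB).
- apply: idx_ext (idx1 (@sg0 (munit (L (k + m))))) => x.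
    by split=> [->|[]//]; split=> //; rewrite (morB0 (trcB mB _)).
  split=> [->|[y [-> ->]]]; last by rewrite (morB0 mB) subrr.
  by exists 0; rewrite (morB0 mB) subrr.
- apply: idx_ext (idx1 (@sg0 (munit (L (k + m))))) => x.
    by split=> [->|[]//]; split=> //; rewrite (morB0 mB).
  split=> [->|[y [-> ->]]]; last by rewrite (morB0 (trcB mB _)).
  by exists 0; rewrite (morB0 (trcB mB _)).
by rewrite mul1n => h1; exists H0.
Qed.

Lemma ff_norm n (s : nat) : idx (EfT n 1) (EnormT n 1) s -> s = 1%N.
Proof.
move=> h; have [N hN] := UF n.
have [s' hs'] : exists s', forall k, idx (EfT n k) (EnormT n k) (s' k).
  apply: (choice_ex (P := fun k s => idx (EfT n k) (EnormT n k) s)) => k; have [H0 h0 _] := ff_units n k.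
  by have [s' hs' _] := norm_idx h0; exists s'.
have le k : (s' k <= N)%N.
  have [H0 h0 _] := ff_units n k; have [s2 hs2 ls2] := norm_idx h0.
  rewrite (idx_uniq (sgEnormT _ _) (hs' k) hs2); apply: leq_trans ls2 _.
  have i0 : idx (EfT n k) (fun x => x = 0) N.
    apply: (proj1 (@idx_hom _ _ (mu_map (fm n k)) (fun x : munit (L n) => dv x = 0) (fun x => x = 0) (EfT n k) (fun x => x = 0) N (sgE n) (@sg0 _) (mu_mapB _) _ _ _)) hN.
    - exact: units_fixed.
    - move=> x _; split=> [->|]; first exact: (morB0 (mu_mapB _)).
      by move=> e; apply: val_inj; apply: (fmorph_inj (fm n k)); rewrite -[LHS]/(val (mu_map (fm n k) x)) e /= rmorph1.
    - by move=> y /fixed_units[x dx ->]; exists x => //; rewrite subrr.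
  have [||H0' [z [h0' hz ->]]] := idx_sub (sgEfT n k) (sgENET n k) (@sg0 _) _ _ i0.
  - by move=> x ->; apply: subg0 (sgENET n k).
  - by move=> x /ENE_norm[].
  by rewrite (idx_uniq (sgENET _ _) h0 h0') leq_pmulr // (idx_pos _ hz) //; apply: sgENET.
have s1 : (s' 1 <= 1)%N.
  by apply: (pow_bound (c := N)) => k; rewrite exp1n mul1n; apply: leq_trans (norm_growth hs' k) _.
rewrite (idx_uniq (sgEnormT _ _) h (hs' 1)); apply/eqP; rewrite eqn_leq s1 /=.
by apply: (idx_pos (sgEfT n 1) (hs' 1)).
Qed.

Notation K1T m k := (K1 (tau_g0 k) (@tau_g m k)).
Notation K2T m k := (K2 (tau_g0 k) (@tau_g m k) (@tau_fix m k)).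
Notation I0fT m k := (I0f (sVT m k) (@Div0 (L (k + m)))).
Notation Jim0T m k := (Jim0 (tau_g0 k) (@tau_g m k) (@tau_fix m k)).

Lemma I0f_fin m k W : idx (IfixT m k) (JimT m k) W -> exists w0, idx (I0fT m k) (Jim0T m k) w0.
Proof.
move=> hW; have [||||w _ hw] := @nc_inj _ _ (fun u v => Jim0T m k (u - v)) (fun u v => JimT m k (u - v)) (I0fT m k) (IfixT m k) id W _ _ _ _ hW.
- by apply: subg_eqv; apply: subg_Jim0.
- by apply: subg_eqv; apply: subg_Jim.
- by move=> x [[fx _] hx].
- move=> x y [x0 _] [y0 _] h; apply/(Jim0P _ _ _ (GD _) (GD _)); split=> //.
  by apply: (subgB (subg_Div0 _)).
by exists w.
Qed.

(** From y X = w0 h it suffices that X divides w0, and X divides the degree defect b, which is 1 or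
    p. If X = b = p, nothing is left for c, so w0 is the whole ramification index W, a positive
    power of p as soon as something ramifies. *)
Lemma ff_core n b : idx (@fsupp (L (1 + n))) (K2T n 1) b -> b = 1%N \/ b = p ->
  (exists v, ramified n v) \/ b = 1%N -> divides_at n.
Proof.
move=> hb b1p hr h y hh hy; have [R [_ hR hW]] := ram_ex n.
have [w0 hw0] := I0f_fin hW.
have [a [c [ha eb eW]]] := deg_indices (GD _) (GD _) hW hw0 hb.
have [H0 h0 h1] := ff_units n 1.
have [s [X [hs hX e _ _]]] := chev hh hw0 h0 h1 hy.
have [z ez _] := X_dvd (@tau_fix n 1) (GD _) (GD _) hX ha.
have H00 : (0 < H0)%N := idx_pos (sgEfT _ _) h0.
have {}e : (y * X = w0 * h)%N.
  by apply/eqP; rewrite -(eqn_pmul2r H00) -e (ff_norm hs); apply/eqP; ring.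
have X0 : (0 < X)%N.
  have hpos := idx_pos (subg_Div0 _) hh; have wpos := idx_pos (sgI0fT _ _) hw0.
  by move: (leq_mul wpos hpos); rewrite -e; case: (X); rewrite ?muln0.
have /dvdnP[q eq] : (X %| w0)%N.
  have eb2 : (b = z * c * X)%N by rewrite eb ez mulnAC.
  have Xb : (X %| b)%N by rewrite eb2 dvdn_mull.
  case: b1p hr => eb1; rewrite eb1 in Xb eb2; first by move=> _; move: Xb; rewrite dvdn1 => /eqP ->; apply: dvd1n.
  case=> [[v rv]|b1]; last by move: (prime_gt1 pp); rewrite -eb1 b1.
  have [_ hd] := primeP pp; have := hd X Xb; rewrite /= => /orP[/eqP->|/eqP eX]; first exact: dvd1n.
  have zc : (z * c = 1)%N.
    by apply/eqP; rewrite -(eqn_pmul2r p0) mul1n -{1}eX -eb2.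
  have c1 : c = 1%N by move/eqP: zc; rewrite muln_eq1 => /andP[_ /eqP].
  rewrite c1 mul1n in eW; rewrite -eW eX.
  have [P iP _] := rv; have : ipull n P \in R by apply/hR; exists P.
  by case: (R) => // ? ? _; rewrite /= expnS dvdn_mulr.
apply/dvdnP; exists q; apply/eqP; rewrite -(eqn_pmul2r X0) e eq; apply/eqP; ring.
Qed.

(** Degree defects multiply along the tower, as extension preserves degree 0 in both directions. *)
Lemma K2_step m k a b : idx (@fsupp (L (k.+1 + m))) (K2T m k.+1) a ->
  idx (@fsupp (L (k.+2 + m))) (K2T (k.+1 + m) 1) b -> idx (@fsupp (L (k.+2 + m))) (K2T m k.+2) (b * a)%N.
Proof.
move=> ha hb; have sK : subg (K2T m k.+2) by apply: subg_K2.
have sKt : subg (K2T (k.+1 + m) 1) by apply: subg_K2.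
pose J : dvs (L (k.+1 + m)) -> dvs (L (k.+2 + m)) := jd (cp (k.+1 + m) 1).
have JB : forall x y, J (x - y) = J x - J y by move=> x y; apply: jdB.
have JE D : jd (cp m k.+2) D = J (jd (cp m k.+1) D) := @jd_step m k.+1 D.
have fJ D : fsupp D -> fsupp (J D) by apply: (fsupp_jd (G _) (G _)).
apply: (idx_mul (@subg_fsupp _) sKt sK _ _ hb).
- move=> _ [u [v [hu [D [fD ->]] ->]]]; exists u, (jd (cp m k.+2) D); split=> //.
  by exists (jd (cp m k.+1) D); rewrite JE; split=> //; apply: (fsupp_jd (G _) (G _)).
- by move=> D /(K2K1 (GD _) (GD _)) /K1I.
apply: (proj1 (@idx_hom _ _ J (@fsupp (L (k.+1 + m))) (K2T m k.+1) (K2T (k.+1 + m) 1) (K2T m k.+2) a (@subg_fsupp _) sK JB _ _ _)) ha.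
- by move=> D fD; exists 0, (J D); rewrite add0r; split=> //; [apply: (subg0 (subg_Div0 _))|exists D].
- move=> D fD; split=> [[u [_ [hu [D0 [fD0 ->]] ->]]]|[u [_ [hu [D0 [fD0 ->]] e]]]].
    exists (J u), (jd (cp m k.+2) D0); split; last by rewrite JE (morBD JB).
      exact: (jf_Div0 (tau_g0 1) (@tau_g (k.+1 + m) 1) (@tau_fix (k.+1 + m) 1) (GD _) (GD _) hu).
    by exists D0.
  have fj : fsupp (jd (cp m k.+1) D0) by apply: (fsupp_jd (G _) (G _)).
  exists (D - jd (cp m k.+1) D0), (jd (cp m k.+1) D0); rewrite subrK; split=> //; last by exists D0.
  have fd : fsupp (D - jd (cp m k.+1) D0) by apply: (subgB (@subg_fsupp _)).
  split=> //; apply: (jf_deg0 (g0 := tau_g0 1) (sg := @tau_g (k.+1 + m) 1) (sfix := @tau_fix (k.+1 + m) 1) (GD _) (GD _) fd).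
  by change (deg (J (D - jd (cp m k.+1) D0)) = 0); rewrite JB -JE e addrK; case: hu.
- move=> _ [u [_ [hu [D [fD ->]] ->]]]; exists D => //; rewrite addrK.
  by exists u, 0; rewrite addr0; split=> //; apply: (subg0 (subg_Jim _ _ _)).
Qed.

Lemma bounded_prod (a b : nat -> nat) B : (forall k, a k.+1 = b k.+1 * a k)%N ->
  (forall k, 0 < a k <= B)%N -> exists j0, forall j, (j0 < j)%N -> b j = 1%N.
Proof.
move=> hab ha; pose P i := `[< exists k, a k = i >].
have [|i /asboolP Pi|i /asboolP[j0 e0] mx] := @ex_maxnP P B.
- by exists (a 0); apply/asboolP; exists 0.
- by case: Pi => k <-; case/andP: (ha k).
exists j0 => -[|j] // lt; rewrite ltnS in lt.
have b0 k : (0 < b k.+1)%N by have /andP[] := ha k.+1; rewrite hab muln_gt0 => /andP[].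
have mono : (a j0 <= a j)%N.
  rewrite -(subnK lt); elim: (j - j0)%N => // k IH; apply: leq_trans IH _.
  by rewrite addSn hab leq_pmull.
have : (a j.+1 <= i)%N by apply: mx; apply/asboolP; exists j.+1.
have aj : (0 < a j)%N by have /andP[] := ha j.
rewrite -e0 => /leq_trans/(_ mono); rewrite hab -{2}[a j]mul1n leq_pmul2r // => b1.
by apply/eqP; rewrite eqn_leq b1 b0.
Qed.

Lemma ff_step : exists n0, forall n, (n0 <= n)%N -> divides_at n.
Proof.
have ex_b n : exists2 b, idx (@fsupp (L (1 + n))) (K2T n 1) b & b = 1%N \/ b = p.
  have [||||b hb b1] := (@idx_prime_cyc (L (1 + n)) (p ^ 1) (tau_g0 1) pp (K2T n 1)).
  - exact: subg_K2.
  - exact: I0K2.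
  - by move=> D /(K2K1 (GD _) (GD _)) /K1I.
  - move=> D; exact: (@pK2 _ _ (fm n 1) (tau n 1) (p ^ 1) (tau_g0 1) (@tau_g n 1) (@tau_fix n 1) (@tau_faith n 1) (GD _) (GD _) pp D).
  by exists b.
have [[n1 [v rv]]|nr] := pselect (exists n v, ramified n v).
  exists n1 => n le; have [b hb b1] := ex_b n; apply: (ff_core hb b1); left; exists v.
  exact: ramified_up rv.
have [b hb] : exists b : nat -> nat, forall j, idx (@fsupp (L (1 + (j + 0)))) (K2T (j + 0) 1) (b j) /\ (b j = 1%N \/ b j = p).
  apply: (choice_ex (P := fun j b => idx (@fsupp (L (1 + (j + 0)))) (K2T (j + 0) 1) b /\ (b = 1%N \/ b = p))) => j.
  by have [b hb b1] := ex_b (j + 0)%N; exists b.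
have unram j : idx (IfixT (j + 0) 1) (JimT (j + 0) 1) 1.
  have [R [_ hR]] := ram_ex (j + 0); suff -> : R = [::] by rewrite expn0.
  case: R hR => // P0 R' /(_ P0); rewrite mem_head => -[/(_ isT)[P iP _] _].
  by case: nr; exists (j + 0)%N, (down P), P.
have [a ha] : exists a : nat -> nat, forall k, idx (@fsupp (L (k.+1 + 0))) (K2T 0 k.+1) (a k) /\ a k.+1 = (b k.+1 * a k)%N.
  pose a := fix a k := if k is k'.+1 then (b k'.+1 * a k')%N else b 0; exists a => k; split=> //.
  elim: k => [|k IH]; first by case: (hb 0).
  by apply: K2_step IH _; case: (hb k.+1).
have [h0 hh0] := gd_h (GD 0).
have [|k|j0 hj] := @bounded_prod a b h0; first by move=> k; case: (ha k).
  have [hk _] := ha k; rewrite (idx_pos _ hk) /=; last exact: subg_fsupp.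
  have [W hW lW] := @ram_product 0 (fun=> 1%N) unram k.
  have W1 : W = 1%N.
    have W0 := idx_pos (subg_Ifix _ _) hW; apply/eqP; rewrite eqn_leq W0 andbT.
    by apply: leq_trans lW _; rewrite big1.
  (* Without ramification W = 1, so c = w0 = 1 and the total defect is z X with z <= y; Chevalley's
     formula bounds y X by the class number of the bottom layer. *)
  have [w0 hw0] := I0f_fin hW; have [a' [c [ha' ea eW]]] := deg_indices (GD _) (GD _) hW hw0 hk.
  move/esym/eqP: eW; rewrite W1 muln_eq1 => /andP[/eqP c1 /eqP w1].
  have [H0 u0 u1] := ff_units 0 k.+1; have [h' hh'] := gd_h (GD (k.+1 + 0)).
  have sQ : subg (QambT 0 k.+1) by apply: sgQ => //; [apply: dvB|apply: subg_Div0].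
  have [|v [] //|n1 [y [_ hy _]]] := idx_sub (subg_Div0 _) sQ (subg_PB (GD _)) _ _ hh'.
    move=> v hv; have hv' := sV_PB (tau_g0 k.+1) (@tau_g 0 k.+1) (GD _) hv.
    by split; [apply: (Div0_PB (GD _) hv)|apply: (subgB (subg_PB (GD _)))].
  have [s [X [hs hX e _ _]]] := chev hh0 hw0 u0 u1 hy.
  have [z ez lz] := X_dvd (@tau_fix 0 k.+1) (GD _) (GD _) hX ha'.
  rewrite ea c1 muln1 ez; have H00 : (0 < H0)%N := idx_pos (sgEfT _ _) u0.
  have s0 : (0 < s)%N := idx_pos (sgEfT _ _) hs.
  apply: (@leq_trans (y * X)); first by rewrite leq_mul // lz.
  rewrite -(leq_pmul2r H00) -[(h0 * H0)%N]mul1n mulnA -w1 -e.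
  have -> : (y * H0 * X * s = y * X * H0 * s)%N by ring.
  by rewrite leq_pmulr.
exists j0.+1 => n ln; have : divides_at (n + 0).
  by have [hbn b1] := hb n; apply: (ff_core hbn b1); right; apply: hj.
by rewrite addn0.
Qed.
End FunctionField.

(** * Congruences between the layers and convergence *)

Notation sVs n := (sV (tau_g0 n) (@T2 n)).

Lemma fixed_classes n (X : dvs (L n.+1) -> Prop) N : (forall D, X D -> X (sVs n.+1 D)) ->
  idx X (PrT n.+1) N ->
  exists2 M, nclasses (fun x y => PrT n.+1 (x - y)) (fun D => X D /\ PrT n.+1 (sVT n 1 D - D)) M
  & N = M %[mod p ^ n.+1].
Proof.
move=> Xs hN; have sP := subg_PB (GD n.+1).
have [||M hM eM] := @nc_fix_mod _ (fun x y => PrT n.+1 (x - y)) X (sVs n.+1) p n N pp (subg_eqv sP) Xs _ _ hN.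
- move=> x y _ _ h; exact: (sV_PB (tau_g0 n.+1) (@T2 n.+1) (GD _) h).
- by move=> D _; rewrite (sV_g (tau_g0 n.+1) (@T2 n.+1)) subrr; apply: subg0.
exists M => //; apply: nc_ext hM => // D.
have -> : iter (p ^ n) (sVs n.+1) D = sVT n 1 D by symmetry; apply: sV_iter.
by [].
Qed.

Lemma prime_to_p (Q : nat -> Prop) (N : nat -> nat) : (forall m, Q m -> (0 < m)%N /\ coprime m p) ->
  (forall n, idx (fun D => Div0 D /\ exists m, Q m /\ PrT n (D *+ m)) (PrT n) (N n)) ->
  padic_converges p N.
Proof.
move=> hQ hN; apply: padic_cauchy => m; exists m => n mn.
have [|M hM e] := fixed_classes _ (hN n.+1).
  move=> D [D0 [m' [Qm h]]]; split; first exact: sV_Div0.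
  exists m'; split=> //; rewrite -(morB_Mn (sVB' (tau_g0 n.+1) (@T2 n.+1))).
  exact: (sV_PB (tau_g0 n.+1) (@T2 n.+1) (GD _) h).
have eM := @step_fixed_classes _ _ (fm n 1) (tau n 1) (p ^ 1) (tau_g0 1) (@tau_g n 1) (@tau_fix n 1) (@tau_faith n 1)
  (GD _) (GD _) pp Q (N n) M hQ (hN n) hM.
have d : (p ^ m %| p ^ n.+1)%N by rewrite dvdn_exp2l // ltnW.
by rewrite -(modn_dvdm _ d) e -eM modn_dvdm.
Qed.

Lemma tower_convergence : (exists n0, forall n, (n0 <= n)%N -> divides_at n) ->
  [/\ exists a : nat -> nat, (forall n, C_card (L n) all_part (a n)) /\ padic_converges p a,
      exists a : nat -> nat, (forall n, C_card (L n) (nonp_part p) (a n)) /\ padic_converges p a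
    & forall l : nat, prime l ->
      exists a : nat -> nat, (forall n, C_card (L n) (l_part l) (a n)) /\ padic_converges p a].
Proof.
move=> [n0 hd]; have [h hh] := choice_ex (fun n => gd_h (GD n)).
have h0 n : (0 < h n)%N := idx_pos (subg_Div0 _) (hh n).
have sP n := subg_PB (GD n).
have hpar l (pl : prime l) n := idx_parts pl (subg_Div0 (L n)) (sP n) (@Div0_PB _ (GD n)) (hh n).
have cp : padic_converges p (fun n => p ^ logn p (h n))%N.
  apply: (@padic_pow p (fun n => logn p (h n)) n0 p0) => n ln.
  have [|y hy e] := fixed_classes _ (hh n.+1); first by move=> D; apply: sV_Div0.
  have dy := hd n ln _ _ (hh n) hy.
  rewrite -pfactor_dvdn // /dvdn; set v := minn _ _.
  have dv1 : (p ^ v %| p ^ n.+1)%N by rewrite dvdn_exp2l // (leq_trans (geq_minl _ _)).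
  rewrite -(modn_dvdm _ dv1) e modn_dvdm // -/(dvdn _ _); apply: dvdn_trans dy.
  by rewrite pfactor_dvdn // geq_minr.
have cn : padic_converges p (fun n => (h n)`_p^')%N.
  by apply: (@prime_to_p (fun m => (0 < m)%N /\ coprime m p)) => // n; case: (hpar p pp n).
have cl l : prime l -> l != p -> padic_converges p (fun n => (h n)`_l)%N.
  move=> pl lp; apply: (@prime_to_p (fun m => exists e, m = (l ^ e)%N)).
    by move=> _ [e ->]; rewrite expn_gt0 prime_gt0 // coprimeXl // prime_coprime // dvdn_prime2.
  move=> n; have [hl _] := hpar l pl n; apply: idx_ext hl => // D.
  by split=> -[D0]; [move=> [k hk]; split=> //; exists (l ^ k)%N; split=> //; exists k
    |move=> [_ [[k ->] hk]]; split=> //; exists k].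
split.
- exists h; split=> [n|]; first by apply: (gd_card (GD n)); apply: idx_ext (hh n) => // D; split=> [|[]].
  have e n : (p ^ logn p (h n) * (h n)`_p^')%N = h n by rewrite -p_part partnC.
  by apply: padic_ext e _; apply: padic_mul.
- exists (fun n => (h n)`_p^')%N; split=> // n; apply: (gd_card (GD n)).
  by case: (hpar p pp n).
move=> l pl; exists (fun n => (h n)`_l)%N; split.
  move=> n; apply: (gd_card (GD n)); have [hl _] := hpar l pl n; apply: idx_ext hl => // D.
  by split=> -[D0]; [move=> [k hk]; split=> //; exists (l ^ k)%N; split=> //; exists k
    |move=> [_ [[k ->] hk]]; split=> //; exists k].
have [->|lp] := eqVneq l p; last exact: cl.
by apply: padic_ext cp => n; rewrite p_part.
Qed.

(** An automorphism acting as complex conjugation has order 2 in a cyclic group of order p^N, which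
    determines p and j. *)
Lemma conj_order (C : rcfType) N j (psi : {rmorphism L N -> C[i]}) : (0 < j < p ^ N)%N ->
  (forall x, psi (irm (sig N) j x) = conjc (psi x)) -> exists M, [/\ N = M.+1, p = 2%N & j = (2 ^ M)%N].
Proof.
move=> /andP[j0 jN] hc; have h2 x : irm (sig N) (j + j) x = x.
  by apply: (fmorph_inj psi); rewrite irmD !hc conjcK.
have hg := irm_gcd_id (ltn_addl j j0) h2 (T2 (n := N)).
have g0 : (0 < gcdn (j + j) (p ^ N))%N by rewrite gcdn_gt0 addn_gt0 j0.
have dN : (p ^ N %| j + j)%N.
  have [lt|ge] := ltnP (gcdn (j + j) (p ^ N)) (p ^ N).
    have [|x /eqP[]] := @sig_faith N (gcdn (j + j) (p ^ N)); last exact: hg.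
    by rewrite g0.
  have le : (gcdn (j + j) (p ^ N) <= p ^ N)%N by rewrite dvdn_leq ?dvdn_gcdr // expn_gt0 prime_gt0.
  have -> : (p ^ N = gcdn (j + j) (p ^ N))%N by apply/eqP; rewrite eqn_leq ge le.
  exact: dvdn_gcdl.
have ej : (j + j = p ^ N)%N.
  case/dvdnP: dN => -[|[|c]] e; rewrite ?mul1n // in e *; first by lia.
  by move: e jN; rewrite !mulSn; lia.
have p2 : p = 2%N.
  have : (2 %| p ^ N)%N by rewrite -ej addnn dvdn2 odd_double.
  by rewrite Euclid_dvdX // => /andP[+ _]; rewrite dvdn_prime2 // => /eqP.
case: N psi jN hc h2 hg g0 dN ej => [|M] psi jN hc h2 hg g0 dN ej; first by move: jN; rewrite expn0; lia.
exists M; split=> //; move: ej; rewrite p2 expnS; lia.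
Qed.

(** Lifted to layer N + 1, the automorphism becomes [rho] of order 4. For b negated by [rho] squared
    and c = rho b, the elements b c, b^2 + c^2 and b^2 - c^2 lie in layer N, where [rho] acts as
    complex conjugation; so their signs under [rho] decide whether they are real or purely
    imaginary. *)
Lemma no_conj (C : rcfType) N j (psi : {rmorphism L N -> C[i]}) : (0 < j < p ^ N)%N ->
  ~ forall x, psi (irm (sig N) j x) = conjc (psi x).
Proof.
move=> jN hc; have [M [eN e2 ej]] := conj_order jN hc.
pose rho := irm (sig N.+1) j.
have jj : (j + j = p ^ N)%N by rewrite ej eN e2 expnS; lia.
have r2 x : rho (rho x) = irm (sig N.+1) (p ^ N) x by rewrite -irmD jj.
have r4 x : rho (rho (rho (rho x))) = x.
  by rewrite !r2 -irmD addnn -mul2n -{1}e2 -expnS T2.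
have [y hy] := T4 N; pose b := y - rho (rho y).
have b0 : b != 0 by rewrite subr_eq0 eq_sym /b r2.
have rb : rho (rho b) = - b by rewrite /b !rmorphB r4 opprB.
pose c := rho b; have rc : rho c = - b by [].
have c0 : c != 0 by rewrite fmorph_eq0.
have inI z : rho (rho z) = z -> exists a, z = iot N a by rewrite r2 => /T3.
have tI1 a z : z = iot N a -> rho z = z -> psi a = conjc (psi a).
  move=> ez rz; rewrite -hc; congr (psi _); apply: (fmorph_inj (iot N)).
  by rewrite iot_irm -ez.
have tIN a z : z = iot N a -> rho z = - z -> - psi a = conjc (psi a).
  move=> ez rz; rewrite -hc -rmorphN; congr (psi _); apply: (fmorph_inj (iot N)).
  by rewrite iot_irm -ez rmorphN -ez.
have rg : rho (b * c) = - (b * c) by rewrite rmorphM rc mulrN mulrC.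
have ru : rho (b ^+ 2 + c ^+ 2) = b ^+ 2 + c ^+ 2 by rewrite rmorphD !rmorphXn rc sqrrN addrC.
have rv : rho (b ^+ 2 - c ^+ 2) = - (b ^+ 2 - c ^+ 2) by rewrite rmorphB !rmorphXn rc sqrrN opprB.
have [g eg] := inI (b * c) ltac:(by rewrite rg rmorphN rg opprK).
have [u eu] := inI (b ^+ 2 + c ^+ 2) ltac:(by rewrite ru).
have [v ev] := inI (b ^+ 2 - c ^+ 2) ltac:(by rewrite rv rmorphN rv opprK).
(* With g and v purely imaginary and u real, the left side is at most 0 and the right side at least
   0, which forces g = 0. *)
have e : (g + g) ^+ 2 = u ^+ 2 - v ^+ 2.
  by apply: (fmorph_inj (iot N)); rewrite rmorphB !rmorphXn rmorphD -eg -eu -ev; ring.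
have g0 : psi g != 0 by rewrite fmorph_eq0 -(fmorph_eq0 (iot N)) -eg mulf_neq0.
have := congr1 psi e; rewrite rmorphB !rmorphXn rmorphD /=.
move: (tIN _ _ eg rg) (tI1 _ _ eu ru) (tIN _ _ ev rv) g0.
case: (psi g) (psi u) (psi v) => g1 g2 [u1 u2] [v1 v2] /= [eg1] [eu2] [ev1] g0.
rewrite !expr2 => /(congr1 (@complex.Re C)) /=.
have {}eg1 : g1 = 0 by lra.
have {}eu2 : u2 = 0 by lra.
have {}ev1 : v1 = 0 by lra.
subst g1 u2 v1; move=> h; case/eqP: g0; congr (_ +i* _)%C.
have : g2 ^+ 2 = 0 by move: h (sqr_ge0 g2) (sqr_ge0 u1) (sqr_ge0 v2); rewrite !expr2; lra.
by move/eqP; rewrite sqrf_eq0 => /eqP.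
Qed.
End Tower.

(** * Galois groups of the layers *)

Section FieldExtension.
Variables (K M : fieldType) (phi : {rmorphism K -> M}) (d : nat) (e : 'I_d -> M).
Hypothesis span : forall x : M, exists a : 'I_d -> K, x = \sum_j phi (a j) * e j.

Lemma char0_ext : char0 K -> char0 M.
Proof. by move=> c n; rewrite -(rmorph_nat phi) fmorph_eq0; apply: c. Qed.

Lemma number_field_ext : number_field K -> number_field M.
Proof.
move=> nF; have [c [n [b hb]]] := nF; split; first exact: char0_ext.
exists #|{: 'I_d * 'I_n}|, (fun i => e (enum_val i).1 * phi (b (enum_val i).2)) => x.
have [a ->] := span x; have [co hco] := choice_ex (fun j => hb (a j)).
exists (fun i => co (enum_val i).1 (enum_val i).2).
rewrite (reindex (@enum_rank _)) /=; last by exists enum_val => i _; rewrite ?enum_rankK ?enum_valK.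
transitivity (\sum_(j < d) \sum_(i < n) ratr (co j i) * (e j * phi (b i))); last first.
  by rewrite pair_bigA /=; apply: eq_bigr => -[j i] _; rewrite enum_rankK.
apply: eq_bigr => j _.
rewrite {1}(hco j) rmorph_sum mulr_suml; apply: eq_bigr => i _.
rewrite rmorphM mulrAC -mulrA; congr (_ * _).
by rewrite /ratr rmorphM fmorphV !rmorph_int.
Qed.

Lemma evalN_ext (q : seq nat) t : evalN q (phi t) = phi (evalN q t).
Proof. by rewrite /evalN rmorph_sum; apply: eq_bigr => i _; rewrite rmorphM rmorphXn rmorph_nat. Qed.

Lemma function_field_ext : function_field K -> function_field M.
Proof.
move=> [q [pq q0 [t [tt [n [b hb]]]]]]; exists q; split=> //.
  by rewrite -(rmorph_nat phi) q0 rmorph0.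
exists (phi t); split.
  by move=> s; rewrite evalN_ext => /eqP; rewrite fmorph_eq0 => /eqP/tt.
exists #|{: 'I_d * 'I_n}|, (fun i => e (enum_val i).1 * phi (b (enum_val i).2)) => x.
have [a ->] := span x; have [co hco] := choice_ex (fun j => hb (a j)).
exists (fun i => phi (co (enum_val i).1 (enum_val i).2)); split.
  move=> i; have [/(_ (enum_val i).2)[f [g [g0 ->]]] _] := hco (enum_val i).1.
  by exists f, g; rewrite !evalN_ext fmorph_eq0 fmorph_div.
rewrite (reindex (@enum_rank _)) /=; last by exists enum_val => i _; rewrite ?enum_rankK ?enum_valK.
transitivity (\sum_(j < d) \sum_(i < n) phi (co j i) * (e j * phi (b i))); last first.
  by rewrite pair_bigA /=; apply: eq_bigr => -[j i] _; rewrite enum_rankK.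
apply: eq_bigr => j _.
have [_ ea] := hco j; rewrite {1}ea rmorph_sum mulr_suml; apply: eq_bigr => i _.
by rewrite rmorphM -mulrA; congr (_ * _); rewrite mulrC.
Qed.
End FieldExtension.

Lemma splitting_span (K : fieldType) (M : splittingFieldType K) :
  exists d (e : 'I_d -> M), forall x : M, exists a : 'I_d -> K, x = \sum_j in_alg M (a j) * e j.
Proof.
pose b := vbasis (fullv : {vspace M}).
exists (\dim (fullv : {vspace M})), (fun j => b`_j) => x; exists (fun j => coord b j x).
rewrite {1}(coord_vbasis (memvf x)); apply: eq_bigr => j _.
by rewrite /= mulr_algl.
Qed.

(** * Compatible generators of the Galois groups *)

Section GalMap.
Variables (K : fieldType) (M : splittingFieldType K).
Notation V := (fullv : {vspace M}).

Fact grm_ex (h : gal_of V) : {s : {rmorphism M -> M} | forall x, s x = h x}.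
Proof.
have hB : zmod_morphism (fun x : M => h x) by move=> x y; apply: raddfB.
have hM : monoid_morphism (fun x : M => h x) by split=> [|x y]; [apply: rmorph1|apply: rmorphM].
by exists (rm_of hB hM).
Qed.
Definition grm h : {rmorphism M -> M} := sval (grm_ex h).
Lemma grmE h x : grm h x = h x. Proof. exact: svalP (grm_ex h) x. Qed.

Lemma grm_irm h i x : irm (grm h) i x = (h ^+ i)%g x.
Proof.
elim: i => [|i IH]; first by rewrite expg0 gal_id.
by rewrite expgSr galM ?memvf // -IH -grmE.
Qed.

Lemma grm_inj h i : (forall x, irm (grm h) i x = x) -> (h ^+ i)%g = 1%g.
Proof. by move=> e; apply/eqP/gal_eqP => x _; rewrite gal_id -grm_irm. Qed.
End GalMap.

Fact arm_ex (K : fieldType) (M N : splittingFieldType K) (f : 'AHom(M, N)) :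
  {s : {rmorphism M -> N} | forall x, s x = f x}.
Proof.
have hB : zmod_morphism (fun x : M => f x) by move=> x y; apply: raddfB.
have hM : monoid_morphism (fun x : M => f x) by split=> [|x y]; [apply: rmorph1|apply: rmorphM].
by exists (rm_of hB hM).
Qed.

Section GalStep.
Variables (K : fieldType) (M N : splittingFieldType K) (f : 'AHom(M, N)) (p n : nat).
Notation VM := (fullv : {vspace M}).
Notation VN := (fullv : {vspace N}).
Hypothesis pp : prime p.
Hypothesis gM : galois 1%VS VM.
Hypothesis gN : galois 1%VS VN.
Hypothesis cM : #|'Gal(VM / 1%VS)%g| = (p ^ n)%N.
Variable h : gal_of VN.
Hypothesis hN : 'Gal(VN / 1%VS)%g = <[h]>%g.
Hypothesis oh : #[h]%g = (p ^ n.+1)%N.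

Let E : {subfield N} := (f @: VM)%AS.

Lemma gal_step_group : [/\ galois E VN, #|'Gal(VN / E)%g| = p
  & 'Gal(VN / E)%g = <[h ^+ (p ^ n)]>%g].
Proof.
have dE : \dim E = (p ^ n)%N.
  rewrite /= limg_dim_eq ?(eqP (AHom_lker0 f)) ?capv0 //.
  by have := galois_dim gM; rewrite dimv1 divn1 cM.
have gE : galois E VN by apply: galoisS gN; rewrite sub1v subvf.
have dN : \dim VN = (p ^ n.+1)%N.
  by have := galois_dim gN; rewrite dimv1 divn1 hN -orderE oh.
have cE : #|'Gal(VN / E)%g| = p.
  by rewrite -(galois_dim gE) dE dN expnS mulnK // expn_gt0 prime_gt0.
split=> //; apply/eqP; rewrite (eq_subG_cyclic (cycle_cyclic h)).
- by rewrite cE -orderE orderXdiv oh ?dvdn_exp2l // expnS mulnK ?expn_gt0 ?prime_gt0.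
- by have := galS VN (sub1v E); rewrite hN.
- by rewrite cycle_subG mem_cycle.
Qed.

Lemma gal_step_fix x : irm (grm h) (p ^ n) x = x <-> exists a, x = f a.
Proof.
have [gE cE GE] := gal_step_group.
split=> [hx|[a ->]].
  suff /memv_imgP[a _ ->] : x \in (f @: VM)%VS by exists a.
  have /galois_fixedField <- := gE; apply/fixedFieldP; first exact: memvf.
  move=> y; rewrite GE => /cycleP[i ->]; rewrite -expgM -grm_irm mulnC.
  exact: irm_mul_id.
rewrite grm_irm; apply: (@fixed_gal _ _ E VN); first exact: subvf.
  by rewrite GE cycle_id.
by rewrite memv_img ?memvf.
Qed.

Lemma gal_step_move : exists y, irm (grm h) (p ^ n) y != y.
Proof.
apply/not_existsP => no; have /eqP : (h ^+ (p ^ n))%g = 1%g.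
  by apply: grm_inj => x; have /negP/negPn/eqP := no x.
by rewrite -order_dvdn oh dvdn_Pexp2l ?prime_gt1 // ltnn.
Qed.

Variable g : gal_of VM.
Hypothesis gg : 'Gal(VM / 1%VS)%g = <[g]>%g.

(** The image of M is the fixed field of h^(p^n), so h restricts to M, as a power g^b with b prime
    to p if n > 0. For a inverse to b modulo p^n and prime to p, h^a still generates and restricts
    to g. *)
Lemma gal_step_lift : exists h', 'Gal(VN / 1%VS)%g = <[h']>%g /\ forall x, h' (f x) = f (g x).
Proof.
have finj : injective f by apply/lker0P/AHom_lker0.
have og : #[g]%g = (p ^ n)%N by rewrite orderE -gg.
have him x : h (f x) \in limg f.
  suff [a ->] : exists a, h (f x) = f a by rewrite memv_img ?memvf.
  apply/gal_step_fix; rewrite -grmE -[grm h _]/(irm (grm h) 1 _) -irmD addnC irmD; congr (grm h _).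
  by apply/gal_step_fix; exists x.
pose r : 'End(M) := (f^-1 \o h \o f)%VF.
have fr x : f (r x) = h (f x) by rewrite /r !comp_lfunE limg_lfunVK.
have kr : kAut 1 VM r.
  rewrite kAutE subvf andbT; apply/kHomP_tmp; split=> [x /vlineP[k ->]|x y _ _].
    by apply: finj; rewrite fr !linearZ /= !rmorph1.
  by apply: finj; rewrite fr !rmorphM /= !fr.
have [x xG xr] := kAut_to_gal kr.
have [b eb] : exists b, x = (g ^+ b)%g by apply/cycleP; rewrite -gg.
have hr y : h (f y) = f ((g ^+ b)%g y) by rewrite -fr xr ?memvf // eb.
have hri i y : (h ^+ i)%g (f y) = f ((g ^+ (b * i))%g y).
  elim: i y => [|i IH] y; first by rewrite muln0 !expg0 !gal_id.
  by rewrite expgSr galM ?memvf // IH hr -galM ?memvf // mulnS addnC expgD.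
have [a [ca ea]] : exists a, coprime (p ^ n.+1) a /\ b * a = 1 %[mod p ^ n].
  have [n0|n0] := posnP n.
    by exists 1%N; rewrite coprimen1 n0 expn0 !modn1.
  (* If p divided b, h^(p^(n-1)) would fix the image of M and thus lie in a group of order p, so h
     would have order at most p^n. *)
  have cb : coprime b p.
    rewrite coprime_sym prime_coprime //; apply/negP => /dvdnP[c ec].
    have : (h ^+ (p ^ n))%g = 1%g.
      have h1 y : (h ^+ (p ^ n.-1))%g (f y) = f y.
        rewrite hri ec -mulnA -expnS prednK // mulnC expgM -og expg_order expg1n gal_id //.
      have [_ cE _] := gal_step_group.
      have hE : (h ^+ (p ^ n.-1))%g \in 'Gal(VN / E)%g.
        by rewrite gal_kHom ?subvf //; apply/kAHomP => _ /memv_imgP[y _ ->]; apply: h1.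
      by have := expg_cardG hE; rewrite cE -expgM -expnSr prednK.
    move/eqP; rewrite -order_dvdn oh dvdn_Pexp2l ?prime_gt1 // ltnn //.
  have b0 : (0 < b)%N by case: (b) cb => //; rewrite /coprime gcd0n => /eqP e; move: pp; rewrite e.
  have [a ea] := coprime_inv (coprimeXr n cb) b0; exists a; split=> //.
  apply: coprimeXl; rewrite prime_coprime //; apply/negP => pa.
  have := ea; move/eqP => ea'; have : (p %| 1)%N; last by rewrite dvdn1 => /eqP e; move: pp; rewrite e.
  have pn : (p %| p ^ n)%N by rewrite -{1}(expn1 p) dvdn_exp2l.
  rewrite /dvdn -(modn_dvdm 1 pn) -(eqP ea') modn_dvdm // -/(dvdn _ _); exact: dvdn_mull.
exists (h ^+ a)%g; split.
  rewrite hN; apply/eqP; rewrite -/(generator _ _) generator_coprime oh //.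
move=> y; rewrite hri; congr (f _).
suff -> : (g ^+ (b * a))%g = g by [].
by rewrite -[RHS]expg1; apply/eqP; rewrite eq_expg_mod_order og ea.
Qed.
End GalStep.

Theorem theorem2p1 (p : nat) (K : fieldType) (L : nat -> splittingFieldType K) :
  prime p -> global_field K -> Zp_extension p L ->
  [/\ exists a : nat -> nat, (forall n, C_card (L n) all_part (a n)) /\ padic_converges p a,
      exists a : nat -> nat, (forall n, C_card (L n) (nonp_part p) (a n)) /\ padic_converges p a
    & forall l : nat, prime l ->
      exists a : nat -> nat, (forall n, C_card (L n) (l_part l) (a n)) /\ padic_converges p a].
Proof.
move=> pp gK hZ.
have f n : 'AHom(L n, L n.+1) by have [_ _ _ h] := hZ n; exact: sval (cid h).
pose V n := (fullv : {vspace L n}).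
pose st n := {g : gal_of (V n) | 'Gal(V n / 1%VS)%g = <[g]>%g}.
have ost n (g : st n) : #[sval g]%g = (p ^ n)%N.
  by have [_ _ <- _] := hZ n; rewrite orderE -(svalP g).
have st0 : st 0.
  by have [_ cG _ _] := hZ 0; have /cyclicP h := cG; exact: (cid h).
have nxt n (g : st n) : {g' : st n.+1 | forall x, sval g' (f n x) = f n (sval g x)}.
  apply: cid; have [gM _ cM _] := hZ n; have [gN cN oN _] := hZ n.+1; have /cyclicP[h hh] := cN.
  have oh : #[h]%g = (p ^ n.+1)%N by rewrite orderE -hh.
  by have [h' [hh' e]] := gal_step_lift (f n) pp gM gN cM hh oh (svalP g); exists (exist _ h' hh').
(* Generators are chosen recursively, each lifting the previous one; this yields the commutation T1
   of the tower. *)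
pose hs := nat_rect st st0 (fun n s => sval (nxt n s)).
have hsE n x : sval (hs n.+1) (f n x) = f n (sval (hs n) x) := svalP (nxt n (hs n)) x.
pose F n : fieldType := L n.
pose sig n : {rmorphism F n -> F n} := grm (sval (hs n)).
pose iot n : {rmorphism F n -> F n.+1} := sval (arm_ex (f n)).
have iotE n x : iot n x = f n x := svalP (arm_ex (f n)) x.
have T1 n x : iot n (sig n x) = sig n.+1 (iot n x) by rewrite !iotE /sig !grmE hsE.
have T2 n x : irm (sig n) (p ^ n) x = x by rewrite /sig grm_irm -(ost n (hs n)) expg_order gal_id.
have T3 n x : irm (sig n.+1) (p ^ n) x = x <-> exists a, x = iot n a.
  have [gM _ cM _] := hZ n; have [gN _ _ _] := hZ n.+1.
  rewrite (gal_step_fix (f n) pp gM gN cM (svalP (hs n.+1)) (ost _ _)).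
  by split=> -[a ->]; exists a; rewrite ?iotE.
have T4 n : exists y, irm (sig n.+1) (p ^ n) y != y.
  exact: (gal_step_move pp (ost _ (hs n.+1))).
case: gK => [nK|fK].
  have nF n : number_field (F n).
    by have [d [e he]] := splitting_span (L n); apply: number_field_ext he nK.
  have GD n := nf_gdata (nF n).
  apply: (tower_convergence (pp := pp) T1 (T2 := T2) T3 T4 GD).
  apply: (nf_step pp T1 T2 T3 T4 GD); first by move=> n; case: (nF n).
  move=> m k; have [n [w [co H]]] := nfb_ex (nF (k + m)).
  pose R : realType := Rdefinitions.R.
  have [phi [hN hT hU]] := embed_ex H (R[i] : numClosedFieldType).
  apply: (@units_herbrand R _ n w co H phi hN hT hU (tau p sig m k) (p ^ k) (tau_g0 pp k) (@tau_g p F sig T2 m k)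
    (@tau_faith p F sig pp T2 T4 m k)).
  (* The i-th power of [tau] is the power p^m i of the generator of the whole layer, to which
     [no_conj] applies. *)
  move=> i psi /andP[i0 ik] h; apply: (@no_conj p F sig iot pp T1 T2 T3 T4 R (k + m) (p ^ m * i) psi).
    by rewrite muln_gt0 expn_gt0 prime_gt0 // i0 /= addnC expnD ltn_pmul2l // expn_gt0 prime_gt0.
  by move=> x; rewrite -h tau_irm.
have fF n : function_field (F n).
  by have [d [e he]] := splitting_span (L n); apply: function_field_ext he fK.
have GD n := ff_gdata (fF n).
apply: (tower_convergence (pp := pp) T1 (T2 := T2) T3 T4 GD).
apply: (ff_step pp T1 T2 T3 T4 GD) => n.
by have [q [t H]] := ffield_ex (fF n); apply: units_fin H.
Qed.
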